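(* Assume $V,W$ satisfy assumptions (H) of the context. Assume that $u_0^{(N)}\in\mathcal P_2(\mathbb R^{dN})$ for every $N\ge1$ and $u_0\in\mathcal P_{2m^2}(\mathbb R^d)$. Then there exists a constant $\mathrm C_{\rm init}>0$, depending only on $V,W,d$ and the initial laws, independent of $t$ and $N$, such that for all $t\ge0$, $N\ge1$, $$\mathbf W_2^2\left(u_t^{(N)},u_t^{\otimes N}\right)\le 2e^{-2\beta t}\,\mathbf W_2^2\left(u_0^{(N)},u_0^{\otimes N}\right)+\mathrm C_{\rm init}.$$ Moreover, let $p\ge1$ be an integer. If $u_0\in\mathcal P_{2m^2p}(\mathbb R^d)$ and $u_0^{(N)}\in\mathcal P_{2p}(\mathbb R^{dN})$ for every $N\ge1$, and either $d=1$ or $W(x)=\lambda_W|x|^2/2$, then there exists a constant $\mathrm C_{\rm init}>0$, depending only on $p,V,W,d$ and the initial laws, independent of $t$ and $N$, such that for all $t\ge0$, $N\ge1$, $$\mathbf W_{2p}^{2p}\left(u_t^{(N)},u_t^{\otimes N}\right)\le 2^pe^{-2p\beta t}\,\mathbf W_{2p}^{2p}\left(u_0^{(N)},u_0^{\otimes N}\right)+\frac{\mathrm C_{\rm init}}{N^{p-1}}.$$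
   Context: Let $V,W:\mathbb R^d\to\mathbb R$ be smooth potentials and $(B^i)_{i\ge1}$ independent Brownian motions on $\mathbb R^d$. Particle system: for each $N\ge1$, $(X^{1,N},\dots,X^{N,N})$ solves $$dX_t^{i,N}=\sqrt2\,dB_t^i-\nabla V(X_t^{i,N})\,dt-\frac1N\sum_{j=1}^N\nabla W(X_t^{i,N}-X_t^{j,N})\,dt,\quad 1\le i\le N,$$ with initial law $u_0^{(N)}$ on $\mathbb R^{dN}$ (not assumed exchangeable or product); $u_t^{(N)}$ denotes the law on $\mathbb R^{dN}$ of the solution at time $t$. Limit equation: $u_t$ is the law at time $t$ of the solution of the McKean-Vlasov equation $$d\bar X_t=\sqrt2\,dB_t-\nabla V(\bar X_t)\,dt-\nabla W\ast u_t(\bar X_t)\,dt,\qquad \mathcal L(\bar X_t)=u_t,$$ with initial law $u_0$ on $\mathbb R^d$. Assumptions (H): - $\nabla W$ is odd: $\nabla W(-x)=-\nabla W(x)$; - $(\nabla W(x)-\nabla W(y))\cdot(x-y)\ge\lambda_W|x-y|^2$ for all $x,y$, with $\lambda_W\in\mathbb R$; - $(\nabla V(x)-\nabla V(y))\cdot(x-y)\ge\lambda_V|x-y|^2$ for all $x,y$, with $\lambda_V>0$; - $\lambda_V+2\lambda_W>0$; - $|\nabla W(x)-\nabla W(y)|\le M(|x-y|\wedge1)(1+|x|^m+|y|^m)$ for all $x,y$, with $m\in\mathbb N$, $M>0$; - $\nabla V$ is locally Lipschitz with polynomial growth. $\beta=\lambda_V$ if $\lambda_W\ge0$, and $\beta=\lambda_V+2\lambda_W$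 otherwise. $\mathcal P_q(\mathbb R^n)$ is the set of probability measures on $\mathbb R^n$ with finite moment of order $q$. For probability measures $\mu,\nu$ on $\mathbb R^{dN}$, $$\mathbf W_q^q(\mu,\nu)=\inf_\pi\int\sum_{i=1}^N|x^i-y^i|^q\,d\pi(x,y),$$ the infimum being over couplings $\pi$ of $\mu$ and $\nu$, with $x=(x^1,\dots,x^N)$ and $|\cdot|$ the Euclidean norm on $\mathbb R^d$. *)

(* Defs.v *)
From HB Require Import structures.
From mathcomp Require Import all_boot all_order all_algebra.
From mathcomp Require Import all_classical all_reals all_analysis.

Set Implicit Arguments.
Unset Strict Implicit.
Unset Printing Implicit Defensive.
Import Order.TTheory GRing.Theory Num.Theory.
Import numFieldNormedType.Exports.
Local Open Scope classical_set_scope.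
Local Open Scope ring_scope.

(* R^d is 'rV[R]_d with its Borel sigma-algebra; R^(dN) is N.-tuple 'rV[R]_d  *)
(* with the library's product sigma-algebra on tuples. The library norm `|x|  *)
(* on 'rV[R]_d is the sup norm, hence the Euclidean norm enorm below.         *)

Definition mx_display : measure_display -> measure_display.
Proof. exact. Qed.

Section borel_matrix.
Context {R : realType} {m n : nat}.

Let borel0 : <<s @open 'M[R]_(m, n) >> set0.
Proof. exact: sigma_algebra0. Qed.

Let borelC A : <<s @open 'M[R]_(m, n) >> A -> <<s @open 'M[R]_(m, n) >> (~` A).
Proof. exact: sigma_algebraC. Qed.

Let borelU (F : (set 'M[R]_(m, n))^nat) :
  (forall i, <<s @open 'M[R]_(m, n) >> (F i)) ->
  <<s @open 'M[R]_(m, n) >> (\bigcup_i F i).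
Proof. exact: sigma_algebra_bigcup. Qed.

HB.instance Definition _ :=
  @isMeasurable.Build (mx_display default_measure_display) 'M[R]_(m, n)
    <<s @open 'M[R]_(m, n) >> borel0 borelC borelU.

End borel_matrix.

Section potentials.
Context {R : realType} {d : nat}.
Implicit Types (x y : 'rV[R]_d) (V W f : 'rV[R]_d -> R).

Definition dotp x y : R := \sum_k x ord0 k * y ord0 k.

Definition enorm x : R := Num.sqrt (dotp x x).

Definition partial (k : 'I_d) f : 'rV[R]_d -> R :=
  fun x => 'D_(delta_mx ord0 k) f x.

Definition grad f x : 'rV[R]_d := \row_k partial k f x.

Fixpoint C_class (n : nat) f : Prop :=
  continuous f /\
  if n is n'.+1 then
    (forall k x, derivable f x (delta_mx ord0 k)) /\
    (forall k, C_class n' (partial k f))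
  else True.

Definition smooth f : Prop := forall n, C_class n f.

Definition monotone_with (lambda : R) (F : 'rV[R]_d -> 'rV[R]_d) : Prop :=
  forall x y, lambda * enorm (x - y) ^+ 2 <= dotp (F x - F y) (x - y).

Definition locally_lipschitz (F : 'rV[R]_d -> 'rV[R]_d) : Prop :=
  forall x, exists r L : R, 0 < r /\
    forall y z, enorm (y - x) < r -> enorm (z - x) < r ->
      enorm (F y - F z) <= L * enorm (y - z).

Definition polynomial_growth (F : 'rV[R]_d -> 'rV[R]_d) : Prop :=
  exists (K : R) (r : nat), forall x, enorm (F x) <= K * (1 + enorm x ^+ r).

Record assumptions_H V W (lambdaV lambdaW M : R) (m : nat) : Prop := {
  H_gradW_odd : forall x, grad W (- x) = - grad W x ;
  H_gradW_monotone : monotone_with lambdaW (grad W) ;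
  H_gradV_monotone : monotone_with lambdaV (grad V) ;
  H_lambdaV_gt0 : 0 < lambdaV ;
  H_lambda_gt0 : 0 < lambdaV + 2 * lambdaW ;
  H_M_gt0 : 0 < M ;
  H_gradW_growth : forall x y,
    enorm (grad W x - grad W y) <=
      M * Num.min (enorm (x - y)) 1 * (1 + enorm x ^+ m + enorm y ^+ m) ;
  H_gradV_lipschitz : locally_lipschitz (grad V) ;
  H_gradV_growth : polynomial_growth (grad V) }.

End potentials.

Definition rate {R : realType} (lambdaV lambdaW : R) : R :=
  if 0 <= lambdaW then lambdaV else lambdaV + 2 * lambdaW.

Section measures.
Context {R : realType} {d : nat}.

(* mu \in P_q, with respect to the Euclidean norm, here and in               *)
(* finite_moment_tuple.                                                       *)
Definition finite_moment (q : nat) (mu : probability 'rV[R]_d R) : Prop :=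
  (\int[mu]_x (enorm x ^+ q)%:E < +oo)%E.

Definition tuple_enorm (N : nat) (x : N.-tuple 'rV[R]_d) : R :=
  Num.sqrt (\sum_(i < N) enorm (tnth x i) ^+ 2).

Definition finite_moment_tuple (q N : nat)
    (mu : probability (N.-tuple 'rV[R]_d) R) : Prop :=
  (\int[mu]_x (tuple_enorm x ^+ q)%:E < +oo)%E.

Definition coupling (N : nat) (mu nu : set (N.-tuple 'rV[R]_d) -> \bar R)
    (pi : probability (N.-tuple 'rV[R]_d * N.-tuple 'rV[R]_d)%type R) : Prop :=
  (forall A, measurable A -> pi (fst @^-1` A) = mu A) /\
  (forall A, measurable A -> pi (snd @^-1` A) = nu A).

(* The q-th power of the q-Wasserstein distance, possibly +oo. *)
Definition wasserstein_pow (q N : nat)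
    (mu nu : set (N.-tuple 'rV[R]_d) -> \bar R) : \bar R :=
  ereal_inf [set c | exists pi, coupling mu nu pi /\
    c = (\int[pi]_z (\sum_(i < N)
           enorm (tnth z.1 i - tnth z.2 i) ^+ q)%:E)%E].

End measures.

Section tensor_power.
Context {R : realType} {dT : measure_display} {T : measurableType dT}.

Definition tuple_cons (n : nat) (z : T * n.-tuple T) : n.+1.-tuple T :=
  [tuple of z.1 :: z.2].

Lemma measurable_tuple_cons n :
  measurable_fun [set: T * n.-tuple T] (@tuple_cons n).
Proof. by apply: measurable_cons; [exact: measurable_fst|exact: measurable_snd]. Qed.

HB.instance Definition _ n := isMeasurableFun.Build _ _ _ _
  (@tuple_cons n) (@measurable_tuple_cons n).

(* mu^{\otimes N} *)
Fixpoint tensor_power (mu : probability T R) (N : nat) :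
    probability (N.-tuple T) R :=
  match N with
  | 0 => dirac [tuple]
  | n.+1 => distribution (mu \x tensor_power mu n)%E (@tuple_cons n)
  end.

End tensor_power.

Section processes.
Context {R : realType} {dO : measure_display} {Omega : measurableType dO}.
Variable P : probability Omega R.

Definition sigma_of {dT} {T : measurableType dT} (X : Omega -> T) :
    set_system Omega :=
  preimage_set_system setT X measurable.

Definition sigma_of_process {dT} {T : measurableType dT} (X : R -> Omega -> T) :
    set_system Omega :=
  <<s \bigcup_(t in [set t | 0 <= t]) sigma_of (X t) >>.

Definition mutually_independent {I : eqType} (F : I -> set_system Omega) : Prop :=
  forall (s : seq I) (A : I -> set Omega), uniq s ->
    (forall i, i \in s -> F i (A i)) ->
    P (\bigcap_(i in [set` s]) A i) = (\prod_(i <- s) P (A i))%E.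

(* The second parameter of normal_prob is the standard deviation. *)
Definition real_brownian_motion (w : R -> Omega -> R) : Prop :=
  [/\ forall t, 0 <= t -> measurable_fun setT (w t),
      {ae P, forall omega, w 0 omega = 0 /\
         {within `[0, +oo[, continuous (w ^~ omega)}},
      forall t : nat -> R, 0 <= t 0%N ->
        (forall k, t k <= t k.+1) ->
        mutually_independent (fun k =>
          sigma_of (fun omega => w (t k.+1) omega - w (t k) omega)) &
      forall s t, 0 <= s -> s < t -> forall A, measurable A ->
        P [set omega | A (w t omega - w s omega)] =
        normal_prob 0 (Num.sqrt (t - s)) A].

Definition brownian_motion {d} (B : R -> Omega -> 'rV[R]_d) : Prop :=
  (forall k, real_brownian_motion (fun t omega => B t omega ord0 k)) /\
  mutually_independent (fun k : 'I_d =>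
    sigma_of_process (fun t omega => B t omega ord0 k)).

End processes.

Section dynamics.
Context {R : realType} {d : nat}.
Variables V W : 'rV[R]_d -> R.

(* Coordinatewise Lebesgue integral over [0, t]. *)
Definition integral_to (t : R) (f : R -> 'rV[R]_d) : 'rV[R]_d :=
  \row_k \int[lebesgue_measure]_(s in `[0, t]) f s ord0 k.

Definition particle_drift (N : nat) (x : N.-tuple 'rV[R]_d) (i : 'I_N) : 'rV[R]_d :=
  - grad V (tnth x i) -
  N%:R^-1 *: \sum_(j < N) grad W (tnth x i - tnth x j).

(* The noise being additive, the equation is understood pathwise, in          *)
(* integrated form: no stochastic integral is involved.                       *)
Definition particle_solution (N : nat) {dO} {Omega : measurableType dO}
    (P : probability Omega R) (B : 'I_N -> R -> Omega -> 'rV[R]_d)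
    (X : R -> Omega -> N.-tuple 'rV[R]_d) : Prop :=
  [/\ forall i, brownian_motion P (B i),
      mutually_independent P (fun o : option 'I_N =>
        if o is Some i then sigma_of_process (B i) else sigma_of (X 0)),
      forall t, 0 <= t -> measurable_fun setT (X t) &
      {ae P, forall omega,
        (forall i, {within `[0, +oo[, continuous (fun t => tnth (X t omega) i)}) /\
        forall t, 0 <= t -> forall i,
          tnth (X t omega) i = tnth (X 0 omega) i +
            Num.sqrt 2 *: B i t omega +
            integral_to t (fun s => particle_drift (X s omega) i)}].

Definition particle_flow (N : nat) (mu0 : probability (N.-tuple 'rV[R]_d) R)
    (mu : R -> probability (N.-tuple 'rV[R]_d) R) : Prop :=
  exists dO (Omega : measurableType dO) (P : probability Omega R)
      (B : 'I_N -> R -> Omega -> 'rV[R]_d) (X : R -> Omega -> N.-tuple 'rV[R]_d),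
    [/\ particle_solution P B X,
        forall A, measurable A -> pushforward P (X 0) A = mu0 A &
        forall t, 0 <= t -> forall A, measurable A ->
          pushforward P (X t) A = mu t A].

Definition grad_conv (mu : probability 'rV[R]_d R) (x : 'rV[R]_d) : 'rV[R]_d :=
  \row_k \int[mu]_y grad W (x - y) ord0 k.

Definition mckean_vlasov_drift (mu : probability 'rV[R]_d R) (x : 'rV[R]_d) :
    'rV[R]_d :=
  - grad V x - grad_conv mu x.

Definition mckean_vlasov_solution (u : R -> probability 'rV[R]_d R)
    {dO} {Omega : measurableType dO} (P : probability Omega R)
    (B X : R -> Omega -> 'rV[R]_d) : Prop :=
  [/\ brownian_motion P B,
      mutually_independent P (fun b : bool =>
        if b then sigma_of_process B else sigma_of (X 0)),
      forall t, 0 <= t -> measurable_fun setT (X t) &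
      {ae P, forall omega,
        {within `[0, +oo[, continuous (X ^~ omega)} /\
        forall t, 0 <= t ->
          (forall k, lebesgue_measure.-integrable `[0, t]
             (fun s => (mckean_vlasov_drift (u s) (X s omega) ord0 k)%:E)) /\
          X t omega = X 0 omega + Num.sqrt 2 *: B t omega +
            integral_to t (fun s => mckean_vlasov_drift (u s) (X s omega))}].

(* Moments of order m, the growth exponent of grad W, give a meaning to       *)
(* grad W * u_t. They are required to be bounded on compact time intervals,   *)
(* as usual in the definition of solutions of the McKean-Vlasov equation.     *)
Definition locally_bounded_moment (m : nat)
    (u : R -> probability 'rV[R]_d R) : Prop :=
  forall T : R, exists K : R, forall t, 0 <= t -> t <= T ->
    (\int[u t]_x (enorm x ^+ m)%:E <= K%:E)%E.

Definition mckean_vlasov_flow (m : nat) (u0 : probability 'rV[R]_d R)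
    (u : R -> probability 'rV[R]_d R) : Prop :=
  locally_bounded_moment m u /\
  exists dO (Omega : measurableType dO) (P : probability Omega R)
      (B X : R -> Omega -> 'rV[R]_d),
    [/\ mckean_vlasov_solution u P B X,
        forall A, measurable A -> pushforward P (X 0) A = u0 A &
        forall t, 0 <= t -> forall A, measurable A ->
          pushforward P (X t) A = u t A].

End dynamics.

(* Main.v *)
(* The particle system and N independent copies of the limit process are driven by the
   same Brownian motions, the initial values being coupled by an arbitrary coupling. Both
   equations have additive noise, so the difference of the solutions is absolutely
   continuous, and the monotonicity of grad V and the oddness of grad W give
     d/dt S <= - 2 p beta S + (forcing),  S = sum_i |X^i - Y^i|^(2 p),
   where the forcing is the 2p-th power of the difference between grad W * u_t and the
   empirical average of grad W over the N copies. These are i.i.d. with law u_t, so its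
   2p-th moment is O(N^-p) per particle by a Marcinkiewicz-Zygmund inequality, provided
   that the moments of Y - Y' are bounded in time for independent copies Y, Y' of the
   limit process. They are, because Y - Y' has contracting drift and Gaussian noise; this
   is seen on a time discretisation, which also shows that the law of a solution does not
   depend on the probability space, hence that the given flows can be realised on the
   coupled space. *)
Require Import Defs.
From HB Require Import structures.
From mathcomp Require Import all_boot all_order all_algebra.
From mathcomp Require Import all_classical all_reals all_analysis.
From mathcomp Require Import measurable_realfun ring lra.

Set Implicit Arguments.
Unset Strict Implicit.
Unset Printing Implicit Defensive.
Import Order.TTheory GRing.Theory Num.Theory.
Import numFieldNormedType.Exports.
Local Open Scope classical_set_scope.
Local Open Scope ring_scope.

(** * Integral calculus along continuous paths *)

(** The two flows live on unrelated probability spaces, and the initial coupling is an arbitrary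
    measure. Both equations are therefore solved afresh, path by path, on the product of that
    coupling with the noise space of the particle system, and the laws so obtained must be
    recognised as the given ones. Separating drift and noise makes this elementary: the noiseless
    flow is a contraction, so the solution at time [t] is a limit of functions of the initial value
    and of finitely many increments, whose joint law is known; neither filtrations nor stochastic
    calculus enter. The same scheme replaces Ito's formula in the moment bounds: a step is a
    contraction followed by an independent increment. Moments of a single limit process would
    involve its drift at the origin, which depends on its own law; in the difference of two copies
    that term cancels, whence bounds uniform in time. As only moments of order [m] are controlled,
    locally in time, the limit drift is merely known to be measurable in time. *)

Section AbsolutelyContinuous.
Context {R : realType}.
Implicit Types (F G f g : R -> R) (s t T : R).
Local Notation mu := (@lebesgue_measure R).

(** The regularity in time that is known of a drift along a path: measurable on the whole line,
    bounded on the interval where it is integrated. *)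
Definition lbm T f := measurable_fun setT f /\
  exists K, forall s, 0 <= s <= T -> `|f s| <= K.

Lemma lbm_integrable T f s t : lbm T f -> 0 <= s -> t <= T ->
  mu.-integrable `[s, t] (EFin \o f).
Proof.
move=> [mf [K fK]] s0 tT.
apply: measurable_bounded_integrable => //=.
- have [st|ts] := leP s t; last by rewrite set_itv_ge ?measure0// bnd_simp -ltNge.
  by rewrite lebesgue_measure_itv/=; case: ifP => // _; rewrite -EFinB ltry.
- exact: measurable_funTS.
- exists K; split; first exact: num_real.
  move=> y Ky x /=; rewrite in_itv/= => /andP[sx xt].
  by rewrite (le_trans _ (ltW Ky))// fK// (le_trans s0 sx) (le_trans xt tT).
Qed.

Lemma lbmD T f g : lbm T f -> lbm T g -> lbm T (fun s => f s + g s).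
Proof.
move=> [mf [K fK]] [mg [L gL]]; split; first exact: measurable_funD.
exists (K + L) => s hs; rewrite (le_trans (ler_normD _ _))// lerD// ?fK ?gL//.
Qed.

Lemma lbmM T f g : lbm T f -> lbm T g -> lbm T (fun s => f s * g s).
Proof.
move=> [mf [K fK]] [mg [L gL]]; split; first exact: measurable_funM.
by exists (K * L) => s hs; rewrite normrM ler_pM// ?fK ?gL.
Qed.

Lemma lbm_cst T c : lbm T (fun=> c).
Proof. by split; [exact: measurable_cst|exists `|c|]. Qed.

Lemma lbmN T f : lbm T f -> lbm T (fun s => - f s).
Proof.
move=> lf; have := lbmM (lbm_cst T (-1)) lf.
by under eq_fun do rewrite mulN1r.
Qed.

Lemma lbmB T f g : lbm T f -> lbm T g -> lbm T (fun s => f s - g s).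
Proof. by move=> lf lg; exact: lbmD lf (lbmN lg). Qed.

Lemma lbm_sum T (I : Type) (r : seq I) (P : pred I) (f : I -> R -> R) :
  (forall i, lbm T (f i)) -> lbm T (fun s => \sum_(i <- r | P i) f i s).
Proof.
move=> lf; elim: r => [|i r ih].
  by under eq_fun do rewrite big_nil; exact: lbm_cst.
under eq_fun do rewrite big_cons.
by case: (P i) => //; exact: lbmD.
Qed.

Lemma lbmX T f n : lbm T f -> lbm T (fun s => f s ^+ n).
Proof.
move=> lf; elim: n => [|n ih].
  by under eq_fun do rewrite expr0; exact: lbm_cst.
by under eq_fun do rewrite exprS; exact: lbmM.
Qed.

Lemma lbm_continuous T F : continuous F -> lbm T F.
Proof.
move=> cF; split; first exact: continuous_measurable_fun.
have [T0|T0] := leP 0 T; last first.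
  by exists 0 => s /andP[s0 sT]; move: (le_trans s0 sT); rewrite leNgt T0.
have : bounded_set (F @` `[0, T]).
  apply: compact_bounded; apply: continuous_compact.
    exact: continuous_subspaceT.
  exact: segment_compact.
move=> [M [_ FM]]; exists (M + 1) => s hs.
by apply: (FM (M + 1)); rewrite ?ltrDl//; exists s.
Qed.

Lemma Rint_split T f s t : lbm T f -> 0 <= s -> s <= t -> t <= T ->
  \int[mu]_(r in `[0, t]) f r - \int[mu]_(r in `[0, s]) f r =
  \int[mu]_(r in `[s, t]) f r.
Proof.
move=> lf s0 st tT.
rewrite Rintegral_itvB ?bnd_simp//; last exact: (lbm_integrable lf).
by rewrite Rintegral_itv_obnd_cbnd//; apply: integrableS (lbm_integrable lf s0 tT) => //;
  apply: subset_itvr; rewrite bnd_simp.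
Qed.

Lemma Rint_cst s t (c : R) : s <= t -> \int[mu]_(r in `[s, t]) c = c * (t - s).
Proof.
move=> st; rewrite Rintegral_cst//= lebesgue_measure_itv/= lte_fin.
move: st; rewrite le_eqVlt => /predU1P[->|->]; last by rewrite -EFinB.
by rewrite ltxx subrr.
Qed.

Lemma Rint_bound T f s t K : lbm T f -> 0 <= s -> s <= t -> t <= T ->
  (forall r, s <= r <= t -> `|f r| <= K) ->
  `|\int[mu]_(r in `[s, t]) f r| <= K * (t - s).
Proof.
move=> lf s0 st tT fK.
have If := lbm_integrable lf s0 tT.
rewrite (le_trans (le_normr_Rintegral _ If))// -Rint_cst//.
apply: le_Rintegral => //.
- by have := integrable_norm If.
- exact: (lbm_integrable (lbm_cst T K) s0 tT).
Qed.

Lemma ler_Rint T f g s t : lbm T f -> lbm T g -> 0 <= s -> t <= T ->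
  (forall r, s <= r <= t -> f r <= g r) ->
  \int[mu]_(r in `[s, t]) f r <= \int[mu]_(r in `[s, t]) g r.
Proof.
move=> lf lg s0 tT fg; apply: le_Rintegral => //.
- exact: (lbm_integrable lf).
- exact: (lbm_integrable lg).
Qed.

(** Over [n] equal pieces the increments add up to at most [C * T ^+ 2 / n]. This takes the place of
    differentiation almost everywhere in the product rule. *)
Lemma quadratic_increments_cst (P : R -> R) T C : 0 <= T ->
  (forall s t, 0 <= s -> s <= t -> t <= T -> `|P t - P s| <= C * (t - s) ^+ 2) ->
  P T = P 0.
Proof.
move=> T0 hP.
(* A negative [C] is possible on a degenerate interval only. *)
have C0 : 0 <= C \/ T = 0.
  have [<-|T0'] := eqVneq 0 T; first by right.
  left; have := hP 0 T (lexx _) T0 (lexx _).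
  rewrite subr0 => /(le_trans (normr_ge0 _)).
  by rewrite pmulr_lge0// exprn_even_gt0//= eq_sym.
case: C0 => [C0|->//].
suff H n : `|P T - P 0| <= (C * T ^+ 2) / n.+1%:R.
  suff E (e : R) : 0 < e -> `|P T - P 0| <= e.
    apply/eqP; rewrite -subr_eq0 -normr_le0; apply/ler_addgt0Pr => e e0.
    by rewrite add0r; exact: E.
  move=> e0; have := truncnS_gt ((C * T ^+ 2) / e).
  set n := Num.trunc _ => hn.
  rewrite (le_trans (H n))// ler_pdivrMr ?ltr0Sn// [leRHS]mulrC -ler_pdivrMr//.
  exact: ltW.
pose h := T / n.+1%:R.
have h0 : 0 <= h by rewrite divr_ge0.
have key k : (k <= n.+1)%N -> `|P (k%:R * h) - P 0| <= k%:R * (C * h ^+ 2).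
  elim: k => [_|k ih kn]; first by rewrite !mul0r subrr normr0.
  rewrite -[P _](subrK (P (k%:R * h))) -addrA (le_trans (ler_normD _ _))//.
  rewrite -[in leRHS]natr1 mulrDl mul1r [leRHS]addrC lerD ?ih 1?ltnW//.
  apply: (le_trans (hP _ _ _ _ _)).
  - by rewrite mulr_ge0.
  - by rewrite ler_wpM2r// ler_nat.
  - rewrite (_ : T = n.+1%:R * h); first by rewrite ler_wpM2r// ler_nat.
    by rewrite /h mulrCA divff ?mulr1// pnatr_eq0.
  - by rewrite -mulrBl -natr1 [k%:R + 1]addrC addrK mul1r.
have := key n.+1 (leqnn _).
have -> : n.+1%:R * h = T by rewrite /h mulrCA divff ?mulr1// pnatr_eq0.
move=> /le_trans; apply; rewrite /h.
rewrite le_eqVlt; apply/orP; left; apply/eqP; field.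
by rewrite addrC natr1 pnatr_eq0.
Qed.

(* The coefficients are only bounded and measurable in time, so the derivatives of
   solutions are kept in integrated form. *)
Definition prim T F f := [/\ continuous F, lbm T f &
  forall t, 0 <= t <= T -> F t = F 0 + \int[mu]_(r in `[0, t]) f r].

Lemma prim_incr T F f s t : prim T F f -> 0 <= s -> s <= t -> t <= T ->
  F t - F s = \int[mu]_(r in `[s, t]) f r.
Proof.
move=> [cF lf Ff] s0 st tT.
rewrite (Ff t) ?(le_trans s0 st)// (Ff s) ?s0 ?(le_trans st)//.
by rewrite -(Rint_split lf s0 st tT); ring.
Qed.

Lemma Rint_sum T (I : Type) (r : seq I) (f : I -> R -> R) s t :
  (forall i, lbm T (f i)) -> 0 <= s -> t <= T ->
  \int[mu]_(x in `[s, t]) (\sum_(i <- r) f i x) =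
  \sum_(i <- r) \int[mu]_(x in `[s, t]) f i x.
Proof.
move=> lf s0 tT; elim: r => [|i r ih].
  under eq_Rintegral do rewrite big_nil.
  by rewrite big_nil /Rintegral integral0_eq.
under eq_Rintegral do rewrite big_cons.
rewrite big_cons RintegralD//; first by rewrite ih.
- exact: (lbm_integrable (lf i)).
- by apply: (lbm_integrable _ s0 tT); apply: lbm_sum.
Qed.

Lemma continuous_big_sum (X : topologicalType) (I : Type) (r : seq I) (F : I -> X -> R) :
  (forall i, continuous (F i)) -> continuous (fun t : X => \sum_(i <- r) F i t).
Proof.
move=> cF; elim: r => [|i r ih].
  by under eq_fun do rewrite big_nil; move=> x; exact: cvg_cst.
rewrite (_ : (fun t : X => _) = (fun t : X => F i t + \sum_(j <- r) F j t)); last first.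
  by apply/funext => t; rewrite big_cons.
by move=> x; apply: cvgD; [exact: cF|exact: ih].
Qed.

Lemma prim_sum T (I : Type) (r : seq I) (F f : I -> R -> R) :
  (forall i, prim T (F i) (f i)) ->
  prim T (fun t => \sum_(i <- r) F i t) (fun t => \sum_(i <- r) f i t).
Proof.
move=> hF; split.
- by apply: continuous_big_sum => i; have [] := hF i.
- by apply: lbm_sum => i; have [] := hF i.
- move=> t /andP[t0 tT]; rewrite (@Rint_sum T)//; last by move=> i; have [] := hF i.
  by rewrite -big_split/=; apply: eq_bigr => i _; have [_ _ ->] := hF i; rewrite ?t0.
Qed.

Lemma prim_cst T c : prim T (fun=> c) (fun=> 0).
Proof.
split; [by move=> x; exact: cvg_cst|exact: lbm_cst|].
by move=> t _; rewrite /Rintegral integral0_eq ?addr0.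
Qed.

(** The function [P], namely [F * G] minus the integral of the expected derivative, has increments
    of order [(u - s) ^+ 2]: each is the integral of a bounded function times an increment of [F] or
    [G], and these are Lipschitz on the interval. Hence [P] is constant. *)
Lemma primM T F f G g : prim T F f -> prim T G g ->
  prim T (fun t => F t * G t) (fun t => f t * G t + F t * g t).
Proof.
move=> pF pG; have [cF lf Ff] := pF; have [cG lg Gg] := pG.
have lF := lbm_continuous T cF; have lG := lbm_continuous T cG.
have lH : lbm T (fun t => f t * G t + F t * g t) by apply: lbmD; exact: lbmM.
split=> //.
  by move=> x; apply: cvgM; [exact: cF|exact: cG].
move=> t /andP[t0 tT].
have [K fK] := lf.2; have [L gL] := lg.2.
pose P u := F u * G u - \int[mu]_(r in `[0, u]) (f r * G r + F r * g r).
suff : P t = P 0.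
  rewrite /P set_itv1 Rintegral_set1 subr0 => <-.
  by rewrite subrK.
apply: (@quadratic_increments_cst P t (2 * `|K| * `|L|)) => // s u s0 su ut.
have uT := le_trans ut tT.
have K0 r : s <= r <= u -> `|f r| <= `|K|.
  move=> /andP[sr ru]; rewrite (le_trans (fK _ _)) ?ler_norm//.
  by rewrite (le_trans s0 sr) (le_trans ru uT).
have L0 r : s <= r <= u -> `|g r| <= `|L|.
  move=> /andP[sr ru]; rewrite (le_trans (gL _ _)) ?ler_norm//.
  by rewrite (le_trans s0 sr) (le_trans ru uT).
have -> : P u - P s = \int[mu]_(r in `[s, u])
    (f r * (G u - G r) - g r * (F r - F s)).
  have -> : P u - P s = (F u - F s) * G u + F s * (G u - G s)
      - \int[mu]_(r in `[s, u]) (f r * G r + F r * g r).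
    by rewrite -(Rint_split lH s0 su uT) /P; ring.
  rewrite (prim_incr pF s0 su uT) (prim_incr pG s0 su uT).
  rewrite -RintegralZr//; last exact: (lbm_integrable lf).
  rewrite -RintegralZl//; last exact: (lbm_integrable lg).
  rewrite -RintegralD//; last 2 first.
    exact: (lbm_integrable (lbmM lf (lbm_cst T _))).
    exact: (lbm_integrable (lbmM (lbm_cst T _) lg)).
  rewrite -RintegralB//; last 2 first.
    by apply: (lbm_integrable (lbmD (lbmM lf (lbm_cst T _)) (lbmM (lbm_cst T _) lg))).
    exact: (lbm_integrable lH).
  by apply: eq_Rintegral => r _; ring.
have -> : 2 * `|K| * `|L| * (u - s) ^+ 2 = 2 * `|K| * `|L| * (u - s) * (u - s).
  by ring.
apply: (@Rint_bound T) => //.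
  by apply: lbmB; apply: lbmM => //; apply: lbmB => //; exact: lbm_cst.
move=> r /andP[sr ru].
have -> : 2 * `|K| * `|L| * (u - s) = `|K| * (`|L| * (u - s)) + `|L| * (`|K| * (u - s)).
  by ring.
rewrite (le_trans (ler_normB _ _))// !normrM lerD// ler_pM ?K0 ?L0 ?sr//.
  have r0 := le_trans s0 sr.
  rewrite (prim_incr pG r0 ru uT).
  rewrite (le_trans (Rint_bound (K := `|L|) lg r0 ru uT _))//.
    by move=> x /andP[rx xu]; rewrite L0 ?xu ?(le_trans sr rx).
  by rewrite ler_wpM2l// lerB.
have rT := le_trans ru uT.
rewrite (prim_incr pF s0 sr rT).
rewrite (le_trans (Rint_bound (K := `|K|) lf s0 sr rT _))//.
  by move=> x /andP[sx xr]; rewrite K0 ?sx ?(le_trans xr ru).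
by rewrite ler_wpM2l// lerB.
Qed.

Lemma prim_ext T F f g : prim T F f -> (forall t, f t = g t) -> prim T F g.
Proof. by move=> + /funext <-. Qed.

Lemma primX T F f n : prim T F f ->
  prim T (fun t => F t ^+ n) (fun t => n%:R * F t ^+ n.-1 * f t).
Proof.
move=> pF; elim: n => [|n ih].
  apply: prim_ext; last by move=> t; rewrite !mul0r.
  by under eq_fun do rewrite expr0; exact: prim_cst.
under eq_fun do rewrite exprS.
apply: prim_ext (primM pF ih) _ => t /=.
case: n {ih} => [|n]; first by rewrite !expr0 !mul0r; ring.
by rewrite /= exprS -[n.+2%:R]natr1; ring.
Qed.

Lemma primD T F f G g : prim T F f -> prim T G g ->
  prim T (fun t => F t + G t) (fun t => f t + g t).
Proof.
move=> [cF lf Ff] [cG lg Gg]; split; [|exact: lbmD|].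
  by move=> x; apply: cvgD; [exact: cF|exact: cG].
move=> t /andP[t0 tT]; rewrite RintegralD//; last 2 first.
- exact: (lbm_integrable lf).
- exact: (lbm_integrable lg).
by rewrite Ff ?t0// Gg ?t0// addrACA.
Qed.

Lemma primZ T F f c : prim T F f -> prim T (fun t => c * F t) (fun t => c * f t).
Proof.
move=> pF; apply: prim_ext (primM (prim_cst T c) pF) _ => t.
by rewrite mul0r add0r.
Qed.

Lemma primB T F f G g : prim T F f -> prim T G g ->
  prim T (fun t => F t - G t) (fun t => f t - g t).
Proof.
move=> pF /(primZ (-1)) pG; have := primD pF pG.
under eq_fun do rewrite mulN1r.
by move=> /prim_ext; apply=> t; rewrite mulN1r.
Qed.

Lemma prim_C1 T F f : (forall t, is_derive t (1 : R) F (f t)) -> continuous f ->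
  prim T F f.
Proof.
move=> dF cf.
have cF : continuous F.
  by move=> x; apply: differentiable_continuous; apply/derivable1_diffP; exact: ex_derive.
split=> //; first exact: lbm_continuous.
move=> t /andP[+ tT]; rewrite le_eqVlt => /predU1P[<-|t0].
  by rewrite set_itv1 Rintegral_set1 addr0.
rewrite /Rintegral (@continuous_FTC2 _ _ F) //=.
- by rewrite addrCA subrr addr0.
- exact: continuous_subspaceT.
- split => //.
  + by apply: cvg_at_right_filter; exact: cF.
  + by apply: cvg_at_left_filter; exact: cF.
- by move=> x _; rewrite derive1E derive_val.
Qed.

Lemma prim_le T F f g : 0 <= T -> prim T F f -> lbm T g ->
  (forall s, 0 <= s <= T -> f s <= g s) ->
  F T <= F 0 + \int[mu]_(r in `[0, T]) g r.
Proof.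
move=> T0 [_ lf Ff] lg fg; rewrite Ff ?T0 ?lexx// lerD2l.
exact: (ler_Rint (T := T)).
Qed.

End AbsolutelyContinuous.

(** * Euclidean vectors indexed by a finite type *)

Section Euclid.
Context {R : realType} {I : finType}.
Implicit Types (x y z : I -> R).

(** Vectors are functions on a finite type, so that one theory covers a single particle, with index
    ['I_d], and a whole system of particles, with index ['I_N * 'I_d]. *)
Definition dot x y : R := \sum_i x i * y i.
Definition n1 x : R := \sum_i `|x i|.
Definition n2 x : R := Num.sqrt (dot x x).

Lemma dotC x y : dot x y = dot y x.
Proof. by apply: eq_bigr => i _; rewrite mulrC. Qed.

Lemma dotDl x y z : dot (x \+ y) z = dot x z + dot y z.
Proof. by rewrite -big_split; apply: eq_bigr => i _; rewrite mulrDl. Qed.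

Lemma dotBl x y z : dot (x \- y) z = dot x z - dot y z.
Proof. by rewrite -sumrB; apply: eq_bigr => i _; rewrite mulrBl. Qed.

Lemma dotDr x y z : dot z (x \+ y) = dot z x + dot z y.
Proof. by rewrite dotC dotDl !(dotC z). Qed.

Lemma dotBr x y z : dot z (x \- y) = dot z x - dot z y.
Proof. by rewrite dotC dotBl !(dotC z). Qed.

Lemma dot_ge0 x : 0 <= dot x x.
Proof. by apply: sumr_ge0 => i _; rewrite -expr2 sqr_ge0. Qed.

Lemma dot_CS x y : dot x y ^+ 2 <= dot x x * dot y y.
Proof.
have [Y0|Y0] := eqVneq (dot y y) 0.
  have y0 i : y i = 0.
    have /psumr_eq0P : \sum_i y i * y i = 0 by exact: Y0.
    move=> H; have : y i * y i = 0.
      by apply: H => // j _; rewrite -expr2 sqr_ge0.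
    by move=> /eqP; rewrite mulf_eq0 orbb => /eqP.
  by rewrite Y0 mulr0 /dot big1 ?expr0n// => i _; rewrite y0 mulr0.
have Yp : 0 < dot y y by rewrite lt_def Y0 dot_ge0.
have : 0 <= \sum_i (x i * dot y y - y i * dot x y) ^+ 2.
  by apply: sumr_ge0 => i _; rewrite sqr_ge0.
have -> : \sum_i (x i * dot y y - y i * dot x y) ^+ 2 =
    dot y y * (dot x x * dot y y - dot x y ^+ 2).
  transitivity (\sum_i (dot y y ^+ 2 * (x i * x i) - 2 * dot x y * dot y y * (x i * y i)
      + dot x y ^+ 2 * (y i * y i))).
    by apply: eq_bigr => i _; ring.
  by rewrite big_split sumrB/= -!mulr_sumr -/(dot x x) -/(dot x y) -/(dot y y); ring.
by rewrite pmulr_rge0// subr_ge0.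
Qed.

Lemma n2_ge0 x : 0 <= n2 x. Proof. exact: sqrtr_ge0. Qed.

Lemma n2_sqr x : n2 x ^+ 2 = dot x x.
Proof. by rewrite sqr_sqrtr// dot_ge0. Qed.

Lemma dot_le_n2 x y : `|dot x y| <= n2 x * n2 y.
Proof.
rewrite -(@ler_pXn2r _ 2)// ?nnegrE ?mulr_ge0 ?n2_ge0//.
by rewrite exprMn !n2_sqr real_normK ?num_real// dot_CS.
Qed.

Lemma n2D x y : n2 (x \+ y) <= n2 x + n2 y.
Proof.
rewrite -(@ler_pXn2r _ 2)// ?nnegrE ?addr_ge0 ?n2_ge0//.
rewrite sqrrD !n2_sqr dotDl !dotDr (dotC y x).
have := le_trans (ler_norm _) (dot_le_n2 x y); lra.
Qed.

Lemma coord_le_n2 x i : `|x i| <= n2 x.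
Proof.
rewrite -(@ler_pXn2r _ 2)// ?nnegrE ?n2_ge0// n2_sqr real_normK ?num_real//.
rewrite /dot (bigD1 i)//= expr2 lerDl.
by apply: sumr_ge0 => j _; rewrite -expr2 sqr_ge0.
Qed.

Lemma n1_ge0 x : 0 <= n1 x. Proof. by apply: sumr_ge0. Qed.

Lemma coord_le_n1 x i : `|x i| <= n1 x.
Proof. by rewrite /n1 (bigD1 i)//= lerDl; apply: sumr_ge0. Qed.

Lemma n1_le_n2 x : n1 x <= #|I|%:R * n2 x.
Proof.
rewrite mulr_natl -sumr_const; apply: ler_sum => i _; exact: coord_le_n2.
Qed.

Lemma n2_le_n1 x : n2 x <= n1 x.
Proof.
rewrite -(@ler_pXn2r _ 2)// ?nnegrE ?n2_ge0 ?n1_ge0// n2_sqr expr2 {1}/n1 mulr_suml.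
apply: ler_sum => i _; rewrite (le_trans (ler_norm _))// normrM ler_wpM2l//.
exact: coord_le_n1.
Qed.

Lemma n1D x y : n1 (x \+ y) <= n1 x + n1 y.
Proof. by rewrite -big_split; apply: ler_sum => i _; exact: ler_normD. Qed.

Lemma n1C x y : n1 (x \- y) = n1 (y \- x).
Proof. by apply: eq_bigr => i _; exact: distrC. Qed.

Lemma n2C x y : n2 (x \- y) = n2 (y \- x).
Proof. by rewrite /n2 /dot; congr Num.sqrt; apply: eq_bigr => i _ /=; ring. Qed.

Lemma n2_0 : n2 (fun=> 0) = 0.
Proof. by rewrite /n2 /dot big1 ?sqrtr0// => i _; rewrite mulr0. Qed.

End Euclid.

(** * Gronwall's inequality and geometric convergence *)

Section Gronwall.
Context {R : realType}.
Local Notation mu := (@lebesgue_measure R).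

Lemma prim_expR (T c : R) : prim T (fun t => expR (c * t)) (fun t => c * expR (c * t)).
Proof.
apply: prim_C1 => [t|].
  rewrite mulrC; apply: (@is_derive1_comp _ expR (fun t => c * t)).
  have := is_deriveZ c (is_derive_id t (1 : R)).
  by rewrite /GRing.scale/= mulr1.
move=> t; apply: cvgM; first exact: cvg_cst.
apply: continuous_comp; last exact: continuous_expR.
by apply: cvgM; [exact: cvg_cst|exact: cvg_id].
Qed.

Lemma lbm_expR (T c d : R) : lbm T (fun t => expR (c * (d - t))).
Proof.
apply: lbm_continuous => t.
apply: (@continuous_comp _ _ _ (fun t => c * (d - t)) expR); last exact: continuous_expR.
by apply: cvgM; [exact: cvg_cst|apply: cvgB; [exact: cvg_cst|exact: cvg_id]].
Qed.

(** Integrate the derivative of [expR (c * t) * F t]. The sign of [c] is free: it is positive for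
    contraction estimates and equals [- h^-1] over one time step of length [h]. *)
Lemma gronwall (T c : R) (F f h : R -> R) : 0 <= T -> prim T F f -> lbm T h ->
  (forall s, 0 <= s <= T -> f s <= - c * F s + h s) ->
  F T <= expR (- c * T) * F 0 + \int[mu]_(s in `[0, T]) (expR (- c * (T - s)) * h s).
Proof.
move=> T0 pF lh fh.
have := prim_le T0 (primM (prim_expR T c) pF)
  (lbmM (lbm_continuous T (let: And3 c _ _ := prim_expR T c in c)) lh).
move=> /(_ _)/wrap[s sT|].
  have := ler_wpM2l (expR_ge0 (c * s)) (fh s sT); nra.
rewrite mulr0 expR0 mul1r => H.
rewrite -(@ler_pM2l _ (expR (c * T))) ?expR_gt0//.
rewrite mulrDr mulrA mulNr -expRD subrr expR0 mul1r -RintegralZl//; last first.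
  by apply: (lbm_integrable (T := T)) => //; apply: lbmM => //; exact: lbm_expR.
rewrite (le_trans H)// lerD2l le_eqVlt; apply/orP; left; apply/eqP.
apply: eq_Rintegral => s _; rewrite mulrA -expRD; congr (expR _ * _); ring.
Qed.

Lemma expR_int (T c : R) : 0 < c -> 0 <= T ->
  \int[mu]_(s in `[0, T]) expR (c * s) <= expR (c * T) / c.
Proof.
move=> c0 T0; have [_ _ /(_ T)] := prim_expR T c; rewrite T0 lexx => /(_ isT).
rewrite RintegralZl//; last first.
  apply: (lbm_integrable (T := T)) => //.
  by apply: lbm_continuous; have [] := prim_expR T c.
move=> ->; rewrite mulr0 expR0 ler_pdivlMr// mulrC lerDr ler01//.
Qed.

Lemma expR_int_rev (T c : R) : 0 < c -> 0 <= T ->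
  \int[mu]_(s in `[0, T]) expR (- c * (T - s)) <= c^-1.
Proof.
move=> c0 T0.
under eq_Rintegral do rewrite mulNr mulrBr opprB addrC expRD.
rewrite RintegralZl//; last first.
  apply: (lbm_integrable (T := T)) => //.
  by apply: lbm_continuous; have [] := prim_expR T c.
rewrite (le_trans (ler_wpM2l (expR_ge0 _) (expR_int c0 T0)))//.
by rewrite mulrA -expRD addNr expR0 mul1r.
Qed.

(** The intervals of centre [u k] and radius [2 * D / 2 ^+ k] are nested, and the supremum of their
    lower ends lies in all of them; this gives the limit together with its rate. *)
Lemma geometric_limit (u : nat -> R) (D : R) :
  (forall k, `|u k.+1 - u k| <= D / 2 ^+ k) ->
  exists l, forall k, `|l - u k| <= 2 * D / 2 ^+ k.
Proof.
move=> uD.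
pose v k := u k - 2 * D / 2 ^+ k; pose w k := u k + 2 * D / 2 ^+ k.
have e2 k : 2 * D / 2 ^+ k.+1 = D / 2 ^+ k.
  by rewrite exprS; field; rewrite expf_neq0.
have e3 k : 2 * D / 2 ^+ k = D / 2 ^+ k + D / 2 ^+ k by ring.
have vS k : v k <= v k.+1.
  by rewrite /v e2 e3; have := uD k; rewrite ler_norml => /andP[+ _]; lra.
have wS k : w k.+1 <= w k.
  by rewrite /w e2 e3; have := uD k; rewrite ler_norml => /andP[_ +]; lra.
have vm j k : (j <= k)%N -> v j <= v k.
  by move=> jk; apply: (homo_leq (r := fun x y : R => x <= y)) => //; exact: le_trans.
have wm j k : (j <= k)%N -> w k <= w j.
  by move=> jk; apply: (homo_leq (r := fun x y : R => y <= x)) => // y x z xy yz; exact: le_trans yz xy.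
have D0 : 0 <= D by have := le_trans (normr_ge0 _) (uD 0%N); rewrite expr0 divr1.
have vw j k : v j <= w k.
  apply: (le_trans (vm j (maxn j k) (leq_maxl _ _))).
  apply: (le_trans _ (wm k (maxn j k) (leq_maxr _ _))).
  have : 0 <= 2 * D / 2 ^+ maxn j k by rewrite divr_ge0// ?mulr_ge0// exprn_ge0.
  rewrite /v /w; lra.
exists (sup (range v)) => k; rewrite ler_distl.
have hs : has_sup (range v).
  by split; [exists (v 0%N); exists 0%N|exists (w 0%N) => _ [j _ <-]].
apply/andP; split.
  by apply: ub_le_sup; [case: hs|exists k].
by apply: ge_sup => [|_ [j _ <-]]; [case: hs|exact: vw].
Qed.

Lemma half_powers_to0 (D e : R) : 0 < e -> exists k, D / 2 ^+ k <= e.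
Proof.
move=> e0; exists (Num.trunc (D / e)).+1.
set k := Num.trunc _.
rewrite ler_pdivrMr ?exprn_gt0// mulrC -ler_pdivrMr//.
rewrite (le_trans (ltW (truncnS_gt _)))// -/k -natrX ler_nat.
exact: ltnW (ltn_expl _ _).
Qed.

End Gronwall.

Section ImageMeasure.
Context d d' (T : measurableType d) (T' : measurableType d') (R : realType).

Definition image_measure (m : {measure set T -> \bar R}) (f : T -> T')
    (mf : measurable_fun setT f) : {measure set T' -> \bar R} :=
  measure_function_pushforward__canonical__measure_function_Measure m mf.

Definition mfun_of (f : T -> T') (mf : measurable_fun setT f) : {mfun T >-> T'} :=
  HB.pack f (isMeasurableFun.Build _ _ _ _ _ mf).

Definition law (P : probability T R) (f : T -> T') (mf : measurable_fun setT f) :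
  probability T' R := distribution P (mfun_of mf).

Lemma lawE P (f : T -> T') (mf : measurable_fun setT f) A : law P mf A = P (f @^-1` A).
Proof. by []. Qed.

End ImageMeasure.

(** * Primitives frozen outside an interval *)

Section ClampedPrimitive.
Context {R : realType}.
Local Notation mu := (@lebesgue_measure R).
Implicit Types (f : R -> R).

Definition clamp (T t : R) : R := Num.max 0 (Num.min t T).

Lemma clamp_itv T t : 0 <= T -> 0 <= clamp T t <= T.
Proof.
by move=> T0; rewrite /clamp le_max lexx ge_max T0 ge_min lexx orbT.
Qed.

Lemma clamp_id T t : 0 <= t <= T -> clamp T t = t.
Proof. by move=> /andP[t0 tT]; rewrite /clamp (min_l tT) (max_r t0). Qed.

Lemma clamp_homo T s t : s <= t -> clamp T s <= clamp T t.
Proof.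
move=> st; rewrite /clamp le_max2//; apply: le_min2 => //.
Qed.

Lemma clamp_lip T s t : 0 <= T -> s <= t -> clamp T t - clamp T s <= t - s.
Proof.
move=> T0 st; rewrite /clamp lerBlDr ge_max addr_ge0 ?subr_ge0 ?le_max ?lexx//=.
have [sT|Ts] := leP s T.
  have : s <= Num.max 0 s by rewrite le_max lexx orbT.
  have : Num.min t T <= t by rewrite ge_min lexx.
  lra.
have : T <= Num.max 0 T by rewrite le_max lexx orbT.
have : Num.min t T <= T by rewrite ge_min lexx orbT.
lra.
Qed.

(** Frozen outside [[0, T]], the primitive is continuous on the whole line although [f] is bounded
    on [[0, T]] only; paths can then be required to be continuous everywhere. *)
Definition clamped_int T f t := \int[mu]_(r in `[0, clamp T t]) f r.

Lemma clamped_int_lip T f K s t : 0 <= T -> lbm T f -> (forall r, 0 <= r <= T -> `|f r| <= K) ->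
  s <= t -> `|clamped_int T f t - clamped_int T f s| <= K * (t - s).
Proof.
move=> T0 lf fK st; have /andP[s0 sT] := clamp_itv s T0.
have /andP[t0 tT] := clamp_itv t T0; have hst := clamp_homo T st.
rewrite /clamped_int (Rint_split lf s0 hst tT).
rewrite (le_trans (Rint_bound (K := K) lf s0 hst tT _))//.
  by move=> r /andP[sr rt]; rewrite fK// (le_trans s0 sr) (le_trans rt tT).
rewrite ler_wpM2l ?clamp_lip//.
by rewrite (le_trans (normr_ge0 _) (fK 0 _))// lexx T0.
Qed.

Lemma clamped_int_continuous T f : 0 <= T -> lbm T f -> continuous (clamped_int T f).
Proof.
move=> T0 lf t0; have [mf [K fK]] := lf.
have fK' r : 0 <= r <= T -> `|f r| <= `|K| + 1.
  by move=> /fK /le_trans; apply; rewrite (le_trans (ler_norm _))// lerDl.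
apply/cvgrPdist_le => e e0; near=> t.
have [st|ts] := leP t t0.
  rewrite (le_trans (clamped_int_lip T0 lf fK' st))// mulrC -ler_pdivlMr// ?ltr_wpDl//.
  rewrite (le_trans (ler_norm _))//; near: t; apply: cvgr_dist_le => //.
  by rewrite divr_gt0// ltr_wpDl.
rewrite distrC (le_trans (clamped_int_lip T0 lf fK' (ltW ts)))// mulrC -ler_pdivlMr// ?ltr_wpDl//.
rewrite (le_trans (ler_norm _))// distrC; near: t; apply: cvgr_dist_le => //.
by rewrite divr_gt0// ltr_wpDl.
Unshelve. all: by end_near. Qed.

Lemma clamped_intE T f t : 0 <= T -> t <= T -> clamped_int T f t = \int[mu]_(r in `[0, t]) f r.
Proof.
move=> T0 tT; have [t0|t0] := leP 0 t; first by rewrite /clamped_int clamp_id ?t0.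
rewrite /clamped_int /clamp (min_l tT) (max_l (ltW t0)) set_itv1 Rintegral_set1.
by rewrite set_itv_ge ?Rintegral_set0// bnd_simp -ltNge.
Qed.

(** Lebesgue measure and its translate agree on half-open intervals, hence everywhere; the rest is a
    change of variables for an image measure. It serves to restart a solution at time [s0]. *)
Lemma Rint_translate T f s0 h : lbm T f -> 0 <= s0 -> 0 <= h -> s0 + h <= T ->
  \int[mu]_(r in `[s0, s0 + h]) f r = \int[mu]_(r in `[0, h]) f (s0 + r).
Proof.
move=> lf s00 h0 hT.
have mphi : measurable_fun setT (fun r : R => s0 + r) by exact: measurable_funD.
have -> : `[0, h]%classic = (fun r : R => s0 + r) @^-1` `[s0, s0 + h]%classic.
  by apply/seteqP; split => r /=; rewrite !in_itv/= lerDl lerD2l.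
pose nu := image_measure (T' := measurableTypeR R) mu mphi.
rewrite /Rintegral; congr fine.
have E A : measurable A -> mu A = nu A.
  apply: lebesgue_measure_unique => _ [[a b] /= _ <-].
  rewrite /nu /= /pushforward.
  have -> : (fun r : R => s0 + r) @^-1` `]a, b]%classic = `]a - s0, b - s0]%classic.
    by apply/seteqP; split => r /=; rewrite !in_itv/= ltrBlDl lerBrDl.
  rewrite !lebesgue_measure_itv/= !lte_fin ltrD2r.
  by case: ifP => // _; rewrite -!EFinB opprB addrA subrK.
have mf : measurable_fun setT (EFin \o f) by apply/measurable_EFinP; case: lf.
have EI (g : R -> \bar R) : (\int[mu]_(x in `[s0, (s0 + h)%R]) g x =
    \int[nu]_(x in `[s0, (s0 + h)%R]) g x)%E.
  by apply: eq_measure_integral => A mA _; exact: E.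
rewrite EI.
apply: (@integral_pushforward _ _ (measurableTypeR R) (measurableTypeR R) R _ mphi mu
  `[s0, s0 + h]%classic (EFin \o f)) => //.
apply/integrableP; split.
  by apply: measurable_funTS; apply: measurableT_comp mf mphi.
have /integrableP[_] := lbm_integrable lf s00 hT.
rewrite EI; congr (_ < _)%E.
apply: (@ge0_integral_pushforward _ _ (measurableTypeR R) (measurableTypeR R) R _ mphi mu
  `[s0, s0 + h]%classic) => //.
by apply: measurable_funTS; apply: measurableT_comp.
Qed.

End ClampedPrimitive.

(** * Pathwise equations with a dissipative drift *)

Section Drift.
Context {R : realType} {I : finType}.
Local Notation mu := (@lebesgue_measure R).
Implicit Types (x y : I -> R) (z w : R -> I -> R) (b : R -> (I -> R) -> I -> R).

Definition continuous_path z := forall i, continuous (fun t => z t i).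

(** Measurability in time is asked along continuous paths, which is how the drift enters the
    equation. The bounds hold uniformly for all [s <= T], negative times included, so that no lower
    bound on time has to be carried along. *)
Record drift_ok b (kappa : R) : Prop := {
  drift_gt0 : 0 < kappa ;
  drift_meas : forall z, continuous_path z -> forall i, measurable_fun setT (fun s => b s (z s) i) ;
  drift_lip : forall T K, exists L, 0 <= L /\ forall s x y, s <= T ->
    n1 x <= K -> n1 y <= K -> forall i, `|b s x i - b s y i| <= L * n1 (x \- y) ;
  drift_bd : forall T, exists K, forall s i, s <= T -> `|b s (fun=> 0) i| <= K ;
  drift_mono : forall s x y, dot (b s x \- b s y) (x \- y) <= - kappa * dot (x \- y) (x \- y) }.

(* The noise is additive, so [w] is a fixed path. For [t < 0] the integral is over the
   empty set. *)
Definition is_sol T b x w z := continuous_path z /\ forall t, t <= T -> forall i,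
  z t i = x i + w t i + \int[mu]_(s in `[0, t]) b s (z s) i.

Lemma continuous_pathB z w : continuous_path z -> continuous_path w -> continuous_path (fun t => z t \- w t).
Proof. by move=> cz cw i t; apply: cvgB; [exact: cz|exact: cw]. Qed.

Lemma continuous_n1 z : continuous_path z -> continuous (fun t => n1 (z t)).
Proof.
move=> cz; apply: continuous_big_sum => i t.
apply: continuous_comp; [exact: cz|exact: norm_continuous].
Qed.

Lemma continuous_path_bounded z T : continuous_path z -> exists K, 0 <= K /\ forall t, 0 <= t <= T -> n1 (z t) <= K.
Proof.
move=> cz; have [_ [K hK]] := lbm_continuous T (continuous_n1 cz).
by exists `|K|; split => // t /hK; rewrite ger0_norm ?n1_ge0// => /le_trans; apply; exact: ler_norm.
Qed.

Lemma drift_bounded b kappa T K : drift_ok b kappa -> exists M, 0 <= M /\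
  forall s x i, s <= T -> n1 x <= K -> `|b s x i| <= M.
Proof.
move=> ok; have [L [L0 hL]] := drift_lip ok T `|K|; have [B hB] := drift_bd ok T.
have n10 : n1 (fun _ : I => 0 : R) <= `|K| by rewrite /n1 big1 ?normr0// => i _; rewrite normr0.
exists (L * `|K| + `|B|); split; first by rewrite addr_ge0 ?mulr_ge0.
move=> s x i sT xK; rewrite -[b s x i](subrK (b s (fun=> 0) i)).
rewrite (le_trans (ler_normD _ _))// lerD//.
  rewrite (le_trans (hL s x _ sT _ n10 i))//; first exact: le_trans (ler_norm _).
  rewrite ler_wpM2l// (le_trans _ (le_trans xK (ler_norm _)))//.
  by apply: ler_sum => j _ /=; rewrite subr0.
exact: le_trans (hB _ _ sT) (ler_norm _).
Qed.

Lemma lbm_drift T b kappa z i : drift_ok b kappa -> continuous_path z -> lbm T (fun s => b s (z s) i).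
Proof.
move=> ok cz; split; first exact: drift_meas ok _ cz i.
have [K [_ hK]] := continuous_path_bounded T cz.
have [M [_ hM]] := drift_bounded T K ok.
by exists M => s /andP[s0 sT]; rewrite hM// hK// s0.
Qed.

Lemma sol_prim T b kappa x w z : drift_ok b kappa -> continuous_path w -> 0 <= T ->
  is_sol T b x w z ->
  forall i, prim T (fun t => z t i - w t i) (fun s => b s (z s) i).
Proof.
move=> ok cw T0 [cz hz] i; split; [exact: continuous_pathB cz cw i|exact: (lbm_drift _ _ ok cz)|].
move=> t /andP[t0 tT]; rewrite (hz t tT) (hz 0 T0) set_itv1 Rintegral_set1; ring.
Qed.

Lemma sol0 T b x w z : 0 <= T -> is_sol T b x w z -> forall i, z 0 i = x i + w 0 i.
Proof. by move=> T0 [_ hz] i; rewrite hz// set_itv1 Rintegral_set1 addr0. Qed.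

Lemma is_sol_le T T' b x w z : T' <= T -> is_sol T b x w z -> is_sol T' b x w z.
Proof. by move=> h [cz hz]; split=> // t tT; apply: hz; exact: le_trans h. Qed.

(** The common noise cancels in [z - z'], whose square is then a primitive to which Gronwall's
    inequality applies with rate [2 * kappa]. *)
Lemma sol_contract t b kappa x x' w z z' : drift_ok b kappa -> continuous_path w -> 0 <= t ->
  is_sol t b x w z -> is_sol t b x' w z' ->
  n2 (z t \- z' t) <= expR (- kappa * t) * n2 (x \- x').
Proof.
move=> ok cw t0 hz hz'.
have pF : prim t (fun s => \sum_i (z s i - z' s i) ^+ 2)
    (fun s => \sum_i 2%:R * (z s i - z' s i) ^+ 1 * (b s (z s) i - b s (z' s) i)).
  apply: prim_sum => i.
  have := primX 2 (primB (sol_prim ok cw t0 hz i) (sol_prim ok cw t0 hz' i)).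
  by under eq_fun do rewrite opprB addrA subrK;
    under [X in prim _ _ X -> _]eq_fun do rewrite opprB addrA subrK.
have := gronwall (c := 2 * kappa) t0 pF (lbm_cst t 0) => /(_ _)/wrap[s _|].
  rewrite addr0; have := drift_mono ok s (z s) (z' s).
  have -> : \sum_i 2%:R * (z s i - z' s i) ^+ 1 * (b s (z s) i - b s (z' s) i) =
      2 * dot (b s (z s) \- b s (z' s)) (z s \- z' s).
    by rewrite mulr_sumr; apply: eq_bigr => i _ /=; ring.
  have -> : \sum_i (z s i - z' s i) ^+ 2 = dot (z s \- z' s) (z s \- z' s).
    by apply: eq_bigr => i _ /=; rewrite expr2.
  lra.
rewrite (@eq_Rintegral _ _ _ mu _ (cst 0)); last by move=> r _ /=; rewrite mulr0.
rewrite Rint_cst// mul0r addr0 => H.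
rewrite -(@ler_pXn2r _ 2)// ?nnegrE ?mulr_ge0 ?expR_ge0 ?n2_ge0//.
rewrite exprMn !n2_sqr -expRM_natl.
have -> : 2%:R * (- kappa * t) = - (2 * kappa) * t by ring.
have -> : dot (z t \- z' t) (z t \- z' t) = \sum_i (z t i - z' t i) ^+ 2.
  by apply: eq_bigr => i _ /=; rewrite expr2.
have -> // : dot (x \- x') (x \- x') = \sum_i (z 0 i - z' 0 i) ^+ 2.
apply: eq_bigr => i _ /=; rewrite (sol0 t0 hz) (sol0 t0 hz'); ring.
Qed.

End Drift.

(** * Existence of solutions *)

Section Existence.
Context {R : realType} {I : finType}.
Local Notation mu := (@lebesgue_measure R).
Implicit Types (x y : I -> R) (z w : R -> I -> R) (b c : R -> (I -> R) -> I -> R) (s t T K L : R).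

Lemma continuous_path_uniform_limit (zz : nat -> R -> I -> R) z (D : R) :
  (forall k, continuous_path (zz k)) ->
  (forall t i k, `|z t i - zz k t i| <= D / 2 ^+ k) -> continuous_path z.
Proof.
move=> czz h i t0; apply/cvgrPdist_le => e e0.
have e3 : 0 < e / 3 by rewrite divr_gt0.
have [k hk] := half_powers_to0 D e3.
near=> t.
have -> : z t0 i - z t i =
    (z t0 i - zz k t0 i) + (zz k t0 i - zz k t i) + - (z t i - zz k t i) by ring.
have -> : e = e / 3 + e / 3 + e / 3 by field.
rewrite (le_trans (ler_normD _ _))// lerD ?normrN ?(le_trans (h _ _ k))//.
rewrite (le_trans (ler_normD _ _))// lerD ?(le_trans (h _ _ k))//.
near: t; apply: cvgr_dist_le => //; exact: czz.
Unshelve. all: by end_near. Qed.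

(** The weight [expR (2 * La * t)] makes each Picard iteration gain a factor two on all of [[0, T]]
    at once, so that no short intervals have to be glued together. *)
Lemma picard T c L K x w : 0 <= T -> continuous_path w ->
  (forall z, continuous_path z -> forall i, measurable_fun setT (fun s => c s (z s) i)) ->
  0 <= L ->
  (forall s y y' i, s <= T -> `|c s y i - c s y' i| <= L * n1 (y \- y')) ->
  (forall s y i, s <= T -> `|c s y i| <= K) ->
  exists z, is_sol T c x w z.
Proof.
move=> T0 cw mc L0 cL cK.
have lc z i : continuous_path z -> lbm T (fun s => c s (z s) i).
  by move=> cz; split; [exact: mc|exists K => s /andP[_ sT]; exact: cK].
pose nxt z t i := x i + w t i + clamped_int T (fun s => c s (z s) i) t.
have cnxt z : continuous_path z -> continuous_path (nxt z).
  move=> cz i t; apply: cvgD; last exact: (clamped_int_continuous T0 (lc _ i cz)).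
  by apply: cvgD; [exact: cvg_cst|exact: cw].
pose zz k := iter k nxt (fun t i => x i + w t i).
have czz k : continuous_path (zz k).
  elim: k => [|k ih]; last exact: cnxt.
  by move=> i t; apply: cvgD; [exact: cvg_cst|exact: cw].
have IntB z z' i t : continuous_path z -> continuous_path z' ->
    clamped_int T (fun s => c s (z s) i) t - clamped_int T (fun s => c s (z' s) i) t =
    \int[mu]_(s in `[0, clamp T t]) (c s (z s) i - c s (z' s) i).
  move=> cz cz'; have /andP[a0 aT] := clamp_itv t T0.
  by rewrite RintegralB//; apply: lbm_integrable (lc _ _ _) _ aT.
pose n : R := #|I|%:R.
have n0 : 0 <= n by rewrite ler0n.
(* The summand one keeps [La] positive when [L] or the dimension is zero. *)
pose La := n * L + 1.
have La0 : 0 < La by rewrite ltr_wpDl// mulr_ge0.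
have nLLa : n * L <= La by rewrite lerDl.
pose C := n * (`|K| * T).
have C0 : 0 <= C by rewrite !mulr_ge0.
have key k t : 0 <= t <= T ->
    n1 (zz k.+1 t \- zz k t) <= C * expR (2 * La * t) / 2 ^+ k.
  elim: k t => [|k ih] t t0T; have /andP[t0 tT] := t0T.
    rewrite expr0 divr1 (@le_trans _ _ C)//; last first.
      rewrite ler_peMr// -[leLHS]expR0 ler_expR !mulr_ge0// ltW//.
    rewrite /C /n mulr_natl -sumr_const; apply: ler_sum => i _ /=.
    rewrite /nxt addrC addKr /clamped_int clamp_id//.
    rewrite (le_trans (Rint_bound (K := `|K|) (lc _ _ (czz 0%N)) (lexx 0) t0 tT _))//.
      by move=> r /andP[_ rt]; rewrite (le_trans (cK _ _ _ (le_trans rt tT)))// ler_norm.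
    by rewrite ler_wpM2l// subr0.
  have E i : `|zz k.+2 t i - zz k.+1 t i| <=
      L * (C / 2 ^+ k) * (expR (2 * La * t) / (2 * La)).
    have zS j : zz j.+1 t i = x i + w t i + clamped_int T (fun s => c s (zz j s) i) t by [].
    have -> : zz k.+2 t i - zz k.+1 t i =
        \int[mu]_(s in `[0, t]) (c s (zz k.+1 s) i - c s (zz k s) i).
      by rewrite -[X in `[0, X]](clamp_id t0T) -IntB// !zS; ring.
    have lB := lbmB (lc _ i (czz k.+1)) (lc _ i (czz k)).
    have IB := lbm_integrable lB (lexx 0) tT.
    rewrite (le_trans (le_normr_Rintegral _ IB))//.
    have cE : continuous (fun s => expR (2 * La * s)) by have [] := prim_expR T (2 * La).
    have IE := lbm_integrable (lbm_continuous T cE) (lexx 0) tT.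
    apply: (@le_trans _ _ (\int[mu]_(s in `[0, t]) (L * (C / 2 ^+ k) * expR (2 * La * s)))).
      apply: le_Rintegral => //.
      - exact: (integrable_norm IB).
      - exact: (lbm_integrable (lbmM (lbm_cst T _) (lbm_continuous T cE)) (lexx 0) tT).
      move=> s; rewrite /= in_itv/= => /andP[s0 st]; have sT := le_trans st tT.
      rewrite (le_trans (cL _ _ _ _ sT))// -mulrA ler_wpM2l// mulrAC.
      by apply: ih; rewrite s0.
    rewrite RintegralZl// ler_wpM2l// ?expR_int ?mulr_gt0//.
    by rewrite mulr_ge0// divr_ge0// exprn_ge0.
  apply: (@le_trans _ _ (n * (L * (C / 2 ^+ k) * (expR (2 * La * t) / (2 * La))))).
    rewrite /n mulr_natl -sumr_const; apply: ler_sum => i _; exact: E.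
  have -> : n * (L * (C / 2 ^+ k) * (expR (2 * La * t) / (2 * La))) =
      (n * L / La) * (C * expR (2 * La * t) / 2 ^+ k.+1).
    by rewrite exprS; field; rewrite expf_neq0 ?gt_eqF.
  rewrite ler_piMl//.
    by rewrite divr_ge0 ?mulr_ge0 ?expR_ge0 ?exprn_ge0.
  by rewrite ler_pdivrMr// mul1r.
(* Apart from the noise, iterates are frozen outside [[0, T]]; the estimate on [[0, T]] thus holds
   for differences of iterates at all times. *)
have shift k t i : zz k t i - w t i = zz k (clamp T t) i - w (clamp T t) i.
  case: k => [|k] /=; first by rewrite !addrK.
  rewrite /nxt /clamped_int (clamp_id (clamp_itv t T0)); ring.
pose D := C * expR (2 * La * T).
have step t i k : `|zz k.+1 t i - zz k t i| <= D / 2 ^+ k.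
  have -> : zz k.+1 t i - zz k t i = zz k.+1 (clamp T t) i - zz k (clamp T t) i.
    have := shift k.+1 t i; have := shift k t i; lra.
  rewrite (le_trans (coord_le_n1 (zz k.+1 _ \- zz k _) i))//.
  rewrite (le_trans (key _ _ (clamp_itv t T0)))//.
  rewrite ler_wpM2r ?invr_ge0 ?exprn_ge0// /D ler_wpM2l// ler_expR.
  apply: ler_wpM2l; first by rewrite mulr_ge0// ltW.
  by have /andP[] := clamp_itv t T0.
pose z t i := sval (cid (geometric_limit (step t i))).
have hz t i k : `|z t i - zz k t i| <= 2 * D / 2 ^+ k.
  by rewrite /z; case: cid => l /=; exact.
have cz : continuous_path z by apply: (@continuous_path_uniform_limit zz z (2 * D)).
exists z; split=> // t tT i.
suff : z t i = nxt z t i by rewrite /nxt clamped_intE.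
apply/eqP; rewrite -subr_eq0 -normr_le0.
suff E (e : R) : 0 < e -> `|z t i - nxt z t i| <= e.
  by apply/ler_addgt0Pr => e e0; rewrite add0r; exact: E.
move=> e0.
have [k hk] := half_powers_to0 (2 * D + L * (n * (2 * D)) * T) e0.
apply: le_trans hk.
have -> : z t i - nxt z t i = (z t i - zz k.+1 t i) +
    (clamped_int T (fun s => c s (zz k s) i) t - clamped_int T (fun s => c s (z s) i) t).
  by rewrite /= /nxt; ring.
have D0 : 0 <= D by rewrite mulr_ge0 ?expR_ge0.
rewrite (le_trans (ler_normD _ _))// [in leRHS]mulrDl lerD//.
  rewrite (le_trans (hz _ _ k.+1))// ler_wpM2l ?mulr_ge0//.
  by rewrite lef_pV2 ?posrE ?exprn_gt0// ler_eXn2l// ltr1n.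
have /andP[a0 aT] := clamp_itv t T0.
rewrite IntB//.
have lB := lbmB (lc _ i (czz k)) (lc _ i cz).
rewrite (le_trans (Rint_bound (K := L * (n * (2 * D / 2 ^+ k))) lB (lexx 0) a0 aT _))//.
  move=> r /andP[_ ra]; rewrite (le_trans (cL _ _ _ _ (le_trans ra aT)))// ler_wpM2l//.
  rewrite /n mulr_natl -sumr_const; apply: ler_sum => j _ /=.
  by rewrite distrC; exact: hz.
rewrite subr0.
have -> : L * (n * (2 * D)) * T / 2 ^+ k = L * (n * (2 * D / 2 ^+ k)) * T.
  by field; rewrite expf_neq0.
by rewrite ler_wpM2l// !mulr_ge0 ?invr_ge0 ?exprn_ge0.
Qed.

Lemma cutoff_lip (K : R) x y :
  `|Num.max 0 (Num.min 1 (K - n1 x)) - Num.max 0 (Num.min 1 (K - n1 y))| <= n1 (x \- y).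
Proof.
have h : `|n1 x - n1 y| <= n1 (x \- y).
  rewrite /n1 -sumrB (le_trans (ler_norm_sum _ _ _))//.
  by apply: ler_sum => i _; exact: ler_dist_dist.
have aux (a b d : R) : `|a - b| <= d ->
    Num.max 0 (Num.min 1 (K - a)) - Num.max 0 (Num.min 1 (K - b)) <= d.
  move=> hd; have d0 := le_trans (normr_ge0 _) hd.
  move: hd; rewrite ler_norml => /andP[hd1 hd2].
  rewrite lerBlDr ge_max addr_ge0 ?le_max ?lexx//=.
  have [h1|h1] := leP 1 (K - b).
    have := ge_min 1 1 (K - a); rewrite lexx /= => h2.
    have : 1 <= Num.max 0 (1 : R) by rewrite le_max lexx orbT.
    lra.
  have h2 : Num.min 1 (K - a) <= K - a by rewrite ge_min lexx orbT.
  have : K - b <= Num.max 0 (K - b) by rewrite le_max lexx orbT.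
  lra.
rewrite ler_norml; apply/andP; split; last exact: aux.
by rewrite lerNl opprB aux// distrC.
Qed.

(* Dissipativity confines solutions to a ball, outside of which the drift is cut off to
   become globally Lipschitz. *)
Lemma sol_exists T b kappa x w : drift_ok b kappa -> continuous_path w -> 0 <= T ->
  exists z, is_sol T b x w z.
Proof.
move=> ok cw T0.
have kp := drift_gt0 ok.
have [Kw [Kw0 hw]] := continuous_path_bounded T cw.
have [B [B0 hB]] := drift_bounded T Kw ok.
pose n : R := #|I|%:R.
(* For [y = z - w], Young's inequality [n * B * n2 y <= kappa * n2 y ^+ 2 + A / 2] bounds the
   derivative of [n2 y ^+ 2] by [A]. In [K], one plus a bound on the square of a norm serves as a
   bound on the norm. *)
pose A := (n * B) ^+ 2 / (2 * kappa).
have A0 : 0 <= A by rewrite divr_ge0 ?sqr_ge0// mulr_ge0// ltW.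
pose K := n * (1 + dot x x + A * T) + Kw.
have [M [M0 hM]] := drift_bounded T (K + 1) ok.
have [L [L0 hL]] := drift_lip ok T (K + 1).
pose chi y := Num.max 0 (Num.min 1 (K + 1 - n1 y)).
have chi0 y : 0 <= chi y by rewrite le_max lexx.
have chi1 y : chi y <= 1 by rewrite ge_max ler01 ge_min lexx.
have chiK y : n1 y <= K -> chi y = 1.
  by move=> h; rewrite /chi (min_l (_ : 1 <= K + 1 - n1 y)) ?max_r//; lra.
have chiO y : K + 1 < n1 y -> chi y = 0.
  by move=> h; apply/max_l; rewrite ge_min; apply/orP; right; lra.
pose c s y i := chi y * b s y i.
have cchi z : continuous_path z -> measurable_fun setT (fun s => chi (z s)).
  move=> cz; apply: measurable_maxr => //; apply: measurable_minr => //.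
  by apply: measurable_funB => //; apply: continuous_measurable_fun; exact: continuous_n1.
have [z hz] : exists z, is_sol T c x w z.
  apply: (@picard T c (L + M) M x w) => //.
  - by move=> z cz i; apply: measurable_funM; [exact: cchi|exact: drift_meas ok _ cz i].
  - exact: addr_ge0.
  - move=> s y y' i sT.
    have aux u v : n1 u <= K + 1 -> `|chi u * b s u i - chi v * b s v i| <= (L + M) * n1 (u \- v).
      move=> hu; have [hv|/chiO v0] := leP (n1 v) (K + 1); last first.
        have := cutoff_lip (K + 1) u v; rewrite -/(chi u) -/(chi v) v0 mul0r !subr0 normrM => h.
        rewrite (le_trans (ler_pM (normr_ge0 _) (normr_ge0 _) h (hM s u i sT hu)))//.
        by rewrite mulrC ler_wpM2r ?n1_ge0// lerDr.
      have -> : chi u * b s u i - chi v * b s v i =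
          chi u * (b s u i - b s v i) + (chi u - chi v) * b s v i by ring.
      rewrite (le_trans (ler_normD _ _))// [leRHS]mulrDl lerD// normrM.
        rewrite ger0_norm// (le_trans (ler_wpM2r _ (chi1 u)))// mul1r; exact: hL.
      by rewrite [leRHS]mulrC ler_pM// ?cutoff_lip// hM.
    have [hy|/chiO y0] := leP (n1 y) (K + 1); first exact: aux.
    have [hy'|/chiO y'0] := leP (n1 y') (K + 1).
      by rewrite distrC n1C; exact: aux.
    by rewrite /c y0 y'0 !mul0r subrr normr0 mulr_ge0 ?n1_ge0 ?addr_ge0.
  - move=> s y i sT; rewrite /c normrM ger0_norm//.
    have [hy|/chiO ->] := leP (n1 y) (K + 1); last by rewrite mul0r.
    by rewrite (le_trans (ler_wpM2r _ (chi1 y)))// mul1r hM.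
have [cz ez] := hz.
have lc i : lbm T (fun s => c s (z s) i).
  apply: lbmM; last exact: (lbm_drift _ _ ok cz).
  split; first exact: cchi.
  by exists 1 => s _; rewrite ger0_norm.
pose y t := z t \- w t.
have py i : prim T (fun t => y t i) (fun s => c s (z s) i).
  split; [exact: continuous_pathB cz cw i|exact: lc|].
  move=> t /andP[t0 tT]; rewrite /y /= (ez t tT) (ez 0 T0) set_itv1 Rintegral_set1; ring.
have pF : prim T (fun s => \sum_i y s i ^+ 2) (fun s => \sum_i 2%:R * y s i ^+ 1 * c s (z s) i).
  by apply: prim_sum => i; exact: primX (py i).
have zK t : 0 <= t <= T -> n1 (z t) <= K.
  move=> /andP[t0 tT].
  have [cF lF hF] := pF.
  have : \sum_i y t i ^+ 2 <= \sum_i y 0 i ^+ 2 + \int[mu]_(r in `[0, t]) A.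
    rewrite hF ?t0// lerD2l; apply: (ler_Rint (T := T)) => //; first exact: lbm_cst.
    move=> s /andP[s0 st]; have sT := le_trans st tT.
    have -> : \sum_i 2%:R * y s i ^+ 1 * c s (z s) i = 2 * (chi (z s) * dot (b s (z s)) (y s)).
      by rewrite /dot !mulr_sumr; apply: eq_bigr => i _; rewrite /c; ring.
    have H1 : dot (b s (z s)) (y s) <= A / 2.
      (* Dissipativity is used between [z s] and [w s]: the drift is bounded along the noise
         path. *)
      have -> : dot (b s (z s)) (y s) =
          dot (b s (z s) \- b s (w s)) (z s \- w s) + dot (b s (w s)) (y s).
        by rewrite dotBl subrK.
      have m1 := drift_mono ok s (z s) (w s).
      have m2 := le_trans (ler_norm _) (dot_le_n2 (b s (w s)) (y s)).
      rewrite -/(y s) -n2_sqr in m1.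
      have m3 : n2 (b s (w s)) <= n * B.
        apply: (le_trans (n2_le_n1 _)); rewrite /n mulr_natl -sumr_const.
        by apply: ler_sum => i _; apply: hB => //; apply: hw; rewrite s0.
      have m4 := ler_wpM2r (n2_ge0 (y s)) m3.
      have m5 : n * B * n2 (y s) <= kappa * n2 (y s) ^+ 2 + A / 2.
        rewrite -subr_ge0.
        have -> : kappa * n2 (y s) ^+ 2 + A / 2 - n * B * n2 (y s) =
            (2 * kappa * n2 (y s) - n * B) ^+ 2 / (4 * kappa).
          by rewrite /A; field; rewrite gt_eqF.
        by rewrite divr_ge0 ?sqr_ge0// mulr_ge0// ltW.
      by move: m1; rewrite -/(y s); lra.
    have H2 : chi (z s) * dot (b s (z s)) (y s) <= A / 2.
      rewrite (le_trans (ler_wpM2l (chi0 _) H1))// ler_piMl// divr_ge0//.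
    lra.
  rewrite Rint_cst// subr0 => H.
  have y0 : \sum_i y 0 i ^+ 2 = dot x x.
    by apply: eq_bigr => i _; rewrite /y /= (sol0 T0 hz) addrK expr2.
  rewrite y0 in H.
  have -> : z t = y t \+ w t by apply/funext => i; rewrite /= subrK.
  rewrite (le_trans (n1D _ _))// lerD ?hw ?t0//.
  rewrite (le_trans (n1_le_n2 _))// ler_wpM2l//.
  have n2y : n2 (y t) ^+ 2 <= dot x x + A * t.
    by rewrite n2_sqr; apply: le_trans H; apply: ler_sum => i _; rewrite expr2.
  have At : A * t <= A * T by rewrite ler_wpM2l.
  have [h|h] := leP (n2 (y t)) 1.
    have := dot_ge0 x; have : 0 <= A * T by rewrite mulr_ge0.
    lra.
  have : n2 (y t) * 1 <= n2 (y t) ^+ 2 by rewrite expr2 ler_wpM2l ?n2_ge0// ltW.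
  lra.
exists z; split=> // t tT i; rewrite (ez t tT); congr (_ + _).
apply: eq_Rintegral => s; rewrite inE/= in_itv/= => /andP[s0 st].
by rewrite /c chiK ?mul1r// zK// s0 (le_trans st).
Qed.

End Existence.

(** * Splitting of drift and noise *)

Section Splitting.
Context {R : realType} {I : finType}.
Local Notation mu := (@lebesgue_measure R).
Implicit Types (x y : I -> R) (z w : R -> I -> R) (b c : R -> (I -> R) -> I -> R)
  (s t r T K L h kappa : R) (f : nat -> I -> R).

Lemma drift_ok_shift b kappa r : drift_ok b kappa -> drift_ok (fun s => b (r + s)) kappa.
Proof.
move=> ok; split.
- exact: drift_gt0 ok.
- move=> z cz i.
  have cz' : continuous_path (fun s => z (s - r)).
    move=> j s; apply: (@continuous_comp _ _ _ (fun s => s - r) (fun s => z s j)).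
      by apply: cvgB; [exact: cvg_id|exact: cvg_cst].
    exact: cz.
  have m := drift_meas ok cz' i.
  have : measurable_fun setT ((fun s => b s (z (s - r)) i) \o (fun s : R => r + s)).
    by apply: measurableT_comp m _; exact: measurable_funD.
  by apply: eq_measurable_fun => s _ /=; rewrite addrAC subrr add0r.
- move=> T K; have [L [L0 hL]] := drift_lip ok (r + T) K.
  by exists L; split=> // s x y sT; apply: hL; rewrite lerD2l.
- move=> T; have [K hK] := drift_bd ok (r + T).
  by exists K => s i sT; apply: hK; rewrite lerD2l.
- by move=> s x y; exact: drift_mono ok _ x y.
Qed.

Let zero_path_continuous : continuous_path (fun _ : R => fun _ : I => 0 : R).
Proof. by move=> i t; exact: cvg_cst. Qed.

(** The value after a duration [h] of the noiseless solution started from [x] at time [r]. The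
    choice makes it a total function of [x]; for an admissible drift and [0 <= h] the default value
    is not taken. *)
Definition flow b r h x : I -> R :=
  xget (fun=> 0) [set y | exists z, is_sol h (fun s => b (r + s)) x (fun _ _ => 0) z /\ y = z h].

Lemma flowP b kappa r h x : drift_ok b kappa -> 0 <= h ->
  exists z, is_sol h (fun s => b (r + s)) x (fun _ _ => 0) z /\ flow b r h x = z h.
Proof.
move=> ok h0.
have [z hz] := sol_exists x (drift_ok_shift r ok) zero_path_continuous h0.
by rewrite /flow; case: xgetP => [y -> [z' [hz' ->]]|/(_ (z h))]; [exists z'|case; exists z].
Qed.

Lemma flow_contract b kappa r h x y : drift_ok b kappa -> 0 <= h ->
  n2 (flow b r h x \- flow b r h y) <= expR (- kappa * h) * n2 (x \- y).
Proof.
move=> ok h0; have [z [hz ->]] := flowP r x ok h0; have [z' [hz' ->]] := flowP r y ok h0.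
exact: (sol_contract (drift_ok_shift r ok) zero_path_continuous h0 hz hz').
Qed.

Lemma n2_scale_bound x (K : R) : (forall i, `|x i| <= K) -> n2 x <= #|I|%:R * K.
Proof.
move=> h; apply: (le_trans (n2_le_n1 _)); rewrite mulr_natl -sumr_const.
by apply: ler_sum.
Qed.

(** Deprived of its noise increment, the solution obeys an equation whose drift differs from the
    noiseless one by a Lipschitz constant times the oscillation [d] of the noise. The error of a
    step is thus [h * d], which sums up to a multiple of [d] over a fixed time. *)
Lemma local_error T b kappa x w z : drift_ok b kappa -> continuous_path w -> 0 <= T ->
  is_sol T b x w z -> exists C, 0 <= C /\ forall s h d, 0 <= s -> 0 < h -> s + h <= T ->
    0 <= d <= 1 -> (forall r, s <= r <= s + h -> n1 (w r \- w s) <= d) ->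
    n2 ((z (s + h) \- (w (s + h) \- w s)) \- flow b s h (z s)) <= C * h * d.
Proof.
move=> ok cw T0 hz; have [cz ez] := hz.
have [K [K0 hK]] := continuous_path_bounded T cz.
have [L [L0 hL]] := drift_lip ok T (K + 1).
pose A := #|I|%:R * L.
have A0 : 0 <= A by rewrite mulr_ge0.
exists ((1 + expR 1) * A); split.
  by rewrite mulr_ge0// addr_ge0// expR_ge0.
move=> s h d s0 hp shT /andP[d0 d1] hw; have h0 := ltW hp.
have okS := drift_ok_shift s ok.
have [v [hv ->]] := flowP s (z s) ok h0; have [cv ev] := hv.
have ctr (u : R -> I -> R) : continuous_path u -> continuous_path (fun r => u (s + r)).
  move=> cu j r; apply: (@continuous_comp _ _ _ (fun r => s + r) (fun s => u s j)).
    by apply: cvgD; [exact: cvg_cst|exact: cvg_id].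
  exact: cu.
pose q r := z (s + r) \- (w (s + r) \- w s).
have cq : continuous_path q.
  move=> j r; apply: cvgB; first exact: ctr.
  by apply: cvgB; [exact: ctr|exact: cvg_cst].
have pq i : prim h (fun r => q r i) (fun r => b (s + r) (z (s + r)) i).
  split; [exact: cq|exact: (lbm_drift _ _ okS (ctr _ cz))|].
  move=> r /andP[r0 rh].
  have lz := lbm_drift T i ok cz.
  have srT : s + r <= T by rewrite (le_trans _ shT)// lerD2l.
  rewrite -(Rint_translate lz s0 r0 srT) -(Rint_split lz s0 _ srT) ?lerDl//.
  rewrite /q /= addr0 (ez _ srT) (ez s) ?(le_trans _ srT) ?lerDl//; ring.
have pv i : prim h (fun r => v r i) (fun r => b (s + r) (v r) i).
  have := sol_prim okS zero_path_continuous h0 hv i.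
  by under eq_fun do rewrite subr0.
have pF : prim h (fun r => \sum_i (q r i - v r i) ^+ 2) (fun r => \sum_i
    2%:R * (q r i - v r i) ^+ 1 * (b (s + r) (z (s + r)) i - b (s + r) (v r) i)).
  by apply: prim_sum => i; exact: primX (primB (pq i) (pv i)).
(* The rate [h^-1] absorbs the cross term of Young's inequality and costs only a factor [expR 1]
   over a step of length [h]. *)
have := gronwall (c := - h^-1) h0 pF (lbm_cst h (h * (A * d) ^+ 2)) => /(_ _)/wrap[r|].
  move=> /andP[r0 rh]; rewrite opprK.
  set e := q r \- v r.
  have -> : \sum_i (q r i - v r i) ^+ 2 = n2 e ^+ 2.
    by rewrite n2_sqr; apply: eq_bigr => i _; rewrite expr2.
  have -> : \sum_i 2%:R * (q r i - v r i) ^+ 1 * (b (s + r) (z (s + r)) i - b (s + r) (v r) i)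
     = 2 * (dot (b (s + r) (z (s + r)) \- b (s + r) (q r)) e +
            dot (b (s + r) (q r) \- b (s + r) (v r)) e).
    rewrite -dotDl /dot mulr_sumr; apply: eq_bigr => i _; rewrite /e /=; ring.
  have srT : s + r <= T by rewrite (le_trans _ shT)// lerD2l.
  have sr0 : 0 <= s + r by rewrite addr_ge0.
  have zK : n1 (z (s + r)) <= K by apply: hK; rewrite sr0.
  have zq : n1 (z (s + r) \- q r) <= d.
    rewrite (_ : z (s + r) \- q r = w (s + r) \- w s); last first.
      by apply/funext => i; rewrite /q /=; ring.
    by apply: hw; rewrite lerDl r0 lerD2l.
  have qK : n1 (q r) <= K + 1.
    have -> : q r = z (s + r) \+ (q r \- z (s + r)).
      by apply/funext => i /=; rewrite addrC subrK.
    by rewrite (le_trans (n1D _ _))// lerD// n1C (le_trans zq).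
  have zK1 : n1 (z (s + r)) <= K + 1 by rewrite (le_trans zK)// lerDl.
  have m1 : n2 (b (s + r) (z (s + r)) \- b (s + r) (q r)) <= A * d.
    rewrite -mulrA; apply: n2_scale_bound => i /=.
    by rewrite (le_trans (hL _ _ _ srT zK1 qK i))// ler_wpM2l.
  have m2 := le_trans (ler_norm _) (dot_le_n2 (b (s + r) (z (s + r)) \- b (s + r) (q r)) e).
  have m3 := drift_mono ok (s + r) (q r) (v r).
  have m4 := ler_wpM2r (n2_ge0 e) m1.
  have m5 : 0 <= kappa * dot (q r \- v r) (q r \- v r).
    by rewrite mulr_ge0 ?dot_ge0// ltW// (drift_gt0 ok).
  have m6 : 2 * (A * d * n2 e) <= h^-1 * n2 e ^+ 2 + h * (A * d) ^+ 2.
    rewrite -subr_ge0.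
    have -> : h^-1 * n2 e ^+ 2 + h * (A * d) ^+ 2 - 2 * (A * d * n2 e) =
        (n2 e - h * (A * d)) ^+ 2 / h by field; rewrite gt_eqF.
    by rewrite divr_ge0// sqr_ge0.
  lra.
have -> : \sum_i (q 0 i - v 0 i) ^+ 2 = 0.
  apply: big1 => i _; rewrite /q /= addr0 (sol0 h0 hv) addr0; ring.
rewrite mulr0 add0r opprK => H.
have H2 : \sum_i (q h i - v h i) ^+ 2 <= h * (expR 1 * (h * (A * d) ^+ 2)).
  apply: (le_trans H).
  have -> : h * (expR 1 * (h * (A * d) ^+ 2)) =
      \int[mu]_(r in `[0, h]) (expR 1 * (h * (A * d) ^+ 2)).
    by rewrite Rint_cst// subr0 mulrC.
  apply: (ler_Rint (T := h)) => //.
  - by apply: lbmM; [exact: lbm_expR|exact: lbm_cst].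
  - exact: lbm_cst.
  move=> r /andP[r0 rh]; rewrite ler_wpM2r//; first by rewrite mulr_ge0// sqr_ge0.
  rewrite ler_expR mulrC ler_pdivrMr// mul1r; lra.
rewrite -(@ler_pXn2r _ 2)// ?nnegrE ?n2_ge0//; last first.
  by rewrite !mulr_ge0// addr_ge0// expR_ge0.
rewrite n2_sqr.
have -> : dot (q h \- v h) (q h \- v h) = \sum_i (q h i - v h i) ^+ 2.
  by apply: eq_bigr => i _; rewrite expr2.
apply: (le_trans H2).
have -> : h * (expR 1 * (h * (A * d) ^+ 2)) = expR 1 * (h * (A * d)) ^+ 2 by ring.
have -> : ((1 + expR 1) * A * h * d) ^+ 2 = (1 + expR 1) ^+ 2 * (h * (A * d)) ^+ 2 by ring.
rewrite ler_wpM2r ?sqr_ge0//.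
have := expR_ge0 (1 : R); nra.
Qed.

(* Each step follows the noiseless equation during [h] and then adds the noise increment:
   this approximates the solution by a function of finitely many increments, and the
   exact flow keeps the contraction rate of the equation. *)
Fixpoint splitting b h f k : I -> R :=
  if k is k'.+1 then flow b (k'%:R * h) h (splitting b h f k') \+ f k else f 0.

(** The initial value is stored at index zero, so that a single sequence feeds the scheme. *)
Definition incr w x h : nat -> I -> R :=
  fun k => if k is k'.+1 then w (k'.+1%:R * h) \- w (k'%:R * h) else x.

(** Since the noiseless flow contracts, earlier errors are not amplified and the local errors simply
    add up. *)
Lemma splitting_error T b kappa x w z : drift_ok b kappa -> continuous_path w -> 0 <= T -> w 0 = (fun=> 0) ->
  is_sol T b x w z -> exists C, 0 <= C /\ forall n h d, 0 < h -> n%:R * h <= T ->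
    0 <= d <= 1 -> (forall s r, 0 <= s <= T -> s <= r <= s + h -> n1 (w r \- w s) <= d) ->
    n2 (z (n%:R * h) \- splitting b h (incr w x h) n) <= C * (n%:R * h) * d.
Proof.
move=> ok cw T0 w0 hz; have [C [C0 hC]] := local_error ok cw T0 hz.
exists C; split=> // n h d hp nT hd hw; have h0 := ltW hp; have /andP[d0 _] := hd.
elim: n nT => [|k ih] nT.
  rewrite !mul0r mulr0 mul0r /=.
  rewrite (_ : _ \- _ = fun=> 0) ?n2_0//.
  by apply/funext => i; rewrite /= (sol0 T0 hz) w0 addr0 subrr.
have e1 : k.+1%:R * h = k%:R * h + h by rewrite -natr1 mulrDl mul1r.
rewrite e1 in nT.
have kT : k%:R * h <= T by rewrite (le_trans _ nT)// lerDl.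
have k0 : 0 <= k%:R * h by rewrite mulr_ge0.
have -> : z (k.+1%:R * h) \- splitting b h (incr w x h) k.+1 =
   ((z (k%:R * h + h) \- (w (k%:R * h + h) \- w (k%:R * h))) \- flow b (k%:R * h) h (z (k%:R * h)))
   \+ (flow b (k%:R * h) h (z (k%:R * h)) \- flow b (k%:R * h) h (splitting b h (incr w x h) k)).
  by apply/funext => i; rewrite /= e1; ring.
rewrite (le_trans (n2D _ _))// e1 mulrDr mulrDl [leRHS]addrC lerD//.
  by apply: hC => // r hr; apply: hw => //; rewrite k0.
rewrite (le_trans (flow_contract _ _ _ ok h0))// (le_trans _ (ih kT))// ler_piMl ?n2_ge0//.
by rewrite -[leRHS]expR0 ler_expR mulNr oppr_le0 mulr_ge0// ltW// (drift_gt0 ok).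
Qed.

(** Uniform continuity on a compact interval, by a near-covering argument: a window that works at
    [s] works at all nearby points. *)
Lemma small_oscillation w t d : continuous_path w -> 0 <= t -> 0 < d ->
  \forall n \near \oo, forall s r, 0 <= s <= t -> s <= r <= s + t / n.+1%:R -> n1 (w r \- w s) <= d.
Proof.
move=> cw t0 d0.
have [P _] := compact_near_coveringP `[0, t]%classic.
have loc (s : R) : \forall s' \near s & n \near \oo,
    forall r, s' <= r <= s' + t / n.+1%:R -> n1 (w r \- w s') <= d.
  have c : {for s, continuous (fun r => n1 (w r \- w s))}.
    apply: (@continuous_n1 R I (fun r => w r \- w s)) => i r.
    by apply: cvgB; [exact: cw|exact: cvg_cst].
  have d2 : 0 < d / 2 by rewrite divr_gt0.
  have /cvgrPdist_le /(_ _ d2) [e /= e0 he] := c.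
  have he' r : `|r - s| < e -> n1 (w r \- w s) <= d / 2.
    move=> hr; have := he r; rewrite /= distrC => /(_ hr).
    have -> : w s \- w s = (fun _ : I => 0 : R) by apply/funext => i /=; rewrite subrr.
    have -> : n1 (fun _ : I => 0 : R) = 0 by apply: big1 => i _; rewrite normr0.
    by rewrite sub0r normrN ger0_norm ?n1_ge0.
  have e2 : 0 < e / 2 by rewrite divr_gt0.
  near=> s' n => r /= /andP[sr rs].
  have hs' : `|s' - s| < e / 2.
    by rewrite distrC; near: s'; exact: cvgr_dist_lt.
  have hn : t / n.+1%:R < e / 2.
    have : 0 < e / 2 by [].
    near: n.
    exists (Num.trunc (t / (e / 2))) => // n /= hn _.
    rewrite ltr_pdivrMr// mulrC -ltr_pdivrMr// (lt_le_trans (truncnS_gt _))//.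
    by rewrite ler_nat.
  have hr : `|r - s| < e.
    have := hs'; move: (t / n.+1%:R) rs hn => u rs hn; rewrite !ltr_norml => /andP[h1 h2].
    apply/andP; split; lra.
  have -> : w r \- w s' = (w r \- w s) \+ (w s \- w s').
    by apply/funext => i /=; ring.
  have -> : d = d / 2 + d / 2 by field.
  rewrite (le_trans (n1D _ _))// lerD ?he'// n1C he'//.
have H : \forall n \near \oo, `[0, t]%classic `<=`
    (fun s => forall r, s <= r <= s + t / n.+1%:R -> n1 (w r \- w s) <= d).
  by apply: P; [exact: segment_compact|move=> s _; exact: loc].
near=> n => s r s0t hr.
suff : `[0, t]%classic `<=` (fun s => forall r, s <= r <= s + t / n.+1%:R -> n1 (w r \- w s) <= d).
  by apply=> //=; rewrite in_itv.
near: n; exact: H.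
Unshelve. all: by end_near. Qed.

Lemma splitting_cvg t b kappa x w z i : drift_ok b kappa -> continuous_path w -> 0 < t -> w 0 = (fun=> 0) ->
  is_sol t b x w z ->
  (fun n => splitting b (t / n.+1%:R) (incr w x (t / n.+1%:R)) n.+1 i) @ \oo --> z t i.
Proof.
move=> ok cw tp w0 hz; have t0 := ltW tp.
have [C [C0 hC]] := splitting_error ok cw t0 w0 hz.
apply/cvgrPdist_le => e e0.
have Ct : 0 < C * t + 1 by rewrite ltr_wpDl// mulr_ge0.
pose d := Num.min 1 (e / (C * t + 1)).
have d0 : 0 < d by rewrite lt_min ltr01 divr_gt0.
near=> n.
have hn : forall s r, 0 <= s <= t -> s <= r <= s + t / n.+1%:R -> n1 (w r \- w s) <= d.
  by near: n; exact: small_oscillation.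
have nh : n.+1%:R * (t / n.+1%:R) = t by rewrite mulrCA divff ?mulr1// pnatr_eq0.
have := hC n.+1 (t / n.+1%:R) d; rewrite nh divr_gt0// lexx => /(_ isT isT).
rewrite (ltW d0) ge_min lexx /= => /(_ isT hn) H.
rewrite (le_trans (coord_le_n2 (z t \- splitting b (t / n.+1%:R) (incr w x (t / n.+1%:R)) n.+1) i))//.
rewrite (le_trans H)//.
have : d <= e / (C * t + 1) by rewrite ge_min lexx orbT.
rewrite ler_pdivlMr//; nra.
Unshelve. all: by end_near. Qed.

End Splitting.

(** * Laws of solutions *)

Section Cylinders.
Context {R : realType} {K : finType}.
Implicit Types (x y : K -> R) (a : K -> R).

(** Open lower orthants are stable under intersection and generate the product sigma-algebra; a law
    is thus determined by its joint distribution function. *)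
Definition ray a : set (K -> R) := [set f | forall k, f k < a k].
Definition rays : set (set (K -> R)) := range ray.

Local Notation cyl := (g_sigma_algebraType rays).

Lemma measurable_coord k : measurable_fun setT (fun f : cyl => f k).
Proof.
apply: (measurability _ (RGenInftyO.measurableE R)) => _ [_ [a ->] <-].
rewrite setTI.
have -> : (fun f : cyl => f k) @^-1` `]-oo, a[%classic =
    \bigcup_(n : nat) ray (fun j => if j == k then a else n%:R).
  apply/seteqP; split => f /=.
    rewrite in_itv/= => fa.
    pose M := \sum_j `|f j|.
    exists (Num.trunc M).+1 => // j.
    case: eqP => [->//|_].
    rewrite (le_lt_trans _ (truncnS_gt _))// (le_trans (ler_norm _))//.
    exact: coord_le_n1.
  by move=> [n _ /(_ k)]; rewrite eqxx in_itv.
apply: bigcupT_measurable => n; apply: sub_sigma_algebra; by eexists.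
Qed.

Lemma measurable_to_cyl d (T : measurableType d) (f : T -> K -> R) :
  (forall k, measurable_fun setT (fun t => f t k)) ->
  measurable_fun setT (f : T -> cyl).
Proof.
move=> mf; apply: (@measurability _ _ T cyl setT f rays erefl) => _ [_ [a _ <-] <-].
rewrite setTI.
have -> : f @^-1` (ray a) = \bigcap_(k in [set: K]) ((fun t => f t k) @^-1` `]-oo, a k[%classic).
  apply/seteqP; split => t /=.
    by move=> h k _ /=; rewrite in_itv/=; exact: h.
  by move=> h k; have := h k I; rewrite /= in_itv.
apply: fin_bigcap_measurable; first exact: finite_finset.
by move=> k _; rewrite -[X in measurable X]setTI; exact: mf.
Qed.

(** The cubes of side [p.1.+1%:R^-1] with vertices on the corresponding grid are countably many, and
    an open set is the union of those that it contains. *)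
Lemma open_measurable_cyl (U : set (K -> R)) :
  (forall x, U x -> exists2 e : R, 0 < e & forall y, (forall k, `|y k - x k| < e) -> U y) ->
  measurable (U : set cyl).
Proof.
move=> oU.
pose cell (p : nat * {ffun K -> int}) : set (K -> R) :=
  [set x | forall k, Num.floor (p.1.+1%:R * x k) = p.2 k].
have mcell p : measurable (cell p : set cyl).
  have -> : cell p = \bigcap_(k in [set: K])
      ((fun f : cyl => f k) @^-1` ((fun r : R => p.1.+1%:R * r) @^-1`
         `[(p.2 k)%:~R, (p.2 k + 1)%:~R[%classic)).
    apply/seteqP; split => x /=.
      by move=> h k _ /=; rewrite in_itv/= -h floor_itv.
    by move=> h k; apply: floor_def; have := h k I; rewrite /= in_itv.
  apply: fin_bigcap_measurable; first exact: finite_finset.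
  move=> k _; rewrite -[X in measurable X]setTI.
  apply: measurable_coord => //; rewrite -[X in measurable X]setTI.
  by apply: mulrl_measurable.
have -> : U = \bigcup_p (if pselect (cell p `<=` U) then cell p else set0).
  apply/seteqP; split => x.
    move=> /oU[e e0 he].
    pose n := Num.trunc e^-1.
    have ne : e^-1 < n.+1%:R by exact: truncnS_gt.
    pose v := [ffun k => Num.floor (n.+1%:R * x k)].
    have xc : cell (n, v) x by move=> k /=; rewrite ffunE.
    exists (n, v) => //.
    case: pselect => // -[] y yc; apply: he => k.
    have := yc k; have := xc k => /= <- /eqP; rewrite floor_eq => /andP[h1 h2].
    have /andP[h3 h4] := floor_itv (n.+1%:R * x k).
    rewrite intrD in h2 h4.
    have n0 : 0 < n.+1%:R :> R by rewrite ltr0n.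
    have : `|n.+1%:R * y k - n.+1%:R * x k| < 1.
      by rewrite ltr_norml; apply/andP; split; lra.
    rewrite -mulrBr normrM gtr0_norm// mulrC -ltr_pdivlMr// mul1r => /lt_le_trans; apply.
    by rewrite -[leRHS]invrK lef_pV2 ?posrE ?invr_gt0// ltW.
  by move=> [p _]; case: pselect => // h; exact: h.
apply: countable_bigcupT_measurable; first exact: countableP.
by move=> p; case: (pselect (cell p `<=` U)) => h; [exact: mcell|exact: measurable0].
Qed.

Lemma lipschitz_measurable_cyl (g : (K -> R) -> R) (L : R) :
  (forall x y, `|g x - g y| <= L * n1 (x \- y)) -> measurable_fun setT (g : cyl -> R).
Proof.
move=> hg; apply: (measurability _ (RGenOInfty.measurableE R)) => _ [_ [a ->] <-].
rewrite setTI; apply: open_measurable_cyl => x /=; rewrite in_itv/= andbT => ax.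
pose M := `|L| * #|K|%:R + 1.
have M0 : 0 < M by rewrite ltr_wpDl// mulr_ge0.
exists ((g x - a) / M); first by rewrite divr_gt0// subr_gt0.
move=> y hy; rewrite in_itv/= andbT.
have h1 : n1 (x \- y) <= #|K|%:R * ((g x - a) / M).
  rewrite mulr_natl -sumr_const; apply: ler_sum => k _ /=.
  by rewrite distrC; exact: ltW.
have h2 := hg x y.
have h3 : L * n1 (x \- y) <= `|L| * (#|K|%:R * ((g x - a) / M)).
  by rewrite (le_trans (ler_wpM2r (n1_ge0 _) (ler_norm L)))// ler_wpM2l.
have h4 : `|L| * (#|K|%:R * ((g x - a) / M)) < g x - a.
  have -> : `|L| * (#|K|%:R * ((g x - a) / M)) = (`|L| * #|K|%:R / M) * (g x - a) by ring.
  by rewrite -[ltRHS]mul1r ltr_pM2r ?subr_gt0// ltr_pdivrMr// mul1r /M ltrDl.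
have := ler_norm (g x - g y); lra.
Qed.

Lemma rays_setI : setI_closed rays.
Proof.
move=> _ _ [a _ <-] [b _ <-]; exists (fun k => Num.min (a k) (b k)) => //.
apply/seteqP; split => f /=.
  by move=> h; split=> k; have := h k; rewrite lt_min => /andP[].
by move=> [h1 h2] k; rewrite lt_min h1 h2.
Qed.

Lemma rays_cover : \bigcup_(n : nat) ray (fun=> n%:R) = setT.
Proof.
apply/seteqP; split => // f _; exists (Num.trunc (n1 f)).+1 => // k.
rewrite (le_lt_trans _ (truncnS_gt _))// (le_trans (ler_norm _))//.
exact: coord_le_n1.
Qed.

Lemma cyl_measure_unique (m m' : {measure set cyl -> \bar R}) :
  (forall a, m (ray a) = m' (ray a)) -> (m setT < +oo)%E ->
  forall A, measurable A -> m A = m' A.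
Proof.
move=> mm moo A mA.
apply: (@measure_unique _ R cyl rays (fun n => ray (fun=> n%:R)) erefl) => //.
- exact: rays_setI.
- by move=> n; eexists.
- exact: rays_cover.
- by move=> _ [a _ <-]; exact: mm.
- move=> n; apply: le_lt_trans moo; apply: le_measure => //; rewrite inE//.
  by apply: sub_sigma_algebra; eexists.
Qed.

End Cylinders.
Notation cyl R K := (g_sigma_algebraType (@rays R K)).

Section Transfer.
Context {R : realType} {d d' : measure_display}
  {T : measurableType d} {T' : measurableType d'}
  (P : probability T R) (P' : probability T' R).

Lemma transfer (K : finType) (f : T -> K -> R) (f' : T' -> K -> R) :
  (forall k, measurable_fun setT (fun t => f t k)) ->
  (forall k, measurable_fun setT (fun t => f' t k)) ->
  (forall a, P (f @^-1` ray a) = P' (f' @^-1` ray a)) ->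
  forall A, measurable (A : set (cyl R K)) -> P (f @^-1` A) = P' (f' @^-1` A).
Proof.
move=> mf mf' h A mA.
have mf1 := measurable_to_cyl mf; have mf2 := measurable_to_cyl mf'.
have := @cyl_measure_unique R K (law P mf1) (law P' mf2).
apply=> //; apply: (@le_lt_trans _ _ 1%E); last exact: ltry.
by rewrite probability_le1.
Qed.

Lemma transfer_integral (K : finType) (f : T -> K -> R) (f' : T' -> K -> R) :
  (forall k, measurable_fun setT (fun t => f t k)) ->
  (forall k, measurable_fun setT (fun t => f' t k)) ->
  (forall a, P (f @^-1` ray a) = P' (f' @^-1` ray a)) ->
  forall g : cyl R K -> \bar R, measurable_fun setT g -> (forall x, 0 <= g x)%E ->
  (\int[P]_t g (f t) = \int[P']_t g (f' t))%E.
Proof.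
move=> mf mf' h g mg g0.
have mf1 := measurable_to_cyl mf; have mf2 := measurable_to_cyl mf'.
rewrite -(ge0_integral_pushforward mf1 P measurableT mg (fun x _ => g0 x)).
rewrite -(ge0_integral_pushforward mf2 P' measurableT mg (fun x _ => g0 x)).
apply: eq_measure_integral => A mA _; exact: transfer.
Qed.

Lemma bounded_cvg (f_ : nat -> T -> R) (f : T -> R) (M : R) :
  (forall n, measurable_fun setT (f_ n)) -> (forall n t, `|f_ n t| <= M) ->
  (forall t, (fun n => f_ n t) @ \oo --> f t) ->
  (fun n => \int[P]_t (f_ n t)%:E)%E @ \oo --> (\int[P]_t (f t)%:E)%E.
Proof.
move=> mf fM ff.
apply: (@dominated_cvg _ _ _ P setT measurableT (fun n t => (f_ n t)%:E)
  (fun t => (f t)%:E) (cst M%:E)) => //.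
- by move=> n; apply/measurable_EFinP.
- by move=> t _; apply/cvg_EFin; [exact: nearW|exact: ff].
- exact: (finite_measure_integrable_cst P M measurableT).
- by move=> n t _; rewrite lee_fin.
Qed.

End Transfer.

Section LawOfLimit.
Context {R : realType} {d d' : measure_display}
  {T : measurableType d} {T' : measurableType d'}
  (P : probability T R) (P' : probability T' R) {K : finType}.

(** A continuous approximation from below of the indicator of [ray a], exact in the limit of large
    [j]. *)
Definition ramp (j : nat) (a x : K -> R) : R :=
  \prod_k Num.max 0 (Num.min 1 (j%:R * (a k - x k))).

Let clip01 (r : R) : 0 <= Num.max 0 (Num.min 1 r) <= 1.
Proof. by rewrite le_max lexx ge_max ler01 ge_min lexx. Qed.

Lemma ramp_ge0 j a x : 0 <= ramp j a x.
Proof. by apply: prodr_ge0 => k _; have /andP[] := clip01 (j%:R * (a k - x k)). Qed.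

Lemma ramp_le1 j a x : ramp j a x <= 1.
Proof. by apply: prodr_ile1 => k _; exact: clip01. Qed.

Lemma measurable_ramp j a : measurable_fun setT (ramp j a : cyl R K -> R).
Proof.
apply: measurable_prod => k _.
apply: measurable_maxr => //; apply: measurable_minr => //.
apply: measurable_funM => //; apply: measurable_funB => //; exact: measurable_coord.
Qed.

Lemma cvg_big_prod (I : Type) (r : seq I) (u : I -> nat -> R) (l : I -> R) :
  (forall i, u i @ \oo --> l i) ->
  (fun n => \prod_(i <- r) u i n) @ \oo --> \prod_(i <- r) l i.
Proof.
move=> h; elim: r => [|i r ih].
  by rewrite big_nil; under eq_fun do rewrite big_nil; exact: cvg_cst.
rewrite big_cons (_ : (fun n => _) = (fun n => u i n * \prod_(j <- r) u j n)); last first.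
  by apply/funext => n; rewrite big_cons.
by apply: cvgM.
Qed.

Lemma cvg_maxr (u v : nat -> R) (l m : R) : u @ \oo --> l -> v @ \oo --> m ->
  (fun n => Num.max (u n) (v n)) @ \oo --> Num.max l m.
Proof.
move=> ul vm; rewrite maxr_absE; under eq_fun do rewrite maxr_absE.
apply: cvgM; last exact: cvg_cst.
by apply: cvgD; [exact: cvgD|apply: cvg_norm; exact: cvgB].
Qed.

Lemma cvg_minr (u v : nat -> R) (l m : R) : u @ \oo --> l -> v @ \oo --> m ->
  (fun n => Num.min (u n) (v n)) @ \oo --> Num.min l m.
Proof.
move=> ul vm; rewrite minr_absE; under eq_fun do rewrite minr_absE.
apply: cvgM; last exact: cvg_cst.
by apply: cvgB; [exact: cvgD|apply: cvg_norm; exact: cvgB].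
Qed.

Lemma cvg_ramp j a (u : nat -> K -> R) (x : K -> R) :
  (forall k, (fun n => u n k) @ \oo --> x k) ->
  (fun n => ramp j a (u n)) @ \oo --> ramp j a x.
Proof.
move=> h; apply: cvg_big_prod => k.
have c1 : (fun n => Num.min 1 (j%:R * (a k - u n k))) @ \oo --> Num.min 1 (j%:R * (a k - x k)).
  apply: cvg_minr; first exact: cvg_cst.
  by apply: cvgM; [exact: cvg_cst|apply: cvgB; [exact: cvg_cst|exact: h]].
by apply: cvg_maxr; [exact: cvg_cst|exact: c1].
Qed.

Lemma ramp_indic a x : (fun j => ramp j a x) @ \oo --> (\1_(ray a) x : R).
Proof.
rewrite indicE; case: (pselect (ray a x)) => h.
  rewrite mem_set//; apply: cvg_near_cst.
  have H : \forall j \near \oo, forall k, 1 <= j%:R * (a k - x k).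
    apply: filter_forall => k; exists (Num.trunc (a k - x k)^-1).+1 => // j /= hj.
    rewrite -ler_pdivrMr ?subr_gt0 ?h// mul1r (le_trans (ltW (truncnS_gt _)))//.
    by rewrite ler_nat.
  near=> j.
  rewrite /ramp big1// => k _.
  have hj : 1 <= j%:R * (a k - x k) by move: k; near: j.
  by rewrite (min_l hj) max_r.
rewrite memNset//; have [k hk] : exists k, a k <= x k.
  apply: contrapT => hn; apply: h => k; rewrite ltNge; apply/negP => hk.
  by apply: hn; exists k.
apply: cvg_near_cst; apply: nearW => j.
rewrite /ramp (bigD1 k)//= max_l ?mul0r// ge_min; apply/orP; right.
by rewrite mulr_ge0_le0// subr_le0.
Unshelve. all: by end_near. Qed.

(** Probabilities of orthants do not pass to the limit when mass sits on the boundary. Expectations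
    of ramps do, by dominated convergence, first in [n] and then in [j]. *)
Lemma law_of_limit (f_ : nat -> T -> K -> R) (f : T -> K -> R)
    (g_ : nat -> T' -> K -> R) (g : T' -> K -> R) :
  (forall n k, measurable_fun setT (fun t => f_ n t k)) ->
  (forall n k, measurable_fun setT (fun t => g_ n t k)) ->
  (forall t k, (fun n => f_ n t k) @ \oo --> f t k) ->
  (forall t k, (fun n => g_ n t k) @ \oo --> g t k) ->
  (forall n a, P (f_ n @^-1` ray a) = P' (g_ n @^-1` ray a)) ->
  forall A, measurable (A : set (cyl R K)) -> P (f @^-1` A) = P' (g @^-1` A).
Proof.
move=> mf mg ff gg fg.
have mf' k : measurable_fun setT (fun t => f t k).
  apply: (measurable_fun_cvg (h := fun n t => f_ n t k)) => // t _; exact: ff.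
have mg' k : measurable_fun setT (fun t => g t k).
  apply: (measurable_fun_cvg (h := fun n t => g_ n t k)) => // t _; exact: gg.
have mr (d0 : measure_display) (T0 : measurableType d0) (F : T0 -> K -> R) j a :
    (forall k, measurable_fun setT (fun t => F t k)) ->
    measurable_fun setT (fun t => ramp j a (F t)).
  move=> mF; exact: (measurableT_comp (measurable_ramp j a) (measurable_to_cyl mF)).
have r1 j a x : `|ramp j a x| <= 1 by rewrite ger0_norm ?ramp_ge0 ?ramp_le1.
apply: transfer => // a.
have E j : (\int[P]_t (ramp j a (f t))%:E = \int[P']_t (ramp j a (g t))%:E)%E.
  have c1 := @bounded_cvg _ _ _ P (fun n t => ramp j a (f_ n t)) (fun t => ramp j a (f t)) 1
    (fun n => mr _ _ _ j a (mf n)) (fun n t => r1 _ _ _) (fun t => cvg_ramp (ff t)).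
  have c2 := @bounded_cvg _ _ _ P' (fun n t => ramp j a (g_ n t)) (fun t => ramp j a (g t)) 1
    (fun n => mr _ _ _ j a (mg n)) (fun n t => r1 _ _ _) (fun t => cvg_ramp (gg t)).
  have e n : (\int[P]_t (ramp j a (f_ n t))%:E = \int[P']_t (ramp j a (g_ n t))%:E)%E.
    apply: (transfer_integral (mf n) (mg n) (fg n)
      (g := fun x => (ramp j a x)%:E)).
      by apply/measurable_EFinP; exact: measurable_ramp.
    by move=> x; rewrite lee_fin ramp_ge0.
  rewrite -(cvg_lim _ c1)// -(cvg_lim _ c2)//.
  by rewrite (funext e).
have c1 := @bounded_cvg _ _ _ P (fun j t => ramp j a (f t)) (fun t => \1_(ray a) (f t)) 1
    (fun j => mr _ _ _ j a mf') (fun n t => r1 _ _ _) (fun t => @ramp_indic a (f t)).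
have c2 := @bounded_cvg _ _ _ P' (fun j t => ramp j a (g t)) (fun t => \1_(ray a) (g t)) 1
    (fun j => mr _ _ _ j a mg') (fun n t => r1 _ _ _) (fun t => @ramp_indic a (g t)).
have mray : measurable (ray a : set (cyl R K)).
  by apply: sub_sigma_algebra; eexists.
have i1 : (\int[P]_t (\1_(ray a) (f t))%:E = P (f @^-1` ray a))%E.
  transitivity (\int[P]_t (\1_(f @^-1` ray a) t)%:E)%E; first by [].
  rewrite integral_indic ?setIT//.
  by rewrite -[X in measurable X]setTI; exact: (measurable_to_cyl mf').
have i2 : (\int[P']_t (\1_(ray a) (g t))%:E = P' (g @^-1` ray a))%E.
  transitivity (\int[P']_t (\1_(g @^-1` ray a) t)%:E)%E; first by [].
  rewrite integral_indic ?setIT//.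
  by rewrite -[X in measurable X]setTI; exact: (measurable_to_cyl mg').
rewrite -i1 -i2 -(cvg_lim _ c1)// -(cvg_lim _ c2)//.
by rewrite (funext E).
Qed.

End LawOfLimit.

(** * Noises with independent Gaussian increments *)

Section Driven.
Context {R : realType}.

(** The law of one coordinate of an increment of [Num.sqrt 2 *: B] over a duration [h]: the
    diffusion coefficient is part of the noise. *)
Definition noise (h : R) : probability R R :=
  law (normal_prob 0 (Num.sqrt h)) (@mulrl_measurable R setT (Num.sqrt 2)).

Context {I : finType} {d : measure_display} {T : measurableType d}.
Implicit Types (b : R -> (I -> R) -> I -> R) (kappa t h : R).

Lemma splitting_ext b h (f g : nat -> I -> R) n :
  (forall k, (k <= n)%N -> f k = g k) -> splitting b h f n = splitting b h g n.
Proof.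
elim: n => [|n ih] fg /=; first exact: fg.
by rewrite ih ?fg// => k kn; apply: fg; rewrite (leq_trans kn).
Qed.

(** The noiseless flow is 1-Lipschitz in its starting point, hence measurable, although it is
    defined by a choice. *)
Lemma measurable_splitting b kappa h (F : T -> nat -> I -> R) : drift_ok b kappa -> 0 <= h ->
  (forall k i, measurable_fun setT (fun o => F o k i)) ->
  forall k i, measurable_fun setT (fun o => splitting b h (F o) k i).
Proof.
move=> ok h0 mF; elim=> [|k ih] i /=; first exact: mF.
apply: measurable_funD; last exact: mF.
have mflow : measurable_fun setT (fun x : cyl R I => flow b (k%:R * h) h x i).
  apply: (@lipschitz_measurable_cyl _ _ _ 1) => x y; rewrite mul1r.
  apply: (le_trans (coord_le_n2 (flow b (k%:R * h) h x \- flow b (k%:R * h) h y) i)).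
  apply: (le_trans (flow_contract _ _ _ ok h0)).
  apply: le_trans (n2_le_n1 _); rewrite ler_piMl ?n2_ge0// -[leRHS]expR0 ler_expR.
  by rewrite mulNr oppr_le0 mulr_ge0// ltW// (drift_gt0 ok).
exact: (measurableT_comp mflow (measurable_to_cyl ih)).
Qed.

(* The only property of the noise that is used: increments over regular grids are
   independent Gaussians, independent of the initial value. *)
Record driven (P : probability T R) (x : T -> I -> R) (w : T -> R -> I -> R) : Prop := {
  driven_x : forall i, measurable_fun setT (fun o => x o i) ;
  driven_w : forall s i, measurable_fun setT (fun o => w o s i) ;
  driven_cont : forall o, continuous_path (w o) ;
  driven_0 : forall o, w o 0 = (fun=> 0) ;
  driven_rect : forall h n (C : set (cyl R I)) (D : nat -> I -> set R), 0 < h ->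
    measurable C -> (forall k i, measurable (D k i)) ->
    (P [set o | C (x o) /\ forall k i, (k < n)%N -> D k i (incr (w o) (x o) h k.+1 i)] =
     P (x @^-1` C) * \prod_(k < n) \prod_i noise h (D k i))%E }.

Arguments driven_cont [P x w] _ _ _ _ _.

Lemma measurable_incr (x : T -> I -> R) (w : T -> R -> I -> R) h :
  (forall i, measurable_fun setT (fun o => x o i)) ->
  (forall s i, measurable_fun setT (fun o => w o s i)) ->
  forall k i, measurable_fun setT (fun o => incr (w o) (x o) h k i).
Proof. by move=> mx mw [|k] i //=; apply: measurable_funB; exact: mw. Qed.

(** Solutions are chosen path by path, with no measurability built in; it is recovered because the
    splitting schemes converge to them. *)
Lemma measurable_sol P x w b kappa t (z : T -> R -> I -> R) i :
  driven P x w -> drift_ok b kappa -> 0 <= t -> (forall o, is_sol t b (x o) (w o) (z o)) ->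
  measurable_fun setT (fun o => z o t i).
Proof.
move=> dr ok; rewrite le_eqVlt => /predU1P[<-|t0] hz.
  apply: (eq_measurable_fun (fun o => x o i)); last exact: (driven_x dr).
  by move=> o _; rewrite (sol0 (lexx 0) (hz o)) (driven_0 dr) addr0.
apply: (measurable_fun_cvg
  (h := fun n o => splitting b (t / n.+1%:R) (incr (w o) (x o) (t / n.+1%:R)) n.+1 i)).
  move=> n; apply: (measurable_splitting ok); first by rewrite divr_ge0// ltW.
  by apply: measurable_incr; [exact: driven_x dr|exact: driven_w dr].
by move=> o _; exact: (@splitting_cvg _ _ _ _ _ _ _ _ i ok (driven_cont dr o) t0 (driven_0 dr o) (hz o)).
Qed.

Lemma sol_at0 P x w b z : driven P x w -> (forall o, is_sol 0 b (x o) (w o) (z o)) ->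
  forall o, z o 0 = x o.
Proof.
by move=> dr hz o; apply/funext => i; rewrite (sol0 (lexx 0) (hz o)) (driven_0 dr) addr0.
Qed.

End Driven.
Arguments driven_cont {R I d T P x w} _ _ _ _ _.

(** * Uniqueness in law *)

Section LawUnique.
Context {R : realType} {I : finType} {d d' : measure_display}
  {T : measurableType d} {T' : measurableType d'}
  (P : probability T R) (P' : probability T' R).

Lemma driven_transfer x w x' w' h n : @driven R I d T P x w -> @driven R I d' T' P' x' w' ->
  0 < h -> (forall a, P (x @^-1` ray a) = P' (x' @^-1` ray a)) ->
  forall A : set (cyl R ('I_n.+1 * I)%type), measurable A ->
    P ((fun o (p : 'I_n.+1 * I) => incr (w o) (x o) h p.1 p.2) @^-1` A) =
    P' ((fun o (p : 'I_n.+1 * I) => incr (w' o) (x' o) h p.1 p.2) @^-1` A).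
Proof.
move=> dr dr' h0 xx'.
apply: transfer.
- by move=> p; apply: measurable_incr; [exact: driven_x dr|exact: driven_w dr].
- by move=> p; apply: measurable_incr; [exact: driven_x dr'|exact: driven_w dr'].
move=> a.
pose C := ray (fun i => a (ord0, i)).
pose D (k : nat) i : set R := `]-oo, a (inord k.+1, i)[%classic.
have E (f : nat -> I -> R) : ray a (fun p : 'I_n.+1 * I => f p.1 p.2) <->
    C (f 0%N) /\ forall k i, (k < n)%N -> D k i (f k.+1 i).
  split=> [H|[H1 H2] [k i] /=].
    split=> [i|k i kn]; first exact: (H (ord0, i)).
    by rewrite /D /= in_itv/=; have := H (inord k.+1, i); rewrite /= inordK.
  have [k0|k0] := posnP k.
    have -> : k = ord0 by apply/val_inj.
    exact: H1.
  have kn : (k.-1 < n)%N by rewrite -ltnS prednK.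
  by have := H2 k.-1 i kn; rewrite /D /= in_itv/= prednK// inord_val.
have mC : measurable (C : set (cyl R I)) by apply: sub_sigma_algebra; eexists.
have mD k i : measurable (D k i) by exact: measurable_itv.
have E1 : (fun o (p : 'I_n.+1 * I) => incr (w o) (x o) h p.1 p.2) @^-1` ray a =
    [set o | C (x o) /\ forall k i, (k < n)%N -> D k i (incr (w o) (x o) h k.+1 i)].
  by apply/seteqP; split => o /=; rewrite (E (incr (w o) (x o) h)).
have E2 : (fun o (p : 'I_n.+1 * I) => incr (w' o) (x' o) h p.1 p.2) @^-1` ray a =
    [set o | C (x' o) /\ forall k i, (k < n)%N -> D k i (incr (w' o) (x' o) h k.+1 i)].
  by apply/seteqP; split => o /=; rewrite (E (incr (w' o) (x' o) h)).
rewrite E1 E2 (driven_rect dr)// (driven_rect dr')//.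
by congr (_ * _)%E; exact: xx'.
Qed.

(** On both spaces the solution at time [t] is the limit of the same functions of the initial value
    and of finitely many increments, and [driven] prescribes the joint law of these. Only the law at
    a single time is compared. *)
Lemma sol_law_unique x w x' w' b kappa t (z : T -> R -> I -> R) (z' : T' -> R -> I -> R) :
  driven P x w -> driven P' x' w' -> drift_ok b kappa -> 0 <= t ->
  (forall a, P (x @^-1` ray a) = P' (x' @^-1` ray a)) ->
  (forall o, is_sol t b (x o) (w o) (z o)) ->
  (forall o, is_sol t b (x' o) (w' o) (z' o)) ->
  forall A : set (cyl R I), measurable A ->
    P ((fun o => z o t) @^-1` A) = P' ((fun o => z' o t) @^-1` A).
Proof.
move=> dr dr' ok + xx'; rewrite le_eqVlt => /predU1P[<-|t0] hz hz'.
  have -> : (fun o => z o 0) = x by apply/funext; exact: sol_at0 dr hz.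
  have -> : (fun o => z' o 0) = x' by apply/funext; exact: sol_at0 dr' hz'.
  by apply: transfer => //; [exact: driven_x dr|exact: driven_x dr'].
pose h n : R := t / n.+1%:R.
have h0 n : 0 < h n by rewrite divr_gt0.
apply: (@law_of_limit _ _ _ _ _ P P' I
  (fun n o => splitting b (h n) (incr (w o) (x o) (h n)) n.+1) _
  (fun n o => splitting b (h n) (incr (w' o) (x' o) (h n)) n.+1)).
- move=> n i; apply: (measurable_splitting ok (ltW (h0 n))).
  by apply: measurable_incr; [exact: driven_x dr|exact: driven_w dr].
- move=> n i; apply: (measurable_splitting ok (ltW (h0 n))).
  by apply: measurable_incr; [exact: driven_x dr'|exact: driven_w dr'].
- by move=> o i; exact: (@splitting_cvg _ _ _ _ _ _ _ _ i ok (driven_cont dr o) t0 (driven_0 dr o) (hz o)).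
- by move=> o i; exact: (@splitting_cvg _ _ _ _ _ _ _ _ i ok (driven_cont dr' o) t0 (driven_0 dr' o) (hz' o)).
move=> n a.
(* The scheme as a function of a finite array. Reading indices through [inord] is harmless, as the
   scheme looks at indices up to [n.+1] only. *)
pose G (f : cyl R ('I_n.+2 * I)%type) : cyl R I := splitting b (h n) (fun k i => f (inord k, i)) n.+1.
have mG : measurable_fun setT G.
  apply: measurable_to_cyl => i; apply: (measurable_splitting ok (ltW (h0 n))) => k j.
  exact: measurable_coord.
have mA : measurable (G @^-1` (ray a)).
  rewrite -[X in measurable X]setTI; apply: mG => //; apply: sub_sigma_algebra; by eexists.
have := driven_transfer dr dr' (h0 n) xx' mA.
have E S (X : S -> I -> R) (W : S -> R -> I -> R) :
    (fun o (p : 'I_n.+2 * I) => incr (W o) (X o) (h n) p.1 p.2) @^-1` (G @^-1` (ray a)) =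
    (fun o => splitting b (h n) (incr (W o) (X o) (h n)) n.+1) @^-1` ray a.
  have EG o : G (fun p : 'I_n.+2 * I => incr (W o) (X o) (h n) p.1 p.2) =
      splitting b (h n) (incr (W o) (X o) (h n)) n.+1.
    by apply: splitting_ext => k kn; apply/funext => i /=; rewrite inordK.
  by apply/seteqP; split => o; rewrite /preimage /= EG.
by rewrite !E.
Qed.

End LawUnique.

Section RowVectors.
Context {R : realType} {n : nat}.

Lemma measurable_continuous_rV (g : 'rV[R]_n -> R) : continuous g -> measurable_fun setT g.
Proof.
move=> cg; apply: (measurability _ (RGenOInfty.measurableE R)) => _ [_ [a ->] <-].
rewrite setTI; apply: sub_sigma_algebra.
move/continuousP : cg; apply; exact: interval_open.
Qed.

Lemma measurable_rV_coord (k : 'I_n) : measurable_fun setT (fun v : 'rV[R]_n => v ord0 k).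
Proof. by apply: measurable_continuous_rV; exact: coord_continuous. Qed.

Lemma measurable_to_rV d (T : measurableType d) (f : T -> 'rV[R]_n) :
  (forall k, measurable_fun setT (fun o => f o ord0 k)) -> measurable_fun setT f.
Proof.
move=> mf; apply: (@measurability _ _ T _ setT f open erefl) => _ [U oU <-].
rewrite setTI.
have mU : measurable ([set x : 'I_n -> R | U (\row_k x k)] : set (cyl R 'I_n)).
  apply: open_measurable_cyl => x Ux.
  have /nbhs_ballP[e /= e0 he] := open_nbhs_nbhs (conj oU Ux).
  exists e => // y hy; apply: he; split=> // i j.
  by rewrite !mxE /ball /= distrC; exact: hy.
have := measurable_to_cyl mf measurableT mU; rewrite setTI.
congr measurable; apply/seteqP; split => o /=;
  by rewrite (_ : \row_k f o ord0 k = f o)//; apply/rowP => k; rewrite mxE.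
Qed.

End RowVectors.

(** * Tensor powers and boxes *)

Section TensorPower.
Context {R : realType} {d : measure_display} {T : measurableType d}.
Implicit Types (P : probability T R).

Definition box (N : nat) (A : 'I_N -> set T) : set (N.-tuple T) :=
  [set o | forall i, A i (tnth o i)].

Lemma measurable_box N (A : 'I_N -> set T) : (forall i, measurable (A i)) -> measurable (box A).
Proof.
move=> mA; have -> : box A = \bigcap_(i in [set: 'I_N]) ((@tnth N T)^~ i @^-1` (A i)).
  by apply/seteqP; split => o /= h; [move=> i _; exact: h|move=> i; exact: h].
apply: fin_bigcap_measurable; first exact: finite_finset.
by move=> i _; rewrite -[X in measurable X]setTI; exact: measurable_tnth.
Qed.

Lemma tensor_power_box P N (A : 'I_N -> set T) : (forall i, measurable (A i)) ->
  tensor_power P N (box A) = (\prod_i P (A i))%E.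
Proof.
elim: N A => [|N ih] A mA.
  by rewrite big_ord0 /= /dirac indicE mem_set// => -[].
rewrite big_ord_recl /= /distribution /pushforward.
have -> : (@tuple_cons _ T N) @^-1` box A = A ord0 `*` box (fun i => A (lift ord0 i)).
  apply/seteqP; split => -[z o] /=.
    move=> h; split; first by have := h ord0; rewrite /tuple_cons tnth0.
    by move=> i; have := h (lift ord0 i); rewrite /tuple_cons /= tnthS.
  move=> [h0 h1] i; have [j ->|->] := unliftP ord0 i.
    by rewrite /tuple_cons /= tnthS; exact: h1.
  by rewrite /tuple_cons tnth0.
rewrite product_measure1E//; last by apply: measurable_box => i; exact: mA.
by congr (_ * _)%E; apply: ih => i; exact: mA.
Qed.

Lemma boxes_setI N : setI_closed [set box A | A in [set A : 'I_N -> set T | forall i, measurable (A i)]].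
Proof.
move=> _ _ [A mA <-] [B mB <-]; exists (fun i => A i `&` B i).
  by move=> i; exact: measurableI.
apply/seteqP; split => o /=; first by move=> h; split=> i; have [] := h i.
by move=> [h1 h2] i; split.
Qed.

Lemma measurable_tupleE N : @measurable _ (N.-tuple T) =
  <<s [set box A | A in [set A : 'I_N -> set T | forall i, measurable (A i)]] >>.
Proof.
apply/seteqP; split.
  apply: smallest_sub; first exact: smallest_sigma_algebra.
  rewrite -bigcup_seq; apply: bigcup_sub => i _ _ [B mB <-]; rewrite setTI.
  apply: sub_sigma_algebra; exists (fun j => if j == i then B else setT).
    by move=> j; case: ifP.
  apply/seteqP; split => o /=; first by move=> /(_ i); rewrite eqxx.
  by move=> h j; case: eqP => // ->.
apply: smallest_sub; first exact: sigma_algebra_measurable.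
by move=> _ [A mA <-]; exact: measurable_box.
Qed.

Lemma tuple_measure_unique N (m m' : {measure set (N.-tuple T) -> \bar R}) :
  (forall A, (forall i, measurable (A i)) -> m (box A) = m' (box A)) ->
  (m setT < +oo)%E -> forall A, measurable A -> m A = m' A.
Proof.
move=> mm moo A mA.
have boxT : box (fun _ : 'I_N => [set: T]) = setT by apply/seteqP; split.
apply: (@measure_unique _ R (N.-tuple T) _ (fun=> setT) (measurable_tupleE N)) => //.
- exact: boxes_setI.
- by move=> _; exists (fun=> setT).
- by apply/seteqP; split => // o _; exists 0%N.
- by move=> _ [B mB <-]; exact: mm.
Qed.

End TensorPower.

(** * Building driven noises *)

Section DrivenConstructors.
Context {R : realType} {I : finType}.

Lemma fin_num_prod_noise (h : R) n (D : nat -> I -> set R) : (forall k i, measurable (D k i)) ->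
  exists2 r : R, 0 <= r & (\prod_(k < n) \prod_i noise h (D k i) = r%:E)%E.
Proof.
move=> mD; pose r := \prod_(k < n) \prod_i fine (noise h (D k i)).
exists r; first by apply: prodr_ge0 => k _; apply: prodr_ge0 => i _; exact: fine_ge0.
rewrite /r -prodEFin; apply: eq_bigr => k _; rewrite -prodEFin; apply: eq_bigr => i _.
by rewrite fineK// fin_num_measure.
Qed.

Lemma measurable_increment_event d (T : measurableType d) (x : T -> I -> R)
    (w : T -> R -> I -> R) h n (D : nat -> I -> set R) :
  (forall i, measurable_fun setT (fun o => x o i)) ->
  (forall s i, measurable_fun setT (fun o => w o s i)) ->
  (forall k i, measurable (D k i)) ->
  measurable [set o | forall k i, (k < n)%N -> D k i (incr (w o) (x o) h k.+1 i)].
Proof.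
move=> mx mw mD.
rewrite [X in measurable X](_ : _ = \bigcap_(p in [set: 'I_n * I])
    ((fun o => incr (w o) (x o) h p.1.+1 p.2) @^-1` D p.1 p.2)); last first.
  apply/seteqP; split => o /=; first by move=> hE [k i] _ /=; exact: hE.
  by move=> hE k i kn; exact: (hE (Ordinal kn, i) Logic.I).
apply: fin_bigcap_measurable; first exact: finite_finset.
by move=> p _; rewrite -[X in measurable X]setTI; apply: (measurable_incr (x := x)).
Qed.

(** For a fixed event on the increments, both sides are finite measures of the event on the initial
    value; agreeing on orthants, they agree everywhere. *)
Lemma driven_intro d (T : measurableType d) (P : probability T R) (x : T -> I -> R)
    (w : T -> R -> I -> R) :
  (forall i, measurable_fun setT (fun o => x o i)) ->
  (forall s i, measurable_fun setT (fun o => w o s i)) ->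
  (forall o, continuous_path (w o)) -> (forall o, w o 0 = (fun=> 0)) ->
  (forall h n a (D : nat -> I -> set R), 0 < h -> (forall k i, measurable (D k i)) ->
    (P [set o | ray a (x o) /\ forall k i, (k < n)%N -> D k i (incr (w o) (x o) h k.+1 i)] =
     P (x @^-1` ray a) * \prod_(k < n) \prod_i noise h (D k i))%E) ->
  driven P x w.
Proof.
move=> mx mw cw w0 rect; split=> // h n C D h0 mC mD.
pose E := [set o | forall k i, (k < n)%N -> D k i (incr (w o) (x o) h k.+1 i)].
have mE : measurable E by exact: measurable_increment_event.
have mX := measurable_to_cyl mx.
have [r r0 rE] := fin_num_prod_noise h n mD.
pose m1 := image_measure (mrestr P mE) mX.
pose m2 := mscale (NngNum r0) (law P mX).
have : m1 C = m2 C.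
  apply: cyl_measure_unique => //.
    move=> a; rewrite /m1 /m2 /image_measure /= /pushforward /mrestr /mscale /=.
    by rewrite muleC -rE -(rect h n a D h0 mD).
  rewrite /m1 /image_measure /= /pushforward /mrestr preimage_setT setTI.
  by rewrite (le_lt_trans (probability_le1 _ mE))// ltry.
rewrite /m1 /m2 /image_measure /= /pushforward /mrestr /mscale /= => e.
rewrite rE muleC -e; congr (P _); by apply/seteqP; split.
Qed.

(** An initial value of arbitrary law is attached to an existing noise on a product space. This is
    how coupled initial values meet the noise. *)
Lemma driven_prod d d0 (T : measurableType d) (T0 : measurableType d0)
    (P : probability T R) (Q : probability T0 R) (x : T -> I -> R) (w : T -> R -> I -> R)
    (x0 : T0 -> I -> R) : driven P x w -> (forall i, measurable_fun setT (fun o => x0 o i)) ->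
  driven [the probability _ _ of (Q \x P)%E] (fun o => x0 o.1) (fun o => w o.2).
Proof.
move=> dr mx0; split.
- by move=> i; exact: (measurableT_comp (mx0 i) measurable_fst).
- by move=> s i; exact: (measurableT_comp (driven_w dr s i) measurable_snd).
- by move=> o; exact: driven_cont dr o.2.
- by move=> o; exact: driven_0 dr o.2.
move=> h n C D h0 mC mD.
pose E := [set o | forall k i, (k < n)%N -> D k i (incr (w o) (x o) h k.+1 i)].
have mE : measurable E.
  by apply: measurable_increment_event => //; [exact: driven_x dr|exact: driven_w dr].
have mX0 : measurable (x0 @^-1` C).
  by rewrite -[X in measurable X]setTI; exact: (measurable_to_cyl mx0).
have EE : [set o : T0 * T | C (x0 o.1) /\ forall k i, (k < n)%N ->
    D k i (incr (w o.2) (x0 o.1) h k.+1 i)] = (x0 @^-1` C) `*` E.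
  by apply/seteqP; split => o.
have EX : (fun o : T0 * T => x0 o.1) @^-1` C = (x0 @^-1` C) `*` setT.
  by apply/seteqP; split => o //= [].
have PE : (P E = \prod_(k < n) \prod_i noise h (D k i))%E.
  have := @driven_rect _ _ _ _ _ _ _ dr h n setT D h0 measurableT mD.
  rewrite preimage_setT probability_setT mul1e => <-; congr (P _).
  by apply/seteqP; split => o //= [].
rewrite EE EX.
have -> : [the probability _ _ of (Q \x P)%E] ((x0 @^-1` C) `*` setT) = (Q (x0 @^-1` C)).
  by rewrite -[RHS]mule1 -(probability_setT P); exact: product_measure1E.
by rewrite -PE; exact: product_measure1E.
Qed.

End DrivenConstructors.

Section DrivenTensor.
Context {R : realType} {I : finType}.

(** Independent copies of a driven noise form one driven noise in a larger dimension, so that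
    uniqueness in law applies to [N] independent limit processes at once. *)
Lemma driven_tensor N d (T : measurableType d) (P : probability T R) (x : T -> I -> R)
    (w : T -> R -> I -> R) : driven P x w ->
  driven (tensor_power P N) (fun o (p : 'I_N * I) => x (tnth o p.1) p.2)
    (fun o s p => w (tnth o p.1) s p.2).
Proof.
move=> dr; apply: driven_intro.
- by move=> p; exact: (measurableT_comp (driven_x dr p.2) (measurable_tnth p.1)).
- by move=> s p; exact: (measurableT_comp (driven_w dr s p.2) (measurable_tnth p.1)).
- by move=> o p; exact: (driven_cont dr (tnth o p.1) p.2).
- by move=> o; apply/funext => p; rewrite (driven_0 dr).
move=> h n a D h0 mD.
have mray (i : 'I_N) : measurable (ray (fun c => a (i, c)) : set (cyl R I)).
  by apply: sub_sigma_algebra; eexists.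
have mA (i : 'I_N) : measurable (x @^-1` ray (fun c => a (i, c))).
  rewrite -[X in measurable X]setTI.
  exact: (measurable_to_cyl (driven_x dr) measurableT (mray i)).
have -> : (fun o (p : 'I_N * I) => x (tnth o p.1) p.2) @^-1` ray a =
    box (fun i => x @^-1` ray (fun c => a (i, c))).
  by apply/seteqP; split => o /= H; [move=> i c; exact: (H (i, c))|move=> [i c]; exact: (H i c)].
rewrite tensor_power_box//.
pose E (i : 'I_N) := [set o | ray (fun c => a (i, c)) (x o) /\
   forall k c, (k < n)%N -> D k (i, c) (incr (w o) (x o) h k.+1 c)].
have mE i : measurable (E i).
  have -> : E i = (x @^-1` ray (fun c => a (i, c))) `&` [set o |
      forall k c, (k < n)%N -> D k (i, c) (incr (w o) (x o) h k.+1 c)] by [].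
  apply: measurableI; first exact: mA.
  apply: (@measurable_increment_event _ _ _ _ x w h n (fun k c => D k (i, c))).
  - exact: driven_x dr.
  - exact: driven_w dr.
  - by move=> k c; exact: mD.
rewrite [X in tensor_power P N X](_ : _ = box E); last first.
  apply/seteqP; split => o /=.
    move=> [H1 H2] i; split; first by move=> c; exact: (H1 (i, c)).
    by move=> k c kn; exact: (H2 k (i, c) kn).
  move=> H; split; first by move=> [i c]; have [+ _] := H i; exact.
  by move=> k [i c] kn; have [_] := H i; exact.
rewrite tensor_power_box//.
have PE (i : 'I_N) : (P (E i) = P (x @^-1` ray (fun c => a (i, c))) *
    \prod_(k < n) \prod_c noise h (D k (i, c)))%E.
  exact: (@driven_rect _ _ _ _ _ _ _ dr h n _ (fun k c => D k (i, c)) h0 (mray i)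
    (fun k c => mD k (i, c))).
rewrite (eq_bigr _ (fun i _ => PE i)).
rewrite big_split /=; congr (_ * _)%E.
rewrite exchange_big /=; apply: eq_bigr => k _.
by rewrite pair_bigA; apply: eq_bigr => -[i c].
Qed.

End DrivenTensor.

(** * From Brownian motions to the two flows *)

Section Brownian.
Context {R : realType} {dO : measure_display} {Omega : measurableType dO}.
Variable P : probability Omega R.
Implicit Types (h s t : R).

(** The sample space is given the sigma-algebra generated by the process: proving an event
    measurable there is proving that it belongs to [sigma_of_process X], as the independence
    hypotheses require. *)
Lemma measurable_process d (V : measurableType d) (X : R -> Omega -> V) s : 0 <= s ->
  measurable_fun setT (X s : g_sigma_algebraType
    (\bigcup_(t in [set t | 0 <= t]) sigma_of (X t)) -> V).
Proof.
move=> s0 _ B mB; rewrite setTI; apply: sub_sigma_algebra.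
by exists s => //; exists B => //; rewrite setTI.
Qed.

Lemma measurable_family_event d (T : measurableType d) (I : finType) n (Y : nat -> I -> T -> R)
    (D : nat -> I -> set R) :
  (forall k i, (k < n)%N -> measurable_fun setT (Y k i)) -> (forall k i, measurable (D k i)) ->
  measurable [set o | forall k i, (k < n)%N -> D k i (Y k i o)].
Proof.
move=> mY mD.
rewrite [X in measurable X](_ : _ = \bigcap_(p in [set: 'I_n * I]) (Y p.1 p.2 @^-1` D p.1 p.2)).
  apply: fin_bigcap_measurable; first exact: finite_finset.
  by move=> p _; rewrite -[X in measurable X]setTI; apply: mY.
apply/seteqP; split => o /=; first by move=> hE [k i] _ /=; exact: hE.
by move=> hE k i kn; exact: (hE (Ordinal kn, i) Logic.I).
Qed.

Lemma brownian_increments_law (w : R -> Omega -> R) h n (D : nat -> set R) :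
  real_brownian_motion P w -> 0 < h -> (forall k, measurable (D k)) ->
  P [set o | forall k, (k < n)%N ->
      D k (Num.sqrt 2 * w (k.+1%:R * h) o - Num.sqrt 2 * w (k%:R * h) o)]
   = (\prod_(k < n) noise h (D k))%E.
Proof.
move=> [mw _ ind gau] h0 mD.
pose t k : R := k%:R * h.
have t0 : 0 <= t 0%N by rewrite /t mul0r.
have tS k : t k <= t k.+1 by rewrite /t ler_wpM2r ?ler_nat// ltW.
pose X k o := w (t k.+1) o - w (t k) o.
pose A k := X k @^-1` [set r | D k (Num.sqrt 2 * r)].
have mB k : measurable [set r : R | D k (Num.sqrt 2 * r)].
  by rewrite -[X in measurable X]setTI; apply: mulrl_measurable.
have -> : [set o | forall k, (k < n)%N ->
      D k (Num.sqrt 2 * w (k.+1%:R * h) o - Num.sqrt 2 * w (k%:R * h) o)] =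
    \bigcap_(k in [set` iota 0 n]) A k.
  apply/seteqP; split => o /=.
    by move=> H k /=; rewrite mem_iota add0n => kn; rewrite /A /X /= mulrBr; exact: H.
  move=> H k kn; rewrite -mulrBr; apply: H.
  by rewrite /= mem_iota.
rewrite (ind t t0 tS); first last.
- by move=> k _; exists [set r | D k (Num.sqrt 2 * r)] => //; rewrite setTI.
- exact: iota_uniq.
have -> : iota 0 n = index_iota 0 n by rewrite /index_iota subn0.
rewrite big_mkord; apply: eq_bigr => k _.
have tk : 0 <= t k by rewrite /t mulr_ge0// ltW.
have tk1 : t k < t k.+1 by rewrite /t ltr_pM2r// ltr_nat.
have := gau _ _ tk tk1 _ (mB k).
have -> : t k.+1 - t k = h by rewrite /t -mulrBl -natr1 addrAC subrr add0r mul1r.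
by [].
Qed.

(** The probability factors over coordinates by their independence, then over time steps. The second
    conjunct lets the event enter the independence of the Brownian motions from each other and from
    the initial value. *)
Lemma brownian_event {d} (B : R -> Omega -> 'rV[R]_d) h n (D : nat -> 'I_d -> set R) :
  brownian_motion P B -> 0 < h -> (forall k c, measurable (D k c)) ->
  let E := [set o | forall k c, (k < n)%N ->
    D k c (Num.sqrt 2 * B (k.+1%:R * h) o ord0 c - Num.sqrt 2 * B (k%:R * h) o ord0 c)] in
  (P E = \prod_(k < n) \prod_c noise h (D k c))%E /\ sigma_of_process B E.
Proof.
move=> [bm ind] h0 mD /=.
have t0 k : 0 <= k%:R * h by rewrite mulr_ge0// ltW.
split; last first.
  pose B' : R -> g_sigma_algebraType (\bigcup_(t in [set t | 0 <= t]) sigma_of (B t)) ->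
    'rV[R]_d := B.
  apply: (@measurable_family_event _ (g_sigma_algebraType
    (\bigcup_(t in [set t | 0 <= t]) sigma_of (B t))) 'I_d n
    (fun k c o => Num.sqrt 2 * B' (k.+1%:R * h) o ord0 c - Num.sqrt 2 * B' (k%:R * h) o ord0 c)) => //.
  have mB' s c : 0 <= s -> measurable_fun setT (fun o => B' s o ord0 c).
    by move=> s0; apply: (measurableT_comp (measurable_rV_coord c)); exact: measurable_process.
  move=> k c _; apply: measurable_funB; apply: measurable_funM => //; exact: mB'.
pose A c := [set o | forall k, (k < n)%N ->
    D k c (Num.sqrt 2 * B (k.+1%:R * h) o ord0 c - Num.sqrt 2 * B (k%:R * h) o ord0 c)].
rewrite [X in P X](_ : _ = \bigcap_(c in [set` enum 'I_d]) A c); last first.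
  apply/seteqP; split => o /=.
    by move=> H c _ k kn; exact: H.
  by move=> H k c kn; apply: (H c) => //=; rewrite mem_enum.
rewrite ind; first last.
- move=> c _.
  pose w (t : R) (o : Omega) : R := B t o ord0 c.
  pose w' : R -> g_sigma_algebraType (\bigcup_(t in [set t | 0 <= t]) sigma_of (w t)) -> R := w.
  have := @measurable_family_event _ (g_sigma_algebraType
    (\bigcup_(t in [set t | 0 <= t]) sigma_of (w t))) unit n
    (fun k _ o => Num.sqrt 2 * w' (k.+1%:R * h) o - Num.sqrt 2 * w' (k%:R * h) o)
    (fun k _ => D k c).
  rewrite [X in measurable X](_ : _ = A c); last first.
    by apply/seteqP; split => o H k; [exact: H k tt|move=> _; exact: H].
  apply=> // k _ _; apply: measurable_funB; apply: measurable_funM => //.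
    by apply: measurable_process; exact: t0.
  by apply: measurable_process; exact: t0.
- exact: enum_uniq.
rewrite big_enum/= exchange_big/=; apply: eq_bigr => c _.
exact: (@brownian_increments_law (fun t o => B t o ord0 c) h n (fun k => D k c)).
Qed.

(** Paths are given at nonnegative times; freezing them at their initial value makes them continuous
    on the line. *)
Lemma within_continuous_max (f : R -> R) : {within `[0, +oo[, continuous f} ->
  continuous (fun s : R => f (Num.max 0 s)).
Proof.
move=> /subspace_continuousP cf s.
have m0 : `[0, +oo[%classic (Num.max 0 s) by rewrite /= in_itv/= le_max lexx.
have cm : (fun s => Num.max 0 s) @ s --> (Num.max 0 s : R).
  rewrite maxr_absE; under eq_fun do rewrite maxr_absE.
  apply: cvgM; last exact: cvg_cst.
  apply: cvgD; first by apply: cvgD; [exact: cvg_cst|exact: cvg_id].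
  by apply: cvg_norm; apply: cvgB; [exact: cvg_cst|exact: cvg_id].
move=> U /(cf _ m0) H.
have H2 : \forall r \near s, Num.max 0 r \in `[0, +oo[ -> U (f (Num.max 0 r)) := cm _ H.
apply: filterS H2 => r; apply.
by rewrite /= in_itv/= le_max lexx.
Qed.

Lemma ae_good_set (Q : Omega -> Prop) : {ae P, forall o, Q o} ->
  exists G, [/\ measurable G, P (~` G) = 0%E & forall o, G o -> Q o].
Proof.
move=> [N [mN N0 hN]]; exists (~` N); split; first exact: measurableC.
  by rewrite setCK.
by move=> o No; apply: contrapT => nQ; apply: No; exact: hN.
Qed.

Lemma prob_good_set G A B : measurable G -> P (~` G) = 0%E -> measurable A -> measurable B ->
  (forall o, G o -> A o <-> B o) -> P A = P B.
Proof.
move=> mG G0 mA mB AB.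
have aux C : measurable C -> P C = P (C `&` G).
  move=> mC; rewrite -[in LHS](setIT C) -(setUv G) setIUr measureU//.
  - have : (P (C `&` ~` G) <= P (~` G))%E.
      have mG' := measurableC mG.
      by apply: le_measure; rewrite ?inE//; exact: measurableI.
    rewrite G0 measure_le0 => /eqP ->; by rewrite adde0.
  - exact: measurableI.
  - by apply: measurableI => //; exact: measurableC.
  - by rewrite setIACA setICr setI0.
rewrite (aux A)// (aux B)//; congr (P _).
by apply/seteqP; split => o /= [h1 h2]; split => //; have [] := AB o h2; auto.
Qed.

(* Off the almost sure set [G] the noise is set to zero, so that every path is continuous. *)
Definition cleaned {I : Type} (G : set Omega) (w : Omega -> R -> I -> R) : Omega -> R -> I -> R :=
  fun o s i => if pselect (G o) then w o (Num.max 0 s) i else 0.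

Lemma driven_cleaned {I : finType} (G : set Omega) (x : Omega -> I -> R)
    (w : Omega -> R -> I -> R) :
  measurable G -> P (~` G) = 0%E ->
  (forall i, measurable_fun setT (fun o => x o i)) ->
  (forall s i, 0 <= s -> measurable_fun setT (fun o => w o s i)) ->
  (forall o, G o -> w o 0 = (fun=> 0) /\ forall i, {within `[0, +oo[, continuous (fun s => w o s i)}) ->
  (forall h n a (D : nat -> I -> set R), 0 < h -> (forall k i, measurable (D k i)) ->
    P [set o | ray a (x o) /\ forall k i, (k < n)%N -> D k i (w o (k.+1%:R * h) i - w o (k%:R * h) i)] =
     (P (x @^-1` ray a) * \prod_(k < n) \prod_i noise h (D k i))%E) ->
  driven P x (cleaned G w).
Proof.
move=> mG G0 mx mw hw rect.
have m0 s : 0 <= Num.max 0 s :> R by rewrite le_max lexx.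
have mc s i : measurable_fun setT (fun o => cleaned G w o s i).
  have -> : (fun o => cleaned G w o s i) = (fun o => \1_G o * w o (Num.max 0 s) i).
    apply/funext => o; rewrite /cleaned indicE; case: pselect => h.
      by rewrite mem_set// mul1r.
    by rewrite memNset// mul0r.
  by apply: measurable_funM => //; exact: mw.
apply: driven_intro => //.
- move=> o i; rewrite /cleaned; case: pselect => h /=; last by move=> s; exact: cvg_cst.
  by apply: (@within_continuous_max (fun s => w o s i)); have [_] := hw o h; exact.
- move=> o; apply/funext => i; rewrite /cleaned; case: pselect => // h.
  by rewrite max_l//; have [->] := hw o h.
move=> h n a D h0 mD.
have t0 k : 0 <= k%:R * h by rewrite mulr_ge0// ltW.
rewrite -(rect h n a D h0 mD).
have mr : measurable (x @^-1` ray a).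
  rewrite -[X in measurable X]setTI; apply: (measurable_to_cyl mx) => //.
  by apply: sub_sigma_algebra; eexists.
apply: (prob_good_set mG G0).
- apply: (@measurableI _ _ (x @^-1` ray a)) => //.
  by apply: measurable_increment_event.
- apply: (@measurableI _ _ (x @^-1` ray a)) => //.
  apply: (@measurable_family_event _ _ _ n (fun k i o => w o (k.+1%:R * h) i - w o (k%:R * h) i)) => //.
  by move=> k i _; apply: measurable_funB; apply: mw.
move=> o Go /=.
have E k i : cleaned G w o (k%:R * h) i = w o (k%:R * h) i.
  by rewrite /cleaned; case: pselect => // ?; rewrite max_r.
split=> -[h1 h2]; split => // k i kn; have := h2 k i kn; by rewrite ?E.
Qed.

End Brownian.

Lemma within_continuousZ {R : realType} (A : set R) (c : R) (f : R -> R) :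
  {within A, continuous f} -> {within A, continuous (fun s => c * f s)}.
Proof. by move=> cf s; apply: cvgM; [exact: cvg_cst|exact: cf]. Qed.

Section CleanedSolution.
Context {R : realType} {I : finType} {dO : measure_display} {Omega : measurableType dO}.
Variable P : probability Omega R.
Local Notation mu := (@lebesgue_measure R).
Implicit Types (h s t T : R).

(** On the almost sure set, the given process, frozen at negative times, is itself the solution.
    Elsewhere the noise has been set to zero and a solution is picked by [sol_exists]. The laws are
    not affected. *)
Lemma cleaned_solution b kappa T (x : Omega -> I -> R) (w X : Omega -> R -> I -> R) :
  drift_ok b kappa -> 0 <= T ->
  (forall i, measurable_fun setT (fun o => x o i)) ->
  (forall s i, 0 <= s -> measurable_fun setT (fun o => w o s i)) ->
  (forall s i, 0 <= s -> measurable_fun setT (fun o => X o s i)) ->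
  {ae P, forall o, [/\ w o 0 = (fun=> 0), forall i, {within `[0, +oo[, continuous (fun s => w o s i)},
    forall i, {within `[0, +oo[, continuous (fun s => X o s i)} &
    forall t i, 0 <= t -> X o t i = x o i + w o t i + \int[mu]_(s in `[0, t]) b s (X o s) i]} ->
  (forall h n a (D : nat -> I -> set R), 0 < h -> (forall k i, measurable (D k i)) ->
    P [set o | ray a (x o) /\ forall k i, (k < n)%N -> D k i (w o (k.+1%:R * h) i - w o (k%:R * h) i)] =
     (P (x @^-1` ray a) * \prod_(k < n) \prod_i noise h (D k i))%E) ->
  exists (w' z : Omega -> R -> I -> R), [/\ driven P x w',
    forall o, is_sol T b (x o) (w' o) (z o) &
    forall t (A : set (cyl R I)), 0 <= t <= T -> measurable A ->
      P ((fun o => z o t) @^-1` A) = P ((fun o => X o t) @^-1` A)].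
Proof.
move=> ok T0 mx mw mX /ae_good_set[G [mG G0 hG]] rect.
have dr : driven P x (cleaned G w).
  by apply: driven_cleaned => // o /hG[h1 h2 _ _].
have ex o : exists z, is_sol T b (x o) (cleaned G w o) z /\
    (G o -> forall s, 0 <= s -> z s = X o s).
  have [Go|nGo] := pselect (G o); last first.
    by have [z hz] := sol_exists (x o) ok (driven_cont dr o) T0; exists z; split.
  have [w0 _ cX eX] := hG o Go.
  exists (fun s => X o (Num.max 0 s)); split; last first.
    by move=> _ s s0; rewrite max_r.
  split.
    by move=> i; exact: (@within_continuous_max _ (fun s => X o s i) (cX i)).
  move=> t tT i; rewrite /cleaned; case: pselect => // ?.
  have [t0|t0] := leP 0 t.
    rewrite (eX _ i t0); congr (_ + _); apply: eq_Rintegral => s.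
    by rewrite inE/= in_itv/= => /andP[s0 _]; rewrite max_r.
  (* At negative times both sides are the initial value, the integral being over the empty set. *)
  rewrite (eX _ i (lexx 0)) set_itv1 Rintegral_set1 w0 addr0.
  by rewrite set_itv_ge ?Rintegral_set0 ?addr0// bnd_simp -ltNge.
pose z o := sval (cid (ex o)).
have hz o : is_sol T b (x o) (cleaned G w o) (z o) by rewrite /z; case: cid => ? [].
have hzX o : G o -> forall s, 0 <= s -> z o s = X o s by rewrite /z; case: cid => ? [].
exists (cleaned G w), z; split=> // t A /andP[t0 tT] mA.
apply: (prob_good_set mG G0).
- rewrite -[X in measurable X]setTI; apply: (measurable_to_cyl _) => // i.
  by apply: (measurable_sol i dr ok t0) => o; exact: is_sol_le tT (hz o).
- by rewrite -[X in measurable X]setTI; apply: (measurable_to_cyl _) => // i; exact: mX.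
- by move=> o Go; rewrite /preimage /= hzX.
Qed.

End CleanedSolution.

Lemma integral_to_coord {R : realType} d (x b : 'rV[R]_d) (c t : R) f (k : 'I_d) :
  (x + c *: b + integral_to t f) ord0 k =
  x ord0 k + c * b ord0 k + \int[lebesgue_measure]_(s in `[0, t]) f s ord0 k.
Proof. by rewrite /integral_to !mxE. Qed.

Section Coordinates.
Context {R : realType} {d : nat}.

Definition coordT N (y : N.-tuple 'rV[R]_d) : 'I_N * 'I_d -> R :=
  fun p => tnth y p.1 ord0 p.2.

Definition tupT N (x : 'I_N * 'I_d -> R) : N.-tuple 'rV[R]_d :=
  [tuple \row_k x (i, k) | i < N].

Lemma tnth_tupT N (x : 'I_N * 'I_d -> R) i : tnth (tupT x) i = \row_k x (i, k).
Proof. by rewrite tnth_mktuple. Qed.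

Lemma tupTK N (x : 'I_N * 'I_d -> R) : coordT (tupT x) = x.
Proof. by apply/funext => -[i k]; rewrite /coordT tnth_tupT mxE. Qed.

Lemma coordTK N (y : N.-tuple 'rV[R]_d) : tupT (coordT y) = y.
Proof. by apply/eq_from_tnth => i; rewrite tnth_tupT; apply/rowP => k; rewrite mxE. Qed.

Lemma measurable_coordT N p : measurable_fun setT (fun y : N.-tuple 'rV[R]_d => coordT y p).
Proof. exact: (measurableT_comp (measurable_rV_coord p.2) (measurable_tnth p.1)). Qed.

Lemma measurable_to_tuple N dT (T : measurableType dT) (f : T -> 'I_N * 'I_d -> R) :
  (forall p, measurable_fun setT (fun o => f o p)) -> measurable_fun setT (fun o => tupT (f o)).
Proof.
move=> mf; apply/measurable_fun_tnthP => i; apply: measurable_to_rV => k.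
apply: (eq_measurable_fun (fun o => f o (i, k))); last exact: mf.
by move=> o _ /=; rewrite tnth_tupT mxE.
Qed.

Lemma measurable_tupT N : measurable_fun setT (@tupT N : cyl R ('I_N * 'I_d)%type -> _).
Proof.
exact: (@measurable_to_tuple N _ (cyl R ('I_N * 'I_d)%type) (fun x => x) (fun p => measurable_coord p)).
Qed.

Lemma measurable_rowT : measurable_fun setT (fun x : cyl R 'I_d => \row_k x k : 'rV[R]_d).
Proof.
apply: measurable_to_rV => k; apply: (eq_measurable_fun (fun x : cyl R 'I_d => x k)).
  by move=> x _; rewrite mxE.
exact: measurable_coord.
Qed.

End Coordinates.

(** * The two flows as driven equations *)

Section Flows.
Context {R : realType} {d : nat}.
Variables V W : 'rV[R]_d -> R.
Implicit Types (h s t T : R).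
Local Notation mu := (@lebesgue_measure R).

Definition particle_field N (s : R) (x : 'I_N * 'I_d -> R) : 'I_N * 'I_d -> R :=
  fun p => particle_drift V W (tupT x) p.1 ord0 p.2.

(* A McKean-Vlasov flow is constrained at nonnegative times only. *)
Definition mckean_vlasov_field (u : R -> probability 'rV[R]_d R) (s : R) (x : 'I_d -> R) : 'I_d -> R :=
  fun k => mckean_vlasov_drift V W (u (Num.max 0 s)) (\row_k x k) ord0 k.

(** Independence over [option 'I_N] factors the event into one factor for the initial value, at
    [None], and one for each Brownian motion, which [brownian_event] computes. *)
Lemma particle_flow_driven N mu0 mut kappa T :
  drift_ok (@particle_field N) kappa -> 0 <= T -> particle_flow V W mu0 mut ->
  exists dO (Omega : measurableType dO) (P : probability Omega R)
    (x : Omega -> 'I_N * 'I_d -> R) w z, [/\ driven P x w,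
    forall o, is_sol T (@particle_field N) (x o) (w o) (z o),
    forall A, measurable A -> P ((fun o => tupT (x o)) @^-1` A) = mu0 A &
    forall t A, 0 <= t <= T -> measurable A ->
      P ((fun o => tupT (z o t)) @^-1` A) = mut t A].
Proof.
move=> ok T0 [dO [Om [P [B [X H]]]]].
have [sol law0 lawt] := H; have [bm ind mX hae] := sol.
pose x o := coordT (X 0 o).
pose w o s (p : 'I_N * 'I_d) := Num.sqrt 2 * B p.1 s o ord0 p.2.
have mXc s p : 0 <= s -> measurable_fun setT (fun o => coordT (X s o) p).
  by move=> s0; exact: (measurableT_comp (measurable_coordT p) (mX s s0)).
have mw s p : 0 <= s -> measurable_fun setT (fun o => w o s p).
  move=> s0; apply: measurable_funM => //; have [bmk _] := bm p.1.
  by have [+ _ _ _] := bmk p.2; exact.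
have cont_coord (f : R -> 'rV[R]_d) k : {within `[0, +oo[, continuous f} ->
    {within `[0, +oo[, continuous (fun s => f s ord0 k)}.
  move=> cf s; apply: (@continuous_comp _ _ _ (f : subspace _ -> _) (fun v : 'rV[R]_d => v ord0 k)).
    exact: cf.
  exact: coord_continuous.
have aeB : {ae P, forall o, forall p : 'I_N * 'I_d, B p.1 0 o ord0 p.2 = 0 /\
    {within `[0, +oo[, continuous (fun s => B p.1 s o ord0 p.2)}}.
  apply: filter_forall => p; have [bmk _] := bm p.1.
  by have [_ + _ _] := bmk p.2.
have [w' [z [dr hz lz]]] : exists (w' z : Om -> R -> 'I_N * 'I_d -> R), [/\ driven P x w',
    forall o, is_sol T (@particle_field N) (x o) (w' o) (z o) &
    forall t (A : set (cyl R ('I_N * 'I_d)%type)), 0 <= t <= T -> measurable A ->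
      P ((fun o => z o t) @^-1` A) = P ((fun o => coordT (X t o)) @^-1` A)].
  apply: (@cleaned_solution _ _ _ _ P _ kappa T x w (fun o s => coordT (X s o))) => //.
  - by move=> p; exact: mXc.
  - move: aeB hae; apply: filterS2 => o hB [cX eX]; split.
    + by apply/funext => p; rewrite /w; have [-> _] := hB p; rewrite mulr0.
    + move=> p s; apply: within_continuousZ.
      by have [_] := hB p; exact.
    + by move=> p; exact: cont_coord (cX p.1).
    + move=> t [i k] t0; rewrite /coordT /= (eX t t0 i) integral_to_coord.
      by apply: f_equal; apply: eq_Rintegral => s _; rewrite /particle_field coordTK.
  move=> h n a D h0 mD.
  pose A (o : option 'I_N) := if o is Some i then [set o | forall k c, (k < n)%N ->
    D k (i, c) (Num.sqrt 2 * B i (k.+1%:R * h) o ord0 c - Num.sqrt 2 * B i (k%:R * h) o ord0 c)]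
    else x @^-1` ray a.
  pose l := None :: [seq Some i | i <- enum 'I_N].
  rewrite [X in P X](_ : _ = \bigcap_(i in [set` l]) A i); last first.
    apply/seteqP; split => o /=.
      move=> [H1 H2] [i _ k c kn|_]; last exact: H1.
      exact: (H2 k (i, c) kn).
    move=> HA; split; first by apply: (HA None); rewrite /= inE.
    move=> k [i c] kn; apply: (HA (Some i)) => //.
    by rewrite /= inE /=; apply: map_f; rewrite mem_enum.
  have E i := @brownian_event _ _ _ P _ (B i) h n (fun k c => D k (i, c)) (bm i) h0
    (fun k c => mD k (i, c)).
  rewrite ind; first last.
  - move=> [i|] _; first by have [] := E i.
    exists [set y | ray a (coordT y)]; last by rewrite setTI.
    rewrite -[X in measurable X]setTI; apply: (measurable_to_cyl (@measurable_coordT _ _ N)) => //.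
    by apply: sub_sigma_algebra; eexists.
  - rewrite /l /= map_inj_uniq ?enum_uniq; last by move=> ? ? [].
    by rewrite andbT; apply/mapP => -[].
  rewrite /l big_cons big_map big_enum/=; congr (_ * _)%E.
  rewrite (eq_bigr (fun i => \prod_(k < n) \prod_c noise h (D k (i, c)))%E); last first.
    by move=> i _; have [] := E i.
  by rewrite exchange_big; apply: eq_bigr => k _; rewrite pair_bigA; apply: eq_bigr => -[i c].
exists dO, Om, P, x, w', z; split => //.
  move=> A mA; rewrite -(law0 A mA); congr (P _).
  by apply/seteqP; split => o /=; rewrite /x coordTK.
move=> t A tT mA; rewrite -(lawt t _ A mA); last by have /andP[] := tT.
have mA' : measurable (@tupT R d N @^-1` A : set (cyl R ('I_N * 'I_d)%type)).
  by rewrite -[X in measurable X]setTI; exact: measurable_tupT.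
rewrite (lz t _ tT mA'); congr (P _).
by apply/seteqP; split => o /=; rewrite coordTK.
Qed.

Lemma mckean_vlasov_flow_driven m u0 u kappa T :
  drift_ok (mckean_vlasov_field u) kappa -> 0 <= T -> mckean_vlasov_flow V W m u0 u ->
  exists dO (Omega : measurableType dO) (P : probability Omega R)
    (x : Omega -> 'I_d -> R) w z, [/\ driven P x w,
    forall o, is_sol T (mckean_vlasov_field u) (x o) (w o) (z o),
    forall A, measurable A -> P ((fun o => \row_k x o k) @^-1` A) = u0 A &
    forall t A, 0 <= t <= T -> measurable A ->
      P ((fun o => \row_k z o t k) @^-1` A) = u t A].
Proof.
move=> ok T0 [_ [dO [Om [P [B [X H]]]]]].
have [sol law0 lawt] := H; have [bm ind mX hae] := sol.
have rowK (v : 'rV[R]_d) : \row_k v ord0 k = v by apply/rowP => k; rewrite mxE.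
pose x o k := X 0 o ord0 k.
pose w o s k := Num.sqrt 2 * B s o ord0 k.
have mXc s k : 0 <= s -> measurable_fun setT (fun o => X s o ord0 k).
  by move=> s0; exact: (measurableT_comp (measurable_rV_coord k) (mX s s0)).
have mw s k : 0 <= s -> measurable_fun setT (fun o => w o s k).
  move=> s0; apply: measurable_funM => //; have [bmk _] := bm.
  by have [+ _ _ _] := bmk k; exact.
have cont_coord (f : R -> 'rV[R]_d) k : {within `[0, +oo[, continuous f} ->
    {within `[0, +oo[, continuous (fun s => f s ord0 k)}.
  move=> cf s; apply: (@continuous_comp _ _ _ (f : subspace _ -> _) (fun v : 'rV[R]_d => v ord0 k)).
    exact: cf.
  exact: coord_continuous.
have aeB : {ae P, forall o, forall k : 'I_d, B 0 o ord0 k = 0 /\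
    {within `[0, +oo[, continuous (fun s => B s o ord0 k)}}.
  apply: filter_forall => k; have [bmk _] := bm.
  by have [_ + _ _] := bmk k.
have [w' [z [dr hz lz]]] : exists (w' z : Om -> R -> 'I_d -> R), [/\ driven P x w',
    forall o, is_sol T (mckean_vlasov_field u) (x o) (w' o) (z o) &
    forall t (A : set (cyl R 'I_d)), 0 <= t <= T -> measurable A ->
      P ((fun o => z o t) @^-1` A) = P ((fun o k => X t o ord0 k) @^-1` A)].
  apply: (@cleaned_solution _ _ _ _ P _ kappa T x w (fun o s k => X s o ord0 k)) => //.
  - by move=> p; exact: mXc.
  - move: aeB hae; apply: filterS2 => o hB [cX eX]; split.
    + by apply/funext => p; rewrite /w; have [-> _] := hB p; rewrite mulr0.
    + move=> p s; apply: within_continuousZ.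
      by have [_] := hB p; exact.
    + by move=> p; exact: cont_coord cX.
    + move=> t k t0; have [_ ->] := eX t t0; rewrite integral_to_coord.
      apply: f_equal; apply: eq_Rintegral => s; rewrite inE/= in_itv/= => /andP[s0 _].
      by rewrite /mckean_vlasov_field rowK max_r.
  move=> h n a D h0 mD.
  pose A (o : bool) := if o then [set o | forall k c, (k < n)%N ->
    D k c (Num.sqrt 2 * B (k.+1%:R * h) o ord0 c - Num.sqrt 2 * B (k%:R * h) o ord0 c)]
    else x @^-1` ray a.
  pose l := [:: false; true].
  rewrite [X in P X](_ : _ = \bigcap_(i in [set` l]) A i); last first.
    apply/seteqP; split => o /=.
      by move=> [H1 H2] [|] _; [exact: H2|exact: H1].
    by move=> HA; split; [exact: (HA false)|exact: (HA true)].
  have [E1 E2] := @brownian_event _ _ _ P _ B h n D bm h0 mD.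
  rewrite ind//; first last.
  - move=> [|] _; first exact: E2.
    exists [set y : 'rV[R]_d | ray a (fun k => y ord0 k)]; last by rewrite setTI.
    rewrite -[X in measurable X]setTI; apply: (measurable_to_cyl (@measurable_rV_coord _ d)) => //.
    by apply: sub_sigma_algebra; eexists.
  by rewrite /l big_cons big_seq1; congr (_ * _)%E.
exists dO, Om, P, x, w', z; split => //.
  move=> A mA; rewrite -(law0 A mA); congr (P _).
  by apply/seteqP; split => o /=; rewrite /x rowK.
move=> t A tT mA; rewrite -(lawt t _ A mA); last by have /andP[] := tT.
have mA' : measurable ((fun x : 'I_d -> R => \row_k x k) @^-1` A : set (cyl R 'I_d)).
  by rewrite -[X in measurable X]setTI; exact: measurable_rowT.
rewrite (lz t _ tT mA'); congr (P _).
by apply/seteqP; split => o /=; rewrite rowK.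
Qed.

End Flows.

(** * Drifts of the particle system and of its limit *)

Section LocallyLipschitz.
Context {R : realType} {K : finType}.
Implicit Types (x y : K -> R).

(** Lipschitz on balls with one constant per ball, as [drift_lip] demands, and not merely near each
    point. *)
Definition loclip (g : (K -> R) -> R) := forall r : R, exists L, 0 <= L /\
  forall x y, n1 x <= r -> n1 y <= r -> `|g x - g y| <= L * n1 (x \- y).

Lemma n1_near x y (e : R) : (forall k, `|y k - x k| < e) -> n1 (y \- x) <= #|K|%:R * e.
Proof.
move=> H; rewrite /n1 mulr_natl -sumr_const; apply: ler_sum => k _.
exact: (ltW (H k)).
Qed.

Lemma loclip_near g x (e : R) : loclip g -> 0 < e -> exists2 r : R, 0 < r &
  forall y, (forall k, `|y k - x k| < r) -> `|g y - g x| < e.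
Proof.
move=> lg e0; pose r0 := n1 x + #|K|%:R; have [L [L0 HL]] := lg r0.
have c0 : 0 <= #|K|%:R :> R by [].
have d0 : 0 < 1 + L * #|K|%:R by rewrite ltr_pwDl ?mulr_ge0.
exists (Num.min 1 (e / (1 + L * #|K|%:R))); first by rewrite lt_min ltr01 divr_gt0.
move=> y hy.
have h1 : n1 (y \- x) <= #|K|%:R * Num.min 1 (e / (1 + L * #|K|%:R)) by apply: n1_near => k; exact: hy.
have yr : n1 y <= r0.
  have -> : y = (y \- x) \+ x by apply/funext => k /=; rewrite subrK.
  apply: le_trans (n1D _ _) _; rewrite addrC lerD2l; apply: le_trans h1 _.
  by rewrite -[leRHS]mulr1 ler_wpM2l// ge_min lexx.
have xr : n1 x <= r0 by rewrite lerDl.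
apply: le_lt_trans (HL y x yr xr) _.
apply: le_lt_trans (ler_wpM2l L0 h1) _.
have -> : L * (#|K|%:R * Num.min 1 (e / (1 + L * #|K|%:R))) =
  (L * #|K|%:R) * Num.min 1 (e / (1 + L * #|K|%:R)) by rewrite mulrA.
apply: (@le_lt_trans _ _ ((L * #|K|%:R) * (e / (1 + L * #|K|%:R)))).
  by rewrite ler_wpM2l ?mulr_ge0// ge_min lexx orbT.
rewrite mulrA ltr_pdivrMr// mulrDr mulr1 [e * _]mulrC.
by rewrite ltrDr.
Qed.

Lemma loclip_measurable g : loclip g -> measurable_fun setT (g : cyl R K -> R).
Proof.
move=> lg; apply: (measurability _ (RGenOInfty.measurableE R)) => _ [_ [a ->] <-]; rewrite setTI; apply: open_measurable_cyl => x /=.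
rewrite in_itv/= andbT => ax; have [r r0 Hr] := loclip_near x lg (e := g x - a) ltac:(by rewrite subr_gt0).
exists r => // y /Hr; rewrite ltr_distl => /andP[+ _].
by rewrite in_itv/= andbT opprB addrC subrK.
Qed.

Lemma loclip_cvg g (z : nat -> K -> R) x : loclip g -> (forall k, z ^~ k @ \oo --> x k) ->
  g (z n) @[n --> \oo] --> g x.
Proof.
move=> lg cz; apply/cvgrPdist_lt => e e0.
have [r r0 Hr] := loclip_near x lg e0.
have : \forall s \near \oo, forall k, `|z s k - x k| < r.
  apply: filter_forall => k; have /cvgrPdist_lt/(_ r r0) := cz k.
  by apply: filterS => s; rewrite distrC.
by apply: filterS => s /Hr; rewrite distrC.
Qed.

Lemma loclip_continuous g (z : R -> K -> R) : loclip g -> continuous_path z -> continuous (fun t => g (z t)).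
Proof.
move=> lg cz t; apply/(@cvg_nbhsP R R^o (fun s => g (z s)) t (g (z t))) => u ut.
apply: (loclip_cvg lg) => k.
by have /(@cvg_nbhsP R R^o (fun s => z s k)) := cz k t; exact.
Qed.

End LocallyLipschitz.

Section Fields.
Context {R : realType} {I : finType}.
Implicit Types (x y : I -> R).

(** Assumptions (H) read on coordinate functions, with the local Lipschitz continuity of [grad V] in
    its form uniform on balls. *)
Record fields (GV GW : (I -> R) -> I -> R) (lV lW M : R) (m : nat) : Prop := {
  GW_odd : forall x, GW (fun k => - x k) = fun k => - GW x k ;
  GW_mono : forall x y, lW * dot (x \- y) (x \- y) <= dot (GW x \- GW y) (x \- y) ;
  GV_mono : forall x y, lV * dot (x \- y) (x \- y) <= dot (GV x \- GV y) (x \- y) ;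
  lV_gt0 : 0 < lV ;
  lVW_gt0 : 0 < lV + 2 * lW ;
  M_gt0 : 0 < M ;
  GW_growth : forall x y, n2 (GW x \- GW y) <=
    M * Num.min (n2 (x \- y)) 1 * (1 + n2 x ^+ m + n2 y ^+ m) ;
  GV_lip : forall i, loclip (fun x => GV x i) }.

Context {GV GW : (I -> R) -> I -> R} {lV lW M : R} {m : nat}.
Hypothesis F : fields GV GW lV lW M m.

Lemma GW0 : GW (fun=> 0) = fun=> 0.
Proof.
apply/funext => k; have := congr1 (fun f => f k) (GW_odd F (fun=> 0)).
have -> : (fun=> - 0 : R) = (fun _ : I => 0 : R) by apply/funext => ?; rewrite oppr0.
by move=> /= E; lra.
Qed.

(* The summand [0 ^+ m] is [1] when [m = 0]. *)
Lemma GW_bound x : n2 (GW x) <= M * (1 + n2 x ^+ m + 0 ^+ m).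
Proof.
have := GW_growth F x (fun=> 0); rewrite GW0 n2_0.
have -> : (GW x \- fun=> 0) = GW x by apply/funext => k /=; rewrite subr0.
move=> /le_trans; apply; rewrite ler_wpM2r//; last first.
  by rewrite -[leRHS]mulr1 ler_wpM2l ?(ltW (M_gt0 F))// ge_min lexx orbT.
by rewrite !addr_ge0// exprn_ge0// n2_ge0.
Qed.

Lemma minr_le1 (a : R) : Num.min a 1 <= a. Proof. by rewrite ge_min lexx. Qed.

Lemma n2_growth x y (r : R) : n1 x <= r -> n1 y <= r ->
  n2 (GW x \- GW y) <= M * (1 + r ^+ m + r ^+ m) * n2 (x \- y).
Proof.
move=> xr yr; have r0 : 0 <= r := le_trans (n1_ge0 x) xr.
apply: le_trans (GW_growth F x y) _; rewrite -!mulrA ler_wpM2l ?(ltW (M_gt0 F))// mulrC.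
have h z : n1 z <= r -> n2 z ^+ m <= r ^+ m.
  by move=> zr; rewrite lerXn2r ?nnegrE ?n2_ge0// (le_trans (n2_le_n1 z)).
apply: ler_pM; rewrite ?addr_ge0 ?exprn_ge0 ?n2_ge0//.
- by rewrite le_min n2_ge0 ler01.
- by rewrite !lerD// h.
- exact: minr_le1.
Qed.

Lemma GW_lip i : loclip (fun x => GW x i).
Proof.
move=> r; pose r' := `|r|; exists (M * (1 + r' ^+ m + r' ^+ m)).
have r0 : 0 <= r' by exact: normr_ge0.
have C0 : 0 <= M * (1 + r' ^+ m + r' ^+ m).
  by rewrite mulr_ge0 ?(ltW (M_gt0 F)) ?addr_ge0 ?exprn_ge0.
split=> // x y xr yr; have rr : r <= r' by exact: ler_norm.
apply: le_trans (coord_le_n2 (GW x \- GW y) i) _.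
apply: le_trans (n2_growth (le_trans xr rr) (le_trans yr rr)) _.
by rewrite ler_wpM2l ?n2_le_n1.
Qed.

End Fields.

Section LocallyLipschitzFields.
Context {R : realType} {d : nat}.
Implicit Types (v w : 'rV[R]_d).

Lemma enormE v : enorm v = n2 (fun k => v ord0 k). Proof. by []. Qed.

Lemma enorm_row (x : 'I_d -> R) : enorm (\row_k x k) = n2 x.
Proof. by rewrite enormE; congr n2; apply/funext => k; rewrite mxE. Qed.

Lemma enormD v w : enorm (v + w) <= enorm v + enorm w.
Proof.
rewrite !enormE (_ : (fun k => (v + w) ord0 k) = (fun k => v ord0 k) \+ (fun k => w ord0 k)).
  exact: n2D.
by apply/funext => k; rewrite mxE.
Qed.

Lemma enormB_C v w : enorm (v - w) = enorm (w - v).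
Proof.
rewrite !enormE (_ : (fun k => (v - w) ord0 k) = (fun k => v ord0 k) \- (fun k => w ord0 k)).
  by rewrite n2C; congr n2; apply/funext => k; rewrite !mxE.
by apply/funext => k; rewrite !mxE.
Qed.

Lemma enorm_continuous : continuous (@enorm R d).
Proof.
move=> v; apply: (@continuous_comp _ _ _ (fun v => dotp v v) Num.sqrt); last exact: sqrt_continuous.
apply: (@continuous_big_sum R _ _ _ (fun k v => v ord0 k * v ord0 k)) => k u.
by apply: (@continuousM R _ (fun v => v ord0 k) (fun v => v ord0 k)); exact: coord_continuous.
Qed.

Lemma enorm_near v w (e : R) : enorm (v - w) < e -> \forall u \near v, enorm (u - w) < e.
Proof.
move=> h; have c : {for v, continuous (fun u : 'rV[R]_d => enorm (u - w))}.
  apply: (@continuous_comp _ _ _ (fun u : 'rV[R]_d => u - w) (@enorm R d)); last exact: enorm_continuous.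
  by apply: (@continuousB R _ _ (fun u => u) (fun=> w)); [exact: cvg_id|exact: cst_continuous].
by move/cvgr_lt : c; exact.
Qed.

Lemma enorm0_eq0 v : enorm v = 0 -> v = 0.
Proof.
move=> h; apply/rowP => k; rewrite mxE; apply/eqP; rewrite -normr_le0 -h enormE.
exact: (coord_le_n2 (fun k => v ord0 k)).
Qed.

(** Compactness is applied to pairs of points of a cube. Near a diagonal pair the local constant
    works; near any other pair the distance is bounded below, so that a bound on the increment is
    enough. *)
Lemma locally_lipschitz_compact (F : 'rV[R]_d -> 'rV[R]_d) (r : R) : locally_lipschitz F ->
  exists L, 0 <= L /\ forall v w, (forall k, `|v ord0 k| <= r) -> (forall k, `|w ord0 k| <= r) ->
    enorm (F v - F w) <= L * enorm (v - w).
Proof.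
move=> lF.
pose A := [set v : 'rV[R]_d | forall k, `[-r, r]%classic (v ord0 k)].
have cA : compact A by apply: (@rV_compact R d (fun=> `[-r, r]%classic)) => k; exact: segment_compact.
have /compact_near_coveringP := compact_setX cA cA.
move=> /(_ R (pinfty_nbhs R) (fun L p => enorm (F p.1 - F p.2) <= L * enorm (p.1 - p.2)) _).
have loc (a b : 'rV[R]_d) : \forall x' \near (a, b) & L \near +oo, enorm (F x'.1 - F x'.2) <= L * enorm (x'.1 - x'.2).
  have [ra [La [ra0 ha]]] := lF a; have [rb [Lb [rb0 hb]]] := lF b.
  have aa : enorm (a - a) < ra by rewrite subrr enormE (_ : (fun _ => _) = fun=> 0) ?n2_0//; apply/funext => k; rewrite mxE.
  have bb : enorm (b - b) < rb by rewrite subrr enormE (_ : (fun _ => _) = fun=> 0) ?n2_0//; apply/funext => k; rewrite mxE.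
  have [<-|ab] := eqVneq a b.
    exists ([set p | enorm (p.1 - a) < ra /\ enorm (p.2 - a) < ra], [set L | La <= L]).
      split; last by apply: nbhs_pinfty_ge; rewrite num_real.
      exists ([set v | enorm (v - a) < ra], [set v | enorm (v - a) < ra]).
        by split; exact: enorm_near.
      by move=> [u v] [].
    move=> [[u v] L] /= [[hu hv] hL]; apply: le_trans (ha _ _ hu hv) _.
    by rewrite ler_wpM2r ?sqrtr_ge0.
  have e0 : 0 < enorm (a - b).
    rewrite lt_neqAle sqrtr_ge0 andbT; apply/eqP => /esym/enorm0_eq0 /eqP.
    by rewrite subr_eq0 (negbTE ab).
  set e := enorm (a - b) in e0.
  (* Within [e / 4] of [a] and of [b], two points stay at distance at least [e / 2], while [C]
     bounds the increment of [F]. *)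
  pose C := `|La| * ra + enorm (F a - F b) + `|Lb| * rb.
  exists ([set p | (enorm (p.1 - a) < Num.min ra (e / 4)) /\ (enorm (p.2 - b) < Num.min rb (e / 4))],
    [set L | C / (e / 2) <= L]).
    split; last by apply: nbhs_pinfty_ge; rewrite num_real.
    exists ([set v | enorm (v - a) < Num.min ra (e / 4)], [set v | enorm (v - b) < Num.min rb (e / 4)]).
      have z0 : @enorm R d 0 = 0 by rewrite enormE (_ : (fun _ => _) = fun=> 0) ?n2_0//; apply/funext => k; rewrite mxE.
      by split; apply: enorm_near; rewrite subrr z0 lt_min ?ra0 ?rb0 divr_gt0.
    by move=> [u v] [].
  move=> [[u v] L] /= []; rewrite !lt_min => -[/andP[u1 u2] /andP[v1 v2]] hL.
  have h1 : enorm (F u - F v) <= C.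
    have -> : F u - F v = (F u - F a) + (F a - F b) + (F b - F v) by rewrite !addrA !subrK.
    apply: le_trans (enormD _ _) _; apply: lerD; last first.
      apply: le_trans (hb _ _ bb v1) _; apply: (@le_trans _ _ (`|Lb| * enorm (b - v))).
        by rewrite ler_wpM2r ?sqrtr_ge0 ?ler_norm.
      by rewrite ler_wpM2l// enormB_C ltW.
    apply: le_trans (enormD _ _) _; rewrite lerD2r.
    apply: le_trans (ha _ _ u1 aa) _; apply: (@le_trans _ _ (`|La| * enorm (u - a))).
      by rewrite ler_wpM2r ?sqrtr_ge0 ?ler_norm.
    by rewrite ler_wpM2l// ltW.
  have C0 : 0 <= C by rewrite !addr_ge0 ?mulr_ge0 ?sqrtr_ge0// ltW.
  have h2 : e / 2 <= enorm (u - v).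
    have : e <= enorm (a - u) + enorm (u - v) + enorm (v - b).
      rewrite /e (_ : a - b = (a - u) + (u - v) + (v - b)); last by rewrite !addrA !subrK.
      by apply: le_trans (enormD _ _) _; rewrite lerD2r enormD.
    by rewrite (enormB_C a u); lra.
  apply: le_trans h1 _; rewrite -[leLHS](@divfK _ (e / 2)) ?gt_eqF ?divr_gt0//.
  have e20 : 0 < e / 2 by rewrite divr_gt0.
  by apply: ler_pM => //; [exact: divr_ge0 C0 (ltW e20)|exact: ltW].
have H p : (A `*` A) p -> \forall x' \near p & L \near +oo,
    enorm (F x'.1 - F x'.2) <= L * enorm (x'.1 - x'.2) by case: p => a b _; exact: loc.
move=> /(_ H) hn.
have [L [L0 HL]] : exists L : R, 0 <= L /\ A `*` A `<=` (fun p => enorm (F p.1 - F p.2) <= L * enorm (p.1 - p.2)).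
  by near (pinfty_nbhs R) => L; exists L; split; near: L; [by apply: nbhs_pinfty_ge; rewrite num_real|exact: hn].
exists L; split=> // v w hv hw; apply: (HL (v, w)); split => k /=; rewrite in_itv/= -ler_norml; [exact: hv|exact: hw].
Unshelve. all: by end_near. Qed.

Lemma locally_lipschitz_loclip (F : 'rV[R]_d -> 'rV[R]_d) k : locally_lipschitz F ->
  loclip (fun x : 'I_d -> R => F (\row_k x k) ord0 k).
Proof.
move=> lF r; have [L [L0 HL]] := locally_lipschitz_compact r lF.
exists L; split=> // x y xr yr.
apply: (@le_trans _ _ (enorm (F (\row_k x k) - F (\row_k y k)))).
  have := coord_le_n2 (fun j => (F (\row_k x k) - F (\row_k y k)) ord0 j) k.
  by rewrite -enormE !mxE.
apply: le_trans (HL _ _ _ _) _.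
- by move=> j; rewrite mxE (le_trans (coord_le_n1 x j)).
- by move=> j; rewrite mxE (le_trans (coord_le_n1 y j)).
rewrite ler_wpM2l// (_ : \row_k x k - \row_k y k = \row_k (x \- y) k); first by rewrite enorm_row n2_le_n1.
by apply/rowP => j; rewrite !mxE.
Qed.

Definition field (F : 'rV[R]_d -> 'rV[R]_d) (x : 'I_d -> R) : 'I_d -> R :=
  fun k => F (\row_k x k) ord0 k.

Lemma fieldB F (x y : 'I_d -> R) :
  field F x \- field F y = fun k => (F (\row_k x k) - F (\row_k y k)) ord0 k.
Proof. by apply/funext => k; rewrite !mxE. Qed.

Lemma row_sub (x y : 'I_d -> R) : \row_k x k - \row_k y k = \row_k (x \- y) k.
Proof. by apply/rowP => j; rewrite !mxE. Qed.

Lemma dotp_row (v : 'rV[R]_d) (x : 'I_d -> R) : dotp v (\row_k x k) = dot (fun k => v ord0 k) x.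
Proof. by apply: eq_bigr => k _; rewrite mxE. Qed.

Lemma fields_of_H (V W : 'rV[R]_d -> R) (lV lW M : R) m :
  assumptions_H V W lV lW M m -> fields (field (grad V)) (field (grad W)) lV lW M m.
Proof.
case=> h1 h2 h3 h4 h5 h6 h7 h8 h9; split => //.
- move=> x; apply/funext => k; rewrite /field.
  rewrite (_ : \row_k - x k = - \row_k x k); first by rewrite h1 mxE.
  by apply/rowP => j; rewrite !mxE.
- move=> x y; have := h2 (\row_k x k) (\row_k y k).
  by rewrite row_sub dotp_row -fieldB enorm_row n2_sqr.
- move=> x y; have := h3 (\row_k x k) (\row_k y k).
  by rewrite row_sub dotp_row -fieldB enorm_row n2_sqr.
- move=> x y; have := h7 (\row_k x k) (\row_k y k).
  by rewrite row_sub !enorm_row fieldB.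
- by move=> i; exact: locally_lipschitz_loclip.
Qed.

End LocallyLipschitzFields.

Section Loclip.
Context {R : realType} {K : finType}.
Implicit Types (x y : K -> R) (f g : (K -> R) -> R).

Lemma loclipD f g : loclip f -> loclip g -> loclip (fun x => f x + g x).
Proof.
move=> hf hg r; have [L [L0 HL]] := hf r; have [L' [L'0 HL']] := hg r.
exists (L + L'); split; first exact: addr_ge0.
move=> x y xr yr; rewrite mulrDl.
rewrite (_ : f x + g x - (f y + g y) = (f x - f y) + (g x - g y)); last by ring.
by apply: le_trans (ler_normD _ _) _; rewrite lerD ?HL ?HL'.
Qed.

Lemma loclipZ f (c : R) : loclip f -> loclip (fun x => c * f x).
Proof.
move=> hf r; have [L [L0 HL]] := hf r; exists (`|c| * L); split; first by rewrite mulr_ge0.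
by move=> x y xr yr; rewrite -mulrBr normrM -mulrA ler_wpM2l// HL.
Qed.

Lemma loclip_cst (c : R) : loclip (fun _ : K -> R => c).
Proof. by move=> r; exists 0; split => // x y _ _; rewrite subrr normr0 mul0r. Qed.

Lemma loclip_sum (J : Type) (s : seq J) (f : J -> (K -> R) -> R) :
  (forall j, loclip (f j)) -> loclip (fun x => \sum_(j <- s) f j x).
Proof.
move=> hf; elim: s => [|j s IH].
  by under [X in loclip X]funext do rewrite big_nil; exact: loclip_cst.
under [X in loclip X]funext do rewrite big_cons.
exact: loclipD.
Qed.

Lemma loclip_comp (J : finType) (g : (J -> R) -> R) (A : (K -> R) -> J -> R) (c : R) : loclip g ->
  (forall x y, A x \- A y = A (x \- y)) -> (forall x, n1 (A x) <= c * n1 x) -> 0 <= c ->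
  loclip (fun x => g (A x)).
Proof.
move=> hg AB An c0 r; have [L [L0 HL]] := hg (c * r); exists (L * c).
split; first exact: mulr_ge0.
move=> x y xr yr; apply: le_trans (HL _ _ _ _) _.
- by rewrite (le_trans (An x))// ler_wpM2l.
- by rewrite (le_trans (An y))// ler_wpM2l.
by rewrite AB -mulrA ler_wpM2l.
Qed.

Lemma drift_ok_loclip (b : (K -> R) -> K -> R) (kappa : R) : 0 < kappa ->
  (forall i, loclip (fun x => b x i)) ->
  (forall x y, dot (b x \- b y) (x \- y) <= - kappa * dot (x \- y) (x \- y)) ->
  drift_ok (fun _ => b) kappa.
Proof.
move=> k0 lb mb; split => //.
- move=> z cz i; apply: continuous_measurable_fun.
  by exact: (loclip_continuous (lb i) cz).
- move=> T r; have /choice[L HL] : forall i, exists L, 0 <= L /\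
    forall x y, n1 x <= r -> n1 y <= r -> `|b x i - b y i| <= L * n1 (x \- y) by move=> i; exact: lb.
  exists (\sum_i L i); split; first by apply: sumr_ge0 => i _; have [] := HL i.
  move=> _ x y _ xr yr i; have [L0 H] := HL i.
  apply: le_trans (H x y xr yr) _; rewrite ler_wpM2r ?n1_ge0// (bigD1 i)//= lerDl.
  by apply: sumr_ge0 => j _; have [] := HL j.
- move=> T; exists (\sum_i `|b (fun=> 0) i|) => s i _.
  by rewrite (bigD1 i)//= lerDl; apply: sumr_ge0.
Qed.

End Loclip.

Lemma dot_sumr {R : realType} {I J : finType} (v : I -> R) (g : J -> I -> R) :
  dot v (fun k => \sum_j g j k) = \sum_j dot v (g j).
Proof. by rewrite /dot exchange_big; apply: eq_bigr => k _; rewrite mulr_sumr. Qed.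

Lemma dot_lin {R : realType} {I : finType} (v f h : I -> R) (c : R) :
  dot v (fun k => - f k - c * h k) = - dot v f - c * dot v h.
Proof. by rewrite /dot mulr_sumr -sumrN -sumrB; apply: eq_bigr => k _; ring. Qed.

(** * Monotonicity of the interaction, weighted by powers *)

Section PowerMonotone.
Context {R : realType} {I : finType}.
Implicit Types (x y a b : I -> R).

(** The gradient of [dot a a ^+ p] divided by [2 * p]. *)
Definition powvec p a : I -> R := fun k => dot a a ^+ p.-1 * a k.

Lemma dot_powvec p a b : dot (powvec p a) b = dot a a ^+ p.-1 * dot a b.
Proof. by rewrite /dot mulr_sumr; apply: eq_bigr => k _; rewrite /powvec mulrA. Qed.

(** Write [A], [B] for the squared norms and [P], [Q] for their powers of exponent [p.-1]. Twice the
    middle term is [(P + Q) |a - b|^2 + (P - Q) (A - B)], and twice its distance to the upper bound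
    is the same with [|a + b|^2]; powers being monotone, all these terms are nonnegative. *)
Lemma dot_powvec_diff p a b : (0 < p)%N ->
  0 <= dot (a \- b) (powvec p a \- powvec p b) <= 2 * (dot a a ^+ p + dot b b ^+ p).
Proof.
case: p => // p _; rewrite dotC !dotBl !dot_powvec !dotBr /= (dotC b a).
have A0 := dot_ge0 a; have B0 := dot_ge0 b.
have := dot_ge0 (a \- b); have := dot_ge0 (a \+ b).
rewrite !dotBl !dotBr !dotDl !dotDr (dotC b a).
rewrite !exprS.
have hm : 0 <= (dot a a ^+ p - dot b b ^+ p) * (dot a a - dot b b).
  have [h|/ltW h] := leP (dot b b) (dot a a).
    by rewrite mulr_ge0 ?subr_ge0// lerXn2r.
  by rewrite mulr_le0 ?subr_le0// lerXn2r.
have := exprn_ge0 p A0; have := exprn_ge0 p B0.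
move: hm A0 B0; move: (dot a a ^+ p) (dot b b ^+ p) => P Q; move: (dot a a) (dot b b) (dot a b) => A B c hm A0 B0 Q0 P0 h1 h2.
have e1 : 0 <= (P + Q) * (A + B + 2 * c) by apply: mulr_ge0; lra.
have e2 : 0 <= (P + Q) * (A + B - 2 * c) by apply: mulr_ge0; lra.
apply/andP; split; lra.
Qed.

Context {GV GW : (I -> R) -> I -> R} {lV lW M : R} {m : nat}.
Hypothesis F : fields GV GW lV lW M m.

(* The interaction of two particles enters through [a - b] only, but the weights
   [|a|^(2 p - 2)] and [|b|^(2 p - 2)] break the symmetry when [1 < p]: this is where one
   needs [d = 1] or a quadratic [W]. *)
Definition power_monotone p := forall x y a b, x \- y = a \- b ->
  2 * Num.min lW 0 * (dot a a ^+ p + dot b b ^+ p) <=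
  dot (GW x \- GW y) (powvec p a \- powvec p b).

(** The weights are trivial, so this is the monotonicity of [GW]; for negative [lW] it is completed
    by [|a - b|^2 <= 2 (|a|^2 + |b|^2)]. *)
Lemma power_monotone1 : power_monotone 1.
Proof.
move=> x y a b E; rewrite !expr1.
have -> : powvec 1 a \- powvec 1 b = x \- y.
  by rewrite E; apply/funext => k; rewrite /powvec /= !expr0 !mul1r.
apply: le_trans (GW_mono F x y); rewrite E.
have := dot_ge0 (a \+ b); have := dot_ge0 (a \- b); have := dot_ge0 a; have := dot_ge0 b.
rewrite !dotBl !dotBr !dotDl !dotDr (dotC b a).
rewrite minEle; case: ifP => [h|/negbT]; last rewrite -ltNge => h; nra.
Qed.

(** Everything reduces to [dot_powvec_diff]: its lower bound serves to replace [c] by [lW], its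
    upper bound to conclude when [lW] is negative. *)
Lemma power_monotone_scale p : (0 < p)%N ->
  (forall x y, exists2 c, lW <= c & GW x \- GW y = (fun k => c * (x k - y k))) -> power_monotone p.
Proof.
move=> p0 h x y a b E; have [c lc ->] := h x y.
have -> : (fun k => c * (x k - y k)) = (fun k => c * (a \- b) k) by rewrite -E.
have -> : dot (fun k => c * (a \- b) k) (powvec p a \- powvec p b) =
    c * dot (a \- b) (powvec p a \- powvec p b).
  by rewrite /dot mulr_sumr; apply: eq_bigr => k _; rewrite mulrA.
have /andP[] := dot_powvec_diff a b p0.
move: (dot _ _) (dot a a ^+ p + _) => D S D0 DS.
rewrite minEle; case: ifP => [h0|/negbT]; last rewrite -ltNge => h0; nra.
Qed.

End PowerMonotone.

(** * Dissipation of the particle system *)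

Section ParticleDrift.
Context {R : realType} {I : finType}.
Context {GV GW : (I -> R) -> I -> R} {lV lW M : R} {m : nat}.
Hypothesis F : fields GV GW lV lW M m.
Variable N : nat.
Implicit Types (x y : 'I_N * I -> R).

Definition slice x (i : 'I_N) : I -> R := fun k => x (i, k).

Definition pair_drift x : 'I_N * I -> R := fun q =>
  - GV (slice x q.1) q.2 - N%:R^-1 * \sum_j GW (slice x q.1 \- slice x j) q.2.

Definition block_power p x := \sum_i dot (slice x i) (slice x i) ^+ p.

(** The constant [rate lV lW], in a form free of case distinction. *)
Definition dissipation := lV + 2 * Num.min lW 0.

Lemma dissipation_gt0 : 0 < dissipation.
Proof.
have h1 := lV_gt0 F; have h2 := lVW_gt0 F.
by rewrite /dissipation minEle; case: ifP => // _; rewrite mulr0 addr0.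
Qed.

(** Oddness of [GW] makes [G j i] the opposite of [G i j], so that exchanging the summation indices
    pairs [T i j] with [T j i], and [power_monotone] bounds each pair. Every particle is met [2 * N]
    times in the doubled sum; after division by [N] the constant is [2 * Num.min lW 0], whatever
    [N]. *)
Lemma pair_drift_dissip p x y : (0 < p)%N -> (0 < N)%N -> power_monotone (GW := GW) (lW := lW) p ->
  \sum_i dot (powvec p (slice (x \- y) i)) (slice (pair_drift x \- pair_drift y) i) <=
    - dissipation * block_power p (x \- y).
Proof.
move=> p0 N0 K.
pose xi i := slice (x \- y) i.
pose G i j := GW (slice x i \- slice x j) \- GW (slice y i \- slice y j).
pose T i j := dot (powvec p (xi i)) (G i j).
have E i : dot (powvec p (xi i)) (slice (pair_drift x \- pair_drift y) i) =
    - dot (powvec p (xi i)) (GV (slice x i) \- GV (slice y i)) - N%:R^-1 * \sum_j T i j.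
  rewrite -dot_sumr -dot_lin; congr dot; apply/funext => k.
  by rewrite /slice /pair_drift /G /= sumrB; ring.
have h1 i : lV * dot (xi i) (xi i) ^+ p <= dot (powvec p (xi i)) (GV (slice x i) \- GV (slice y i)).
  rewrite dot_powvec -[in leLHS](prednK p0) exprS mulrA mulrC ler_wpM2l ?exprn_ge0 ?dot_ge0//.
  by rewrite [leRHS]dotC; exact: (GV_mono F (slice x i) (slice y i)).
have Go i j : G j i = fun k => - G i j k.
  have odd z i' j' : GW (slice z j' \- slice z i') = fun k => - GW (slice z i' \- slice z j') k.
    by rewrite -(GW_odd F); congr GW; apply/funext => k; rewrite /= opprB.
  by apply/funext => k; rewrite /G /= (odd x i j) (odd y i j); ring.
have h2 i j : 2 * Num.min lW 0 * (dot (xi i) (xi i) ^+ p + dot (xi j) (xi j) ^+ p) <= T i j + T j i.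
  have -> : T i j + T j i = dot (G i j) (powvec p (xi i) \- powvec p (xi j)).
    rewrite dotBr /T (Go i j) ![dot (G i j) _]dotC; congr (_ + _).
    by rewrite /dot -sumrN; apply: eq_bigr => k _; rewrite mulrN.
  by apply: K; apply/funext => k; rewrite /xi /slice /=; ring.
have h3 : 2 * Num.min lW 0 * block_power p (x \- y) * N%:R <= \sum_i \sum_j T i j.
  have S2 : \sum_i \sum_j T i j + \sum_i \sum_j T i j = \sum_i \sum_j (T i j + T j i).
    rewrite [X in _ + X]exchange_big -big_split /=; apply: eq_bigr => i _.
    by rewrite -big_split.
  have : \sum_i \sum_j (2 * Num.min lW 0 * (dot (xi i) (xi i) ^+ p + dot (xi j) (xi j) ^+ p)) <=
      \sum_i \sum_j (T i j + T j i) by apply: ler_sum => i _; apply: ler_sum.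
  rewrite -S2; under eq_bigr do rewrite -mulr_sumr; rewrite -mulr_sumr.
  under eq_bigr do rewrite big_split /= sumr_const card_ord.
  rewrite big_split /= sumr_const card_ord -/(block_power p (x \- y)) sumrMnl -/(block_power p (x \- y)).
  rewrite -(mulr_natr (block_power _ _)); move: (Num.min _ _) (block_power _ _) (\sum_i _) => c S U; lra.
under eq_bigr do rewrite E.
rewrite sumrB sumrN -mulr_sumr /dissipation.
have h4 : lV * block_power p (x \- y) <= \sum_i dot (powvec p (xi i)) (GV (slice x i) \- GV (slice y i)).
  by rewrite mulr_sumr; apply: ler_sum => i _; exact: h1.
have h5 : 2 * Num.min lW 0 * block_power p (x \- y) <= N%:R^-1 * \sum_i \sum_j T i j.
  by rewrite [leRHS]mulrC ler_pdivlMr ?ltr0n.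
lra.
Qed.

Lemma slice_n1 x i : n1 (slice x i) <= n1 x.
Proof.
rewrite /n1 [leRHS](eq_bigr (fun q : 'I_N * I => `|x (q.1, q.2)|)); last by case.
rewrite -(pair_bigA _ (fun i k => `|x (i, k)|)) /= (bigD1 i)//= lerDl.
by apply: sumr_ge0 => j _; apply: sumr_ge0.
Qed.

Lemma block_power1 x : block_power 1 x = dot x x.
Proof.
rewrite /block_power /dot; under eq_bigr do rewrite expr1.
by rewrite pair_bigA; apply: eq_bigr => -[].
Qed.

Lemma pair_drift_ok : (0 < N)%N -> drift_ok (fun _ => pair_drift) dissipation.
Proof.
move=> N0; apply: drift_ok_loclip; first exact: dissipation_gt0.
  move=> [i k]; rewrite /pair_drift /=; apply: loclipD.
    under [X in loclip X]funext do rewrite -mulN1r; apply: loclipZ.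
    apply: (@loclip_comp _ _ _ (fun z => GV z k) (fun x => slice x i) 1) => //.
      exact: (GV_lip F).
    by move=> x; rewrite mul1r slice_n1.
  under [X in loclip X]funext do rewrite -mulNr; apply: loclipZ.
  apply: loclip_sum => j.
  apply: (@loclip_comp _ _ _ (fun z => GW z k) (fun x => slice x i \- slice x j) 2) => //.
  - exact: (GW_lip F).
  - by move=> x y; apply/funext => k' /=; rewrite /slice /=; ring.
  - move=> x; rewrite mulr_natl mulr2n.
    have h : n1 (slice x i \- slice x j) <= n1 (slice x i) + n1 (slice x j).
      by rewrite /n1 -big_split; apply: ler_sum => k' _; exact: ler_normB.
    by apply: le_trans h _; rewrite lerD// slice_n1.
move=> x y; have := pair_drift_dissip x y (ltnSn 0) N0 (power_monotone1 F).
rewrite block_power1; apply: le_trans; rewrite le_eqVlt; apply/orP; left; apply/eqP.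
rewrite [LHS]dotC /dot pair_bigA; apply: eq_bigr => -[i k] _.
by rewrite /powvec /= expr0 mul1r.
Qed.

End ParticleDrift.

(** * Expectations *)

Section Expect.
Context {d : measure_display} {T : measurableType d} {R : realType} (P : probability T R).
Implicit Types (f g : T -> R).

Definition L1 f := P.-integrable setT (EFin \o f).
Definition expect f : R := \int[P]_x f x.

Lemma L1_meas f : L1 f -> measurable_fun setT f.
Proof. by move=> /measurable_int /measurable_EFinP. Qed.

Lemma expectE f : L1 f -> (\int[P]_x (f x)%:E)%E = (expect f)%:E.
Proof. by move=> lf; rewrite /expect /Rintegral fineK//; exact: integrable_fin_num. Qed.

Lemma L1_dom f g : measurable_fun setT f -> (forall x, `|f x| <= g x) -> L1 g -> L1 f.
Proof.
move=> mf fg lg; apply: (@le_integrable _ _ _ P setT _ _ (EFin \o g)) => //.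
  exact/measurable_EFinP.
by move=> x _ /=; rewrite lee_fin (le_trans (fg x))// ler_norm.
Qed.

Lemma L1_ge0_dom f g : measurable_fun setT f -> (forall x, 0 <= f x <= g x) -> L1 g -> L1 f.
Proof. by move=> mf h; apply: L1_dom => // x; have /andP[? ?] := h x; rewrite ger0_norm. Qed.

Lemma L1_cst c : L1 (fun=> c).
Proof. exact: finite_measure_integrable_cst. Qed.

Lemma L1D f g : L1 f -> L1 g -> L1 (fun x => f x + g x).
Proof.
move=> lf lg; rewrite /L1 (_ : EFin \o _ = (EFin \o f) \+ (EFin \o g))%E.
  exact: integrableD.
by apply/funext => x /=; rewrite EFinD.
Qed.

Lemma L1Z c f : L1 f -> L1 (fun x => c * f x).
Proof.
move=> lf; rewrite /L1 (_ : EFin \o _ = fun x => (c%:E * (EFin \o f) x)%E).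
  exact: integrableZl.
by apply/funext => x /=; rewrite EFinM.
Qed.

Lemma L1N f : L1 f -> L1 (fun x => - f x).
Proof. by move/(L1Z (-1)); under [X in L1 X]funext do rewrite mulN1r. Qed.

Lemma L1B f g : L1 f -> L1 g -> L1 (fun x => f x - g x).
Proof. by move=> lf /L1N; exact: L1D. Qed.

Lemma L1_sum (J : Type) (s : seq J) (f : J -> T -> R) :
  (forall j, L1 (f j)) -> L1 (fun x => \sum_(j <- s) f j x).
Proof.
move=> lf; elim: s => [|j s IH].
  by under [X in L1 X]funext do rewrite big_nil; exact: L1_cst.
by under [X in L1 X]funext do rewrite big_cons; exact: L1D.
Qed.

Lemma expectD f g : L1 f -> L1 g -> expect (fun x => f x + g x) = expect f + expect g.
Proof. by move=> lf lg; exact: RintegralD. Qed.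

Lemma expectB f g : L1 f -> L1 g -> expect (fun x => f x - g x) = expect f - expect g.
Proof. by move=> lf lg; exact: RintegralB. Qed.

Lemma expectZ c f : L1 f -> expect (fun x => c * f x) = c * expect f.
Proof. by move=> lf; exact: RintegralZl. Qed.

Lemma expect_cst c : expect (fun=> c) = c.
Proof.
rewrite /expect Rintegral_cst//; have E : fine (P setT) = 1 by rewrite probability_setT.
by rewrite [fine _]E mulr1.
Qed.

Lemma expect_sum (J : Type) (s : seq J) (f : J -> T -> R) : (forall j, L1 (f j)) ->
  expect (fun x => \sum_(j <- s) f j x) = \sum_(j <- s) expect (f j).
Proof.
move=> lf; elim: s => [|j s IH].
  by under [X in expect X]funext do rewrite big_nil; rewrite big_nil expect_cst.
under [X in expect X]funext do rewrite big_cons.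
by rewrite expectD ?IH ?big_cons//; exact: L1_sum.
Qed.

Lemma expect_le f g : L1 f -> L1 g -> (forall x, f x <= g x) -> expect f <= expect g.
Proof. by move=> lf lg h; exact: le_Rintegral. Qed.

Lemma expect_ge0 f : (forall x, 0 <= f x) -> 0 <= expect f.
Proof. by move=> h; exact: Rintegral_ge0. Qed.

Lemma expect_norm f : L1 f -> `|expect f| <= expect (fun x => `|f x|).
Proof. by move=> lf; exact: le_normr_Rintegral. Qed.

Lemma expect_bound f g : measurable_fun setT f -> (forall x, `|f x| <= g x) -> L1 g ->
  `|expect f| <= expect g.
Proof.
move=> mf fg lg; have lf := L1_dom mf fg lg.
apply: le_trans (expect_norm lf) _; apply: expect_le => //.
by apply: L1_dom lg; [exact: measurableT_comp|move=> x; rewrite normr_id].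
Qed.

Lemma L1_of_bound f (K : R) : measurable_fun setT f -> (forall x, 0 <= f x) ->
  (\int[P]_x (f x)%:E <= K%:E)%E -> L1 f /\ expect f <= K.
Proof.
move=> mf f0 h; have lf : L1 f.
  apply/integrableP; split; first exact/measurable_EFinP.
  apply: le_lt_trans (ltry K); apply: le_trans h.
  by apply: ge0_le_integral => //= [||x _]; rewrite ?lee_fin ?ger0_norm//;
    apply/measurable_EFinP => //; exact: measurableT_comp.
by split=> //; move: h; rewrite expectE// lee_fin.
Qed.

Lemma expect_cvg (f_ : nat -> T -> R) f g : (forall n, measurable_fun setT (f_ n)) -> L1 g ->
  (forall n x, `|f_ n x| <= g x) -> (forall x, f_ ^~ x @ \oo --> f x) ->
  expect (f_ n) @[n --> \oo] --> expect f.
Proof.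
move=> mf lg fg ff.
have h := @dominated_cvg _ _ _ P setT measurableT (fun n x => (f_ n x)%:E)
  (fun x => (f x)%:E) (EFin \o g) _ _ _ lg _.
apply: fine_cvg; rewrite -/(expect f).
rewrite -expectE; last first.
  apply: L1_dom lg; first by apply: (@measurable_fun_cvg _ _ _ _ f_ f) => // x _; exact: ff.
  move=> x; have c : (fun n => `|f_ n x|) @ \oo --> `|f x| by apply: cvg_norm; exact: ff.
  rewrite -(cvg_lim _ c)//; apply: limr_le; first by apply/cvg_ex; exists `|f x|.
  by near=> n; exact: fg.
apply: h => //.
- by move=> n; apply/measurable_EFinP.
- by move=> x _; apply: cvg_EFin; [exact: nearW|exact: ff].
- by move=> n x _; rewrite /= lee_fin.
Unshelve. all: by end_near. Qed.

End Expect.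

Section ExpectLaw.
Context {d d' : measure_display} {T : measurableType d} {T' : measurableType d'} {R : realType}
  (P : probability T R) (Q : probability T' R) (X : T -> T').
Hypotheses (mX : measurable_fun setT X) (H : forall A, measurable A -> P (X @^-1` A) = Q A).

Lemma ge0_law_integral (f : T' -> \bar R) : measurable_fun setT f -> (forall y, 0 <= f y)%E ->
  (\int[Q]_y f y = \int[P]_x f (X x))%E.
Proof.
move=> mf f0; have := ge0_integral_pushforward mX P measurableT mf (fun x _ => f0 x).
rewrite preimage_setT => <-; apply: eq_measure_integral => A mA _; exact/esym/H.
Qed.

Lemma law_integral (f : T' -> \bar R) : measurable_fun setT f ->
  (\int[Q]_y f y = \int[P]_x f (X x))%E.
Proof.
move=> mf; rewrite integralE [RHS]integralE; congr (_ - _)%E.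
  rewrite (@ge0_law_integral f^\+%E)//; last exact: measurable_funepos.
  by apply: eq_integral => x _; rewrite !funeposE.
rewrite (@ge0_law_integral f^\-%E)//; last exact: measurable_funeneg.
by apply: eq_integral => x _; rewrite !funenegE.
Qed.

Lemma law_expect (f : T' -> R) : measurable_fun setT f -> expect Q f = expect P (fun x => f (X x)).
Proof. by move=> mf; rewrite /expect /Rintegral law_integral//; exact/measurable_EFinP. Qed.

Lemma law_L1 (f : T' -> R) : measurable_fun setT f -> L1 Q f <-> L1 P (fun x => f (X x)).
Proof.
move=> mf; have mn : measurable_fun setT (fun y => `|(f y)%:E|%E).
  by apply: measurableT_comp => //; exact/measurable_EFinP.
split=> /integrableP[h1 h2]; apply/integrableP; split.
- by apply/measurable_EFinP; exact: measurableT_comp.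
- by move: h2; rewrite (ge0_law_integral mn).
- exact/measurable_EFinP.
- by rewrite (ge0_law_integral mn).
Qed.

End ExpectLaw.

Lemma exprD_le {R : realType} (a b : R) m : 0 <= a -> 0 <= b ->
  (a + b) ^+ m <= 2 ^+ m * (a ^+ m + b ^+ m).
Proof.
move=> a0 b0; wlog ab : a b a0 b0 / a <= b.
  by move=> h; have [?|/ltW ?] := leP a b; [exact: h|rewrite addrC (addrC (a ^+ m)) h].
apply: (@le_trans _ _ ((2 * b) ^+ m)).
  by rewrite lerXn2r ?nnegrE ?addr_ge0 ?mulr_ge0//; lra.
by rewrite exprMn ler_wpM2l ?exprn_ge0// lerDr exprn_ge0.
Qed.

(** * The limit drift *)

Section ConvolutionDrift.
Context {R : realType} {d : nat} {V W : 'rV[R]_d -> R} {lV lW M : R} {m : nat}.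
Hypothesis F : fields (field (grad V)) (field (grad W)) lV lW M m.
Implicit Types (x y : 'I_d -> R) (mu : probability 'rV[R]_d R) (s t : R).

Local Notation gw := (field (grad W)).

Definition rv (v : 'rV[R]_d) : 'I_d -> R := fun k => v ord0 k.

Definition mconv mu x : 'I_d -> R := fun k => expect mu (fun v => gw (x \- rv v) k).

Lemma mckean_vlasov_fieldE (u : R -> probability 'rV[R]_d R) s x :
  mckean_vlasov_field V W u s x = fun k => - field (grad V) x k - mconv (u (Num.max 0 s)) x k.
Proof.
apply/funext => k; rewrite /mckean_vlasov_field /mckean_vlasov_drift mxE; apply: f_equal2; first by rewrite mxE.
rewrite mxE; apply: f_equal; rewrite /grad_conv mxE.
apply: eq_Rintegral => y _; rewrite /field; congr (grad W _ ord0 k).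
by apply/rowP => j; rewrite !mxE.
Qed.

Lemma measurable_gw k : measurable_fun setT ((fun x => gw x k) : cyl R 'I_d -> R).
Proof. by apply: loclip_measurable; exact: (GW_lip F). Qed.

Lemma measurable_gw_comp d0 (T : measurableType d0) (f : T -> 'I_d -> R) k :
  (forall j, measurable_fun setT (fun o => f o j)) -> measurable_fun setT (fun o => gw (f o) k).
Proof.
by move=> mf; exact: (measurableT_comp (measurable_gw k) (measurable_to_cyl mf)).
Qed.

Lemma measurable_gw_sub x k : measurable_fun setT (fun v => gw (x \- rv v) k).
Proof.
apply: measurable_gw_comp => j; apply: measurable_funB => //.
exact: measurable_rV_coord.
Qed.

Lemma n2_sub_pow x v : n2 (x \- rv v) ^+ m <= 2 ^+ m * (n2 x ^+ m + enorm v ^+ m).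
Proof.
apply: le_trans (exprD_le m (n2_ge0 x) (sqrtr_ge0 _)).
rewrite lerXn2r ?nnegrE ?n2_ge0 ?addr_ge0 ?n2_ge0//.
rewrite (_ : x \- rv v = x \+ (fun k => - rv v k))//.
apply: le_trans (n2D _ _) _; rewrite lerD2l /n2 (_ : dot _ _ = dot (rv v) (rv v))//.
by apply: eq_bigr => k _; rewrite mulrNN.
Qed.

Lemma measurable_enorm : measurable_fun setT (@enorm R d).
Proof. by apply: measurable_continuous_rV; exact: enorm_continuous. Qed.

Context {mu : probability 'rV[R]_d R} {K : R}.
Hypothesis momK : (\int[mu]_x (enorm x ^+ m)%:E <= K%:E)%E.

Lemma L1_moment : L1 mu (fun v => enorm v ^+ m) /\ expect mu (fun v => enorm v ^+ m) <= K.
Proof.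
apply: L1_of_bound => //; first exact: measurable_funX measurable_enorm.
by move=> v; rewrite exprn_ge0// sqrtr_ge0.
Qed.

Lemma gw_sub_bound x v k : `|gw (x \- rv v) k| <= M * (2 + 2 ^+ m * (n2 x ^+ m + enorm v ^+ m)).
Proof.
apply: le_trans (coord_le_n2 _ _) _; apply: le_trans (GW_bound F _) _.
rewrite ler_wpM2l ?(ltW (M_gt0 F))// -addrA [X in _ + X]addrC addrA.
apply: lerD; last exact: n2_sub_pow.
by rewrite lerD2l exprn_ile1.
Qed.

Lemma L1_gw_sub x k : L1 mu (fun v => gw (x \- rv v) k).
Proof.
have [l1 _] := L1_moment.
apply: L1_dom (measurable_gw_sub x k) (gw_sub_bound x ^~ k) _.
apply: L1Z; apply: L1D; first exact: L1_cst.
by apply: L1Z; apply: L1D => //; exact: L1_cst.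
Qed.

Lemma mconv_bound x k : `|mconv mu x k| <= M * (2 + 2 ^+ m * (n2 x ^+ m + K)).
Proof.
have [l1 e1] := L1_moment.
have l2 : L1 mu (fun v => n2 x ^+ m + enorm v ^+ m) by apply: L1D => //; exact: L1_cst.
have l3 : L1 mu (fun v => 2 + 2 ^+ m * (n2 x ^+ m + enorm v ^+ m)).
  by apply: L1D; [exact: L1_cst|exact: L1Z].
have := expect_bound (measurable_gw_sub x k) (gw_sub_bound x ^~ k) (L1Z M l3).
move/le_trans; apply; rewrite expectZ// ler_wpM2l ?(ltW (M_gt0 F))//.
rewrite expectD//; [|exact: L1_cst|exact: L1Z].
rewrite expect_cst lerD2l expectZ// ler_wpM2l ?exprn_ge0// expectD//; last exact: L1_cst.
by rewrite expect_cst lerD2l.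
Qed.

Lemma mconv_lip x y k (r : R) : n1 x <= r -> n1 y <= r ->
  `|mconv mu x k - mconv mu y k| <= M * (1 + 2 * (2 ^+ m * (r ^+ m + K))) * n1 (x \- y).
Proof.
move=> xr yr; have [l1 e1] := L1_moment.
have M0 := ltW (M_gt0 F).
rewrite /mconv -expectB; [|exact: L1_gw_sub..].
have hp z v : n1 z <= r -> n2 (z \- rv v) ^+ m <= 2 ^+ m * (r ^+ m + enorm v ^+ m).
  move=> zr; apply: le_trans (n2_sub_pow z v) _; rewrite ler_wpM2l ?exprn_ge0// lerD2r.
  have h := le_trans (n2_le_n1 z) zr.
  by rewrite lerXn2r ?nnegrE ?n2_ge0// (le_trans (n2_ge0 z)).
pose B (v : 'rV[R]_d) := M * n1 (x \- y) * (1 + 2 * (2 ^+ m * (r ^+ m + enorm v ^+ m))).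
have hB v : `|gw (x \- rv v) k - gw (y \- rv v) k| <= B v.
  apply: le_trans (coord_le_n2 (gw (x \- rv v) \- gw (y \- rv v)) k) _.
  apply: le_trans (GW_growth F _ _) _.
  have E : (x \- rv v) \- (y \- rv v) = x \- y by apply/funext => j /=; ring.
  rewrite E; apply: ler_pM.
  - by rewrite mulr_ge0// le_min n2_ge0 ler01.
  - by rewrite !addr_ge0// exprn_ge0// n2_ge0.
  - by rewrite ler_wpM2l// (le_trans (minr_le1 _))// n2_le_n1.
  - by have := hp x v xr; have := hp y v yr; lra.
have l2 : L1 mu (fun v => r ^+ m + enorm v ^+ m) by apply: L1D => //; exact: L1_cst.
have l3 : L1 mu (fun v => 1 + 2 * (2 ^+ m * (r ^+ m + enorm v ^+ m))).
  by apply: L1D; [exact: L1_cst|do 2 apply: L1Z].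
have := expect_bound _ hB (L1Z _ l3).
move/(_ _)/le_trans; apply.
  by apply: measurable_funB; exact: measurable_gw_sub.
rewrite /B expectZ// [leRHS]mulrAC ler_wpM2l ?mulr_ge0 ?n1_ge0//.
rewrite expectD//; [|exact: L1_cst|by do 2 apply: L1Z].
rewrite expect_cst lerD2l expectZ//; last exact: L1Z.
rewrite ler_wpM2l// expectZ// ler_wpM2l ?exprn_ge0// expectD//; last exact: L1_cst.
by rewrite expect_cst lerD2l.
Qed.

Lemma mconv_mono x y : lW * dot (x \- y) (x \- y) <= dot (mconv mu x \- mconv mu y) (x \- y).
Proof.
have E : dot (mconv mu x \- mconv mu y) (x \- y) =
    expect mu (fun v => dot (gw (x \- rv v) \- gw (y \- rv v)) (x \- y)).
  rewrite /dot expect_sum; last first.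
    move=> k; under [X in L1 _ X]funext do rewrite mulrC.
    by apply: L1Z; apply: L1B; exact: L1_gw_sub.
  apply: eq_bigr => k _; under [X in expect _ X]funext do rewrite mulrC.
  rewrite expectZ; last by apply: L1B; exact: L1_gw_sub.
  rewrite mulrC; apply: f_equal; rewrite (expectB (L1_gw_sub x k) (L1_gw_sub y k)).
  by [].
rewrite E -(expect_cst mu (lW * _)); apply: expect_le; first exact: L1_cst.
  rewrite /dot; apply: L1_sum => k; under [X in L1 _ X]funext do rewrite mulrC.
  by apply: L1Z; apply: L1B; exact: L1_gw_sub.
move=> v; have := GW_mono F (x \- rv v) (y \- rv v).
by rewrite (_ : (x \- rv v) \- (y \- rv v) = x \- y)//; apply/funext => j /=; ring.
Qed.

End ConvolutionDrift.

Lemma dot_opp2 {R : realType} {I : finType} (f f' g g' v : I -> R) :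
  dot ((fun k => - f k - g k) \- (fun k => - f' k - g' k)) v =
  - (dot (f \- f') v + dot (g \- g') v).
Proof. by rewrite /dot -big_split -sumrN; apply: eq_bigr => k _ /=; ring. Qed.

Lemma L1_norm {d} {T : measurableType d} {R : realType} (P : probability T R) f :
  L1 P f -> L1 P (fun x => `|f x|).
Proof. by move=> lf; exact: (integrable_abse lf). Qed.

Section TimeMeasurable.
Context {R : realType} {d : nat} {V W : 'rV[R]_d -> R} {lV lW M : R} {m : nat}.
Hypothesis F : fields (field (grad V)) (field (grad W)) lV lW M m.
Implicit Types (s t T : R).
Local Notation gw := (field (grad W)).

Definition clip (r a : R) : R := Num.max (- r) (Num.min r a).

Lemma clip_norm r a : 0 <= r -> `|clip r a| <= r.
Proof. by move=> r0; rewrite ler_norml /clip maxEle minEle; do 2 case: ifPn; rewrite -?ltNge; lra. Qed.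

Lemma clip_le r a : 0 <= r -> `|clip r a| <= `|a|.
Proof.
move=> r0; rewrite ler_norml /clip; have := ler_norm a; have := ler_norm (- a); rewrite normrN.
move: `|a| => n; rewrite maxEle minEle; do 2 case: ifPn; rewrite -?ltNge; lra.
Qed.

Lemma clip_cvg a : (fun n => clip n%:R a) @ \oo --> a.
Proof.
apply: cvg_near_cst; near=> n.
have : `|a| <= n%:R by near: n; exact: nbhs_infty_ger.
by rewrite ler_norml /clip => /andP[h1 h2]; rewrite min_r// max_r.
Unshelve. all: by end_near. Qed.

Lemma clip_seq r (u : nat -> R) l : u @ \oo --> l -> (fun n => clip r (u n)) @ \oo --> clip r l.
Proof.
by move=> h; apply: cvg_maxr; [exact: cvg_cst|apply: cvg_minr => //; exact: cvg_cst].
Qed.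

Lemma measurable_clip r dT (T : measurableType dT) (f : T -> R) :
  measurable_fun setT f -> measurable_fun setT (fun o => clip r (f o)).
Proof. by move=> mf; apply: measurable_maxr => //; exact: measurable_minr. Qed.

Lemma continuous_path_cvg {I : finType} (z : R -> I -> R) (u : nat -> R) t k : continuous_path z -> u @ \oo --> t ->
  (fun n => z (u n) k) @ \oo --> z t k.
Proof. by move=> cz ut; move: (cz k t) => /(@cvg_nbhsP R R^o (fun s => z s k)); exact. Qed.

(** Along continuous paths of the limit process the kernel is continuous in time. It grows like the
    power [m] while only moments of order [m] are bounded, which gives no uniform integrability; the
    kernel is therefore clipped. The clipped averages are continuous in time and converge pointwise,
    whence measurability. *)
Lemma mconv_measurable (u : R -> probability 'rV[R]_d R) (z : R -> 'I_d -> R) k :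
  mckean_vlasov_flow V W m (u 0) u -> continuous_path z ->
  measurable_fun setT (fun s => mconv (W := W) (u (Num.max 0 s)) (z s) k).
Proof.
move=> [mom [dO [Om [P [B [X [[_ _ mX hae] _ lawX]]]]]]] cz.
have [G [mG G0 hG]] := ae_good_set hae.
(* Off the almost sure set the process is replaced by zero, so that all paths are continuous. *)
pose Y s o : 'I_d -> R := fun j => \1_G o * X (Num.max 0 s) o ord0 j.
have m0 s : 0 <= Num.max 0 s by rewrite le_max lexx.
have mY s j : measurable_fun setT (fun o => Y s o j).
  apply: measurable_funM; first exact: measurable_indic.
  exact: (measurableT_comp (measurable_rV_coord j) (mX _ (m0 s))).
have cY o : continuous_path (fun s => Y s o).
  move=> j; rewrite /Y indicE; have [/set_mem Go|nGo] := boolP (o \in G); last first.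
    by under [X in continuous X]funext do rewrite mul0r; exact: cst_continuous.
  under [X in continuous X]funext do rewrite mul1r.
  apply: (within_continuous_max (f := fun s => X s o ord0 j)).
  have [cX _] := hG o Go; move=> s.
  apply: (@continuous_comp _ _ _ (X^~ o : subspace _ -> _) (fun v : 'rV[R]_d => v ord0 j)).
    exact: cX.
  exact: coord_continuous.
have mYr s : measurable_fun setT (fun o => \row_j Y s o j).
  by apply: measurable_to_rV => j; apply: eq_measurable_fun (mY s j) => o _; rewrite mxE.
have lawY s A : measurable A -> P ((fun o => \row_j Y s o j) @^-1` A) = u (Num.max 0 s) A.
  move=> mA; rewrite -(lawX _ (m0 s) A mA); apply: (prob_good_set mG G0).
  - by rewrite -[X in measurable X]setTI; exact: mYr.
  - by rewrite -[X in measurable X]setTI; exact: (mX _ (m0 s)).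
  - move=> o Go; rewrite /preimage /= (_ : \row_j Y s o j = X (Num.max 0 s) o)//.
    by apply/rowP => j; rewrite mxE /Y indicE mem_set// mul1r.
have rvY s o : rv (\row_j Y s o j) = Y s o by apply/funext => j; rewrite /rv mxE.
pose g s o := gw (z s \- Y s o) k.
have mg s : measurable_fun setT (g s).
  by apply: (measurable_gw_comp F) => j; apply: measurable_funB.
have E s : mconv (W := W) (u (Num.max 0 s)) (z s) k = expect P (g s).
  rewrite /mconv (law_expect (mYr s) (lawY s)); last exact: (measurable_gw_sub F).
  by congr (expect P); apply/funext => o; rewrite rvY.
have lg s : L1 P (g s).
  have [K hK] := mom (Num.max 0 s).
  have := L1_gw_sub F (hK _ (m0 s) (lexx _)) (z s) k.
  move/(law_L1 (mYr s) (lawY s) (measurable_gw_sub F (z s) k)).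
  by apply: eq_ind; congr (L1 P); apply/funext => o; rewrite rvY.
under [X in measurable_fun _ X]funext do rewrite E.
have cg o (v : nat -> R) s : v @ \oo --> s -> (fun n => g (v n) o) @ \oo --> g s o.
  move=> vs; apply: (loclip_cvg (GW_lip F k)) => j.
  have h1 : (fun n => z (v n) j) @ \oo --> z s j by exact: continuous_path_cvg.
  have h2 : (fun n => Y (v n) o j) @ \oo --> Y s o j by exact: (continuous_path_cvg (z := fun s => Y s o)).
  exact: cvgB h1 h2.
apply: (@measurable_fun_cvg _ _ _ _ (fun n s => expect P (fun o => clip n%:R (g s o)))).
  move=> n; apply: continuous_measurable_fun => s.
  apply/(@cvg_nbhsP R R^o) => v vs.
  apply: (@expect_cvg _ _ _ P _ _ (fun=> n%:R)).
  - by move=> i; exact: measurable_clip.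
  - exact: L1_cst.
  - by move=> i o; exact: clip_norm.
  - by move=> o; apply: clip_seq; exact: cg.
move=> s _; apply: (@expect_cvg _ _ _ P _ _ (fun o => `|g s o|)).
- by move=> i; exact: measurable_clip.
- exact: L1_norm.
- by move=> n o; exact: clip_le.
- by move=> o; exact: clip_cvg.
Qed.

(** The convolution inherits the monotonicity constant of [grad W], so the constants add up, and
    [2 * (lV + lW)] is the sum of the positive numbers [lV] and [lV + 2 * lW]. *)
Lemma mckean_vlasov_field_ok u0 (u : R -> probability 'rV[R]_d R) : mckean_vlasov_flow V W m u0 u ->
  drift_ok (mckean_vlasov_field V W u) (lV + lW).
Proof.
move=> flow; have [mom _] := flow.
have m0 s : 0 <= Num.max 0 s by rewrite le_max lexx.
have bE s x : mckean_vlasov_field V W u s x = fun k => - field (grad V) x k - mconv (W := W) (u (Num.max 0 s)) x k.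
  exact: mckean_vlasov_fieldE.
pose v s := u (Num.max 0 s).
have mom' T : exists K, forall s, s <= T -> (\int[v s]_x (enorm x ^+ m)%:E <= K%:E)%E.
  have [K hK] := mom (Num.max 0 T); exists K => s sT; apply: hK => //.
  by rewrite ge_max m0 le_max sT orbT.
have mom0 s : exists K, (\int[v s]_x (enorm x ^+ m)%:E <= K%:E)%E.
  by have [K hK] := mom' s; exists K; exact: hK.
split.
- by have := lV_gt0 F; have := lVW_gt0 F; lra.
- move=> z cz k; under [X in measurable_fun _ X]funext do rewrite bE.
  apply: measurable_funB; last first.
    apply: mconv_measurable => //; split=> //; have [_ [dO [Om [P [B [X [h1 h2 h3]]]]]]] := flow.
    exists dO, Om, P, B, X; split=> // A mA; exact: h3.
  apply: measurableT_comp => //; apply: continuous_measurable_fun.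
  exact: (loclip_continuous (GV_lip F k) cz).
- move=> T r; have [K hK] := mom' T.
  have /choice[L HL] k := GV_lip F k r.
  pose L' := \sum_k L k; pose C := M * (1 + 2 * (2 ^+ m * (`|r| ^+ m + `|K|))).
  exists (L' + C).
  have L0 : 0 <= L' by apply: sumr_ge0 => k _; have [] := HL k.
  have C0 : 0 <= C.
    rewrite mulr_ge0 ?(ltW (M_gt0 F))// addr_ge0// mulr_ge0// mulr_ge0 ?exprn_ge0//.
  split; first by rewrite addr_ge0.
  move=> s x y sT xr yr k; rewrite !bE mulrDl.
  set a := field (grad V) x k; set b := field (grad V) y k.
  set a' := mconv _ x k; set b' := mconv _ y k.
  rewrite (_ : - a - a' - (- b - b') = - ((a - b) + (a' - b'))); last by ring.
  rewrite normrN; apply: le_trans (ler_normD _ _) _; apply: lerD.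
    have [Lk0 Hk] := HL k; apply: le_trans (Hk x y xr yr) _.
    rewrite ler_wpM2r ?n1_ge0// /L' (bigD1 k)//= lerDl.
    by apply: sumr_ge0 => j _; have [] := HL j.
  apply: le_trans (mconv_lip F (hK s sT) k (le_trans xr (ler_norm r)) (le_trans yr (ler_norm r))) _.
  rewrite ler_wpM2r ?n1_ge0// ler_wpM2l ?(ltW (M_gt0 F))// lerD2l ler_wpM2l// ler_wpM2l ?exprn_ge0//.
  by rewrite lerD2l ler_norm.
- move=> T; have [K hK] := mom' T.
  exists (\sum_k `|field (grad V) (fun=> 0) k| + M * (2 + 2 ^+ m * (n2 (fun _ : 'I_d => 0 : R) ^+ m + K))).
  move=> s k sT; rewrite bE; apply: le_trans (ler_normB _ _) _; rewrite normrN; apply: lerD.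
    by rewrite (bigD1 k)//= lerDl; apply: sumr_ge0.
  exact: (mconv_bound F (hK s sT)).
move=> s x y; have [K hK] := mom0 s; rewrite !bE -/(v s).
have := mconv_mono F hK x y; have := GV_mono F x y.
rewrite dot_opp2.
move: (dot _ _) (dot _ _) (dot _ _) => A B C; lra.
Qed.

End TimeMeasurable.

(** * Differences of independent copies *)

Section NormalMoments.
Context {R : realType}.
Implicit Types (s h x : R).
Local Notation mu := (@lebesgue_measure R).

(** The Radon-Nikodym derivative and the Gaussian density have the same integral on every measurable
    set, hence agree almost everywhere. *)
Lemma ge0_integral_normal_prob s (f : R -> \bar R) : measurable_fun setT f ->
  (forall x, 0 <= f x)%E ->
  (\int[normal_prob 0 s]_x f x = \int[mu]_x (f x * (normal_pdf 0 s x)%:E))%E.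
Proof.
move=> mf f0.
have dom := normal_prob_dominates 0 s.
rewrite -(Radon_Nikodym_SigmaFinite.change_of_variables dom f0 measurableT mf).
have ir := Radon_Nikodym_SigmaFinite.f_integrable dom.
have mp : measurable_fun setT (fun x => (normal_pdf 0 s x)%:E).
  by apply/measurable_EFinP; exact: measurable_normal_pdf.
apply: ae_eq_integral => //.
- by apply: emeasurable_funM => //; exact: measurable_int ir.
- exact: emeasurable_funM.
- apply: ae_eqe_mul2l; apply: integral_ae_eq => //.
  by move=> E _ mE; rewrite -(Radon_Nikodym_SigmaFinite.f_integral dom).
Qed.

(** The inequality [1 + x <= expR x] at [x = y / (4 * q)], raised to the power [q]. *)
Lemma exprn_le_expR q (y : R) : 0 <= y -> y ^+ q <= (4 * q%:R) ^+ q * expR (y / 4).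
Proof.
case: q => [|q] y0; first by rewrite !expr0 mul1r -expR0 ler_expR divr_ge0.
have q0 : 0 < q.+1%:R :> R by rewrite ltr0n.
have -> : expR (y / 4) = expR (y / (4 * q.+1%:R)) ^+ q.+1.
  by rewrite -expRM_natl; congr expR; field; rewrite gt_eqF.
rewrite -exprMn lerXn2r ?nnegrE// ?mulr_ge0 ?expR_ge0//.
rewrite -ler_pdivrMl ?mulr_gt0//.
apply: le_trans (expR_ge1Dx _); rewrite mulrC lerDr//.
Qed.

(** Half of the Gaussian exponent absorbs the polynomial, and the other half is the density of
    standard deviation [s * Num.sqrt 2]. What matters is the homogeneity in [s]. *)
Lemma normal_moment q s : 0 < s ->
  (\int[normal_prob 0 s]_x (x ^+ (2 * q))%:E <=
   (s ^+ (2 * q) * ((4 * q%:R) ^+ q * Num.sqrt 2))%:E)%E.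
Proof.
move=> s0; have s2 : 0 < s * Num.sqrt 2 by rewrite mulr_gt0// sqrtr_gt0.
have E2 (x : R) : x ^+ (2 * q) = (x ^+ 2) ^+ q by rewrite exprM.
rewrite ge0_integral_normal_prob; last 2 first.
- by apply/measurable_EFinP; exact: measurable_funX.
- by move=> x; rewrite lee_fin E2 exprn_ge0// sqr_ge0.
set C := s ^+ _ * _.
have C0 : 0 <= C.
  by rewrite /C mulr_ge0 ?exprn_ge0 ?(ltW s0)// mulr_ge0 ?sqrtr_ge0// exprn_ge0// mulr_ge0.
have <- : (C%:E * \int[mu]_x (normal_pdf 0 (s * Num.sqrt 2) x)%:E = C%:E)%E.
  by rewrite integral_normal_pdf mule1.
rewrite -ge0_integralZl//; last 2 first.
- by apply/measurable_EFinP; exact: measurable_normal_pdf.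
- by move=> x _; rewrite lee_fin normal_pdf_ge0.
apply: ge0_le_integral => //.
- by move=> x _; rewrite -EFinM lee_fin mulr_ge0 ?normal_pdf_ge0// E2 exprn_ge0// sqr_ge0.
- apply/measurable_EFinP; apply: measurable_funM; last exact: measurable_normal_pdf.
  exact: measurable_funX.
- apply/measurable_EFinP; apply: measurable_funM => //; exact: measurable_normal_pdf.
move=> x _; rewrite -!EFinM lee_fin !normal_pdfE ?gt_eqF// /normal_fun !subr0.
have -> : normal_peak (s * Num.sqrt 2) = normal_peak s / Num.sqrt 2.
  rewrite /normal_peak -invfM; congr (_^-1).
  rewrite exprMn sqr_sqrtr// -sqrtrM//; last first.
    by rewrite mulrn_wge0// mulr_ge0 ?sqr_ge0// pi_ge0.
  by congr Num.sqrt; ring.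
pose y := x ^+ 2 / s ^+ 2.
have y0 : 0 <= y by rewrite divr_ge0 ?sqr_ge0.
have s20 : s ^+ 2 != 0 by rewrite expf_neq0// gt_eqF.
have -> : - x ^+ 2 / (s ^+ 2 *+ 2) = - (y / 4) - y / 4 by rewrite /y -mulr_natr; field; rewrite gt_eqF.
have -> : - x ^+ 2 / ((s * Num.sqrt 2) ^+ 2 *+ 2) = - (y / 4).
  by rewrite /y exprMn sqr_sqrtr// -mulr_natr; field; rewrite gt_eqF.
have -> : x ^+ (2 * q) = s ^+ (2 * q) * y ^+ q.
  by rewrite exprM [in RHS]exprM -exprMn /y mulrC divfK.
rewrite expRD; have h := exprn_le_expR q y0; have e0 := expR_gt0 (- (y / 4)).
have h' : y ^+ q * expR (- (y / 4)) <= (4 * q%:R) ^+ q.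
  have : y ^+ q * expR (- (y / 4)) <= (4 * q%:R) ^+ q * expR (y / 4) * expR (- (y / 4)).
    by rewrite ler_wpM2r// ltW.
  by rewrite -[in leRHS]mulrA -expRD subrr expR0 mulr1.
have p0 := normal_peak_ge0 s.
rewrite /C; have sq : Num.sqrt 2 != 0 :> R by rewrite gt_eqF// sqrtr_gt0.
have -> : s ^+ (2 * q) * ((4 * q%:R) ^+ q * Num.sqrt 2) * (normal_peak s / Num.sqrt 2 * expR (- (y / 4))) =
  (s ^+ (2 * q) * (normal_peak s * expR (- (y / 4)))) * (4 * q%:R) ^+ q by field.
have -> : s ^+ (2 * q) * y ^+ q * (normal_peak s * (expR (- (y / 4)) * expR (- (y / 4)))) =
  (s ^+ (2 * q) * (normal_peak s * expR (- (y / 4)))) * (y ^+ q * expR (- (y / 4))) by ring.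
rewrite ler_wpM2l// mulr_ge0 ?exprn_ge0 ?(ltW s0)// mulr_ge0// ltW.
Qed.

(** The factor [2 ^+ q] is due to the diffusion coefficient [Num.sqrt 2], the rest to
    [normal_moment]. *)
Definition noise_const (q : nat) : R := 2 ^+ q * ((4 * q%:R) ^+ q * Num.sqrt 2).

Lemma noise_const_ge0 q : 0 <= noise_const q.
Proof. by rewrite /noise_const mulr_ge0 ?exprn_ge0// mulr_ge0 ?sqrtr_ge0// exprn_ge0// mulr_ge0. Qed.

Lemma noise_moment q h : 0 < h ->
  L1 (noise h) (fun r => r ^+ (2 * q)) /\ expect (noise h) (fun r => r ^+ (2 * q)) <= noise_const q * h ^+ q.
Proof.
move=> h0; have E2 (x : R) : x ^+ (2 * q) = (x ^+ 2) ^+ q by rewrite exprM.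
apply: L1_of_bound.
- exact: measurable_funX.
- by move=> x; rewrite E2 exprn_ge0// sqr_ge0.
rewrite (@ge0_law_integral _ _ _ _ R (normal_prob 0 (Num.sqrt h)) (noise h)
  (fun x => Num.sqrt 2 * x))//=; last 3 first.
- exact: measurable_funM.
- by apply/measurable_EFinP; exact: measurable_funX.
- by move=> y; rewrite lee_fin E2 exprn_ge0// sqr_ge0.
have E x : ((Num.sqrt 2 * x) ^+ (2 * q))%:E = ((2 ^+ q)%:E * (x ^+ (2 * q))%:E)%E.
  by rewrite -EFinM exprMn [in X in X * _]exprM sqr_sqrtr.
under eq_integral do rewrite E.
have mX : measurable_fun setT (fun x : R => (x ^+ (2 * q))%:E).
  by apply/measurable_EFinP; exact: measurable_funX.
rewrite ge0_integralZl//; last first.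
  by move=> x _; rewrite lee_fin E2 exprn_ge0// sqr_ge0.
have := @normal_moment q (Num.sqrt h) ltac:(by rewrite sqrtr_gt0).
rewrite [in X in X * _]exprM sqr_sqrtr ?(ltW h0)// => le.
rewrite /noise_const [leRHS](_ : _ = ((2 ^+ q)%:E * (h ^+ q * ((4 * q%:R) ^+ q * Num.sqrt 2))%:E)%E).
  by apply: lee_wpmul2l => //; rewrite lee_fin exprn_ge0.
by rewrite -EFinM; congr EFin; ring.
Qed.

End NormalMoments.

Section ProductExpectation.
Context {d1 d2 : measure_display} {T1 : measurableType d1} {T2 : measurableType d2} {R : realType}
  (P : probability T1 R) (Q : probability T2 R).

Lemma prod_expect (a : T1 -> R) (f : T2 -> R) : L1 P a -> L1 Q f ->
  L1 [the probability _ _ of (P \x Q)%E] (fun o => a o.1 * f o.2) /\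
  expect [the probability _ _ of (P \x Q)%E] (fun o => a o.1 * f o.2) = expect P a * expect Q f.
Proof.
move=> la lf.
have m12 : measurable_fun setT (fun o : T1 * T2 => a o.1 * f o.2).
  apply: measurable_funM.
    exact: (measurableT_comp (L1_meas la) measurable_fst).
  exact: (measurableT_comp (L1_meas lf) measurable_snd).
have l12 : L1 [the probability _ _ of (P \x Q)%E] (fun o => a o.1 * f o.2).
  apply/integrableP; split; first exact/measurable_EFinP.
  rewrite (fubini_tonelli1 (fun o : T1 * T2 => `|(a o.1 * f o.2)%:E|%E))//; last first.
    by apply: measurableT_comp => //; exact/measurable_EFinP.
  have E x : fubini_F Q (fun o : T1 * T2 => `|(a o.1 * f o.2)%:E|%E) x =
      (expect Q (fun y => `|f y|) * `|a x|)%:E.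
    rewrite /fubini_F /= mulrC -expectZ; last exact: L1_norm.
    rewrite -expectE; last by apply: L1Z; exact: L1_norm.
    by apply: eq_integral => y _; rewrite normrM.
  under eq_integral do rewrite E.
  rewrite expectE ?ltry//; apply: L1Z; exact: L1_norm.
split=> //; have := integral12_prod_meas1 l12; rewrite expectE// => h.
apply: EFin_inj; rewrite -h.
have E x : fubini_F Q (EFin \o (fun o : T1 * T2 => a o.1 * f o.2)) x = (expect Q f * a x)%:E.
  rewrite /fubini_F /= mulrC -expectZ// -expectE//.
  exact: L1Z.
under eq_integral do rewrite E.
by rewrite expectE ?expectZ 1?mulrC//; exact: L1Z.
Qed.

End ProductExpectation.

(** * Independence of the past and the next increment *)

Section PastNoise.
Context {R : realType} {I : finType} {d : measure_display} {T : measurableType d}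
  {P : probability T R} {x : T -> I -> R} {w : T -> R -> I -> R}.
Hypothesis dr : driven P x w.
Variables (h : R) (k : nat) (j : I).
Hypothesis h0 : 0 < h.

Definition past (o : T) : 'I_k.+1 * I -> R := fun p => incr (w o) (x o) h p.1 p.2.

(** The past together with the next increment, at index [None]: in [f] on the given space, in [f']
    on its product with a fresh Gaussian. Comparing their laws turns independence into Fubini's
    theorem. *)
Let f o (p : option ('I_k.+1 * I)) := if p is Some p' then past o p' else incr (w o) (x o) h k.+1 j.
Let f' (o : T * R) (p : option ('I_k.+1 * I)) := if p is Some p' then past o.1 p' else o.2.

Lemma measurable_past p : measurable_fun setT (fun o => past o p).
Proof. by apply: measurable_incr; [exact: driven_x dr|exact: driven_w dr]. Qed.

Let mf p : measurable_fun setT (fun o => f o p).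
Proof.
case: p => [p|]; first exact: measurable_past.
exact: (measurable_incr h (driven_x dr) (driven_w dr) k.+1 j).
Qed.

Let mf' p : measurable_fun setT (fun o => f' o p).
Proof.
case: p => [p|] /=; last exact: measurable_snd.
exact: (measurableT_comp (measurable_past p) measurable_fst).
Qed.

Let same_rays a : P (f @^-1` ray a) = [the probability _ _ of (P \x noise h)%E] (f' @^-1` ray a).
Proof.
pose C := ray (fun i => a (Some (ord0, i))).
pose D0 (k' : nat) i : set R := `]-oo, a (Some (inord k'.+1, i))[%classic.
pose N : set R := `]-oo, a None[%classic.
(* In the last step only the coordinate [j] is constrained; the others contribute factors one. *)
pose D (k' : nat) i : set R := if (k' < k)%N then D0 k' i else if i == j then N else setT.
have mC : measurable (C : set (cyl R I)) by apply: sub_sigma_algebra; eexists.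
have mN : measurable N by exact: measurable_itv.
have mD0 k' i : measurable (D0 k' i) by exact: measurable_itv.
have mD k' i : measurable (D k' i) by rewrite /D; case: ifP => // _; case: ifP.
have E (g : nat -> I -> R) : ray (fun p => a (Some p)) (fun p : 'I_k.+1 * I => g p.1 p.2) <->
    C (g 0%N) /\ forall k' i, (k' < k)%N -> D0 k' i (g k'.+1 i).
  split=> [H|[H1 H2] [k' i] /=].
    split=> [i|k' i kn]; first exact: (H (ord0, i)).
    by rewrite /D0 /= in_itv/=; have := H (inord k'.+1, i); rewrite /= inordK.
  have [k0|k0] := posnP k'.
    have -> : k' = ord0 by apply/val_inj.
    exact: H1.
  have kn : (k'.-1 < k)%N by rewrite -ltnS prednK.
  by have := H2 k'.-1 i kn; rewrite /D0 /= in_itv/= prednK// inord_val.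
have E1 : f @^-1` ray a =
    [set o | C (x o) /\ forall k' i, (k' < k.+1)%N -> D k' i (incr (w o) (x o) h k'.+1 i)].
  apply/seteqP; split => o /=.
    move=> H; have [H1 H2] := (E (incr (w o) (x o) h)).1 (fun p => H (Some p)).
    split=> // k' i; rewrite /D ltnS leq_eqVlt => /predU1P[->|kk]; last by rewrite kk; exact: H2.
    by rewrite ltnn; case: eqP => // ->; have := H None; rewrite /N /= in_itv.
  move=> [H1 H2] [p|].
    apply: ((E (incr (w o) (x o) h)).2 _ p); split=> // k' i kk.
    by have := H2 k' i (ltnW kk); rewrite /D kk.
  by have := H2 k j (ltnSn k); rewrite /D ltnn eqxx /N /= in_itv.
pose F := [set o | C (x o) /\ forall k' i, (k' < k)%N -> D0 k' i (incr (w o) (x o) h k'.+1 i)].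
have E2 : f' @^-1` ray a = F `*` N.
  apply/seteqP; split; move=> [t r] /=.
    move=> H; have [H1 H2] := (E (incr (w t) (x t) h)).1 (fun p => H (Some p)).
    by split=> //; have := H None; rewrite /N /= in_itv.
  move=> [H1 H2] [p|]; first exact: ((E (incr (w t) (x t) h)).2 H1 p).
  by move: H2; rewrite /N /= in_itv.
have mF : measurable F.
  rewrite (_ : F = x @^-1` C `&` [set o | forall k' i, (k' < k)%N -> D0 k' i (incr (w o) (x o) h k'.+1 i)])//.
  apply: measurableI.
    by rewrite -[X in measurable X]setTI; exact: (measurable_to_cyl (driven_x dr)).
  by apply: measurable_increment_event => //; [exact: driven_x dr|exact: driven_w dr].
rewrite E1 E2 (driven_rect dr)// [RHS]product_measure1E//.
rewrite [RHS](_ : _ = (P (x @^-1` C) * \prod_(k' < k) \prod_i noise h (D0 k' i) * noise h N)%E); last first.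
  by congr (_ * _)%E; exact: (driven_rect dr).
rewrite big_ord_recr /= muleA; congr (_ * _ * _)%E.
  by apply: eq_bigr => k' _; apply: eq_bigr => i _; rewrite /D ltn_ord.
rewrite (bigD1 j)//= /D ltnn eqxx big1 ?mule1// => i /negbTE ->.
exact: probability_setT.
Qed.

Lemma past_noise_indep (A : cyl R ('I_k.+1 * I)%type -> R) (phi : R -> R) :
  measurable_fun setT A -> L1 P (fun o => A (past o)) -> L1 (noise h) phi ->
  L1 P (fun o => A (past o) * phi (incr (w o) (x o) h k.+1 j)) /\
  expect P (fun o => A (past o) * phi (incr (w o) (x o) h k.+1 j)) =
  expect P (fun o => A (past o)) * expect (noise h) phi.
Proof.
move=> mA lA lphi; have [l12 e12] := prod_expect lA lphi.
pose G (y : cyl R (option ('I_k.+1 * I))) := A (fun p => y (Some p)) * phi (y None).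
have mG : measurable_fun setT G.
  apply: measurable_funM.
    by apply: (measurableT_comp mA); apply: measurable_to_cyl => p; exact: measurable_coord.
  by apply: (measurableT_comp (L1_meas lphi)); exact: measurable_coord.
pose Q := law [the probability _ _ of (P \x noise h)%E] (measurable_to_cyl mf').
have H1 (B : set (cyl R (option ('I_k.+1 * I)))) : measurable B -> P (f @^-1` B) = Q B.
  by move=> mB; rewrite (transfer mf mf' same_rays mB) lawE.
have H2 (B : set (cyl R (option ('I_k.+1 * I)))) : measurable B -> [the probability _ _ of (P \x noise h)%E] (f' @^-1` B) = Q B.
  by move=> mB; rewrite lawE.
have e1 := law_expect (measurable_to_cyl mf) H1 mG.
have e2 := law_expect (measurable_to_cyl mf') H2 mG.
have l1 := law_L1 (measurable_to_cyl mf) H1 mG.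
have l2 := law_L1 (measurable_to_cyl mf') H2 mG.
by split; [apply/l1/l2|rewrite -e12 -[RHS]e2 e1].
Qed.

End PastNoise.

(** * Expansion of powers of a perturbed vector *)

Section PowerInequalities.
Context {R : realType}.
Implicit Types (A B s : R).

Lemma mix_le r A B : 0 <= A -> 0 <= B ->
  A * B ^+ r.+1 <= A ^+ r.+1 * B + B ^+ r.+2 /\ A ^+ r * B ^+ 2 <= A ^+ r.+1 * B + B ^+ r.+2.
Proof.
move=> A0 B0; have [AB|/ltW BA] := leP A B.
  split.
    by rewrite [B ^+ r.+2]exprS ler_wpDl ?mulr_ge0 ?exprn_ge0// ler_wpM2r ?exprn_ge0.
  by rewrite -[r.+2]addn2 exprD ler_wpDl ?mulr_ge0 ?exprn_ge0// ler_wpM2r ?exprn_ge0// lerXn2r.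
split.
  rewrite exprSr mulrA ler_wpDr ?exprn_ge0// ler_wpM2r// exprS ler_wpM2l// lerXn2r//.
by rewrite expr2 mulrA ler_wpDr ?exprn_ge0// ler_wpM2r// exprSr ler_wpM2l// exprn_ge0.
Qed.

(* With [A = |a|^2], [B = |e|^2] and [s = a . e]: the term of order one in a centered
   increment [e] is isolated, the other ones are of order at least two. *)
Lemma power_expand r : exists C : R, 0 <= C /\ forall A B s, 0 <= A -> 0 <= B -> s ^+ 2 <= A * B ->
  (A + 2 * s + B) ^+ r.+1 <=
    A ^+ r.+1 + 2 * r.+1%:R * (A ^+ r * s) + C * (A ^+ r * B + B ^+ r.+1).
Proof.
elim: r => [|r [C [C0 IH]]].
  by exists 1; split => // A B s A0 B0 _; rewrite !expr1 !expr0 !mul1r mulr1; lra.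
exists (6 * C + 6 * r.+1%:R + 1); split.
  by rewrite !addr_ge0 ?mulr_ge0.
move=> A B s A0 B0 sAB; have h := IH A B s A0 B0 sAB.
have s2 : 2 * s <= A + B /\ - (A + B) <= 2 * s.
  apply/andP; rewrite andbC -ler_norml -(@ler_pXn2r _ 2)// ?nnegrE ?addr_ge0// -normrX.
  by rewrite ger0_norm ?sqr_ge0//; have := sqr_ge0 (A - B); nra.
have Q0 : 0 <= A + 2 * s + B by lra.
rewrite exprSr; apply: le_trans (ler_wpM2r Q0 h) _.
have [m1 m2] := mix_le r A0 B0.
have p0 : 0 <= A ^+ r by rewrite exprn_ge0.
have q0 : 0 <= B ^+ r by rewrite exprn_ge0.
have n0 : 0 <= r.+1%:R :> R by [].
move: m1 m2; rewrite ![_ ^+ r.+1]exprS ![_ ^+ r.+2]exprS ![_ ^+ r.+1]exprS -natr1 expr2.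
set n := r.+1%:R in n0 *.
move: (A ^+ r) (B ^+ r) p0 q0 => a b a0 b0 m1 m2; clear h IH.
set X := A * a * B + B * (B * b).
have X1 : A * a * B <= X by rewrite /X lerDl mulr_ge0// mulr_ge0.
have X2 : B * (B * b) <= X by rewrite /X lerDr !mulr_ge0.
have e1 : 4 * n * (a * s ^+ 2) <= 4 * n * (A * a * B).
  rewrite ler_wpM2l ?mulr_ge0//; have := ler_wpM2l a0 sAB; lra.
have e2 : C * (2 * s * (a * B + B * b)) <= C * ((A + B) * (a * B + B * b)).
  by rewrite ler_wpM2l// ler_wpM2r ?addr_ge0 ?mulr_ge0//; case: s2.
have e3 : n * (a * (2 * s) * B) <= n * (a * (A + B) * B).
  by rewrite ler_wpM2l// ler_wpM2r// ler_wpM2l//; case: s2.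
have e4 := ler_wpM2l C0 m1.
have e5 := ler_wpM2l C0 m2.
have e6 := ler_wpM2l n0 m2.
have e7 := ler_wpM2l C0 X1.
have e8 := ler_wpM2l C0 X2.
have e9 := ler_wpM2l n0 X1.
rewrite expr2 in e1 *.
clear -e1 e2 e3 e4 e5 e6 e7 e8 e9 X1 X2; rewrite /X in e4 e5 e6 e7 e8 e9 X1 X2 *.
lra.
Qed.

Definition expand_const r : R := sval (cid (power_expand r)).

Lemma expand_constP r : 0 <= expand_const r /\ forall A B s, 0 <= A -> 0 <= B -> s ^+ 2 <= A * B ->
  (A + 2 * s + B) ^+ r.+1 <=
    A ^+ r.+1 + 2 * r.+1%:R * (A ^+ r * s) + expand_const r * (A ^+ r * B + B ^+ r.+1).
Proof. by rewrite /expand_const; case: cid. Qed.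

(* In dimension [n] the noise of the two copies has [2 n] Gaussian coordinates per step. *)
Definition gap_slope (n r : nat) : R := expand_const r * (2 * ((2 * n)%:R * noise_const 1)).

(** The factor [2 ^+ r.+1] comes from [|u - v|^2 <= 2 (|u|^2 + |v|^2)], the power of [(2 * n)%:R]
    from [sum_power_le], and then there is one Gaussian moment per coordinate. *)
Definition gap_const (n r : nat) : R :=
  expand_const r * (2 ^+ r.+1 * ((2 * n)%:R ^+ r.+1 * ((2 * n)%:R * noise_const r.+1))).

Lemma gap_slope_ge0 n r : 0 <= gap_slope n r.
Proof. by have [h _] := expand_constP r; rewrite /gap_slope !mulr_ge0 ?noise_const_ge0. Qed.

Lemma gap_const_ge0 n r : 0 <= gap_const n r.
Proof.
have [h _] := expand_constP r.
by rewrite /gap_const !mulr_ge0 ?exprn_ge0 ?noise_const_ge0.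
Qed.

Lemma young_power r (th A : R) : 0 < th -> 0 <= A -> A ^+ r <= th * A ^+ r.+1 + th^-1 ^+ r.
Proof.
move=> t0 A0; have ti : 0 <= th^-1 by rewrite invr_ge0 ltW.
have [h|/ltW h] := leP A th^-1.
  by rewrite ler_wpDl ?mulr_ge0 ?exprn_ge0 ?(ltW t0)// lerXn2r.
rewrite ler_wpDr ?exprn_ge0// exprS mulrA ler_peMl ?exprn_ge0//.
by rewrite -ler_pdivrMl// mulr1.
Qed.

Lemma sum_power_le (J : finType) (a : J -> R) q : (forall j, 0 <= a j) ->
  (\sum_j a j) ^+ q.+1 <= #|J|%:R ^+ q.+1 * \sum_j a j ^+ q.+1.
Proof.
move=> a0; case: (pickP (@predT J)) => [j0 _|J0]; last first.
  by rewrite !big_pred0// expr0n mulr0.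
case: (@Order.TotalTheory.arg_maxP _ _ _ j0 predT a) => // j _ hj.
have h : \sum_i a i <= #|J|%:R * a j.
  by rewrite mulr_natl -sumr_const; apply: ler_sum => i _; exact: hj.
apply: (@le_trans _ _ ((#|J|%:R * a j) ^+ q.+1)).
  by rewrite lerXn2r ?nnegrE ?mulr_ge0// sumr_ge0.
rewrite exprMn ler_wpM2l ?exprn_ge0// (bigD1 j)//= lerDl.
by apply: sumr_ge0 => i _; rewrite exprn_ge0.
Qed.

End PowerInequalities.

Lemma dot_sqrD {R : realType} {I : finType} (x y : I -> R) :
  dot (x \+ y) (x \+ y) = dot x x + 2 * dot x y + dot y y.
Proof. by rewrite dotDl !dotDr (dotC y x); ring. Qed.

(* The interaction kernel sees only differences of positions, so moments of the difference
   of two independent copies suffice; the noise adds to them while the drift contracts. *)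
Section CopiesGap.
Context {R : realType} {I : finType} {d : measure_display} {T : measurableType d}
  {P : probability T R} {x : T -> I -> R} {w : T -> R -> I -> R}.
Context {b : R -> (I -> R) -> I -> R} {kappa : R}.
Hypotheses (dr : driven P x w) (ok : drift_ok b kappa).
Implicit Types (h : R) (k : nat) (i : I) (c : 'I_2).

Local Notation P2 := (tensor_power P 2).
Local Notation J := ('I_2 * I)%type.

Definition copy_splitting h k c (o : 2.-tuple T) : I -> R :=
  splitting b h (incr (w (tnth o c)) (x (tnth o c)) h) k.

Definition gap h k (o : 2.-tuple T) : I -> R :=
  copy_splitting h k ord0 o \- copy_splitting h k ord_max o.

Definition gap_flow h k (o : 2.-tuple T) : I -> R :=
  flow b (k%:R * h) h (copy_splitting h k ord0 o) \- flow b (k%:R * h) h (copy_splitting h k ord_max o).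

Definition copy_incr h k (o : 2.-tuple T) (j : J) : R :=
  incr (w (tnth o j.1)) (x (tnth o j.1)) h k j.2.

Lemma gapS h k o : gap h k.+1 o =
  gap_flow h k o \+ (fun i => copy_incr h k.+1 o (ord0, i) - copy_incr h k.+1 o (ord_max, i)).
Proof. by apply/funext => i; rewrite /gap /gap_flow /copy_splitting /copy_incr /=; ring. Qed.

(** Uses [expR (- 2 y) <= 1 - y] for [0 <= 2 y <= 1]; a contraction factor affine in [h] is easily
    compared with noise terms of order [h]. *)
Lemma gap_flow_le h k o : 0 <= h -> 2 * kappa * h <= 1 ->
  dot (gap_flow h k o) (gap_flow h k o) <= (1 - kappa * h) * dot (gap h k o) (gap h k o).
Proof.
move=> h0 kh; have k0 := drift_gt0 ok.
have c := flow_contract (k%:R * h) (copy_splitting h k ord0 o) (copy_splitting h k ord_max o) ok h0.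
rewrite -!n2_sqr; apply: (@le_trans _ _ ((expR (- kappa * h) * n2 (gap h k o)) ^+ 2)).
  by rewrite lerXn2r ?nnegrE ?n2_ge0// mulr_ge0 ?n2_ge0// expR_ge0.
rewrite exprMn ler_wpM2r ?sqr_ge0// -expRM_natl.
have -> : 2 * (- kappa * h) = - (2 * (kappa * h)) by ring.
rewrite expRN; set y := kappa * h; have y0 : 0 <= y by rewrite mulr_ge0// ltW.
have y1 : 2 * y <= 1 by rewrite mulrA.
rewrite -[leLHS]mul1r ler_pdivrMr ?expR_gt0//.
apply: (@le_trans _ _ ((1 - y) * (1 + 2 * y))); first by nra.
by rewrite ler_wpM2l ?expR_ge1Dx//; lra.
Qed.

Let dr2 := driven_tensor 2 dr.

Local Notation X2 := (fun (o : 2.-tuple T) (p : J) => x (tnth o p.1) p.2).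
Local Notation W2 := (fun (o : 2.-tuple T) (s : R) (p : J) => w (tnth o p.1) s p.2).

Definition past_seq k (y : 'I_k.+1 * J -> R) c : nat -> I -> R :=
  fun k' i => if (k' <= k)%N then y (inord k', (c, i)) else 0.

(** [gap_flow] as a function of the past alone: one more step of the scheme, whose increment
    [past_seq] sets to zero. *)
Definition past_flow h k (y : 'I_k.+1 * J -> R) : I -> R :=
  splitting b h (past_seq y ord0) k.+1 \- splitting b h (past_seq y ord_max) k.+1.

Lemma past_flowE h k o : past_flow h (@past R J _ _ X2 W2 h k o) = gap_flow h k o.
Proof.
have E c : splitting b h (past_seq (@past R J _ _ X2 W2 h k o) c) k.+1 =
  flow b (k%:R * h) h (copy_splitting h k c o).
  rewrite /copy_splitting /=; apply/funext => i /=; rewrite {2}/past_seq ltnn addr0.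
  congr (flow _ _ _ _ i); apply: splitting_ext => k' kk; apply/funext => i'.
  by rewrite /past_seq kk /past /= inordK// /incr; case: k' kk.
by rewrite /past_flow !E.
Qed.

Lemma measurable_past_flow h k i : 0 <= h ->
  measurable_fun setT (fun y : cyl R ('I_k.+1 * J)%type => past_flow h y i).
Proof.
move=> h0.
have m c : measurable_fun setT (fun y : cyl R ('I_k.+1 * J)%type => splitting b h (past_seq y c) k.+1 i).
  have mF k' i' : measurable_fun setT (fun y : cyl R ('I_k.+1 * J)%type => past_seq y c k' i').
    by rewrite /past_seq; case: (k' <= k)%N => //; exact: measurable_coord.
  exact: (measurable_splitting ok h0 mF k.+1 i).
exact: measurable_funB.
Qed.

Lemma noise_L1_id h : 0 < h -> L1 (noise h) (fun r => r).
Proof.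
move=> h0; have [l2 _] := noise_moment 1 h0.
apply: (@L1_dom _ _ R (noise h) _ (fun r => 1 + r ^+ (2 * 1))).
- exact: measurable_id.
- move=> r; rewrite muln1; have := sqr_ge0 (`|r| - 1); have := sqr_ge0 r.
  have := real_normK (num_real r); nra.
- by apply: L1D => //; exact: L1_cst.
Qed.

Lemma measurable_gap h k i : 0 <= h -> measurable_fun setT (fun o => gap h k o i).
Proof.
move=> h0; have m c : measurable_fun setT (fun o => copy_splitting h k c o i).
  apply: (measurable_splitting ok h0) => k' i'.
  case: k' => [|k'] /=; first exact: (driven_x dr2 (c, i')).
  by apply: measurable_funB; exact: (driven_w dr2 _ (c, i')).
exact: measurable_funB.
Qed.

(** A discrete Ito formula. In the expansion of the power, the term of order one in the noise has
    zero expectation, the increment being independent of the past; the others are of order [h],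
    using [h <= 1] for the higher powers of [h]. *)
Lemma gap_step r h k : 0 < h -> h <= 1 -> 2 * kappa * h <= 1 ->
  L1 P2 (fun o => dot (gap h k o) (gap h k o) ^+ r.+1) ->
  [/\ L1 P2 (fun o => dot (gap_flow h k o) (gap_flow h k o) ^+ r.+1),
    L1 P2 (fun o => dot (gap_flow h k o) (gap_flow h k o) ^+ r),
    L1 P2 (fun o => dot (gap h k.+1 o) (gap h k.+1 o) ^+ r.+1) &
  expect P2 (fun o => dot (gap h k.+1 o) (gap h k.+1 o) ^+ r.+1) <=
  expect P2 (fun o => dot (gap_flow h k o) (gap_flow h k o) ^+ r.+1)
  + gap_slope #|I| r * h * expect P2 (fun o => dot (gap_flow h k o) (gap_flow h k o) ^+ r)
  + gap_const #|I| r * h].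
Proof.
move=> h0 h1 kh lk; have hh := ltW h0; have [C00 HC] := @expand_constP R r.
pose n : R := #|{: J}|%:R; set C0 := expand_const r in C00 HC.
pose Psi := gap_flow h k; pose A o := dot (Psi o) (Psi o).
pose e (j : J) o := copy_incr h k.+1 o j.
have PsiE o i : Psi o i = past_flow h (@past R J _ _ X2 W2 h k o) i by rewrite past_flowE.
have mPsi i : measurable_fun setT (fun y : cyl R ('I_k.+1 * J)%type => past_flow h y i).
  exact: measurable_past_flow.
have A0 o : 0 <= A o by exact: dot_ge0.
pose Ay (y : cyl R ('I_k.+1 * J)%type) := dot (past_flow h y) (past_flow h y).
have mAy : measurable_fun setT Ay.
  by apply: measurable_sum => i; apply: measurable_funM; exact: mPsi.
have AE o : A o = Ay (@past R J _ _ X2 W2 h k o) by rewrite /Ay past_flowE.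
have mA : measurable_fun setT A.
  under [X in measurable_fun _ X]funext do rewrite AE.
  apply: (measurableT_comp mAy); apply: measurable_to_cyl => p.
  exact: (measurable_past dr2 h (k := k) p).
have lA : L1 P2 (fun o => A o ^+ r.+1).
  apply: (L1_ge0_dom _ _ lk); first exact: measurable_funX.
  move=> o; rewrite exprn_ge0//= lerXn2r ?nnegrE ?dot_ge0//.
  apply: le_trans (gap_flow_le k o hh kh) _; rewrite ler_piMl ?dot_ge0//.
  by rewrite gerBl mulr_ge0 ?(ltW (drift_gt0 ok)).
have lAr : L1 P2 (fun o => A o ^+ r).
  apply: (L1_ge0_dom (g := fun o => A o ^+ r.+1 + 1)); first exact: measurable_funX.
    by move=> o; rewrite exprn_ge0//=; have := @young_power R r 1 (A o) ltr01 (A0 o); rewrite mul1r invr1 expr1n.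
  by apply: L1D => //; exact: L1_cst.
have lAP i : L1 P2 (fun o => A o ^+ r * Psi o i).
  apply: (L1_dom (g := fun o => A o ^+ r + A o ^+ r.+1)) (L1D lAr lA).
    apply: measurable_funM; first exact: measurable_funX.
    under [X in measurable_fun _ X]funext do rewrite PsiE.
    apply: (measurableT_comp (mPsi i)); apply: measurable_to_cyl => p.
    exact: (measurable_past dr2 h (k := k) p).
  move=> o; rewrite normrM ger0_norm ?exprn_ge0// exprSr -[X in X + _]mulr1 -mulrDr.
  rewrite ler_wpM2l ?exprn_ge0//.
  have := coord_le_n2 (Psi o) i; have := n2_sqr (Psi o); have := n2_ge0 (Psi o).
  rewrite -/(A o); move: (n2 _) `|_| => u v u0 <- vu; have := sqr_ge0 (u - 1); nra.
have ind1 (G : cyl R ('I_k.+1 * J)%type -> R) (F : 2.-tuple T -> R) phi j :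
    (forall o, F o = G (@past R J _ _ X2 W2 h k o)) -> measurable_fun setT G -> L1 P2 F ->
    L1 (noise h) phi -> L1 P2 (fun o => F o * phi (e j o)) /\
      expect P2 (fun o => F o * phi (e j o)) = expect P2 F * expect (noise h) phi.
  move=> FG mG lF lphi.
  have EF : F = fun o => G (@past R J _ _ X2 W2 h k o) by apply/funext.
  rewrite EF in lF *.
  exact: (@past_noise_indep _ _ _ _ _ _ _ dr2 h k j h0 G phi mG lF lphi).
pose s o := \sum_i Psi o i * (e (ord0, i) o - e (ord_max, i) o).
(* The term of order one, coordinate by coordinate. Its expectation vanishes because the increments
   of the two copies have the same mean. *)
pose Ss o := \sum_i (A o ^+ r * Psi o i * e (ord0, i) o - A o ^+ r * Psi o i * e (ord_max, i) o).
have mG1 i : measurable_fun setT (fun y => Ay y ^+ r * past_flow h y i).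
  by apply: measurable_funM => //; exact: measurable_funX.
have eq1 i o : A o ^+ r * Psi o i = Ay (@past R J _ _ X2 W2 h k o) ^+ r * past_flow h (@past R J _ _ X2 W2 h k o) i.
  by rewrite AE PsiE.
have ic i j := ind1 (fun y => Ay y ^+ r * past_flow h y i) (fun o => A o ^+ r * Psi o i) id j (eq1 i) (mG1 i) (lAP i) (noise_L1_id h0).
have lS : L1 P2 Ss.
  by apply: L1_sum => i; apply: L1B; [have [] := ic i (ord0, i)|have [] := ic i (ord_max, i)].
have eS : expect P2 Ss = 0.
  rewrite /Ss expect_sum; last by move=> i; apply: L1B; [have [] := ic i (ord0, i)|have [] := ic i (ord_max, i)].
  apply: big1 => i _; have [l1 e1] := ic i (ord0, i); have [l2 e2] := ic i (ord_max, i).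
  by rewrite expectB// e1 e2 subrr.
have [ln1 en1] := noise_moment 1 h0; have [lnq enq] := noise_moment r.+1 h0.
have lAe j : L1 P2 (fun o => A o ^+ r * e j o ^+ 2) /\
    expect P2 (fun o => A o ^+ r * e j o ^+ 2) <= expect P2 (fun o => A o ^+ r) * (noise_const 1 * h).
  have mG : measurable_fun setT (fun y => Ay y ^+ r) by exact: measurable_funX.
  have eq2 o : A o ^+ r = Ay (@past R J _ _ X2 W2 h k o) ^+ r by rewrite AE.
  have [l1 e1] := ind1 (fun y => Ay y ^+ r) (fun o => A o ^+ r) _ j eq2 mG lAr ln1.
  split; first exact: l1.
  by rewrite e1 ler_wpM2l//; apply: expect_ge0 => o; rewrite exprn_ge0.
have leq j : L1 P2 (fun o => e j o ^+ (2 * r.+1)) /\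
    expect P2 (fun o => e j o ^+ (2 * r.+1)) <= noise_const r.+1 * h.
  have [l1 e1] := ind1 (fun=> 1) (fun=> 1) _ j (fun o => erefl) (measurable_cst _) (L1_cst _ _) lnq.
  have E : (fun o => 1 * e j o ^+ (2 * r.+1)) = (fun o => e j o ^+ (2 * r.+1)).
    by apply/funext => o; rewrite mul1r.
  split; first by rewrite -E.
  rewrite -E e1 expect_cst mul1r; apply: le_trans enq _.
  rewrite ler_wpM2l ?noise_const_ge0// exprS ler_piMr ?(ltW h0)// exprn_ile1//.
(* The right-hand side of [expand_constP] with the squared increment bounded coordinatewise: each
   summand is a function of the past times a power of one increment. *)
pose U o := A o ^+ r.+1 + 2 * r.+1%:R * Ss o +
  C0 * (2 * \sum_j A o ^+ r * e j o ^+ 2 + 2 ^+ r.+1 * (n ^+ r.+1 * \sum_j e j o ^+ (2 * r.+1))).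
have lU1 : L1 P2 (fun o => 2 * \sum_j A o ^+ r * e j o ^+ 2).
  by apply: L1Z; apply: L1_sum => j; have [] := lAe j.
have lU2 : L1 P2 (fun o => 2 ^+ r.+1 * (n ^+ r.+1 * \sum_j e j o ^+ (2 * r.+1))).
  by apply: L1Z; apply: L1Z; apply: L1_sum => j; have [] := leq j.
have lU : L1 P2 U.
  by apply: L1D; [apply: L1D => //; exact: L1Z|apply: L1Z; exact: L1D].
have gU o : dot (gap h k.+1 o) (gap h k.+1 o) ^+ r.+1 <= U o.
  pose g i := copy_incr h k.+1 o (ord0, i) - copy_incr h k.+1 o (ord_max, i).
  have -> : gap h k.+1 o = Psi o \+ g by rewrite gapS.
  have -> : dot (Psi o \+ g) (Psi o \+ g) = A o + 2 * dot (Psi o) g + dot g g.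
    exact: dot_sqrD.
  apply: le_trans (HC _ _ _ (A0 o) (dot_ge0 g) (dot_CS _ _)) _.
  have gB : dot g g <= 2 * \sum_j e j o ^+ 2.
    rewrite /dot -(pair_bigA _ (fun c i => e (c, i) o ^+ 2)) /= big_ord_recr big_ord1 /=.
    have -> : widen_ord (leqnSn 1) ord0 = ord0 :> 'I_2 by apply/val_inj.
    rewrite -big_split mulr_sumr; apply: ler_sum => i _ /=.
    rewrite /g -/(e (ord0, i) o) -/(e (ord_max, i) o).
    have := sqr_ge0 (e (ord0, i) o + e (ord_max, i) o).
    move: (e (ord0, i) o) (e (ord_max, i) o) => u v; nra.
  have g0 := dot_ge0 g; have C0A : 0 <= A o ^+ r by rewrite exprn_ge0.
  apply: lerD; [apply: lerD => //|].
    rewrite le_eqVlt; apply/orP; left; apply/eqP; congr (_ * _).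
    by rewrite /Ss /dot mulr_sumr; apply: eq_bigr => i _; rewrite /g /e /=; ring.
  rewrite ler_wpM2l//; apply: lerD.
    by rewrite -mulr_sumr mulrCA ler_wpM2l.
  apply: (@le_trans _ _ ((2 * \sum_j e j o ^+ 2) ^+ r.+1)).
    by rewrite lerXn2r ?nnegrE// mulr_ge0// sumr_ge0// => j _; rewrite sqr_ge0.
  rewrite exprMn ler_wpM2l ?exprn_ge0//.
  apply: le_trans (sum_power_le _ _) _; first by move=> j; rewrite sqr_ge0.
  by under eq_bigr do rewrite -exprM.
have mg : measurable_fun setT (fun o => dot (gap h k.+1 o) (gap h k.+1 o)).
  by apply: measurable_sum => i; apply: measurable_funM; exact: measurable_gap.
have lg : L1 P2 (fun o => dot (gap h k.+1 o) (gap h k.+1 o) ^+ r.+1).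
  apply: L1_ge0_dom lU; first exact: measurable_funX.
  by move=> o; rewrite exprn_ge0 ?dot_ge0//=.
split=> //; apply: le_trans (expect_le lg lU gU) _.
rewrite /U expectD; [|by apply: L1D => //; exact: L1Z|by apply: L1Z; exact: L1D].
rewrite expectD//; last exact: L1Z.
rewrite expectZ// eS mulr0 addr0 -addrA lerD2l expectZ; last exact: L1D.
rewrite expectD// expectZ; last by apply: L1_sum => j; have [] := lAe j.
rewrite expect_sum; last by move=> j; have [] := lAe j.
rewrite expectZ; last by apply: L1Z; apply: L1_sum => j; have [] := leq j.
rewrite expectZ; last by apply: L1_sum => j; have [] := leq j.
rewrite expect_sum; last by move=> j; have [] := leq j.
have nE : n = (2 * #|I|)%:R by rewrite /n card_prod card_ord.
have s1 : \sum_j expect P2 (fun o => A o ^+ r * e j o ^+ 2) <=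
    n * (expect P2 (fun o => A o ^+ r) * (noise_const 1 * h)).
  by rewrite mulr_natl -sumr_const; apply: ler_sum => j _; have [] := lAe j.
have s2 : \sum_j expect P2 (fun o => e j o ^+ (2 * r.+1)) <= n * (noise_const r.+1 * h).
  by rewrite mulr_natl -sumr_const; apply: ler_sum => j _; have [] := leq j.
rewrite /gap_slope /gap_const -nE -/C0 mulrDr; apply: lerD.
  have := ler_wpM2l (mulr_ge0 C00 (ler0n R 2)) s1; lra.
have := ler_wpM2l (mulr_ge0 C00 (mulr_ge0 (exprn_ge0 r.+1 (ler0n R 2)) (exprn_ge0 r.+1 (ler0n R #|{: J}|)))) s2.
rewrite -/n; lra.
Qed.

End CopiesGap.

Lemma expect_fatou {d : measure_display} {T : measurableType d} {R : realType} (P : probability T R)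
    (f_ : nat -> T -> R) (f : T -> R) (K : R) :
  (forall n, L1 P (f_ n)) -> (forall n x, 0 <= f_ n x) -> (forall n, expect P (f_ n) <= K) ->
  (forall x, f_ ^~ x @ \oo --> f x) -> L1 P f /\ expect P f <= K.
Proof.
move=> lf f0 fK ff.
have mf : measurable_fun setT f.
  by apply: (@measurable_fun_cvg _ _ _ _ f_) => [n|x _]; [exact: L1_meas|exact: ff].
have fp x : 0 <= f x.
  rewrite -(cvg_lim _ (ff x))//; apply: limr_ge; first by apply/cvg_ex; exists (f x); exact: ff.
  by apply: nearW => n; exact: f0.
apply: L1_of_bound => //.
have := @fatou _ _ _ P setT measurableT (fun n x => (f_ n x)%:E) _ _.
have h1 n : measurable_fun setT (fun x => (f_ n x)%:E) by apply/measurable_EFinP; exact: L1_meas.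
have h2 n x : setT x -> (0 <= (f_ n x)%:E)%E by move=> _; rewrite lee_fin.
move=> /(_ h1 h2); rewrite (eq_integral (fun x => (f x)%:E)); last first.
  move=> x _; have /cvg_limn_einf_sup [-> _] : (fun n => (f_ n x)%:E) @ \oo --> (f x)%:E => //.
  by apply: cvg_EFin; [exact: nearW|exact: ff].
move/le_trans; apply; rewrite limn_einf_lim; apply: lime_le; first exact: is_cvg_einfs.
apply: nearW => n; have En : (\int[P]_x (f_ n x)%:E <= K%:E)%E by rewrite expectE// lee_fin.
by apply: le_trans En; apply: ereal_inf_lbound; exists n => //=.
Qed.

Lemma cvg_big_sum {R : realType} (I : Type) (r : seq I) (u : I -> nat -> R) (l : I -> R) :
  (forall i, u i @ \oo --> l i) ->
  (fun n => \sum_(i <- r) u i n) @ \oo --> \sum_(i <- r) l i.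
Proof.
move=> ul; elim: r => [|i r IH].
  by rewrite big_nil; under [X in X @ _]funext do rewrite big_nil; exact: cvg_cst.
by rewrite big_cons; under [X in X @ _]funext do rewrite big_cons; exact: cvgD.
Qed.

Section GapMoments.
Context {R : realType} {I : finType} {d : measure_display} {T : measurableType d}
  {P : probability T R} {x : T -> I -> R} {w : T -> R -> I -> R}.
Context {b : R -> (I -> R) -> I -> R} {kappa : R}.
Hypotheses (dr : driven P x w) (ok : drift_ok b kappa).
Implicit Types (h : R) (k : nat) (i : I) (c : 'I_2).

Local Notation P2 := (tensor_power P 2).
Local Notation gap := (@gap R I _ T x w b).
Local Notation gflow := (@gap_flow R I _ T x w b).

(** With [th = kap / 2 / (1 + a)] the noise term uses at most half of the contraction. What remains
    is the fixed point of [v |-> (1 - kap / 2 * h) * v + h * (a * th^-1 ^+ r + gap_const n r)],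
    which does not depend on the step [h]. *)
Definition gap_growth (n r : nat) (kap : R) : R :=
  let a := gap_slope n r in
  2 * (a * ((kap / 2 / (1 + a))^-1) ^+ r + gap_const n r) / kap.

Lemma gap_growth_ge0 n r (kap : R) : 0 < kap -> 0 <= gap_growth n r kap.
Proof.
move=> k0; have a0 := @gap_slope_ge0 R n r; have c0 := @gap_const_ge0 R n r.
rewrite /gap_growth divr_ge0 ?(ltW k0)// mulr_ge0// addr_ge0// mulr_ge0// exprn_ge0// invr_ge0.
by rewrite divr_ge0 ?addr_ge0// divr_ge0// ltW.
Qed.

Lemma gap_moment r h k : 0 < h -> h <= 1 -> 2 * kappa * h <= 1 ->
  L1 P2 (fun o => dot (gap h 0 o) (gap h 0 o) ^+ r.+1) ->
  L1 P2 (fun o => dot (gap h k o) (gap h k o) ^+ r.+1) /\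
  expect P2 (fun o => dot (gap h k o) (gap h k o) ^+ r.+1) <=
  expect P2 (fun o => dot (gap h 0 o) (gap h 0 o) ^+ r.+1) + gap_growth #|I| r kappa.
Proof.
move=> h0 h1 kh l0; have k0 := drift_gt0 ok.
have G0 := @gap_growth_ge0 #|I| r _ k0.
elim: k => [|k [lk IH]]; first by split=> //; rewrite lerDl.
have [lf lfr lS le] := gap_step dr ok h0 h1 kh lk; split=> //.
apply: le_trans le _.
set uk := expect _ _ in IH.
pose u0 := expect P2 (fun o => dot (gap h 0 o) (gap h 0 o) ^+ r.+1); rewrite -/u0 in IH *.
set K := u0 + _ in IH *.
have a0 := @gap_slope_ge0 R #|I| r; set a := gap_slope #|I| r in a0 *.
set C := gap_const #|I| r.
pose th := kappa / 2 / (1 + a).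
have th0 : 0 < th by rewrite divr_gt0 ?divr_gt0// ltr_pwDl.
have kh1 : 0 <= kappa * h <= 1.
  by rewrite mulr_ge0 ?ltW//=; have := mulr_gt0 k0 h0; lra.
have /andP[kh0 kh2] := kh1.
have f1 : expect P2 (fun o => dot (gflow h k o) (gflow h k o) ^+ r.+1) <= (1 - kappa * h) * uk.
  rewrite /uk -(expectZ (1 - kappa * h) lk).
  apply: (expect_le lf (L1Z _ lk)).
  move=> o; have g := gap_flow_le (x := x) (w := w) ok k o (ltW h0) kh.
  apply: (@le_trans _ _ (((1 - kappa * h) * dot (gap h k o) (gap h k o)) ^+ r.+1)).
    by rewrite lerXn2r ?nnegrE ?dot_ge0// mulr_ge0 ?dot_ge0// subr_ge0.
  rewrite exprMn ler_wpM2r ?exprn_ge0 ?dot_ge0// exprS ler_piMr ?subr_ge0//.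
  by rewrite exprn_ile1 ?subr_ge0// gerBl.
have f2 : expect P2 (fun o => dot (gflow h k o) (gflow h k o) ^+ r) <= th * uk + th^-1 ^+ r.
  rewrite /uk -expectZ// -[X in _ + X](expect_cst P2) -expectD//; [|exact: L1Z|exact: L1_cst].
  apply: expect_le => //; first by apply: L1D; [exact: L1Z|exact: L1_cst].
  move=> o; have g := gap_flow_le (x := x) (w := w) ok k o (ltW h0) kh.
  apply: le_trans (young_power r th0 (dot_ge0 _)) _; rewrite lerD2r ler_wpM2l ?(ltW th0)//.
  rewrite lerXn2r ?nnegrE ?dot_ge0//; apply: le_trans g _.
  by rewrite ler_piMl ?dot_ge0// gerBl.
have uk0 : 0 <= uk by apply: expect_ge0 => o; rewrite exprn_ge0// dot_ge0.
have u00 : 0 <= u0 by apply: expect_ge0 => o; rewrite exprn_ge0// dot_ge0.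
have ath : a * th <= kappa / 2.
  rewrite /th mulrA ler_pdivrMr ?ltr_pwDl//.
  have : 0 < kappa / 2 by rewrite divr_gt0.
  move: (kappa / 2) => y y0; nra.
have ah : 0 <= a * h by rewrite mulr_ge0// ltW.
have f3 := ler_wpM2l ah f2.
have EG : gap_growth #|I| r kappa * kappa = 2 * (a * th^-1 ^+ r + C).
  by rewrite /gap_growth -/a -/C -/th divfK// gt_eqF.
set X := th^-1 ^+ r in f3 EG *.
have f4 : a * h * (th * uk) <= kappa / 2 * h * uk.
  have := ler_wpM2r (mulr_ge0 (ltW h0) uk0) ath; lra.
have f5 : (1 - kappa / 2 * h) * uk <= (1 - kappa / 2 * h) * K.
  by rewrite ler_wpM2l// subr_ge0; lra.
have f6 : gap_growth #|I| r kappa * kappa * h <= K * kappa * h.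
  by rewrite ler_wpM2r ?(ltW h0)// ler_wpM2r ?(ltW k0)// /K lerDr.
rewrite EG in f6.
lra.
Qed.

(** The bound for the scheme is uniform in the step and in the number of steps, so Fatou's lemma
    along the steps [t / n.+1%:R] passes it on to the solution. The conditions on the step hold from
    some rank on, whence the shift. *)
Lemma gap_solution r t (z : T -> R -> I -> R) : 0 <= t ->
  (forall o, is_sol t b (x o) (w o) (z o)) ->
  let D0 o := x (tnth o ord0) \- x (tnth o ord_max) in
  let D o := z (tnth o ord0) t \- z (tnth o ord_max) t in
  L1 P2 (fun o => dot (D0 o) (D0 o) ^+ r.+1) ->
  L1 P2 (fun o => dot (D o) (D o) ^+ r.+1) /\
  expect P2 (fun o => dot (D o) (D o) ^+ r.+1) <=
  expect P2 (fun o => dot (D0 o) (D0 o) ^+ r.+1) + gap_growth #|I| r kappa.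
Proof.
move=> t0 hz D0 D l0; have k0 := drift_gt0 ok.
have G0 := @gap_growth_ge0 #|I| r _ k0.
have [t_eq|tn0] := eqVneq t 0.
  have E : D = D0.
    apply/funext => o; rewrite /D t_eq.
    by rewrite !(sol_at0 dr (b := b) (z := z))// => o'; rewrite -t_eq.
  by rewrite E; split=> //; rewrite lerDl.
have tp : 0 < t by rewrite lt_neqAle eq_sym tn0.
pose hn n : R := t / n.+1%:R.
have hp n : 0 < hn n by rewrite divr_gt0.
have : \forall n \near \oo, hn n <= 1 /\ 2 * kappa * hn n <= 1.
  near=> n; have : t + 2 * kappa * t <= n%:R by near: n; exact: nbhs_infty_ger.
  have : n%:R <= n.+1%:R :> R by rewrite ler_nat.
  have kt : 0 < kappa * t by exact: mulr_gt0.
  move=> h1 h2; rewrite /hn; split; first by rewrite ler_pdivrMr// mul1r; lra.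
  by rewrite mulrA ler_pdivrMr// mul1r; lra.
move=> [N _ hN].
apply: (@expect_fatou _ _ _ _ (fun n o => dot (gap (hn (n + N)%N) (n + N).+1 o) (gap (hn (n + N)%N) (n + N).+1 o) ^+ r.+1)).
- move=> n; have [a1 a2] := hN (n + N)%N (leq_addl _ _).
  by have [] := @gap_moment r (hn (n + N)%N) (n + N).+1 (hp _) a1 a2 l0.
- by move=> n o; rewrite exprn_ge0// dot_ge0.
- move=> n; have [a1 a2] := hN (n + N)%N (leq_addl _ _).
  by have [] := @gap_moment r (hn (n + N)%N) (n + N).+1 (hp _) a1 a2 l0.
move=> o.
have c i : (fun n => gap (hn n) n.+1 o i) @ \oo --> D o i.
  have c1 := splitting_cvg (i := i) ok (driven_cont dr (tnth o ord0)) tp (driven_0 dr _) (hz (tnth o ord0)).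
  have c2 := splitting_cvg (i := i) ok (driven_cont dr (tnth o ord_max)) tp (driven_0 dr _) (hz (tnth o ord_max)).
  exact: cvgB c1 c2.
have cd : (fun n => dot (gap (hn n) n.+1 o) (gap (hn n) n.+1 o)) @ \oo --> dot (D o) (D o).
  by apply: cvg_big_sum => i; apply: cvgM; exact: c.
have cp : (fun n => dot (gap (hn n) n.+1 o) (gap (hn n) n.+1 o) ^+ r.+1) @ \oo --> dot (D o) (D o) ^+ r.+1.
  elim: r.+1 => [|r' IH]; first by rewrite expr0; under [X in X @ _]funext do rewrite expr0; exact: cvg_cst.
  by rewrite exprS; under [X in X @ _]funext do rewrite exprS; exact: cvgM.
by move: cp; rewrite -(cvg_shiftn N).
Unshelve. all: by end_near. Qed.

End GapMoments.

(** * Fluctuations of empirical averages *)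

Section JensenPower.
Context {R : realType}.

(** The convex function [x ^+ q.+1] lies above its tangent at [m]. *)
Lemma power_tangent q (x m : R) : 0 <= x -> 0 <= m -> q.+1%:R * m ^+ q * x <= x ^+ q.+1 + q%:R * m ^+ q.+1.
Proof.
move=> x0 m0; elim: q => [|q IH]; first by rewrite !expr0 !mul1r !expr1 mul0r addr0.
have h := ler_wpM2l x0 IH; have h2 := mulr_ge0 (mulr_ge0 (ler0n R q.+1) (exprn_ge0 q m0)) (sqr_ge0 (x - m)).
rewrite [x ^+ q.+2]exprS [m ^+ q.+2]exprS; rewrite [m ^+ q.+1]exprS in h *.
have E1 : q.+1%:R = q%:R + 1 :> R by rewrite natr1.
have E2 : q.+2%:R = q%:R + 1 + 1 :> R by rewrite -E1 natr1.
rewrite E2 E1; rewrite !E1 in h h2.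
move: (m ^+ q) (x ^+ q.+1) (q%:R : R) h h2 => a b n h h2; rewrite expr2 in h2; lra.
Qed.

Context {d : measure_display} {T : measurableType d} (P : probability T R).

(** Jensen's inequality: integrate the tangent taken at the mean of the absolute value. The tangent
    at one gives integrability. *)
Lemma expect_power q (X : T -> R) : measurable_fun setT X -> L1 P (fun o => `|X o| ^+ q.+1) ->
  L1 P X /\ `|expect P X| ^+ q.+1 <= expect P (fun o => `|X o| ^+ q.+1).
Proof.
move=> mX lq.
have mN : measurable_fun setT (fun o => `|X o|) by exact: measurableT_comp.
have lN : L1 P (fun o => `|X o|).
  apply: (L1_ge0_dom (g := fun o => `|X o| ^+ q.+1 + q%:R)) => //; last by apply: L1D => //; exact: L1_cst.
  move=> o; rewrite normr_ge0/=; have := @power_tangent q `|X o| 1 (normr_ge0 _) ler01.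
  rewrite !expr1n !mulr1 => h; apply: le_trans h; rewrite ler_peMl// ler1n//.
have lX : L1 P X by apply: L1_dom mX (fun o => lexx _) lN.
split=> //; set m := expect P (fun o => `|X o|).
have m0 : 0 <= m by exact: expect_ge0.
apply: (@le_trans _ _ (m ^+ q.+1)); first by rewrite lerXn2r ?nnegrE// expect_norm.
have : expect P (fun o => q.+1%:R * m ^+ q * `|X o|) <= expect P (fun o => `|X o| ^+ q.+1 + q%:R * m ^+ q.+1).
  apply: expect_le => [||o]; [exact: L1Z|by apply: L1D => //; exact: L1_cst|exact: power_tangent].
rewrite expectZ// expectD//; last exact: L1_cst.
by rewrite expect_cst -/m -mulrA -exprSr -natr1 mulrDl mul1r addrC lerD2r.
Qed.

End JensenPower.

(** * A Marcinkiewicz-Zygmund inequality *)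

Section MarcinkiewiczZygmund.
Context {R : realType} {d : measure_display} {T : measurableType d} (P : probability T R).

Lemma tensor_powerS_expect n (f : n.+1.-tuple T -> R) : measurable_fun setT f ->
  (L1 (tensor_power P n.+1) f <->
    L1 [the probability _ _ of (P \x tensor_power P n)%E] (fun o => f (tuple_cons o))) /\
  expect (tensor_power P n.+1) f =
    expect [the probability _ _ of (P \x tensor_power P n)%E] (fun o => f (tuple_cons o)).
Proof.
move=> mf; have H (A : set (n.+1.-tuple T)) : measurable A ->
    [the probability _ _ of (P \x tensor_power P n)%E] (@tuple_cons _ _ n @^-1` A) = tensor_power P n.+1 A by [].
split; first exact: (law_L1 (@measurable_tuple_cons _ _ n) H mf).
exact: (law_expect (@measurable_tuple_cons _ _ n) H mf).
Qed.

Variables (Y : T -> R) (r : nat).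
Hypotheses (lY : L1 P Y) (Y0 : expect P Y = 0) (lYp : L1 P (fun o => Y o ^+ (2 * r.+1))).

Definition tsum n (o : n.-tuple T) : R := \sum_i Y (tnth o i).

Definition mz_const (s : nat) : R := 2 * expand_const s * expR (expand_const s).

Lemma measurable_tsum n : measurable_fun setT (@tsum n).
Proof.
by apply: measurable_sum => i; exact: (measurableT_comp (L1_meas lY) (measurable_tnth i)).
Qed.

Lemma young_split (N a b : R) : 0 < N -> 0 <= a -> 0 <= b ->
  a ^+ r * b <= a ^+ r.+1 / N + N ^+ r * b ^+ r.+1.
Proof.
move=> N0 a0 b0; have [h|/ltW h] := leP a (N * b).
  rewrite ler_wpDl ?divr_ge0 ?exprn_ge0 ?(ltW N0)// exprSr mulrA -exprMn ler_wpM2r//.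
  by rewrite lerXn2r ?nnegrE// mulr_ge0// ltW.
rewrite ler_wpDr ?mulr_ge0 ?exprn_ge0 ?(ltW N0)// exprSr -mulrA ler_wpM2l ?exprn_ge0//.
by rewrite ler_pdivlMr// mulrC.
Qed.

(** Variables are added one at a time, [N] being kept fixed. The term of order one vanishes by
    independence and centering, and [young_split] with weight [N] shows that each addition
    multiplies the moment by at most [1 + C / N], up to an additive term; over at most [N] additions
    the growth is a factor [expR C]. *)
Lemma marcinkiewicz_zygmund (N n : nat) : (0 < N)%N -> (n <= N)%N ->
  L1 (tensor_power P n) (fun o => tsum o ^+ (2 * r.+1)) /\
  expect (tensor_power P n) (fun o => tsum o ^+ (2 * r.+1)) <=
    2 * expand_const r * N%:R ^+ r * expect P (fun o => Y o ^+ (2 * r.+1)) * n%:R * expR (expand_const r * n%:R / N%:R).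
Proof.
move=> N0; have [C0 HC] := @expand_constP R r; set C := expand_const r in C0 HC *.
set m := expect P (fun o => Y o ^+ (2 * r.+1)).
have NR : 0 < N%:R :> R by rewrite ltr0n.
have m0 : 0 <= m by apply: expect_ge0 => o; rewrite exprM exprn_ge0// sqr_ge0.
elim: n => [|n IH] nN.
  have E : (fun o : 0.-tuple T => tsum o ^+ (2 * r.+1)) = fun=> 0.
    by apply/funext => o; rewrite /tsum big_ord0 expr0n.
  by rewrite E mulr0 mul0r expect_cst; split=> //; exact: L1_cst.
have [ln en] := IH (ltnW nN).
pose S (o : n.-tuple T) := tsum o.
have mS : measurable_fun setT S by exact: measurable_tsum.
have mf : measurable_fun setT (fun o : n.+1.-tuple T => tsum o ^+ (2 * r.+1)).
  by apply: measurable_funX; exact: measurable_tsum.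
have [l12 e12] := tensor_powerS_expect mf.
set PQ := [the probability _ _ of (P \x tensor_power P n)%E] in l12 e12.
have SE o : tsum (tuple_cons o) = Y o.1 + S o.2.
  rewrite /S /tsum big_ord_recl; congr (Y _ + _).
  by apply: eq_bigr => i _; congr (Y _); exact: (tnthS o.1 o.2).
have [lYQ eYQ] := prod_expect lYp (L1_cst (tensor_power P n) 1).
have [lSQ eSQ] := prod_expect (L1_cst P 1) ln.
have lSodd : L1 (tensor_power P n) (fun o => S o ^+ (2 * r).+1).
  apply: (L1_dom (g := fun o => S o ^+ (2 * r.+1) + 1)); first exact: measurable_funX.
    move=> o; rewrite normrX; have := @power_tangent R (2 * r).+1 `|S o| 1 (normr_ge0 _) ler01.
    have h : `|S o| ^+ (2 * r).+1 <= `|S o| ^+ (2 * r).+2 + 1.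
      have [h1|/ltW h1] := leP `|S o| 1.
        by rewrite ler_wpDl ?exprn_ge0// exprn_ile1.
      by rewrite ler_wpDr// ler_weXn2l.
    move=> _; apply: le_trans h _; rewrite mulnS add2n lerD2r -normrX ger0_norm//.
    by rewrite -[(2 * r).+2]add2n -mulnS exprM exprn_ge0// sqr_ge0.
  by apply: L1D => //; exact: L1_cst.
have [lX eX] := prod_expect lY lSodd.
pose U (o : T * n.-tuple T) := 1 * S o.2 ^+ (2 * r.+1) + 2 * r.+1%:R * (Y o.1 * S o.2 ^+ (2 * r).+1) +
  C * (1 * S o.2 ^+ (2 * r.+1) / N%:R + (N%:R ^+ r + 1) * (Y o.1 ^+ (2 * r.+1) * 1)).
have l3 : L1 PQ (fun o => 1 * S o.2 ^+ (2 * r.+1) / N%:R).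
  by under [X in L1 _ X]funext do rewrite mulrC; exact: L1Z.
have l4 : L1 PQ (fun o => (N%:R ^+ r + 1) * (Y o.1 ^+ (2 * r.+1) * 1)) by exact: L1Z.
have lU : L1 PQ U.
  by apply: L1D; [apply: L1D => //; exact: L1Z|apply: L1Z; exact: L1D].
have hU o : tsum (tuple_cons o) ^+ (2 * r.+1) <= U o.
  rewrite SE /U !mul1r mulr1 exprM; set y := Y o.1; set s := S o.2.
  have -> : (y + s) ^+ 2 = s ^+ 2 + 2 * (s * y) + y ^+ 2 by ring.
  apply: le_trans (HC _ _ (s * y) (sqr_ge0 s) (sqr_ge0 y) _) _; first by rewrite exprMn.
  rewrite -!exprM.
  have ys : s ^+ (2 * r) * (s * y) = y * s ^+ (2 * r).+1 by rewrite [s ^+ (2 * r).+1]exprS; ring.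
  rewrite ys lerD2l ler_wpM2l//.
  have := young_split NR (sqr_ge0 s) (sqr_ge0 y); rewrite -!exprM => h.
  rewrite mulrDl mul1r addrA lerD2r.
  exact: h.
have lS1 : L1 (tensor_power P n.+1) (fun o => tsum o ^+ (2 * r.+1)).
  apply/l12; apply: L1_ge0_dom lU.
    by apply: (measurableT_comp mf); exact: measurable_tuple_cons.
  by move=> o; rewrite hU andbT exprM exprn_ge0// sqr_ge0.
split=> //; rewrite e12.
apply: le_trans (expect_le ((l12).1 lS1) lU hU) _.
rewrite /U expectD; [|by apply: L1D => //; exact: L1Z|by apply: L1Z; exact: L1D].
rewrite expectD//; last exact: L1Z.
rewrite (expectZ _ lX) eX Y0 mul0r mulr0 addr0 (expectZ C); last exact: L1D.
rewrite expectD// (expectZ _ lYQ) eYQ expect_cst mulr1.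
have -> : expect PQ (fun o => 1 * S o.2 ^+ (2 * r.+1) / N%:R) = N%:R^-1 * expect PQ (fun o => 1 * S o.2 ^+ (2 * r.+1)).
  by under [X in expect _ X]funext do rewrite mulrC; exact: expectZ.
rewrite eSQ expect_cst mul1r -/m.
set u := expect _ _ in en *.
set K := 2 * C * N%:R ^+ r * m in en *.
have K0 : 0 <= K by rewrite !mulr_ge0 ?exprn_ge0.
have Nr : 1 <= N%:R ^+ r :> R by rewrite exprn_ege1// ler1n.
have u0 : 0 <= u by apply: expect_ge0 => o; rewrite exprM exprn_ge0// sqr_ge0.
have CN0 : 0 <= C / N%:R by rewrite divr_ge0.
have e1 : (1 + C / N%:R) * u <= expR (C * n.+1%:R / N%:R) * (K * n%:R).
  have -> : C * n.+1%:R / N%:R = C / N%:R + C * n%:R / N%:R.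
    by rewrite -natr1; field; rewrite gt_eqF.
  rewrite expRD -mulrA; apply: ler_pM => //; first by rewrite addr_ge0.
    exact: expR_ge1Dx.
  by rewrite mulrC.
have e2 : C * ((N%:R ^+ r + 1) * m) <= K.
  by rewrite /K; have := ler_wpM2l (mulr_ge0 C0 m0) Nr; lra.
have e3 : K <= expR (C * n.+1%:R / N%:R) * K.
  by rewrite ler_peMl// -expR0 ler_expR divr_ge0// mulr_ge0.
rewrite -[X in K * X]natr1; set ex := expR _ in e1 e3 *.
clear -e1 e2 e3; lra.
Qed.

Lemma mz_bound (N n : nat) : (0 < N)%N -> (n <= N)%N ->
  L1 (tensor_power P n) (fun o => tsum o ^+ (2 * r.+1)) /\
  expect (tensor_power P n) (fun o => tsum o ^+ (2 * r.+1)) <=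
    mz_const r * N%:R ^+ r.+1 * expect P (fun o => Y o ^+ (2 * r.+1)).
Proof.
move=> N0 nN; have [l e] := marcinkiewicz_zygmund N0 nN; split=> //.
have [C0 HC] := @expand_constP R r.
have NR : 0 < N%:R :> R by rewrite ltr0n.
have m0 : 0 <= expect P (fun o => Y o ^+ (2 * r.+1)).
  by apply: expect_ge0 => o; rewrite exprM exprn_ge0// sqr_ge0.
apply: le_trans e _; rewrite /mz_const; set C := expand_const r in C0 *.
have h1 : n%:R * expR (C * n%:R / N%:R) <= N%:R * expR C.
  apply: ler_pM; rewrite ?expR_ge0// ?ler_nat// ler_expR ler_pdivrMr//.
  by rewrite ler_wpM2l// ler_nat.
have h0 : 0 <= 2 * C * N%:R ^+ r * expect P (fun o => Y o ^+ (2 * r.+1)).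
  by rewrite !mulr_ge0// exprn_ge0.
have := ler_wpM2l h0 h1; rewrite [N%:R ^+ r.+1]exprSr; lra.
Qed.

End MarcinkiewiczZygmund.

Lemma exprB_even_le {R : realType} (u v : R) q :
  (u - v) ^+ (2 * q) <= 2 ^+ (2 * q) * (u ^+ (2 * q) + v ^+ (2 * q)).
Proof.
have E (z : R) : z ^+ (2 * q) = `|z| ^+ (2 * q) by rewrite !exprM real_normK// num_real.
rewrite (E (u - v)) (E u) (E v); apply: le_trans (exprD_le _ (normr_ge0 _) (normr_ge0 _)).
by rewrite lerXn2r ?nnegrE// ?addr_ge0// ler_normB.
Qed.

Lemma expr_even_ge0 {R : realType} (u : R) q : 0 <= u ^+ (2 * q).
Proof. by rewrite exprM exprn_ge0// sqr_ge0. Qed.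

Section TensorPermutation.
Context {R : realType} {d : measure_display} {T : measurableType d} (P : probability T R).

Definition permute N (s : 'I_N -> 'I_N) (o : N.-tuple T) : N.-tuple T := [tuple tnth o (s j) | j < N].

Lemma measurable_permute N (s : 'I_N -> 'I_N) : measurable_fun setT (permute s).
Proof.
apply/measurable_fun_tnthP => i; apply: (eq_measurable_fun (fun o => tnth o (s i))).
  by move=> o _ /=; rewrite tnth_mktuple.
exact: measurable_tnth.
Qed.

Lemma tensor_power_permute N (s : 'I_N -> 'I_N) A : involutive s -> measurable A ->
  tensor_power P N (permute s @^-1` A) = tensor_power P N A.
Proof.
move=> sK mA; rewrite -[LHS](lawE (tensor_power P N) (measurable_permute s)).
apply: (tuple_measure_unique (m := law (tensor_power P N) (measurable_permute s))) => //.
- move=> B mB; transitivity (tensor_power P N (permute s @^-1` box B)); first exact: lawE.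
  rewrite [RHS]tensor_power_box//.
  rewrite (_ : permute s @^-1` box B = box (fun i => B (s i))).
    by rewrite tensor_power_box// (reindex_inj (inv_inj sK)); apply: eq_bigr => i _; rewrite sK.
  apply/seteqP; split => o /= H i.
    by have := H (s i); rewrite tnth_mktuple sK.
  by rewrite tnth_mktuple; have := H (s i); rewrite sK.
- apply: (@le_lt_trans _ _ 1%E _ _ (probability_le1 (law (tensor_power P N) (measurable_permute s)) measurableT)).
  exact: ltry.
Qed.

End TensorPermutation.

(** * Empirical averages of a kernel *)

Section Fluctuation.
Context {R : realType} {d : measure_display} {T : measurableType d} (P : probability T R).
Variables (G : T -> T -> R) (r : nat).
Hypotheses (mG : measurable_fun setT (fun o : T * T => G o.1 o.2)) (G0 : forall a, G a a = 0)
  (lG : forall a, L1 P (fun c => G a c ^+ (2 * r.+1))).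

Definition fluctuation N (o : N.-tuple T) (i : 'I_N) : R :=
  N%:R^-1 * (\sum_j G (tnth o i) (tnth o j)) - expect P (G (tnth o i)).

(** The outer power of two separates the centered sum from the mean left over in [fluctuation_cons],
    which accounts for the final summand one; the inner [2 ^+ (2 * s.+1) * 2] compares the centered
    kernel with the kernel. *)
Definition fluct_const (s : nat) : R := 2 ^+ (2 * s.+1) * (2 ^+ (2 * s.+1) * 2 * mz_const s + 1).

Let mGa a : measurable_fun setT (G a).
Proof. exact: (measurableT_comp mG (measurable_pair1 a)). Qed.

Let Gnorm a : (fun c => `|G a c| ^+ (2 * r).+2) = (fun c => G a c ^+ (2 * r.+1)).
Proof. by apply/funext => c; rewrite -normrX ger0_norm -[(2 * r).+2]add2n -mulnS// expr_even_ge0. Qed.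

Lemma kernel_L1 a : L1 P (G a).
Proof. by have [] := @expect_power _ _ _ P (2 * r).+1 (G a) (mGa a); rewrite ?Gnorm. Qed.

Lemma kernel_jensen a : expect P (G a) ^+ (2 * r.+1) <= expect P (fun c => G a c ^+ (2 * r.+1)).
Proof.
have [] := @expect_power _ _ _ P (2 * r).+1 (G a) (mGa a); rewrite ?Gnorm// => _.
by rewrite -normrX ger0_norm -[(2 * r).+2]add2n -mulnS// expr_even_ge0.
Qed.

Lemma fluct_const_ge0 : 0 <= fluct_const r.
Proof.
have [h _] := @expand_constP R r.
by rewrite /fluct_const /mz_const !mulr_ge0 ?exprn_ge0// addr_ge0// !mulr_ge0 ?exprn_ge0 ?expR_ge0.
Qed.

(** The self-interaction [G a a] vanishes, so [n] terms are divided by [n.+1]: centering them leaves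
    one mean over. *)
Lemma fluctuation_cons n a (y : n.-tuple T) : fluctuation (tuple_cons (a, y)) ord0 =
  n.+1%:R^-1 * (tsum (fun c => G a c - expect P (G a)) y - expect P (G a)).
Proof.
rewrite /fluctuation big_ord_recl.
have E0 : tnth (tuple_cons (a, y)) ord0 = a by exact: tnth0.
have ES i : tnth (tuple_cons (a, y)) (lift ord0 i) = tnth y i by exact: (tnthS a y).
rewrite E0 G0 add0r /tsum sumrB sumr_const card_ord.
under eq_bigr do rewrite ES.
rewrite -mulr_natr -natr1; field; rewrite natr1 pnatr_eq0//.
Qed.

Lemma fluctuation_cons_moment n a :
  let m := expect P (fun c => G a c ^+ (2 * r.+1)) in
  L1 (tensor_power P n) (fun y => fluctuation (tuple_cons (a, y)) ord0 ^+ (2 * r.+1)) /\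
  expect (tensor_power P n) (fun y => fluctuation (tuple_cons (a, y)) ord0 ^+ (2 * r.+1)) <=
    fluct_const r / n.+1%:R ^+ r.+1 * m.
Proof.
move=> m; set H := expect P (G a).
pose Y c := G a c - H; set q := (2 * r.+1)%N in m *.
have lH := kernel_L1 a.
have lY : L1 P Y by apply: L1B => //; exact: L1_cst.
have Y0 : expect P Y = 0 by rewrite /Y expectB// ?expect_cst ?subrr//; exact: L1_cst.
have lB : L1 P (fun c => 2 ^+ q * (G a c ^+ q + H ^+ q)).
  by apply: L1Z; apply: L1D; [exact: lG|exact: L1_cst].
have lYp : L1 P (fun c => Y c ^+ q).
  apply: (L1_ge0_dom _ _ lB).
    by apply: measurable_funX; exact: (L1_meas lY).
  by move=> c; rewrite expr_even_ge0 exprB_even_le.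
have m0 : 0 <= m by apply: expect_ge0 => c; exact: expr_even_ge0.
have Hm : H ^+ q <= m by exact: kernel_jensen.
have eY : expect P (fun c => Y c ^+ q) <= 2 ^+ q * 2 * m.
  apply: le_trans (expect_le lYp lB _) _; first by move=> c; exact: exprB_even_le.
  rewrite expectZ; last by apply: L1D; [exact: lG|exact: L1_cst].
  rewrite expectD ?expect_cst; [|exact: lG|exact: L1_cst].
  by rewrite -mulrA ler_wpM2l ?exprn_ge0// mulr_natl mulr2n lerD2l.
have [lS eS] := mz_bound lY Y0 lYp (ltn0Sn n) (leqnSn n).
have N0 : 0 < n.+1%:R :> R by rewrite ltr0n.
pose U (y : n.-tuple T) := n.+1%:R ^- q * (2 ^+ q * (tsum Y y ^+ q + H ^+ q)).
have lU : L1 (tensor_power P n) U.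
  by apply: L1Z; apply: L1Z; apply: L1D => //; exact: L1_cst.
have hU y : 0 <= fluctuation (tuple_cons (a, y)) ord0 ^+ q <= U y.
  rewrite expr_even_ge0/= fluctuation_cons exprMn exprVn ler_wpM2l ?invr_ge0 ?exprn_ge0//.
  exact: exprB_even_le.
have mf : measurable_fun setT (fun y : n.-tuple T => fluctuation (tuple_cons (a, y)) ord0 ^+ q).
  apply: measurable_funX; under [X in measurable_fun _ X]funext do rewrite fluctuation_cons.
  apply: measurable_funM => //; apply: measurable_funB => //.
  exact: (@measurable_tsum _ _ _ P Y lY n).
have lf := L1_ge0_dom mf hU lU.
split=> //; apply: le_trans (expect_le lf lU (fun y => proj2 (andP (hU y)))) _.
rewrite /U expectZ; last by apply: L1Z; apply: L1D => //; exact: L1_cst.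
rewrite expectZ; last by apply: L1D => //; exact: L1_cst.
rewrite expectD ?expect_cst//; last exact: L1_cst.
have mz0 : 0 <= mz_const r * n.+1%:R ^+ r.+1 :> R.
  have [h _] := @expand_constP R r.
  by rewrite /mz_const !mulr_ge0 ?exprn_ge0 ?expR_ge0.
have Np : 1 <= n.+1%:R ^+ r.+1 :> R by rewrite exprn_ege1// ler1n.
have h1 : expect (tensor_power P n) (fun y => tsum Y y ^+ q) + H ^+ q <=
    n.+1%:R ^+ r.+1 * ((2 ^+ q * 2 * mz_const r + 1) * m).
  apply: (@le_trans _ _ (mz_const r * n.+1%:R ^+ r.+1 * (2 ^+ q * 2 * m) + n.+1%:R ^+ r.+1 * m)).
    apply: lerD; first by apply: le_trans eS _; rewrite ler_wpM2l.
    by apply: le_trans Hm _; rewrite ler_peMl.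
  by rewrite le_eqVlt; apply/orP; left; apply/eqP; ring.
have h2 := ler_wpM2l (exprn_ge0 q (ler0n R 2)) h1.
have Nq : 0 <= n.+1%:R ^- q :> R by rewrite invr_ge0 exprn_ge0.
apply: le_trans (ler_wpM2l Nq h2) _; rewrite le_eqVlt; apply/orP; left; apply/eqP.
rewrite /fluct_const -/q [X in _ ^- X](_ : q = r.+1 + r.+1)%N; last by rewrite /q mul2n addnn.
rewrite exprD; move: (mz_const r) => c.
have : n.+1%:R ^+ r.+1 != 0 :> R by rewrite expf_neq0// gt_eqF.
move: (n.+1%:R ^+ r.+1) => x x0; field; exact: x0.
Qed.

Lemma measurable_fluctuation N i : measurable_fun setT (fun o : N.-tuple T => fluctuation o i).
Proof.
have mH : measurable_fun setT (fun a => expect P (G a)).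
  pose f (o : T * T) := (G o.1 o.2)%:E.
  have mf : measurable_fun setT f by exact/measurable_EFinP.
  have mp : measurable_fun setT (fubini_F P f^\+%E).
    by apply: measurable_fun_fubini_tonelli_F; [exact: measurable_funepos|exact: funepos_ge0].
  have mn : measurable_fun setT (fubini_F P f^\-%E).
    by apply: measurable_fun_fubini_tonelli_F; [exact: measurable_funeneg|exact: funeneg_ge0].
  have E a : expect P (G a) = fine (fubini_F P f^\+%E a - fubini_F P f^\-%E a)%E.
    rewrite /expect /Rintegral integralE /fubini_F; congr (fine (_ - _)%E).
      by apply: eq_integral => c _; rewrite !funeposE.
    by apply: eq_integral => c _; rewrite !funenegE.
  under [X in measurable_fun _ X]funext do rewrite E.
  exact: (measurableT_comp (fine_measurable measurableT) (emeasurable_funB mp mn)).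
apply: measurable_funB; last exact: (measurableT_comp mH (measurable_tnth i)).
apply: measurable_funM => //; apply: measurable_sum => j.
have mp : measurable_fun setT (fun o : N.-tuple T => (tnth o i, tnth o j)).
  by apply: measurable_fun_pair; exact: measurable_tnth.
exact: (measurableT_comp mG mp).
Qed.

Definition kernel_moment : \bar R := (\int[P]_a (expect P (fun c => G a c ^+ (2 * r.+1)))%:E)%E.

(** Given the head coordinate [a], the other ones are independent of common law, and
    [fluctuation_cons_moment] applies; Tonelli integrates over [a]. *)
Lemma fluctuation_head n :
  (\int[tensor_power P n.+1]_o (fluctuation o ord0 ^+ (2 * r.+1))%:E <=
   (fluct_const r / n.+1%:R ^+ r.+1)%:E * kernel_moment)%E.
Proof.
have mf : measurable_fun setT (fun o : n.+1.-tuple T => (fluctuation o ord0 ^+ (2 * r.+1))%:E).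
  by apply/measurable_EFinP; apply: measurable_funX; exact: measurable_fluctuation.
have f0 (o : n.+1.-tuple T) : (0 <= (fluctuation o ord0 ^+ (2 * r.+1))%:E)%E.
  by rewrite lee_fin expr_even_ge0.
have H (A : set (n.+1.-tuple T)) : measurable A ->
    [the probability _ _ of (P \x tensor_power P n)%E] (@tuple_cons _ _ n @^-1` A) = tensor_power P n.+1 A by [].
rewrite (ge0_law_integral (@measurable_tuple_cons _ _ n) H mf f0).
have mf' : measurable_fun setT (fun o : T * n.-tuple T => (fluctuation (tuple_cons o) ord0 ^+ (2 * r.+1))%:E).
  by apply: (measurableT_comp mf); exact: measurable_tuple_cons.
rewrite (fubini_tonelli1 _ mf')//.
have c0 : 0 <= fluct_const r / n.+1%:R ^+ r.+1 by rewrite divr_ge0 ?exprn_ge0// fluct_const_ge0.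
have mm : measurable_fun setT (fun a => (expect P (fun c => G a c ^+ (2 * r.+1)))%:E).
  under [X in measurable_fun _ X]funext do rewrite -expectE//.
  apply: (measurable_fun_fubini_tonelli_F (fun o : T * T => (G o.1 o.2 ^+ (2 * r.+1))%:E)).
    by apply/measurable_EFinP; exact: measurable_funX.
  by move=> o; rewrite lee_fin expr_even_ge0.
have m0 a : 0 <= expect P (fun c => G a c ^+ (2 * r.+1)) by apply: expect_ge0 => c; exact: expr_even_ge0.
rewrite /kernel_moment -ge0_integralZl//; last by move=> a _; rewrite lee_fin.
apply: ge0_le_integral => //.
- by move=> a _; apply: integral_ge0 => y _.
- exact: measurable_fun_fubini_tonelli_F.
- by apply: emeasurable_funM => //; exact: measurable_cst.
move=> a _; have [l e] := fluctuation_cons_moment n a.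
by rewrite /fubini_F expectE// -EFinM lee_fin.
Qed.

(* Exchanging the coordinates [0] and [i] preserves the tensor power, and reduces to the
   head coordinate, where the sum is over variables independent of it. *)
Lemma fluctuation_bound N (i : 'I_N) :
  (\int[tensor_power P N]_o (fluctuation o i ^+ (2 * r.+1))%:E <=
   (fluct_const r / N%:R ^+ r.+1)%:E * kernel_moment)%E.
Proof.
case: N i => [[]//|n] i.
pose s (j : 'I_n.+1) := if j == ord0 then i else if j == i then ord0 else j.
have sK : involutive s.
  move=> j; rewrite /s; have [->|j0] := eqVneq j ord0.
    by rewrite eqxx; case: eqP.
  have [->|ji] := eqVneq j i; first by rewrite eqxx.
  by rewrite (negbTE j0) (negbTE ji).
have E (o : n.+1.-tuple T) : fluctuation (permute s o) ord0 = fluctuation o i.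
  rewrite /fluctuation tnth_mktuple /s eqxx; congr (_ * _ - _).
  rewrite [RHS](reindex_inj (inv_inj sK)); apply: eq_bigr => j _.
  by rewrite tnth_mktuple.
apply: le_trans (fluctuation_head n); under eq_integral do rewrite -E.
rewrite -(ge0_law_integral (measurable_permute s) (fun A mA => tensor_power_permute P sK mA)
  (f := fun o => (fluctuation o ord0 ^+ (2 * r.+1))%:E))//.
  by apply/measurable_EFinP; apply: measurable_funX; exact: measurable_fluctuation.
by move=> o; rewrite lee_fin expr_even_ge0.
Qed.

End Fluctuation.

Lemma ae_exists {d : measure_display} {T : measurableType d} {R : realType} (P : probability T R)
  (Q : T -> Prop) : {ae P, forall x, Q x} -> exists x, Q x.
Proof.
move=> /ae_good_set[G [mG G0 hG]]; apply/not_existsP => nQ.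
have : ~` G = setT by apply/seteqP; split => // x _ /hG; exact: nQ.
by move=> E; move: G0; rewrite E probability_setT => /eqP; rewrite onee_eq0.
Qed.

Section PairLaw.
Context {R : realType} {d d' : measure_display} {T : measurableType d} {S : measurableType d'}
  (P : probability T R) (Q : probability S R) (Z : T -> S).
Hypotheses (mZ : measurable_fun setT Z) (H : forall A, measurable A -> P (Z @^-1` A) = Q A).

Definition pair_map (o : 2.-tuple T) : S * S := (Z (tnth o ord0), Z (tnth o ord_max)).

Lemma measurable_pair_map : measurable_fun setT pair_map.
Proof. by apply: measurable_fun_pair; apply: measurableT_comp => //; exact: measurable_tnth. Qed.

Lemma pair_law A : measurable A ->
  tensor_power P 2 (pair_map @^-1` A) = [the probability _ _ of (Q \x Q)%E] A.
Proof.
move=> mA; rewrite -[LHS](lawE (tensor_power P 2) measurable_pair_map); apply/esym.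
apply: (@product_measure_unique _ _ _ _ _ Q Q (law (tensor_power P 2) measurable_pair_map)) => //.
move=> B C mB mC; transitivity (tensor_power P 2 (pair_map @^-1` (B `*` C))); first exact: lawE.
rewrite (_ : _ @^-1` _ = box (fun i : 'I_2 => if i == ord0 then Z @^-1` B else Z @^-1` C)); last first.
  apply/seteqP; split => o /=.
    by move=> [h1 h2] i; case: ifP => [/eqP ->//|i0]; rewrite (_ : i = ord_max)//;
      apply/val_inj; move: i i0 => [[|[]]].
  by move=> h; split; [exact: (h ord0)|exact: (h ord_max)].
rewrite tensor_power_box; last first.
  by move=> i; case: ifP => _; rewrite -[X in measurable X]setTI; exact: mZ.
by rewrite big_ord_recl big_ord1 /= !H.
Qed.

End PairLaw.

Section PairMoments.
Context {R : realType} {d : nat} {V W : 'rV[R]_d -> R} {lV lW M : R} {m : nat}.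
Hypothesis F : fields (field (grad V)) (field (grad W)) lV lW M m.
Variable u0 : probability 'rV[R]_d R.
Implicit Types (t : R) (a c : 'rV[R]_d).

Lemma n2_rvB a c : n2 (rv a \- rv c) = enorm (a - c).
Proof. by rewrite enormE; congr n2; apply/funext => k; rewrite /rv !mxE. Qed.

Lemma measurable_enormB : measurable_fun setT (fun o : 'rV[R]_d * 'rV[R]_d => enorm (o.1 - o.2)).
Proof.
have mB : measurable_fun setT (fun o : 'rV[R]_d * 'rV[R]_d => o.1 - o.2).
  apply: measurable_to_rV => k.
  apply: (eq_measurable_fun (fun o : 'rV[R]_d * 'rV[R]_d => o.1 ord0 k - o.2 ord0 k)).
    by move=> o _; rewrite !mxE.
  apply: measurable_funB; [exact: (measurableT_comp (measurable_rV_coord k) measurable_fst)|].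
  exact: (measurableT_comp (measurable_rV_coord k) measurable_snd).
exact: (measurableT_comp measurable_enorm mB).
Qed.

Lemma enormB_pow_le a c q : enorm (a - c) ^+ q <= 2 ^+ q * (enorm a ^+ q + enorm c ^+ q).
Proof.
apply: le_trans (exprD_le _ (sqrtr_ge0 _) (sqrtr_ge0 _)).
rewrite lerXn2r ?nnegrE ?addr_ge0 ?sqrtr_ge0//.
apply: le_trans (enormD a (- c)) _; rewrite lerD2l.
by have := enormB_C 0 c; rewrite sub0r subr0 => ->.
Qed.

Lemma L1_lower_moment (mu : probability 'rV[R]_d R) p q : (p <= q)%N ->
  finite_moment q mu -> L1 mu (fun x => enorm x ^+ p).
Proof.
move=> pq fm; have mp k : measurable_fun setT (fun x : 'rV[R]_d => enorm x ^+ k).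
  by apply: measurable_funX; exact: measurable_enorm.
have lq : L1 mu (fun x => enorm x ^+ q).
  apply/integrableP; split; first exact/measurable_EFinP.
  apply: le_lt_trans fm; rewrite le_eqVlt; apply/orP; left; apply/eqP; apply: eq_integral => x _ /=.
  by rewrite ger0_norm// exprn_ge0// sqrtr_ge0.
apply: (L1_ge0_dom (g := fun x => enorm x ^+ q + 1)) => //; last by apply: L1D => //; exact: L1_cst.
move=> x; rewrite exprn_ge0 ?sqrtr_ge0//=.
have e0 : 0 <= enorm x by exact: sqrtr_ge0.
have [h|/ltW h] := leP (enorm x) 1.
  by rewrite ler_wpDl ?exprn_ge0// exprn_ile1.
by rewrite ler_wpDr// ler_weXn2l.
Qed.

(** The summand one covers [q = 0], which occurs for [m = 0]. The middle term bounds the initial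
    difference by [enormB_pow_le], the last one is the contribution of the noise. *)
Definition pair_const (q : nat) : R :=
  1 + 2 ^+ (2 * q) * (2 * expect u0 (fun x => enorm x ^+ (2 * q))) + gap_growth d q.-1 (lV + lW).

Lemma pair_moment q (u : R -> probability 'rV[R]_d R) t : L1 u0 (fun x => enorm x ^+ (2 * q)) ->
  mckean_vlasov_flow V W m u0 u -> 0 <= t ->
  L1 [the probability _ _ of (u t \x u t)%E] (fun o => enorm (o.1 - o.2) ^+ (2 * q)) /\
  expect [the probability _ _ of (u t \x u t)%E] (fun o => enorm (o.1 - o.2) ^+ (2 * q)) <= pair_const q.
Proof.
have k0 : 0 < lV + lW by have := lV_gt0 F; have := lVW_gt0 F; lra.
case: q => [|r] l0 flow t0.
  have E : (fun o : 'rV[R]_d * 'rV[R]_d => enorm (o.1 - o.2) ^+ (2 * 0)) = fun=> 1 by [].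
  rewrite E expect_cst; split; first exact: L1_cst.
  rewrite /pair_const -addrA lerDl addr_ge0 ?gap_growth_ge0// !mulr_ge0 ?exprn_ge0//.
  by apply: expect_ge0 => x; rewrite exprn_ge0// sqrtr_ge0.
have ok := mckean_vlasov_field_ok F flow.
have [dO [Om [P [x [w [z [dr hz law0 lawt]]]]]]] := mckean_vlasov_flow_driven ok t0 flow.
pose Z o : 'rV[R]_d := \row_k z o t k; pose X o : 'rV[R]_d := \row_k x o k.
have mZ : measurable_fun setT Z.
  apply: measurable_to_rV => k; apply: (eq_measurable_fun (fun o => z o t k)).
    by move=> o _; rewrite mxE.
  exact: (measurable_sol k dr ok t0 hz).
have mX : measurable_fun setT X.
  apply: measurable_to_rV => k; apply: (eq_measurable_fun (fun o => x o k)).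
    by move=> o _; rewrite mxE.
  exact: (driven_x dr).
have lZ A : measurable A -> P (Z @^-1` A) = u t A.
  by move=> mA; apply: lawt => //; rewrite t0 lexx.
have mE : measurable_fun setT (fun o : 'rV[R]_d * 'rV[R]_d => enorm (o.1 - o.2) ^+ (2 * r.+1)).
  by apply: measurable_funX; exact: measurable_enormB.
have EZ o : enorm (Z (tnth o ord0) - Z (tnth o ord_max)) ^+ (2 * r.+1) =
    dot (z (tnth o ord0) t \- z (tnth o ord_max) t) (z (tnth o ord0) t \- z (tnth o ord_max) t) ^+ r.+1.
  by rewrite exprM row_sub enorm_row n2_sqr.
have EX o : enorm (X (tnth o ord0) - X (tnth o ord_max)) ^+ (2 * r.+1) =
    dot (x (tnth o ord0) \- x (tnth o ord_max)) (x (tnth o ord0) \- x (tnth o ord_max)) ^+ r.+1.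
  by rewrite exprM row_sub enorm_row n2_sqr.
have [p1 e1] := prod_expect l0 (L1_cst u0 1).
have [p2 e2] := prod_expect (L1_cst u0 1) l0.
have l12 : L1 [the probability _ _ of (u0 \x u0)%E]
    (fun o => 2 ^+ (2 * r.+1) * (enorm o.1 ^+ (2 * r.+1) * 1 + 1 * enorm o.2 ^+ (2 * r.+1))).
  by apply: L1Z; exact: L1D.
have le12 (o : 'rV[R]_d * 'rV[R]_d) : 0 <= enorm (o.1 - o.2) ^+ (2 * r.+1) <=
    2 ^+ (2 * r.+1) * (enorm o.1 ^+ (2 * r.+1) * 1 + 1 * enorm o.2 ^+ (2 * r.+1)).
  by rewrite exprn_ge0 ?sqrtr_ge0//= mulr1 mul1r enormB_pow_le.
have l00 := L1_ge0_dom mE le12 l12.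
have e00 : expect [the probability _ _ of (u0 \x u0)%E] (fun o => enorm (o.1 - o.2) ^+ (2 * r.+1)) <=
    2 ^+ (2 * r.+1) * (2 * expect u0 (fun x => enorm x ^+ (2 * r.+1))).
  apply: le_trans (expect_le l00 l12 (fun o => proj2 (andP (le12 o)))) _.
  by rewrite expectZ ?expectD// ?e1 ?e2 ?expect_cst; [rewrite mulr1 mul1r mulr_natl mulr2n|exact: L1D].
have lX := law_L1 (measurable_pair_map mX) (pair_law mX law0) mE.
have eX := law_expect (measurable_pair_map mX) (pair_law mX law0) mE.
have lZ' := law_L1 (measurable_pair_map mZ) (pair_law mZ lZ) mE.
have eZ := law_expect (measurable_pair_map mZ) (pair_law mZ lZ) mE.
have EX' : (fun o => enorm ((pair_map X o).1 - (pair_map X o).2) ^+ (2 * r.+1)) = 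
   fun o => dot (x (tnth o ord0) \- x (tnth o ord_max)) (x (tnth o ord0) \- x (tnth o ord_max)) ^+ r.+1.
  by apply/funext => o; exact: EX.
have EZ' : (fun o => enorm ((pair_map Z o).1 - (pair_map Z o).2) ^+ (2 * r.+1)) = 
   fun o => dot (z (tnth o ord0) t \- z (tnth o ord_max) t) (z (tnth o ord0) t \- z (tnth o ord_max) t) ^+ r.+1.
  by apply/funext => o; exact: EZ.
rewrite EX' in lX eX; rewrite EZ' in lZ' eZ.
have [g1 g2] := gap_solution (r := r) dr ok t0 hz ((lX).1 l00).
split; first exact/lZ'.
rewrite eZ; apply: le_trans g2 _; rewrite -eX /pair_const card_ord /=.
by apply: lerD => //; rewrite ler_wpDl.
Qed.

(** Fubini gives integrability for almost every [a]; the triangle inequality through one such [a0]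
    extends it to every [a]. *)
Lemma pair_moment_slices q (u : R -> probability 'rV[R]_d R) t : L1 u0 (fun x => enorm x ^+ (2 * q)) ->
  mckean_vlasov_flow V W m u0 u -> 0 <= t ->
  (forall a, L1 (u t) (fun c => enorm (a - c) ^+ (2 * q))) /\
  (\int[u t]_a (expect (u t) (fun c => enorm (a - c) ^+ (2 * q)))%:E <= (pair_const q)%:E)%E.
Proof.
move=> l0 flow t0; have [l e] := pair_moment l0 flow t0.
have E0 a c : 0 <= enorm (a - c) ^+ (2 * q) by rewrite exprn_ge0// sqrtr_ge0.
have mE : measurable_fun setT (fun o : 'rV[R]_d * 'rV[R]_d => enorm (o.1 - o.2) ^+ (2 * q)).
  by apply: measurable_funX; exact: measurable_enormB.
have ma a : measurable_fun setT (fun c => enorm (a - c) ^+ (2 * q)).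
  exact: (measurableT_comp mE (measurable_pair1 a)).
have L a : L1 (u t) (fun c => enorm (a - c) ^+ (2 * q)).
  have [a0 la0] : exists a0, L1 (u t) (fun c => enorm (a0 - c) ^+ (2 * q)).
    by have [a0 ha0] := ae_exists (ae_integrable1 l); exists a0.
  have lc : L1 (u t) (fun c => 2 ^+ (2 * q) * (enorm (a - a0) ^+ (2 * q) + enorm (a0 - c) ^+ (2 * q))).
    by apply: L1Z; apply: L1D => //; exact: L1_cst.
  apply: (L1_ge0_dom _ _ lc) => // c; rewrite E0/=.
  apply: le_trans (exprD_le _ (sqrtr_ge0 _) (sqrtr_ge0 _)).
  rewrite lerXn2r ?nnegrE ?addr_ge0 ?sqrtr_ge0//.
  by rewrite (_ : a - c = (a - a0) + (a0 - c)) ?enormD// addrA subrK.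
split=> //; rewrite -lee_fin -expectE// in e; apply: le_trans e.
rewrite (fubini_tonelli1 (fun o : 'rV[R]_d * 'rV[R]_d => (enorm (o.1 - o.2) ^+ (2 * q))%:E)).
- by rewrite le_eqVlt; apply/orP; left; apply/eqP; apply: eq_integral => a _; rewrite -expectE.
- exact/measurable_EFinP.
- by move=> o; rewrite lee_fin.
Qed.

End PairMoments.

(** * The synchronous coupling *)

(** The integrating factor of the coupling estimate: its logarithmic derivative is the rate [a]
    diminished by [c * b * expR (- b * (T - s))], whose integral over [[0, T]] is at most [c] when
    [b] and [c] are nonnegative. *)
Lemma prim_weight {R : realType} (T a c b : R) :
  prim T (fun s => expR (a * s - c * expR (- b * (T - s))))
    (fun s => (a - c * (b * expR (- b * (T - s)))) * expR (a * s - c * expR (- b * (T - s)))).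
Proof.
have ce : continuous (fun s => expR (- b * (T - s)) : R).
  move=> s; apply: continuous_comp; last exact: continuous_expR.
  by apply: cvgM; [exact: cvg_cst|apply: cvgB; [exact: cvg_cst|exact: cvg_id]].
have cq : continuous (fun s => expR (a * s - c * expR (- b * (T - s))) : R).
  move=> s; apply: (@continuous_comp _ _ _ (fun s => a * s - c * expR (- b * (T - s))) expR); last exact: continuous_expR.
  by apply: cvgB; apply: cvgM; [exact: cvg_cst|exact: cvg_id|exact: cvg_cst|exact: ce].
apply: prim_C1 => [s|]; last first.
  move=> s; apply: cvgM; last exact: cq.
  apply: cvgB; first exact: cvg_cst.
  by apply: cvgM; [exact: cvg_cst|apply: cvgM; [exact: cvg_cst|exact: ce]].
rewrite mulrC; apply: (@is_derive1_comp _ expR (fun s => a * s - c * expR (- b * (T - s)))).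
have d1 : is_derive s (1 : R) (fun s => - b * (T - s)) b.
  have h := is_deriveZ (- b) (is_deriveB (is_derive_cst T s 1) (is_derive_id s (1 : R))).
  by apply: is_derive_eq h _; rewrite /GRing.scale/=; ring.
have d2 := @is_derive1_comp _ expR (fun s => - b * (T - s)) s _ _ (is_derive_expR _) d1.
have h := is_deriveB (is_deriveZ a (is_derive_id s (1 : R))) (is_deriveZ c d2).
by apply: is_derive_eq h _; rewrite /GRing.scale/=; ring.
Qed.

Section CouplingEstimate.
Context {R : realType} {I : finType}.
Context {GV GW : (I -> R) -> I -> R} {lV lW M : R} {m : nat}.
Hypothesis F : fields GV GW lV lW M m.
Variables (N r : nat).
Hypotheses (N0 : (0 < N)%N) (K : power_monotone (GW := GW) (lW := lW) r.+1).
Local Notation mu := (@lebesgue_measure R).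
Local Notation pair_drift := (pair_drift (GV := GV) (GW := GW) (N := N)).
Local Notation beta := (dissipation (lV := lV) (lW := lW)).
Implicit Types (s t T : R).

(** Either [2 * b <= e * a] and the first term suffices, or [a <= 2 * b / e] and the second one
    does; the constant is [2 * 2 ^+ (2 * r).+1]. *)
Lemma young_odd (a b e : R) : 0 <= a -> 0 <= b -> 0 < e ->
  2 * (a ^+ (2 * r).+1 * b) <= e * a ^+ (2 * r.+1) + 4 ^+ r.+1 / e ^+ (2 * r).+1 * b ^+ (2 * r.+1).
Proof.
move=> a0 b0 e0; have E : (2 * r.+1 = (2 * r).+2)%N by rewrite mulnS.
have pe n : 0 <= e ^+ n by exact: exprn_ge0 (ltW e0).
rewrite E; have [h|/ltW h] := leP (2 * b) (e * a).
  have p1 : 0 <= 4 ^+ r.+1 / e ^+ (2 * r).+1 * b ^+ (2 * r).+2.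
    by apply: mulr_ge0; [exact: divr_ge0 (exprn_ge0 _ (ler0n R 4)) (pe _)|exact: exprn_ge0].
  have := ler_wpM2l (exprn_ge0 (2 * r).+1 a0) h; rewrite [a ^+ (2 * r).+2]exprSr.
  by move: p1; move: (_ * b ^+ _) (a ^+ _) => u v u0; lra.
rewrite ler_wpDl//; first exact: mulr_ge0 (ltW e0) (exprn_ge0 _ a0).
have h' : a <= 2 * b / e by rewrite ler_pdivlMr// mulrC.
have b20 : 0 <= 2 * b / e by rewrite divr_ge0 ?mulr_ge0// ltW.
apply: (@le_trans _ _ (2 * ((2 * b / e) ^+ (2 * r).+1 * b))).
  by rewrite ler_wpM2l// ler_wpM2r// lerXn2r.
rewrite le_eqVlt; apply/orP; left; apply/eqP.
have -> : 4 ^+ r.+1 = 2 * 2 ^+ (2 * r).+1 :> R.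
  by rewrite -exprS -E exprM expr2 -natrM.
rewrite exprMn exprVn exprMn [b ^+ (2 * r).+2]exprSr; ring.
Qed.

(** The fraction is [r.+1%:R] times the constant of [young_odd] for the weight at the final time,
    [b * ln 2]; [2 ^+ r.+1] is the price of the weight. *)
Definition coupling_const (b : R) : R :=
  2 ^+ r.+1 * (r.+1%:R * 4 ^+ r.+1 / (b * ln 2) ^+ (2 * r).+1).

(* In Young's inequality the weight [beta * ln 2 * expR (- beta * (T - s))] has integral
   at most [ln 2] over [0, T]: it costs a factor [2 ^+ r.+1] and no part of the rate. *)
Lemma coupling_estimate T (x y : 'I_N * I -> R) w X Y b2 k2 : 0 <= T -> continuous_path w -> w 0 = (fun=> 0) ->
  is_sol T (fun _ => pair_drift) x w X -> drift_ok b2 k2 -> is_sol T b2 y w Y ->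
  block_power r.+1 (X T \- Y T) <=
    2 ^+ r.+1 * expR (- (2 * r.+1%:R * beta * T)) * block_power r.+1 (x \- y) +
    coupling_const beta * \int[mu]_(s in `[0, T])
      (expR (- beta * (T - s)) * block_power r.+1 (pair_drift (Y s) \- b2 s (Y s))).
Proof.
move=> T0 cw w0 hX ok2 hY.
have ok1 := pair_drift_ok F N0; have b0 := dissipation_gt0 F.
have [cX _] := hX; have [cY _] := hY.
pose xi s q := X s q - Y s q.
pose D s q := pair_drift (X s) q - b2 s (Y s) q.
have pxi q : prim T (fun s => xi s q) (fun s => D s q).
  have := primB (sol_prim ok1 cw T0 hX q) (sol_prim ok2 cw T0 hY q).
  by rewrite (_ : (fun t => _ - _) = (fun s => xi s q))//; apply/funext => s; rewrite /xi; ring.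
pose A i s := dot (slice (xi s) i) (slice (xi s) i).
have pA i : prim T (A i) (fun s => \sum_k (D s (i, k) * xi s (i, k) + xi s (i, k) * D s (i, k))).
  by have h k := primM (pxi (i, k)) (pxi (i, k)); exact: (prim_sum _ h).
pose S s := \sum_i A i s ^+ r.+1.
have pS : prim T S (fun s => \sum_i r.+1%:R * A i s ^+ r *
    \sum_k (D s (i, k) * xi s (i, k) + xi s (i, k) * D s (i, k))).
  by have h i := primX r.+1 (pA i); exact: (prim_sum _ h).
pose del s := pair_drift (Y s) \- b2 s (Y s).
pose Del s := block_power r.+1 (del s).
have ldel q : lbm T (fun s => del s q).
  by apply: lbmB; [exact: (lbm_drift T q ok1 cY)|exact: (lbm_drift T q ok2 cY)].
have lDel : lbm T Del.
  have h i : lbm T (fun s => dot (slice (del s) i) (slice (del s) i) ^+ r.+1).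
    by apply: lbmX; have h' k := lbmM (ldel (i, k)) (ldel (i, k)); exact: (lbm_sum _ _ h').
  exact: (lbm_sum _ _ h).
pose eta s := beta * ln 2 * expR (- beta * (T - s)).
have ln20 : 0 < ln 2 :> R by rewrite ln_gt0// ltr1n.
have eta0 s : 0 < eta s by rewrite mulr_gt0 ?expR_gt0// mulr_gt0.
have dS s : \sum_i r.+1%:R * A i s ^+ r *
    (\sum_k (D s (i, k) * xi s (i, k) + xi s (i, k) * D s (i, k))) <=
    (- (2 * r.+1%:R * beta) + r.+1%:R * eta s) * S s +
    r.+1%:R * 4 ^+ r.+1 / eta s ^+ (2 * r).+1 * Del s.
  have E i : r.+1%:R * A i s ^+ r * (\sum_k (D s (i, k) * xi s (i, k) + xi s (i, k) * D s (i, k))) =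
      2 * r.+1%:R * dot (powvec r.+1 (slice (xi s) i)) (slice (D s) i).
    rewrite dot_powvec /= -/(A i s) /dot !mulr_sumr; apply: eq_bigr => k _.
    by rewrite /slice; ring.
  under eq_bigr do rewrite E.
  (* The particle drift at [Y] is inserted: a dissipative difference plus the consistency error
     [del]. *)
  have E2 i : dot (powvec r.+1 (slice (xi s) i)) (slice (D s) i) =
      dot (powvec r.+1 (slice (X s \- Y s) i)) (slice (pair_drift (X s) \- pair_drift (Y s)) i) +
      dot (powvec r.+1 (slice (xi s) i)) (slice (del s) i).
    rewrite -dotDr; congr dot; apply/funext => k.
    by rewrite /slice /D /del /=; ring.
  under eq_bigr do rewrite E2 mulrDr.
  rewrite big_split /= -mulr_sumr [X in _ <= X + _]mulrDl -[leRHS]addrA; apply: lerD.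
    have := pair_drift_dissip F (X s) (Y s) (ltn0Sn r) N0 K.
    have -> : block_power r.+1 (X s \- Y s) = S s by [].
    move=> h; have n0 : 0 <= 2 * r.+1%:R :> R by [].
    have := ler_wpM2l n0 h; move/le_trans; apply.
    by rewrite le_eqVlt; apply/orP; left; apply/eqP; ring.
  rewrite /S /Del /block_power !mulr_sumr -big_split /=; apply: ler_sum => i _.
  rewrite dot_powvec /= -/(A i s).
  have CS := dot_le_n2 (slice (xi s) i) (slice (del s) i).
  have n2A : A i s = n2 (slice (xi s) i) ^+ 2 by rewrite n2_sqr.
  have n2D : dot (slice (del s) i) (slice (del s) i) = n2 (slice (del s) i) ^+ 2 by rewrite n2_sqr.
  rewrite n2D n2A -!exprM.
  have := young_odd (n2_ge0 (slice (xi s) i)) (n2_ge0 (slice (del s) i)) (eta0 s).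
  set a := n2 _; set b := n2 (slice (del s) i); set e := eta s => yo.
  have a0 : 0 <= a ^+ (2 * r) by rewrite exprn_ge0// n2_ge0.
  have h1 : a ^+ (2 * r) * dot (slice (xi s) i) (slice (del s) i) <= a ^+ (2 * r).+1 * b.
    by rewrite exprSr -mulrA ler_wpM2l// (le_trans (ler_norm _)).
  have h2 := ler_wpM2l (ler0n R r.+1) yo.
  have h3 := ler_wpM2l (mulr_ge0 (ler0n R 2) (ler0n R r.+1)) h1.
  apply: le_trans h3 _; apply: le_trans (_ : _ <= r.+1%:R * (2 * (a ^+ (2 * r).+1 * b))) _.
    by rewrite le_eqVlt; apply/orP; left; apply/eqP; ring.
  apply: le_trans h2 _; rewrite le_eqVlt; apply/orP; left; apply/eqP; ring.
pose e2 s := 2 * r.+1%:R * beta * s.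
pose e1 s := r.+1%:R * ln 2 * expR (- beta * (T - s)).
pose Q s := expR (e2 s - e1 s).
have pQ : prim T Q (fun s => (2 * r.+1%:R * beta - r.+1%:R * eta s) * Q s).
  apply: prim_ext (prim_weight T (2 * r.+1%:R * beta) (r.+1%:R * ln 2) beta) _ => s.
  by rewrite /Q /eta /e2 /e1; ring.
have pF := primM pQ pS.
pose Cc := expR (2 * r.+1%:R * beta * T) * (r.+1%:R * 4 ^+ r.+1 / (beta * ln 2) ^+ (2 * r).+1).
(* The weight to the power [- (2 * r).+1] contributes [expR ((2 * r).+1%:R * beta * (T - s))]; with
   the factor of exponent [2 * r.+1%:R * beta * s] this falls short of the exponent at [T] by
   exactly [beta * (T - s)]. *)
have HE s : expR (e2 s) * (r.+1%:R * 4 ^+ r.+1 / eta s ^+ (2 * r).+1 * Del s) =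
    Cc * (expR (- beta * (T - s)) * Del s).
  rewrite /eta exprMn invfM -[expR _ ^+ _]expRM_natl -expRN /Cc.
  have -> : expR (2 * r.+1%:R * beta * T) = expR (e2 s) * expR (- ((2 * r).+1%:R * (- beta * (T - s)))) / expR (- beta * (T - s)).
    rewrite -expRN -!expRD /e2; congr expR.
    have -> : (2 * r).+1%:R = 2 * r.+1%:R - 1 :> R by rewrite -!natr1 natrM; ring.
    by ring.
  move: (_ ^- _) (expR (e2 s)) (expR (- (_ * _))) => u v w'; field.
  by rewrite gt_eqF// expR_gt0.
have le s : 0 <= s <= T -> (2 * r.+1%:R * beta - r.+1%:R * eta s) * Q s * S s +
    Q s * (\sum_i r.+1%:R * A i s ^+ r * \sum_k (D s (i, k) * xi s (i, k) + xi s (i, k) * D s (i, k))) <=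
    Cc * (expR (- beta * (T - s)) * Del s).
  move=> _; rewrite -HE; have Q0 : 0 <= Q s by exact: expR_ge0.
  have := ler_wpM2l Q0 (dS s) => h.
  have D0 : 0 <= r.+1%:R * 4 ^+ r.+1 / eta s ^+ (2 * r).+1 * Del s.
    rewrite mulr_ge0 ?divr_ge0 ?mulr_ge0 ?exprn_ge0 ?(ltW (eta0 s))//.
    by apply: sumr_ge0 => i _; rewrite exprn_ge0// dot_ge0.
  have Qe : Q s <= expR (e2 s).
    by rewrite ler_expR gerBl /e1 !mulr_ge0 ?expR_ge0// ltW.
  have := ler_wpM2r D0 Qe; move: h; set U := _ / _ * _.
  set Z := \sum_i _; set n := r.+1%:R; clear; move=> h1 h2.
  apply: le_trans h2; move: h1; move: (Q s) (S s) (eta s) => q v e; lra.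
have lH0 : lbm T (fun s => expR (- beta * (T - s)) * Del s).
  by apply: lbmM => //; exact: lbm_expR.
have lH : lbm T (fun s => Cc * (expR (- beta * (T - s)) * Del s)).
  by apply: lbmM => //; exact: lbm_cst.
have := prim_le T0 pF lH le.
rewrite RintegralZl//; last exact: (lbm_integrable lH0 (lexx 0) (lexx T)).
set J := \int[mu]_(s in _) _.
have -> : S T = block_power r.+1 (X T \- Y T) by [].
have X0 : X 0 = x by apply/funext => q; rewrite (sol0 T0 hX) w0 addr0.
have Y0 : Y 0 = y by apply/funext => q; rewrite (sol0 T0 hY) w0 addr0.
have -> : S 0 = block_power r.+1 (x \- y) by rewrite /S /A /xi X0 Y0.
have S00 : 0 <= block_power r.+1 (x \- y) by apply: sumr_ge0 => i _; rewrite exprn_ge0// dot_ge0.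
have Q0le : Q 0 * block_power r.+1 (x \- y) <= block_power r.+1 (x \- y).
  rewrite -[leRHS]mul1r ler_wpM2r// -expR0 ler_expR /e2 mulr0 sub0r oppr_le0.
  by rewrite /e1 !mulr_ge0 ?expR_ge0// ltW.
(* At the final time [e1] equals [r.+1%:R * ln 2], which is where [2 ^+ r.+1] appears. *)
have QT : Q T = expR (2 * r.+1%:R * beta * T) / 2 ^+ r.+1.
  rewrite /Q /e2 /e1 subrr mulr0 expR0 mulr1 expRD expRN expRM_natl lnK//.
  by rewrite posrE.
rewrite QT => hfin.
have E2 : 0 < expR (2 * r.+1%:R * beta * T) by exact: expR_gt0.
have P2 : 0 < 2 ^+ r.+1 :> R by rewrite exprn_gt0.
have hfin' := le_trans hfin (lerD Q0le (lexx _)).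
rewrite expRN /coupling_const.
have h := ler_wpM2l (ltW (divr_gt0 P2 E2)) hfin'.
set ST := block_power _ (X T \- _) in h *.
have -> : ST = 2 ^+ r.+1 / expR (2 * r.+1%:R * beta * T) * (expR (2 * r.+1%:R * beta * T) / 2 ^+ r.+1 * ST).
  by field; rewrite !gt_eqF.
apply: le_trans h _; rewrite le_eqVlt; apply/orP; left; apply/eqP.
rewrite /Cc; move: (_ / (beta * ln 2) ^+ _) => u; field.
by rewrite gt_eqF.
Qed.

End CouplingEstimate.

Lemma measurable_slice_expect {d1 d2 : measure_display} {T1 : measurableType d1}
    {T2 : measurableType d2} {R : realType} (Q : probability T2 R) (f : T1 -> T2 -> R) :
  measurable_fun setT (fun o : T1 * T2 => f o.1 o.2) -> (forall a c, 0 <= f a c) ->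
  (forall a, L1 Q (f a)) -> measurable_fun setT (fun a => expect Q (f a)).
Proof.
move=> mf f0 lf; apply/measurable_EFinP.
apply: (eq_measurable_fun (fubini_F Q (fun o : T1 * T2 => (f o.1 o.2)%:E))).
  by move=> a _; rewrite /fubini_F /= expectE.
apply: measurable_fun_fubini_tonelli_F; first exact/measurable_EFinP.
by move=> o; rewrite lee_fin.
Qed.

(** * Fluctuations of the interaction force *)

Section InteractionFluctuation.
Context {R : realType} {d : nat} {V W : 'rV[R]_d -> R} {lV lW M : R} {m : nat}.
Hypothesis F : fields (field (grad V)) (field (grad W)) lV lW M m.
Variables (u0 : probability 'rV[R]_d R) (r : nat).
Implicit Types (t : R) (a c : 'rV[R]_d) (k : 'I_d).
Local Notation gw := (field (grad W)).

Definition interaction k a c : R := gw (rv a \- rv c) k.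

Definition interaction_const : R :=
  M ^+ (2 * r.+1) * 2 ^+ (2 * r.+1) * 2 ^+ (2 * r.+1).

Lemma interaction_pow_le k a c : interaction k a c ^+ (2 * r.+1) <=
  interaction_const * (1 + enorm (a - c) ^+ (2 * (m * r.+1))).
Proof.
have M0 := ltW (M_gt0 F); have y0 : 0 <= enorm (a - c) by exact: sqrtr_ge0.
have h : `|interaction k a c| <= M * (2 + enorm (a - c) ^+ m).
  apply: le_trans (coord_le_n2 _ _) _; apply: le_trans (GW_bound F _) _.
  rewrite n2_rvB ler_wpM2l// addrAC lerD2r.
  by rewrite lerD2l exprn_ile1.
have -> : interaction k a c ^+ (2 * r.+1) = `|interaction k a c| ^+ (2 * r.+1).
  by rewrite !exprM real_normK// num_real.
apply: (@le_trans _ _ ((M * (2 + enorm (a - c) ^+ m)) ^+ (2 * r.+1))).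
  by rewrite lerXn2r ?nnegrE ?mulr_ge0 ?addr_ge0 ?exprn_ge0.
rewrite exprMn /interaction_const -!mulrA ler_wpM2l ?exprn_ge0//.
apply: le_trans (exprD_le _ (ler0n R 2) (exprn_ge0 m y0)) _.
rewrite ler_wpM2l ?exprn_ge0// mulrDr mulr1 lerD2l -exprM mulnCA.
by rewrite ler_peMl ?exprn_ge0// exprn_ege1// ler1n.
Qed.

Lemma measurable_interaction k : measurable_fun setT (fun o : 'rV[R]_d * 'rV[R]_d => interaction k o.1 o.2).
Proof.
apply: (measurable_gw_comp F) => j; apply: measurable_funB.
  exact: (measurableT_comp (measurable_rV_coord j) measurable_fst).
exact: (measurableT_comp (measurable_rV_coord j) measurable_snd).
Qed.

Lemma interaction_diag k a : interaction k a a = 0.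
Proof.
rewrite /interaction (_ : rv a \- rv a = fun=> 0); first by rewrite (GW0 F).
by apply/funext => j /=; rewrite subrr.
Qed.

Definition empirical_gap (mu : probability 'rV[R]_d R) N (o : N.-tuple 'rV[R]_d) : 'I_N * 'I_d -> R :=
  fun q => fluctuation mu (interaction q.2) o q.1.

(** One factor [d%:R] counts the coordinates of the force and [d%:R ^+ r.+1] comes from
    [sum_power_le]; the rest bounds the moment of one coordinate. *)
Definition empirical_const : R :=
  d%:R * d%:R ^+ r.+1 * (fluct_const r * (interaction_const * (1 + pair_const (lV := lV) (lW := lW) u0 (m * r.+1)))).

Context {u : R -> probability 'rV[R]_d R}.
Hypotheses (l0 : L1 u0 (fun x => enorm x ^+ (2 * (m * r.+1)))) (flow : mckean_vlasov_flow V W m u0 u).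

Lemma interaction_const_ge0 : 0 <= interaction_const.
Proof. by rewrite /interaction_const !mulr_ge0 ?exprn_ge0// (ltW (M_gt0 F)). Qed.

(** Each particle contributes at the rate [N ^- r.+1], and there are [N] of them. Uniformity in time
    comes from [pair_const]. *)
Lemma empirical_gap_moment t N : 0 <= t -> (0 < N)%N ->
  (\int[tensor_power (u t) N]_o (block_power r.+1 (empirical_gap (u t) o))%:E <=
   (empirical_const / N%:R ^+ r)%:E)%E.
Proof.
move=> t0 N0; have NR : 0 < N%:R :> R by rewrite ltr0n.
have [ls es] := pair_moment_slices F l0 flow t0.
have I0 := interaction_const_ge0.
have mG k a : measurable_fun setT (fun c => interaction k a c ^+ (2 * r.+1)).
  by apply: measurable_funX; exact: (measurableT_comp (measurable_interaction k) (measurable_pair1 a)).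
have lB a : L1 (u t) (fun c => interaction_const * (1 + enorm (a - c) ^+ (2 * (m * r.+1)))).
  by apply: L1Z; apply: L1D => //; exact: L1_cst.
have lG k a : L1 (u t) (fun c => interaction k a c ^+ (2 * r.+1)).
  apply: (L1_ge0_dom _ _ (lB a)) => // c.
  by rewrite expr_even_ge0 interaction_pow_le.
pose Km : R := interaction_const * (1 + pair_const (lV := lV) (lW := lW) u0 (m * r.+1)).
have km k : (kernel_moment (u t) (interaction k) r <= Km%:E)%E.
  rewrite /kernel_moment.
  have mS : measurable_fun setT (fun a => expect (u t) (fun c => enorm (a - c) ^+ (2 * (m * r.+1)))).
    apply: (@measurable_slice_expect _ _ _ _ _ (u t) (fun a c => enorm (a - c) ^+ (2 * (m * r.+1)))) => //.
      by apply: measurable_funX; exact: measurable_enormB.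
    by move=> a c; rewrite exprn_ge0// sqrtr_ge0.
  have S0 a : 0 <= expect (u t) (fun c => enorm (a - c) ^+ (2 * (m * r.+1))).
    by apply: expect_ge0 => c; rewrite exprn_ge0// sqrtr_ge0.
  have [lS eS] := L1_of_bound mS S0 es.
  have lU : L1 (u t) (fun a => interaction_const * (1 + expect (u t) (fun c => enorm (a - c) ^+ (2 * (m * r.+1))))).
    by apply: L1Z; apply: L1D => //; exact: L1_cst.
  apply: (@le_trans _ _ (\int[u t]_a (interaction_const * (1 + expect (u t) (fun c => enorm (a - c) ^+ (2 * (m * r.+1)))))%:E)%E).
    apply: ge0_le_integral => //.
    - by move=> a _; rewrite lee_fin; apply: expect_ge0 => c; exact: expr_even_ge0.
    - apply/measurable_EFinP.
      apply: (@measurable_slice_expect _ _ _ _ _ (u t) (fun a c => interaction k a c ^+ (2 * r.+1))) => //.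
        by apply: measurable_funX; exact: measurable_interaction.
      by move=> a c; exact: expr_even_ge0.
    - by apply/measurable_EFinP; exact: L1_meas lU.
    move=> a _; rewrite lee_fin; apply: le_trans (expect_le (lG k a) (lB a) (fun c => interaction_pow_le k a c)) _.
    rewrite expectZ ?expectD ?expect_cst//; [exact: L1_cst|].
    by apply: L1D => //; exact: L1_cst.
  rewrite expectE// lee_fin expectZ; last by apply: L1D => //; exact: L1_cst.
  rewrite /Km ler_wpM2l// expectD//; last exact: L1_cst.
  by rewrite expect_cst lerD2l.
pose b := fluct_const r / N%:R ^+ r.+1 * Km.
have c0 : 0 <= fluct_const r / N%:R ^+ r.+1 :> R.
  rewrite divr_ge0 ?exprn_ge0//; have [h _] := @expand_constP R r.
  by rewrite /fluct_const /mz_const !mulr_ge0 ?exprn_ge0// addr_ge0// !mulr_ge0 ?exprn_ge0 ?expR_ge0.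
have one i k : L1 (tensor_power (u t) N) (fun o => empirical_gap (u t) o (i, k) ^+ (2 * r.+1)) /\
    expect (tensor_power (u t) N) (fun o => empirical_gap (u t) o (i, k) ^+ (2 * r.+1)) <= b.
  apply: L1_of_bound.
  - by apply: measurable_funX; apply: measurable_fluctuation; exact: measurable_interaction.
  - by move=> o; exact: expr_even_ge0.
  have := fluctuation_bound (r := r) (measurable_interaction k) (interaction_diag k) (lG k) i.
  move=> h; apply: le_trans h _; rewrite /b EFinM.
  by apply: lee_wpmul2l (km k); rewrite lee_fin.
pose U (o : N.-tuple 'rV[R]_d) := \sum_(i < N) (d%:R ^+ r.+1 * \sum_(k < d) empirical_gap (u t) o (i, k) ^+ (2 * r.+1)).
have lU : L1 (tensor_power (u t) N) U.
  by apply: L1_sum => i; apply: L1Z; apply: L1_sum => k; have [] := one i k.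
have hU o : 0 <= block_power r.+1 (empirical_gap (u t) o) <= U o.
  apply/andP; split; first by apply: sumr_ge0 => i _; rewrite exprn_ge0// dot_ge0.
  apply: ler_sum => i _; rewrite /dot.
  have := @sum_power_le R 'I_d (fun k => empirical_gap (u t) o (i, k) ^+ 2) r (fun k => sqr_ge0 _).
  rewrite card_ord; under [X in _ * X]eq_bigr do rewrite -exprM.
  by apply: le_trans; rewrite le_eqVlt; apply/orP; left; apply/eqP.
have mS : measurable_fun setT (fun o : N.-tuple 'rV[R]_d => block_power r.+1 (empirical_gap (u t) o)).
  apply: measurable_sum => i; apply: measurable_funX; apply: measurable_sum => k.
  by apply: measurable_funM; apply: measurable_fluctuation; exact: measurable_interaction.
have lS := L1_ge0_dom mS hU lU.
rewrite expectE// lee_fin; apply: le_trans (expect_le lS lU (fun o => proj2 (andP (hU o)))) _.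
rewrite /U expect_sum; last by move=> i; apply: L1Z; apply: L1_sum => k; have [] := one i k.
apply: (@le_trans _ _ (\sum_(i < N) (d%:R ^+ r.+1 * \sum_(k < d) b))).
  apply: ler_sum => i _; rewrite expectZ; last by apply: L1_sum => k; have [] := one i k.
  rewrite ler_wpM2l ?exprn_ge0// expect_sum; last by move=> k; have [] := one i k.
  by apply: ler_sum => k _; have [] := one i k.
rewrite !sumr_const !card_ord -(mulr_natr b d) -(mulr_natr (_ * _) N) /empirical_const /b -/Km.
rewrite [N%:R ^+ r.+1]exprS.
by rewrite le_eqVlt; apply/orP; left; apply/eqP; field; rewrite !gt_eqF// exprn_gt0.
Qed.

End InteractionFluctuation.

Section TensorMap.
Context {R : realType} {d d' : measure_display} {T : measurableType d} {S : measurableType d'}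
  (P : probability T R) (Q : probability S R) (Z : T -> S).
Hypotheses (mZ : measurable_fun setT Z) (H : forall A, measurable A -> P (Z @^-1` A) = Q A).

Definition map_coords N (o : N.-tuple T) : N.-tuple S := [tuple Z (tnth o i) | i < N].

Lemma measurable_map_coords N : measurable_fun setT (@map_coords N).
Proof.
apply/measurable_fun_tnthP => i; apply: (eq_measurable_fun (fun o => Z (tnth o i))).
  by move=> o _ /=; rewrite tnth_mktuple.
by apply: measurableT_comp => //; exact: measurable_tnth.
Qed.

Lemma tensor_power_map N A : measurable A ->
  tensor_power P N (@map_coords N @^-1` A) = tensor_power Q N A.
Proof.
move=> mA; rewrite -[LHS](lawE (tensor_power P N) (@measurable_map_coords N)).
apply: (tuple_measure_unique (m := law (tensor_power P N) (@measurable_map_coords N))) => //.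
- move=> B mB; transitivity (tensor_power P N (@map_coords N @^-1` box B)); first exact: lawE.
  rewrite [RHS]tensor_power_box//.
  rewrite (_ : _ @^-1` _ = box (fun i => Z @^-1` B i)); last first.
    by apply/seteqP; split => o /= h i; have := h i; rewrite tnth_mktuple.
  rewrite tensor_power_box; first by apply: eq_bigr => i _; exact: H.
  by move=> i; rewrite -[X in measurable X]setTI; exact: mZ.
- apply: (@le_lt_trans _ _ 1%E _ _ (probability_le1 (law (tensor_power P N) (@measurable_map_coords N)) measurableT)).
  exact: ltry.
Qed.

End TensorMap.

Section Copies.
Context {R : realType} {I : finType}.
Implicit Types (b : R -> (I -> R) -> I -> R).

Definition copies N b (s : R) (y : 'I_N * I -> R) : 'I_N * I -> R := fun q => b s (slice y q.1) q.2.

Lemma copies_drift_ok N b kappa : drift_ok b kappa -> drift_ok (@copies N b) kappa.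
Proof.
move=> ok; split; first exact: drift_gt0 ok.
- move=> z cz [i k]; apply: (drift_meas ok (z := fun s => slice (z s) i)).
  by move=> k'; exact: cz.
- move=> T K; have [L [L0 HL]] := drift_lip ok T K; exists L; split=> // s x y sT xK yK [i k].
  apply: le_trans (HL s (slice x i) (slice y i) sT _ _ k) _.
  - exact: le_trans (slice_n1 x i) xK.
  - exact: le_trans (slice_n1 y i) yK.
  by rewrite ler_wpM2l// (slice_n1 (x \- y)).
- move=> T; have [K HK] := drift_bd ok T; exists K => s [i k] sT; exact: HK.
move=> s x y.
have E (u v : 'I_N * I -> R) : dot u v = \sum_i dot (slice u i) (slice v i).
  by rewrite /dot pair_bigA; apply: eq_bigr => -[].
rewrite !E mulr_sumr; apply: ler_sum => i _.
exact: (drift_mono ok s (slice x i) (slice y i)).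
Qed.

Lemma copies_is_sol N b T (x : 'I_N -> I -> R) (w z : 'I_N -> R -> I -> R) :
  (forall i, is_sol T b (x i) (w i) (z i)) ->
  is_sol T (@copies N b) (fun q => x q.1 q.2) (fun s q => w q.1 s q.2) (fun s q => z q.1 s q.2).
Proof.
move=> h; split=> [[i k]|t tT [i k]]; first by have [] := h i.
by have [_ /(_ t tT k)] := h i.
Qed.

End Copies.

(** * Joint measurability in time and randomness *)

Section Caratheodory.
Context {R : realType} {K : finType} {d : measure_display} {T : measurableType d}.

Definition lattice (n : nat) (r : R) : R := (Num.floor (n.+1%:R * r))%:~R / n.+1%:R.

Lemma lattice_dist n r : `|lattice n r - r| <= n.+1%:R^-1.
Proof.
have n0 : 0 < n.+1%:R :> R by rewrite ltr0n.
have := floor_itv (n.+1%:R * r); rewrite /lattice; set f := Num.floor _; rewrite intrD.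
move=> /andP[h1 h2]; rewrite distrC ger0_norm.
  rewrite -subr_ge0 (_ : _ - _ = (f%:~R + 1 - n.+1%:R * r) / n.+1%:R).
    by rewrite divr_ge0// subr_ge0 ltW.
  by field; rewrite gt_eqF.
rewrite (_ : _ - _ = (n.+1%:R * r - f%:~R) / n.+1%:R); first by rewrite divr_ge0// subr_ge0.
by field; rewrite gt_eqF.
Qed.

Lemma lattice_cvg r : (fun n => lattice n r) @ \oo --> r.
Proof.
apply/cvgrPdist_le => e e0; near=> n; rewrite distrC; apply: le_trans (lattice_dist n r) _.
rewrite invf_ple ?posrE//; apply: (@le_trans _ _ n%:R); last by rewrite ler_nat.
by near: n; exact: nbhs_infty_ger.
Unshelve. all: by end_near. Qed.

(** Rounding [y] down to a lattice leaves countably many sections, each measurable; refining the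
    lattice recovers [f] by its continuity in [y]. *)
Lemma caratheodory (f : (K -> R) -> T -> R) :
  (forall y, measurable_fun setT (f y)) ->
  (forall o (y_ : nat -> K -> R) y, (forall k, (fun n => y_ n k) @ \oo --> y k) ->
     (fun n => f (y_ n) o) @ \oo --> f y o) ->
  measurable_fun setT (fun p : cyl R K * T => f p.1 p.2).
Proof.
move=> mf cf.
apply: (@measurable_fun_cvg _ _ _ _ (fun n (p : cyl R K * T) => f (fun k => lattice n (p.1 k)) p.2)); last first.
  by move=> p _; apply: cf => k; exact: lattice_cvg.
move=> n _ B mB; rewrite setTI.
pose val (v : {ffun K -> int}) : K -> R := fun k => (v k)%:~R / n.+1%:R.
pose C (v : {ffun K -> int}) : set (cyl R K) := [set y | forall k, Num.floor (n.+1%:R * y k) = v k].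
rewrite (_ : _ @^-1` B = \bigcup_v (C v `*` (f (val v) @^-1` B))); last first.
  apply/seteqP; split => [[y o] /= h|[y o] [v _ [/= hv h]]].
    exists [ffun k => Num.floor (n.+1%:R * y k)] => //=; split=> [k|]; first by rewrite ffunE.
    by rewrite (_ : val _ = fun k => lattice n (y k))//; apply/funext => k; rewrite /val ffunE.
  by rewrite (_ : (fun k => lattice n (y k)) = val v)//; apply/funext => k; rewrite /lattice hv.
apply: countable_bigcupT_measurable => [|v]; first exact: countableP.
apply: measurableX; last by rewrite -[X in measurable X]setTI; exact: mf.
rewrite (_ : C v = \bigcap_(k in setT) [set y : cyl R K | Num.floor (n.+1%:R * y k) = v k]); last first.
  by apply/seteqP; split => y /= h k => [_|]; exact: h.
apply: fin_bigcap_measurable => // k _.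
rewrite (_ : mkset _ = (fun y : cyl R K => n.+1%:R * y k) @^-1` `[(v k)%:~R, (v k + 1)%:~R[%classic); last first.
  apply/seteqP; split => y /=; rewrite in_itv /=; first by move=> <-; exact: floor_itv.
  by move=> h; exact: floor_def.
rewrite -[X in measurable X]setTI; apply: measurable_funM => //; exact: measurable_coord.
Qed.

End Caratheodory.

Lemma integral_indic_itv {R : realType} (a b : R) (phi : R -> R) :
  (\int[lebesgue_measure]_s (\1_(`[a, b]%classic : set R) s * phi s)%:E =
   \int[lebesgue_measure]_(s in `[a, b]) (phi s)%:E)%E.
Proof.
rewrite [RHS]integral_mkcond; apply: eq_integral => s _; rewrite patchE indicE.
by case: ifP => _; rewrite ?mul1r ?mul0r.
Qed.

Lemma Rintegral_EFin {R : realType} (T : R) (phi : R -> R) : lbm T phi ->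
  (\int[lebesgue_measure]_(s in `[0, T]) phi s)%:E =
  (\int[lebesgue_measure]_(s in `[0%R, T]) (phi s)%:E)%E.
Proof.
move=> lp; rewrite /Rintegral fineK//; apply: integrable_fin_num => //.
exact: (lbm_integrable lp (lexx 0) (lexx T)).
Qed.

Lemma block_power_ge0 {R : realType} {I : finType} N p (x : 'I_N * I -> R) : 0 <= block_power p x.
Proof. by apply: sumr_ge0 => i _; rewrite exprn_ge0// dot_ge0. Qed.

Lemma block_power_opp {R : realType} {I : finType} N p (x y : 'I_N * I -> R) :
  (forall q, x q = - y q) -> block_power p x = block_power p y.
Proof.
move=> h; apply: eq_bigr => i _; congr (_ ^+ _); apply: eq_bigr => k _.
by rewrite /slice h mulrNN.
Qed.

Lemma measurable_block_power {R : realType} {I : finType} {d : measure_display} {T : measurableType d} N p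
    (x : T -> 'I_N * I -> R) : (forall q, measurable_fun setT (fun o => x o q)) ->
  measurable_fun setT (fun o => block_power p (x o)).
Proof.
move=> mx; apply: measurable_sum => i; apply: measurable_funX; apply: measurable_sum => k.
by apply: measurable_funM; exact: mx.
Qed.

Section JointMeasurability.
Context {R : realType} {K : finType} {d : measure_display} {T : measurableType d}.
Implicit Types (s t : R).

Lemma measurable_clamp t : measurable_fun setT (clamp t).
Proof. by apply: measurable_maxr => //; apply: measurable_minr. Qed.

Lemma clamp_cvg t (s_ : nat -> R) s : s_ @ \oo --> s -> (fun n => clamp t (s_ n)) @ \oo --> clamp t s.
Proof.
by move=> h; apply: cvg_maxr; [exact: cvg_cst|apply: cvg_minr => //; exact: cvg_cst].
Qed.

(** Here [caratheodory] is applied with time as the single continuous coordinate; clamping keeps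
    time where measurability is assumed. *)
Lemma joint_path t (Y : T -> R -> K -> R) q : 0 <= t -> (forall o, continuous_path (Y o)) ->
  (forall s, 0 <= s <= t -> measurable_fun setT (fun o => Y o s q)) ->
  measurable_fun setT (fun p : T * R => Y p.1 (clamp t p.2) q).
Proof.
move=> t0 cY mY.
have := @caratheodory R unit _ T (fun y o => Y o (clamp t (y tt)) q) _ _.
move=> h; have mj : measurable_fun setT (fun p : T * R => ((fun _ : unit => p.2) : cyl R unit, p.1)).
  apply: measurable_fun_pair; last exact: measurable_fst.
  by apply: measurable_to_cyl => _; exact: measurable_snd.
apply: (measurableT_comp (h _ _) mj).
- by move=> y; apply: mY; exact: clamp_itv.
- move=> o y_ y hy; have c : (fun n => clamp t (y_ n tt)) @ \oo --> clamp t (y tt) by apply: clamp_cvg; exact: hy.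
  have c2 := cY o q (clamp t (y tt)).
  exact: (cvg_comp _ _ c c2).
Qed.

Lemma joint_drift t b kappa (Z : T -> R -> K -> R) q : 0 <= t -> drift_ok b kappa ->
  (forall q, measurable_fun setT (fun p : T * R => Z p.1 p.2 q)) ->
  measurable_fun setT (fun p : T * R => b (clamp t p.2) (Z p.1 p.2) q).
Proof.
move=> t0 ok mZ.
have := @caratheodory R K _ R (fun y s => b (clamp t s) y q) _ _.
move=> h; have mj : measurable_fun setT (fun p : T * R => (Z p.1 p.2 : cyl R K, p.2)).
  apply: measurable_fun_pair; last exact: measurable_snd.
  exact: measurable_to_cyl.
apply: (measurableT_comp (h _ _) mj).
- move=> y; have mb : measurable_fun setT (fun s => b s y q).
    by apply: (drift_meas ok (z := fun=> y)) => i; exact: cst_continuous.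
  exact: (measurableT_comp mb (measurable_clamp t)).
- move=> s y_ y hy; apply: (@loclip_cvg _ _ (fun y => b (clamp t s) y q)) => //.
  move=> r; have [L [L0 HL]] := drift_lip ok t r; exists L; split=> // x z xr zr.
  by apply: HL => //; have /andP[] := clamp_itv s t0.
Qed.

End JointMeasurability.

Section DriftIdentities.
Context {R : realType} {d : nat} {V W : 'rV[R]_d -> R}.

Lemma particle_fieldE N s : @particle_field R d V W N s = pair_drift (GV := field (grad V)) (GW := field (grad W)) (N := N).
Proof.
apply/funext => x; apply/funext => -[i k]; rewrite /particle_field /particle_drift /pair_drift /= tnth_tupT mxE.
apply: f_equal2; first by rewrite mxE.
rewrite mxE; apply: f_equal; rewrite mxE; apply: f_equal; rewrite summxE; apply: eq_bigr => j _.
by rewrite tnth_tupT row_sub.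
Qed.

(** The terms in [grad V] cancel. The two vectors are opposite, and [block_power] is even. *)
Lemma drift_gapE N (u : R -> probability 'rV[R]_d R) s (y : 'I_N * 'I_d -> R) p : 0 <= s ->
  block_power p (pair_drift (GV := field (grad V)) (GW := field (grad W)) y \- copies (mckean_vlasov_field V W u) s y) =
  block_power p (empirical_gap (W := W) (u s) (tupT y)).
Proof.
move=> s0; apply: block_power_opp => -[i k]; rewrite /= /copies mckean_vlasov_fieldE /pair_drift /empirical_gap /fluctuation /=.
rewrite max_r//.
have rvT j : rv (tnth (tupT y) j) = slice y j.
  by apply/funext => l; rewrite /rv tnth_tupT mxE.
rewrite /interaction /mconv rvT; under [in RHS]eq_bigr do rewrite rvT.
by rewrite !opprB opprK; ring.
Qed.

Lemma transport_costE N p (a b : N.-tuple 'rV[R]_d) :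
  \sum_(i < N) enorm (tnth a i - tnth b i) ^+ (2 * p) = block_power p (coordT a \- coordT b).
Proof.
apply: eq_bigr => i _; rewrite exprM enormE n2_sqr; congr (_ ^+ _).
by apply: eq_bigr => k _; rewrite /slice /coordT /= !mxE.
Qed.

End DriftIdentities.

Lemma prod_fst_law {d1 d2 : measure_display} {T1 : measurableType d1} {T2 : measurableType d2}
    {R : realType} (P : probability T1 R) (Q : probability T2 R) A : measurable A ->
  [the probability _ _ of (P \x Q)%E] (fst @^-1` A) = P A.
Proof.
move=> mA; rewrite (_ : fst @^-1` A = A `*` setT); last by apply/seteqP; split => x //= [].
transitivity (P A * Q setT)%E; first exact: product_measure1E.
by have -> : Q setT = 1%E := probability_setT Q; rewrite mule1.
Qed.

(** By Tonelli the expectation is taken at each fixed time, where [C] bounds it; the exponential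
    weight has integral at most [b^-1]. *)
Lemma running_cost {R : realType} {I : finType} {dO : measure_display} {Om : measurableType dO}
    (Q : probability Om R) N p (b1 b2 : R -> ('I_N * I -> R) -> 'I_N * I -> R) k1 k2 (T b C : R)
    (Y : Om -> R -> 'I_N * I -> R) :
  drift_ok b1 k1 -> drift_ok b2 k2 -> 0 <= T -> 0 < b -> 0 <= C ->
  (forall o, continuous_path (Y o)) -> (forall s q, 0 <= s <= T -> measurable_fun setT (fun o => Y o s q)) ->
  (forall s, 0 <= s <= T -> (\int[Q]_o (block_power p (b1 s (Y o s) \- b2 s (Y o s)))%:E <= C%:E)%E) ->
  let J o := \int[lebesgue_measure]_(s in `[0, T])
    (expR (- b * (T - s)) * block_power p (b1 s (Y o s) \- b2 s (Y o s))) in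
  measurable_fun setT J /\ (\int[Q]_o (J o)%:E <= (C / b)%:E)%E.
Proof.
move=> ok1 ok2 T0 b0 C0 cY mY hC J.
pose g (o : Om) s := block_power p (b1 (clamp T s) (Y o (clamp T s)) \- b2 (clamp T s) (Y o (clamp T s))).
pose psi (z : Om * R) := \1_(`[0, T]%classic : set R) z.2 * (expR (- b * (T - z.2)) * g z.1 z.2).
have psi0 z : (0 <= (psi z)%:E)%E.
  by rewrite lee_fin mulr_ge0// mulr_ge0 ?expR_ge0// block_power_ge0.
have mg : measurable_fun setT (fun z : Om * R => g z.1 z.2).
  have mZ q : measurable_fun setT (fun z : Om * R => Y z.1 (clamp T z.2) q).
    by apply: joint_path => // s hs; exact: mY.
  apply: measurable_block_power => q; apply: measurable_funB.
    exact: (joint_drift (Z := fun o s => Y o (clamp T s)) q T0 ok1 mZ).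
  exact: (joint_drift (Z := fun o s => Y o (clamp T s)) q T0 ok2 mZ).
have mexp : measurable_fun setT (fun s : R => expR (- b * (T - s))).
  by apply: measurableT_comp => //; apply: measurable_funM => //; apply: measurable_funB.
have mpsi : measurable_fun setT (fun z : Om * R => (psi z)%:E).
  apply/measurable_EFinP; apply: measurable_funM.
    by apply: measurableT_comp => //; exact: measurable_indic.
  by apply: measurable_funM => //; exact: (measurableT_comp mexp measurable_snd).
have JE o : (J o)%:E = (\int[lebesgue_measure]_s (psi (o, s))%:E)%E.
  rewrite /J Rintegral_EFin; last first.
    apply: lbmM; first exact: lbm_expR.
    have ldel q : lbm T (fun s => b1 s (Y o s) q - b2 s (Y o s) q).
      by apply: lbmB; [exact: (lbm_drift T q ok1 (cY o))|exact: (lbm_drift T q ok2 (cY o))].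
    have h i : lbm T (fun s => dot (slice (b1 s (Y o s) \- b2 s (Y o s)) i) (slice (b1 s (Y o s) \- b2 s (Y o s)) i) ^+ p).
      by apply: lbmX; have h' k := lbmM (ldel (i, k)) (ldel (i, k)); exact: (lbm_sum _ _ h').
    exact: (lbm_sum _ _ h).
  rewrite -integral_indic_itv; apply: eq_integral => s _; rewrite /psi /g /= indicE.
  by case: (boolP (s \in _)) => [|_]; rewrite ?mul0r// inE/= in_itv/= => hs; rewrite clamp_id.
split.
  apply/measurable_EFinP; rewrite (_ : _ \o _ = fun o => (\int[lebesgue_measure]_s (psi (o, s))%:E)%E); last exact/funext.
  have h := measurable_fun_fubini_tonelli_F (m2 := @lebesgue_measure R) _ mpsi psi0; exact: h.
under eq_integral do rewrite JE.
rewrite (fubini_tonelli (m1 := Q) (m2 := @lebesgue_measure R) _ mpsi psi0).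
apply: (@le_trans _ _ (\int[lebesgue_measure]_s (\1_(`[0, T]%classic : set R) s * (C * expR (- b * (T - s))))%:E)%E).
  apply: ge0_le_integral => //.
  - by move=> s _; exact: integral_ge0.
  - have h := measurable_fun_fubini_tonelli_G (m1 := Q) _ mpsi psi0; exact: h.
  - apply/measurable_EFinP; apply: measurable_funM; first exact: measurable_indic.
    by apply: measurable_funM.
  move=> s _; rewrite /psi /= indicE.
  case: (boolP (s \in _)) => [|_]; last first.
    by rewrite mul0r; under eq_integral do rewrite mul0r; rewrite integral0.
  rewrite inE/= in_itv/= => hs; rewrite !mul1r.
  under eq_integral do rewrite mul1r EFinM.
  rewrite ge0_integralZl//; last 2 first.
  - by apply/measurable_EFinP; exact: (measurableT_comp mg (pair2_measurable s)).
  - by move=> o _; rewrite lee_fin block_power_ge0.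
  rewrite [X in (_ <= X%:E)%E]mulrC EFinM lee_pmul2l//; last by rewrite lte_fin expR_gt0.
  by rewrite /g clamp_id//; exact: hC.
rewrite integral_indic_itv -Rintegral_EFin; last by apply: lbmM; [exact: lbm_cst|exact: lbm_expR].
rewrite RintegralZl//; last exact: (lbm_integrable (lbm_expR T (- b) T) (lexx 0) (lexx T)).
by rewrite lee_fin ler_wpM2l// expR_int_rev.
Qed.

Lemma particle_field_pair_drift {R : realType} {d : nat} {V W : 'rV[R]_d -> R} N :
  @particle_field R d V W N = fun _ => pair_drift (GV := field (grad V)) (GW := field (grad W)) (N := N).
Proof. by apply/funext => s; exact: particle_fieldE. Qed.

Lemma particle_field_ok {R : realType} {d : nat} {V W : 'rV[R]_d -> R} {lV lW M : R} {m : nat}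
    (F : fields (field (grad V)) (field (grad W)) lV lW M m) N :
  (0 < N)%N -> drift_ok (@particle_field R d V W N) (dissipation (lV := lV) (lW := lW)).
Proof.
move=> N0; have h := pair_drift_ok F N0.
by rewrite particle_field_pair_drift; exact: h.
Qed.

(** * Cost of the synchronous coupling *)

Section Coupling.
Context {R : realType} {d : nat} {V W : 'rV[R]_d -> R} {lV lW M : R} {m : nat}.
Hypothesis F : fields (field (grad V)) (field (grad W)) lV lW M m.
Variables (u0 : probability 'rV[R]_d R) (r : nat).
Implicit Types (s t T : R).
Hypothesis K : power_monotone (GW := field (grad W)) (lW := lW) r.+1.
Hypothesis l0 : L1 u0 (fun x => enorm x ^+ (2 * (m * r.+1))).
Local Notation beta := (dissipation (lV := lV) (lW := lW)).
Local Notation mu := (@lebesgue_measure R).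

Definition chaos_const : R :=
  coupling_const r beta * (empirical_const (lV := lV) (lW := lW) (M := M) (m := m) u0 r / beta).

Definition transport_cost N (z : N.-tuple 'rV[R]_d * N.-tuple 'rV[R]_d) : R :=
  \sum_(i < N) enorm (tnth z.1 i - tnth z.2 i) ^+ (2 * r.+1).

(** On the product of [pi] and [P1], the first factor carries both initial values and the second the
    common noise. The particle equation and [N] copies of the limit equation are solved there;
    uniqueness in law identifies their laws, so that the pair of solutions at time [T] provides the
    coupling sought. *)
Lemma coupled_transport_cost N mu0 (mut : R -> probability (N.-tuple 'rV[R]_d) R) u
    (pi : probability (N.-tuple 'rV[R]_d * N.-tuple 'rV[R]_d)%type R) T :
  (0 < N)%N -> 0 <= T -> particle_flow V W mu0 mut -> mckean_vlasov_flow V W m u0 u ->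
  coupling mu0 (tensor_power u0 N) pi ->
  exists pi', coupling (mut T) (tensor_power (u T) N) pi' /\
    (\int[pi']_z (transport_cost z)%:E <=
     (2 ^+ r.+1 * expR (- (2 * r.+1%:R * beta * T)))%:E * \int[pi]_z (transport_cost z)%:E +
     (chaos_const / N%:R ^+ r)%:E)%E.
Proof.
move=> N0 T0 pflow flow [pi1 pi2].
have b0 := dissipation_gt0 F.
have ok1 := particle_field_ok F N0.
have ok2 := mckean_vlasov_field_ok F flow; have okc := copies_drift_ok N ok2.
have [dO1 [Om1 [P1 [x1 [w1 [z1 [dr1 hz1 law01 lawt1]]]]]]] := particle_flow_driven ok1 T0 pflow.
have [dO2 [Om2 [P2 [x2 [w2 [z2 [dr2 hz2 law02 lawt2]]]]]]] := mckean_vlasov_flow_driven ok2 T0 flow.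
pose TT := (N.-tuple 'rV[R]_d * N.-tuple 'rV[R]_d)%type.
pose PP := [the probability _ _ of (pi \x P1)%E].
have mx1 q : measurable_fun setT (fun a : TT => coordT a.1 q).
  exact: (measurableT_comp (measurable_coordT q) measurable_fst).
have mx2 q : measurable_fun setT (fun a : TT => coordT a.2 q).
  exact: (measurableT_comp (measurable_coordT q) measurable_snd).
have drX := driven_prod pi dr1 mx1.
have drY := driven_prod pi dr1 mx2.
have /choice[X hX] : forall o : TT * Om1, exists z, is_sol T (@particle_field R d V W N) (coordT o.1.1) (w1 o.2) z.
  by move=> o; exact: sol_exists ok1 (driven_cont dr1 o.2) T0.
have /choice[Y hY] : forall o : TT * Om1, exists z, is_sol T (@copies R _ N (mckean_vlasov_field V W u)) (coordT o.1.2) (w1 o.2) z.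
  by move=> o; exact: sol_exists okc (driven_cont dr1 o.2) T0.
have cY o : continuous_path (Y o) by have [] := hY o.
have mX q : measurable_fun setT (fun o => X o T q) by exact: (measurable_sol q drX ok1 T0 hX).
have mY s q : 0 <= s <= T -> measurable_fun setT (fun o => Y o s q).
  move=> /andP[s0 sT]; apply: (measurable_sol q drY okc s0) => o; exact: is_sol_le sT (hY o).
have mray (a : 'I_N * 'I_d -> R) : measurable (@coordT R d N @^-1` ray a : set (N.-tuple 'rV[R]_d)).
  rewrite -[X in measurable X]setTI; apply: (measurable_to_cyl (@measurable_coordT R d N)) => //.
  by apply: sub_sigma_algebra; eexists.
have mtup A : measurable A -> measurable (@tupT R d N @^-1` A : set (cyl R ('I_N * 'I_d)%type)).
  by move=> mA; rewrite -[X in measurable X]setTI; exact: measurable_tupT.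
have lawX A : measurable A -> PP ((fun o => tupT (X o T)) @^-1` A) = mut T A.
  move=> mA; rewrite -(lawt1 T A _ mA); last by rewrite T0 lexx.
  apply: (sol_law_unique drX dr1 ok1 T0 _ hX hz1 (mtup A mA)) => a.
  transitivity (pi (fst @^-1` (@coordT R d N @^-1` ray a))).
    apply: (prod_fst_law pi P1 (A := fst @^-1` (@coordT R d N @^-1` ray a))).
    by rewrite -[X in measurable X]setTI; apply: measurable_fst => //; exact: mray.
  rewrite pi1; last exact: mray.
  rewrite -law01; last exact: mray.
  by congr (P1 _); apply/seteqP; split => o; rewrite /preimage /= tupTK.
have mX0 : measurable_fun setT (fun o => \row_k x2 o k : 'rV[R]_d).
  apply: measurable_to_rV => k; apply: (eq_measurable_fun (fun o => x2 o k)).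
    by move=> o _; rewrite mxE.
  exact: (driven_x dr2).
(* The law of the copies is needed at all times up to [T], since the running cost averages the
   fluctuation at each of them. *)
have lawY s A : 0 <= s <= T -> measurable A ->
    PP ((fun o => tupT (Y o s)) @^-1` A) = tensor_power (u s) N A.
  move=> sT mA; have /andP[s0 sT'] := sT.
  have mZ : measurable_fun setT (fun o => \row_k z2 o s k : 'rV[R]_d).
    apply: measurable_to_rV => k; apply: (eq_measurable_fun (fun o => z2 o s k)).
      by move=> o _; rewrite mxE.
    by apply: (measurable_sol k dr2 ok2 s0) => o; exact: is_sol_le sT' (hz2 o).
  rewrite -(tensor_power_map mZ (fun B mB => lawt2 s B sT mB) mA).
  (* The comparison is with [N] independent realisations of the given limit process, on the tensor
     power of its own space. *)
  transitivity (tensor_power P2 N ((fun o q => z2 (tnth o q.1) s q.2) @^-1` (@tupT R d N @^-1` A))); last first.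
    congr (tensor_power P2 N _); apply/seteqP; split => o; rewrite /preimage /=;
    by rewrite (_ : tupT _ = map_coords (fun o => \row_k z2 o s k) o)//;
      apply/eq_from_tnth => i; rewrite tnth_tupT tnth_mktuple.
  apply: (sol_law_unique (z := Y) (z' := fun o s q => z2 (tnth o q.1) s q.2) drY (driven_tensor N dr2) okc s0 _ _ _ (mtup A mA)); last 2 first.
  - by move=> o; exact: is_sol_le sT' (hY o).
  - move=> o; apply: (copies_is_sol (x := fun i => x2 (tnth o i)) (w := fun i => w2 (tnth o i)) (z := fun i => z2 (tnth o i))) => i.
    exact: is_sol_le sT' (hz2 _).
  move=> a.
  transitivity (pi (snd @^-1` (@coordT R d N @^-1` ray a))).
    apply: (prod_fst_law pi P1 (A := snd @^-1` (@coordT R d N @^-1` ray a))).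
    by rewrite -[X in measurable X]setTI; apply: measurable_snd => //; exact: mray.
  rewrite pi2; last exact: mray.
  rewrite -(tensor_power_map mX0 law02 (mray a)).
  congr (tensor_power P2 N _); apply/seteqP; split => o; rewrite /preimage /=;
  by rewrite (_ : coordT (map_coords _ o) = fun q => x2 (tnth o q.1) q.2)//;
    apply/funext => -[i k]; rewrite /coordT tnth_mktuple mxE.
have mpi' : measurable_fun setT (fun o => (tupT (X o T), tupT (Y o T)) : TT).
  apply: measurable_fun_pair; apply: measurable_to_tuple => q; first exact: mX.
  by apply: mY; rewrite T0 lexx.
exists (law PP mpi'); split.
  split=> A mA; (etransitivity; first exact: lawE).
    exact: lawX.
  by apply: lawY => //; rewrite T0 lexx.
have mcost : measurable_fun setT (fun z : TT => (transport_cost z)%:E).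
  apply/measurable_EFinP; apply: (eq_measurable_fun (fun z : TT => block_power r.+1 (coordT z.1 \- coordT z.2))).
    by move=> z _; rewrite /transport_cost transport_costE.
  by apply: measurable_block_power => q; exact: measurable_funB.
have cost0 (z : TT) : (0 <= (transport_cost z)%:E)%E.
  by rewrite lee_fin sumr_ge0// => i _; rewrite exprn_ge0// sqrtr_ge0.
rewrite (@ge0_law_integral _ _ _ _ R PP (law PP mpi') _ mpi' (fun A mA => esym (lawE PP mpi' A)) _ mcost cost0).
have gap s : 0 <= s <= T -> (\int[PP]_o (block_power r.+1 (pair_drift (GV := field (grad V)) (GW := field (grad W)) (Y o s) \- copies (mckean_vlasov_field V W u) s (Y o s)))%:E <=
    (empirical_const (lV := lV) (lW := lW) (M := M) (m := m) u0 r / N%:R ^+ r)%:E)%E.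
  move=> sT; have /andP[s0 _] := sT.
  under eq_integral do rewrite drift_gapE//.
  have mYs : measurable_fun setT (fun o => tupT (Y o s)) by apply: measurable_to_tuple => q; exact: mY.
  have := empirical_gap_moment F l0 flow s0 N0.
  rewrite (@ge0_law_integral _ _ _ _ R PP (tensor_power (u s) N) _ mYs (fun A mA => lawY s A sT mA))//.
    apply/measurable_EFinP; apply: measurable_block_power => -[i k].
    by apply: measurable_fluctuation; exact: (measurable_interaction F).
  by move=> o; rewrite lee_fin block_power_ge0.
have c0 : 0 <= empirical_const (lV := lV) (lW := lW) (M := M) (m := m) u0 r / N%:R ^+ r.
  have := gap 0; rewrite lexx T0 -lee_fin => /(_ isT); apply: le_trans.
  by apply: integral_ge0 => o _; rewrite lee_fin block_power_ge0.
have [mJ] := running_cost (pair_drift_ok F N0) okc T0 b0 c0 cY mY gap.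
set J := (fun o => \int[_]_(s in _) _) in mJ *; move=> leJ.
pose D (z : TT) := block_power r.+1 (coordT z.1 \- coordT z.2).
have D0 z : (0 <= (D z)%:E)%E by rewrite lee_fin block_power_ge0.
have mD : measurable_fun setT D by apply: measurable_block_power => q; exact: measurable_funB.
have J0 o : (0 <= (J o)%:E)%E.
  by rewrite lee_fin; apply: Rintegral_ge0 => s _; rewrite mulr_ge0 ?expR_ge0 ?block_power_ge0.
have cc0 : 0 <= coupling_const r beta.
  have l2 : 0 <= ln 2 :> R by rewrite ltW// ln_gt0// ltr1n.
  rewrite /coupling_const mulr_ge0 ?exprn_ge0// divr_ge0 ?mulr_ge0 ?exprn_ge0//.
  by rewrite mulr_ge0// ltW.
have est o : ((transport_cost (tupT (X o T), tupT (Y o T)))%:E <=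
    (2 ^+ r.+1 * expR (- (2 * r.+1%:R * beta * T)))%:E * (D o.1)%:E + (coupling_const r beta)%:E * (J o)%:E)%E.
  rewrite -!EFinM -EFinD lee_fin /transport_cost transport_costE !tupTK.
  have hXo := hX o; rewrite particle_field_pair_drift in hXo.
  exact: (coupling_estimate F N0 K T0 (driven_cont dr1 o.2) (driven_0 dr1 o.2) hXo okc (hY o)).
have mDf : measurable_fun setT (fun o : TT * Om1 => (D o.1)%:E).
  by apply/measurable_EFinP; exact: (measurableT_comp mD measurable_fst).
have mJf : measurable_fun setT (fun o => (J o)%:E) by apply/measurable_EFinP.
have a0 : 0 <= 2 ^+ r.+1 * expR (- (2 * r.+1%:R * beta * T)) by rewrite mulr_ge0 ?exprn_ge0 ?expR_ge0.
apply: (@le_trans _ _ (\int[PP]_o ((2 ^+ r.+1 * expR (- (2 * r.+1%:R * beta * T)))%:E * (D o.1)%:E + (coupling_const r beta)%:E * (J o)%:E))%E).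
  apply: ge0_le_integral => //.
  - by apply: measurableT_comp mcost _.
  - by apply: emeasurable_funD; apply: measurable_funeM.
rewrite ge0_integralD//; last 4 first.
- by move=> o _; rewrite mule_ge0// lee_fin.
- by apply: measurable_funeM.
- by move=> o _; rewrite mule_ge0// lee_fin.
- by apply: measurable_funeM.
rewrite !ge0_integralZl//; apply: leeD.
  rewrite le_eqVlt; apply/orP; left; apply/eqP; congr (_ * _)%E.
  have mDE : measurable_fun setT (fun z => (D z)%:E) by apply/measurable_EFinP.
  transitivity (\int[pi]_z (D z)%:E)%E.
    have mf : measurable_fun setT (fun o : TT * Om1 => o.1) by exact: measurable_fst.
    symmetry.
    apply: (@ge0_law_integral _ _ _ _ R PP pi _ mf _ (fun z => (D z)%:E)) => // A mA.
    exact: (prod_fst_law pi P1 mA).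
  by apply: eq_integral => z _; rewrite /transport_cost transport_costE.
apply: le_trans (lee_wpmul2l _ leJ) _; first by rewrite lee_fin.
by rewrite -EFinM lee_fin /chaos_const le_eqVlt; apply/orP; left; apply/eqP; rewrite -!mulrA (mulrC _ beta^-1).
Qed.

End Coupling.

(** The bound holds for each initial coupling and passes to the infimum, which need be neither
    attained nor finite; [0 < c] allows dividing by [c]. *)
Lemma wasserstein_affine {R : realType} {d N q : nat} (mu nu mu' nu' : set (N.-tuple 'rV[R]_d) -> \bar R)
    (c C : R) : 0 < c ->
  (forall pi, coupling mu' nu' pi -> exists pi', coupling mu nu pi' /\
    (\int[pi']_z (\sum_(i < N) enorm (tnth z.1 i - tnth z.2 i) ^+ q)%:E <=
     c%:E * \int[pi]_z (\sum_(i < N) enorm (tnth z.1 i - tnth z.2 i) ^+ q)%:E + C%:E)%E) ->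
  (wasserstein_pow q mu nu <= c%:E * wasserstein_pow q mu' nu' + C%:E)%E.
Proof.
move=> c0 h; rewrite -leeBlDr// -lee_pdivrMl//; apply: le_ereal_inf_tmp => _ [pi [cpi ->]].
have [pi' [cpi' le]] := h pi cpi.
rewrite lee_pdivrMl// leeBlDr//; apply: le_trans le.
by apply: ereal_inf_lbound; exists pi'.
Qed.

Lemma partial_quadratic {R : realType} {d : nat} (l : R) (W : 'rV[R]_d -> R) k x :
  (forall x, W x = l * enorm x ^+ 2 / 2) -> partial k W x = l * x ord0 k.
Proof.
move=> hW; rewrite /partial /derive; apply: cvg_lim => //.
(* The difference quotient of a quadratic function is affine in [h]. *)
pose g (h : R) := l * x ord0 k + l / 2 * h.
have gc : g @ 0^' --> g 0.
  apply: (cvg_trans (cvg_app _ (@nbhs_dnbhs _ _))).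
  by rewrite /g; apply: cvgD; [exact: cvg_cst|apply: cvgZr; exact: cvg_id].
rewrite /g mulr0 addr0 in gc; apply: cvg_trans gc; apply: near_eq_cvg.
near=> h.
have h0 : h != 0 by near: h; exact: nbhs_dnbhs_neq.
have esq (y : 'rV[R]_d) : enorm y ^+ 2 = dotp y y.
  by rewrite /enorm sqr_sqrtr// sumr_ge0// => i _; rewrite -expr2 sqr_ge0.
rewrite /= !hW !esq /dotp.
rewrite (bigD1 k)//= [in X in _ - X](bigD1 k)//= !mxE !eqxx mulr1.
rewrite (eq_bigr (fun j => x ord0 j * x ord0 j)); last first.
  by move=> j jk; rewrite !mxE (negbTE jk) andbF mulr0 add0r.
rewrite /g /GRing.scale /=; set S := \sum_(_ | _) _; by field.
Unshelve. all: by end_near. Qed.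

(** In dimension one the increment of [grad W] is a scalar multiple of [x - y], and monotonicity
    bounds the scalar below by [lW]. When [x = y] the scalar is taken to be [lW]. *)
Lemma power_monotone_line {R : realType} {d : nat} (V W : 'rV[R]_d -> R) (lV lW M : R) (m p : nat) :
  fields (field (grad V)) (field (grad W)) lV lW M m -> d = 1%N -> (0 < p)%N ->
  power_monotone (GW := field (grad W)) (lW := lW) p.
Proof.
move=> F d1; subst d => p0; apply: power_monotone_scale => // x y.
have := GW_mono F x y; rewrite /dot !big_ord_recl !big_ord0 !addr0 /=; set a := x _ - y _.
set b := field _ x _ - field _ y _; move=> h.
have e (f g : 'I_1 -> R) : f ord0 = g ord0 -> f = g.
  by move=> fg; apply/funext => i; rewrite (ord1 i).
have [a0|a0] := eqVneq a 0.
  exists lW => //; apply: (e); rewrite -/a a0 mulr0.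
  have xy : x = y by apply: (e); apply/eqP; rewrite -subr_eq0 -/a a0.
  by rewrite xy /= subrr.
exists (b / a); last by apply: (e); rewrite -/a divfK.
have aa : 0 < a * a by rewrite -expr2 exprn_even_gt0.
by rewrite -(ler_pM2r aa) [b / a * _]mulrA divfK.
Qed.

Lemma power_monotone_quadratic {R : realType} {d : nat} (W : 'rV[R]_d -> R) (lW : R) (p : nat) :
  (forall x, W x = lW * enorm x ^+ 2 / 2) -> (0 < p)%N ->
  power_monotone (GW := field (grad W)) (lW := lW) p.
Proof.
move=> hW p0; apply: power_monotone_scale => // x y; exists lW => //.
by apply/funext => k; rewrite /field /grad /= !mxE !(partial_quadratic _ _ hW) !mxE mulrBr.
Qed.

Lemma rateE {R : realType} (lV lW : R) : rate lV lW = dissipation (lV := lV) (lW := lW).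
Proof.
by rewrite /rate /dissipation; case: leP => h; rewrite ?mulr0 ?addr0.
Qed.

Section Corollary.
Context {R : realType} {d : nat} (V W : 'rV[R]_d -> R) (lambdaV lambdaW M : R) (m : nat).
Hypothesis hH : assumptions_H V W lambdaV lambdaW M m.

Lemma propagation_bound (u0 : probability 'rV[R]_d R) p :
  (0 < p)%N -> power_monotone (GW := field (grad W)) (lW := lambdaW) p ->
  finite_moment (2 * m ^ 2 * p) u0 ->
  exists Cinit : R, 0 < Cinit /\
    forall (u0N : forall N : nat, probability (N.-tuple 'rV[R]_d) R)
           (uN : forall N : nat, R -> probability (N.-tuple 'rV[R]_d) R)
           (u : R -> probability 'rV[R]_d R),
    (forall N : nat, (0 < N)%N -> particle_flow V W (u0N N) (uN N)) ->
    mckean_vlasov_flow V W m u0 u ->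
    forall (t : R) (N : nat), 0 <= t -> (0 < N)%N ->
    (wasserstein_pow (2 * p) (uN N t) (tensor_power (u t) N) <=
      (2 ^+ p * expR (- (2 * p%:R * rate lambdaV lambdaW * t)))%:E *
        wasserstein_pow (2 * p) (u0N N) (tensor_power u0 N) +
      (Cinit / N%:R ^+ p.-1)%:E)%E.
Proof.
case: p => // r _ K fm; have F := fields_of_H hH.
(* The order needed follows from the one assumed since [m <= m ^ 2] for natural numbers. *)
have l0 : L1 u0 (fun x => enorm x ^+ (2 * (m * r.+1))).
  apply: L1_lower_moment fm; rewrite -mulnA leq_mul2l /= leq_mul2r /=.
  by case: (m) => // n; rewrite expnS leq_pmulr// expn_gt0.
pose C := chaos_const (lV := lambdaV) (lW := lambdaW) (M := M) (m := m) u0 r.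
(* The maximum with one makes the constant positive. *)
exists (Num.max C 1); split; first by rewrite lt_max ltr01 orbT.
move=> u0N uN u pflow flow t N t0 N0; rewrite rateE.
apply: (@le_trans _ _ ((2 ^+ r.+1 * expR (- (2 * r.+1%:R * dissipation (lV := lambdaV) (lW := lambdaW) * t)))%:E *
    wasserstein_pow (2 * r.+1) (u0N N) (tensor_power u0 N) + (C / N%:R ^+ r)%:E)%E).
  apply: wasserstein_affine; first by rewrite mulr_gt0 ?expR_gt0 ?exprn_gt0.
  by move=> pi cpi; exact: (coupled_transport_cost F K l0 N0 t0 (pflow N N0) flow cpi).
by rewrite leeD2l// lee_fin ler_wpM2r ?invr_ge0 ?exprn_ge0// le_max lexx.
Qed.

End Corollary.

Theorem corollary4 (R : realType) (d : nat) (hd : (0 < d)%N)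
    (V W : 'rV[R]_d -> R) (lambdaV lambdaW M : R) (m : nat)
    (hV : smooth V) (hW : smooth W)
    (hH : assumptions_H V W lambdaV lambdaW M m)
    (u0N : forall N : nat, probability (N.-tuple 'rV[R]_d) R)
    (u0 : probability 'rV[R]_d R) :
  ((forall N : nat, (0 < N)%N -> finite_moment_tuple 2 (u0N N)) ->
   finite_moment (2 * m ^ 2) u0 ->
   exists Cinit : R, 0 < Cinit /\
     forall (uN : forall N : nat, R -> probability (N.-tuple 'rV[R]_d) R)
            (u : R -> probability 'rV[R]_d R),
     (forall N : nat, (0 < N)%N -> particle_flow V W (u0N N) (uN N)) ->
     mckean_vlasov_flow V W m u0 u ->
     forall (t : R) (N : nat), 0 <= t -> (0 < N)%N ->
     (wasserstein_pow 2 (uN N t) (tensor_power (u t) N) <=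
       (2 * expR (- (2 * rate lambdaV lambdaW * t)))%:E *
         wasserstein_pow 2 (u0N N) (tensor_power u0 N) + Cinit%:E)%E)
  /\
  (forall p : nat, (1 <= p)%N ->
   finite_moment (2 * m ^ 2 * p) u0 ->
   (forall N : nat, (0 < N)%N -> finite_moment_tuple (2 * p) (u0N N)) ->
   d = 1%N \/ (forall x, W x = lambdaW * enorm x ^+ 2 / 2) ->
   exists Cinit : R, 0 < Cinit /\
     forall (uN : forall N : nat, R -> probability (N.-tuple 'rV[R]_d) R)
            (u : R -> probability 'rV[R]_d R),
     (forall N : nat, (0 < N)%N -> particle_flow V W (u0N N) (uN N)) ->
     mckean_vlasov_flow V W m u0 u ->
     forall (t : R) (N : nat), 0 <= t -> (0 < N)%N ->
     (wasserstein_pow (2 * p) (uN N t) (tensor_power (u t) N) <=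
       (2 ^+ p * expR (- (2 * p%:R * rate lambdaV lambdaW * t)))%:E *
         wasserstein_pow (2 * p) (u0N N) (tensor_power u0 N) +
       (Cinit / N%:R ^+ p.-1)%:E)%E).
Proof.
have F := fields_of_H hH; split.
  (* The first bound is the case [p = 1], where the power of [N] is trivial and [power_monotone]
     holds in every dimension. *)
  move=> _ fm; have := propagation_bound hH (p := 1) (ltnSn 0) (power_monotone1 F).
  rewrite muln1 => /(_ u0 fm)[C [C0 h]]; exists C; split=> // uN u pflow flow t N t0 N0.
  by have := h u0N uN u pflow flow t N t0 N0; rewrite mulr1 expr1 expr0 divr1 muln1.
move=> p p0 fm _ dW.
have K : power_monotone (GW := field (grad W)) (lW := lambdaW) p.
  by case: dW => h; [exact: power_monotone_line F h p0|exact: power_monotone_quadratic h p0].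
have [C [C0 h]] := propagation_bound hH p0 K fm; exists C; split=> // uN u.
exact: h.
Qed.
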